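(* Fix $d\ge2$, $i\ge1$ and a partition $\nu$, and for $n\ge|\nu|+\nu_1$ let $f_{i,\nu}(n)=\langle\chi^{(n-|\nu|,\nu)},H^{i(d-1)}(\mathrm{Conf}(n,\mathbb R^d);\mathbb Q)\rangle_{S_n}$. Then $f_{i,\nu}(n)=0$ for all $n$ unless $|\nu|\le2i$, and $f_{i,\nu}(n)$ is constant as a function of $n$ for $n\ge|\nu|+i$ when $d$ is odd, and for $n\ge|\nu|+i+1$ when $d$ is even.
   Context: $\mathrm{Conf}(n,\mathbb R^d)$ is the space of ordered $n$-tuples of distinct points of $\mathbb R^d$, with $S_n$ permuting coordinates. $(n-|\nu|,\nu)$ denotes the partition $(n-|\nu|,\nu_1,\nu_2,\dots)$, $\chi^\lambda$ the irreducible $S_n$-character, and $\langle\cdot,\cdot\rangle_{S_n}$ the multiplicity pairing. *)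

(* Defs.v *)
From HB Require Import structures.
From mathcomp Require Import all_boot all_order all_algebra all_fingroup.
From mathcomp Require Import all_classical all_reals all_analysis.
From mathcomp Require Import Rstruct Rstruct_topology.

Unset Strict Implicit.
Unset Printing Implicit Defensive.

Import Order.TTheory GRing.Theory Num.Theory.
Local Open Scope ring_scope.
Local Open Scope classical_set_scope.

Notation RR := Rdefinitions.R.

Section ConfCohomology.
Variables (n d : nat).

(* a point of (R^d)^n: row a = the a-th point *)
Definition Mpt := 'M[RR]_(n, d).

Definition conf : set Mpt :=
  [set X | forall a b : 'I_n, a != b -> row a X != row b X].

Definition std_simplex (k : nat) : set 'rV[RR]_(k.+1) :=
  [set x | (forall j, 0 <= x 0 j) /\ \sum_j x 0 j = 1].

(* maps from R^(k+1); singular simplices are those normalised to 0 outside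
   the standard simplex, continuous on it and landing in conf *)
Definition sing (k : nat) := 'rV[RR]_(k.+1) -> Mpt.

Definition is_simplex (k : nat) (s : sing k) : Prop :=
  [/\ (forall x, ~ std_simplex k x -> s x = 0),
      {within std_simplex k, continuous s} &
      (forall x, std_simplex k x -> conf (s x))].

Definition cochain (k : nat) := sing k -> rat.

Definition face (k : nat) (j : 'I_(k.+2)) (x : 'rV[RR]_(k.+1)) : 'rV[RR]_(k.+2) :=
  \row_l (match unlift j l with Some l' => x 0 l' | None => 0 end).

Definition trunc (k : nat) (s : sing k) : sing k :=
  fun x => if `[< std_simplex k x >] then s x else 0.

Definition dcob (k : nat) (h : cochain k) : cochain k.+1 :=
  fun s => \sum_(j < k.+2) (-1) ^+ j * h (@trunc k (s \o @face k j)).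

Definition cocycle (k : nat) (f : cochain k) : Prop :=
  forall s : sing k.+1, is_simplex _ s -> dcob _ f s = 0.

Definition coh_eq (k : nat) : cochain k -> cochain k -> Prop :=
  match k return cochain k -> cochain k -> Prop with
  | 0 => fun f g => forall s : sing 0, is_simplex _ s -> f s = g s
  | p.+1 => fun f g => exists h : cochain p,
      forall s : sing p.+1, is_simplex _ s -> f s - g s = dcob _ h s
  end.

Definition rowperm (p : 'S_n) (X : Mpt) : Mpt := \matrix_(m, b) X ((p^-1)%g m) b.

Definition cact (k : nat) (p : 'S_n) (f : cochain k) : cochain k :=
  fun s => f (rowperm (p^-1)%g \o s).

Definition cells (l : seq nat) : seq (nat * nat) :=
  flatten [seq [seq (r, c) | c <- iota 0 (nth 0 l r)] | r <- iota 0 (size l)].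

Definition rowOf (l : seq nat) (c : 'I_n) : nat := (nth (0, 0) (cells l) c).1.
Definition colOf (l : seq nat) (c : 'I_n) : nat := (nth (0, 0) (cells l) c).2.

(* a tableau t : 'S_n puts entry t c in cell number c;
   its tabloid sends each entry to its row *)
Definition tabloid (l : seq nat) (t : 'S_n) : 'I_n -> nat :=
  fun m => rowOf l ((t^-1)%g m).

Definition colstab (l : seq nat) (t : 'S_n) (q : 'S_n) : bool :=
  [forall m, colOf l ((t^-1)%g (q m)) == colOf l ((t^-1)%g m)].

(* polytabloid e_t = sum_(q in C_t) sgn(q) {q o t}, as a function on tabloids
   (note q o t = t * q in mathcomp's perm multiplication) *)
Definition polytab (l : seq nat) (t : 'S_n) (T : 'I_n -> nat) : rat :=
  \sum_(q : 'S_n | colstab l t q && [forall m, tabloid l (t * q)%g m == T m])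
     (-1) ^+ odd_perm q.

(* a homomorphism is given by the images w t (classes of cocycles) of the
   polytabloids e_t, compatible with the action and the linear relations *)
Definition family (k : nat) := 'S_n -> cochain k.

Definition valid_hom (l : seq nat) (k : nat) (w : family k) : Prop :=
  [/\ (forall t, cocycle _ (w t)),
      (forall p t, coh_eq _ (w (t * p)%g) (cact _ p (w t))) &
      (forall c : 'S_n -> rat,
          (forall T : 'I_n -> nat, \sum_t c t * polytab l t T = 0) ->
          coh_eq _ (fun s => \sum_t c t * w t s) (fun _ => 0))].

Definition fam_eq (k : nat) (w w' : family k) : Prop :=
  forall t, coh_eq _ (w t) (w' t).

Definition lincomb (k m : nat) (a : 'I_m -> rat) (b : 'I_m -> family k) : family k :=
  fun t s => \sum_j a j * b j t s.

Definition hom_dim (l : seq nat) (k m : nat) : Prop :=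
  exists b : 'I_m -> family k,
    [/\ (forall j, valid_hom l _ (b j)),
        (forall w, valid_hom l _ w -> exists a : 'I_m -> rat, fam_eq _ w (lincomb _ _ a b)) &
        (forall a : 'I_m -> rat, fam_eq _ (lincomb _ _ a b) (fun _ _ => 0) ->
           forall j, a j = 0)].

End ConfCohomology.

Definition is_partition (l : seq nat) : bool :=
  sorted (fun a b : nat => (b <= a)%N) l && all (fun x : nat => (0 < x)%N) l.

(* f_{i,nu}(n) = m  :<->  <chi^(n-|nu|,nu), H^(i(d-1))(Conf(n,R^d);Q)>_{S_n} = m *)
Definition f_mult (d i : nat) (nu : seq nat) (n m : nat) : Prop :=
  hom_dim n d ((n - sumn nu)%N :: nu) (i * (d - 1))%N m.

(* Main.v *)
Require Import Defs.
From mathcomp Require Import all_boot.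
From mathcomp Require Import all_order all_algebra all_fingroup.
From mathcomp Require Import all_classical all_reals all_analysis.
From mathcomp Require Import Rstruct Rstruct_topology.
From mathcomp Require Import ring lra zify.

Set Implicit Arguments.
Unset Strict Implicit.
Unset Printing Implicit Defensive.

Import Order.TTheory GRing.Theory Num.Theory.
Import numFieldNormedType.Exports.

(** The cohomology of an ordered configuration space is spanned by pullbacks of top classes of
    products of spheres: a class of degree [i(d-1)] is a sum of classes [G^* c] with
    [G(u)_m = u_m - u_(f m)] for [m] in a set [J] of [i] points, where [f m < m], so that [f] is a forest
    with [i] edges (Mayer-Vietoris, removing small tubes around the collisions of one point with the others).

    Moving the point [a] far away from the others induces an idempotent [P_a] on cohomology. It fixes the
    forest classes in which [a] is isolated and kills the others, so all [P_a] are simultaneously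
    diagonal. On the top class of a tree with at least two vertices ([d] odd) or at least three ([d] even)
    the full symmetrization vanishes, and for [d] even the exchange of two trees with two vertices changes
    the sign; hence a class invariant under [Sym(A)] and killed by every [P_a], [a] in [A], is zero once [#|A| > i]
    ([d] odd) or [#|A| > i + 1] ([d] even), because at most [i] vertices of [A] are not roots of trees
    contained in [A].

    The multiplicity of a Specht module is the dimension of the space of highest weight vectors: vectors
    fixed by the row group and killed by symmetrization over a row and one point of a lower row. Between
    [n] and [n+1] points, pullback along forgetting the new point followed by symmetrization over the
    lengthened first row maps highest weight vectors to highest weight vectors. Composing it with the
    map that adds a far point gives, up to a factor, [1 + \sum_a P_a], which is invertible; so it is
    injective, and by the vanishing above it is onto in the stable range.

    If [|nu| > 2i], every forest with [i] edges has two isolated vertices in one column, so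
    antisymmetrization over the columns kills all classes. *)

(** The forest classes are only shown to span, so every operator identity is tested on one forest
    class at a time. There each [P_a] acts as 0 or as the identity, so [1 + \sum_a P_a] multiplies a
    forest class by one plus the number of isolated points among the [a]. Hence it is onto, and
    finite dimension makes it injective. The range comes from one count: for [n+1] points the first
    row has [n+1-|nu|] cells, and this exceeds [i] (respectively [i+1]) exactly when [n >= |nu|+i]
    (respectively [|nu|+i+1]). The parity of [d] enters through two signs: the antipode of a sphere
    acts by [(-1)^d] and the exchange of two sphere factors by [-(-1)^d]. For odd [d] already two
    points carry no invariant top class. For even [d] they do carry one, and a third point is
    required; the braid relation in the symmetric group on three letters then forces the vanishing.
    Highest weight vectors are suited to comparing [n] with [n+1], because their defining conditions
    mention only rows, and only the first row changes. *)

Module Development.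
Local Open Scope ring_scope.
Local Open Scope classical_set_scope.

(** * Continuity at a point of real-valued and matrix-valued maps *)

Section PointwiseContinuity.
Variable T : topologicalType.
Implicit Types (f g : T -> RR) (x : T).

Definition cnt f x : Prop := {for x, continuous f}.

Lemma cnt_cst (a : RR) x : cnt (fun=> a) x.
Proof. exact: (@cst_continuous T RR a x). Qed.

Lemma cntD f g x : cnt f x -> cnt g x -> cnt (fun y => f y + g y) x.
Proof. by move=> hf hg; have h := @continuousD RR RR^o T f g x hf hg; exact: h. Qed.

Lemma cntM f g x : cnt f x -> cnt g x -> cnt (fun y => f y * g y) x.
Proof. by move=> hf hg; have h := @continuousM RR T f g x hf hg; exact: h. Qed.

Lemma cntN f x : cnt f x -> cnt (fun y => - f y) x.
Proof. by move=> hf; have h := @continuousN RR RR^o T f x hf; exact: h. Qed.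

Lemma cntB f g x : cnt f x -> cnt g x -> cnt (fun y => f y - g y) x.
Proof. by move=> hf hg; apply: cntD => //; apply: cntN. Qed.

Lemma cntV f x : f x != 0 -> cnt f x -> cnt (fun y => (f y)^-1) x.
Proof. by move=> f0 hf; have h := @continuousV RR T f x f0 hf; exact: h. Qed.

Lemma cnt_norm f x : cnt f x -> cnt (fun y => `|f y|) x.
Proof.
move=> hf; apply: (@continuous_comp _ _ _ f (fun y : RR => `|y|) x hf).
exact: (@norm_continuous RR RR^o).
Qed.

Lemma cnt_sum (I : Type) (r : seq I) (P : pred I) (f : I -> T -> RR) x :
  (forall i, P i -> cnt (f i) x) -> cnt (fun y => \sum_(i <- r | P i) f i y) x.
Proof.
move=> h; elim: r => [|a r IH].
  rewrite (_ : (fun y => _) = (fun=> 0)); first exact: cnt_cst.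
  by apply: funext => y; rewrite big_nil.
rewrite (_ : (fun y => _) = (fun y => (if P a then f a y else 0) + \sum_(i <- r | P i) f i y)).
  apply: cntD; last exact: IH.
  by case E: (P a); [exact: h|exact: cnt_cst].
by apply: funext => y; rewrite big_cons; case: (P a); rewrite ?add0r.
Qed.

Lemma cnt_min f g x : cnt f x -> cnt g x -> cnt (fun y => Num.min (f y) (g y)) x.
Proof.
move=> hf hg.
rewrite (_ : (fun y => _) = (fun y => (f y + g y - `|f y - g y|) / 2)); last first.
  apply: funext => y; case: (leP (f y) (g y)) => h.
    by rewrite ler0_norm ?subr_le0//; field.
  by rewrite gtr0_norm ?subr_gt0//; field.
apply: cntM; last exact: cnt_cst.
by apply: cntB; [exact: cntD|apply: cnt_norm; exact: cntB].
Qed.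

Lemma cnt_bigmin (I : Type) (r : seq I) (P : pred I) (f : I -> T -> RR) (a : RR) x :
  (forall i, P i -> cnt (f i) x) -> cnt (fun y => \big[Num.min/a]_(i <- r | P i) f i y) x.
Proof.
move=> h; elim: r => [|b r IH].
  rewrite (_ : (fun y => _) = (fun=> a)); first exact: cnt_cst.
  by apply: funext => y; rewrite big_nil.
case: (boolP (P b)) => Pb.
  rewrite (_ : (fun y => _) = (fun y => Num.min (f b y) (\big[Num.min/a]_(i <- r | P i) f i y))).
    by apply: cnt_min => //; apply: h.
  by apply: funext => y; rewrite big_cons Pb.
by move: IH; congr cnt; apply: funext => y; rewrite big_cons (negbTE Pb).
Qed.

Lemma cnt_gt0 f x : cnt f x -> 0 < f x -> \forall y \near x, 0 < f y.
Proof.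
move=> hf fx; have : nbhs (f x) [set z : RR | 0 < z].
  by apply: open_nbhs_nbhs; split=> //; apply: open_gt.
by move=> /hf.
Qed.

Lemma cnt_neq0 f x : cnt f x -> f x != 0 -> \forall y \near x, f y != 0.
Proof.
move=> hf fx; have : nbhs (f x) [set z : RR | z != 0].
  by apply: open_nbhs_nbhs; split=> //; apply: open_neq.
by move=> /hf.
Qed.
End PointwiseContinuity.

Lemma cnt_coord n d (i : 'I_n) (j : 'I_d) (x : 'M[RR]_(n, d)) : cnt (fun y : 'M[RR]_(n, d) => y i j) x.
Proof. exact: coord_continuous. Qed.

Section MatrixValued.
Variable T : topologicalType.

Lemma mx_cont n d (f : T -> 'M[RR]_(n, d)) x :
  (forall i j, cnt (fun y => f y i j) x) -> {for x, continuous f}.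
Proof.
move=> h A /nbhs_ballP[e /= e0 eA].
have h' i j : \forall y \near x, `|f x i j - f y i j| < e.
  apply: (h i j [set z | `|f x i j - z| < e]); apply/nbhs_ballP; exists e => //=.
have H : \forall y \near x, forall ij : 'I_n * 'I_d, `|f x ij.1 ij.2 - f y ij.1 ij.2| < e.
  by apply: filter_forall => -[i j]; exact: h'.
apply: filterS H => y hy; apply: eA; split=> // i j.
exact: (hy (i, j)).
Qed.
End MatrixValued.

(** * Affine chains and barycentric subdivision *)

Section AffineChains.

(* An affine simplex is the matrix of its vertices, one per row. The index [m] counts vertices, so the
   complex is augmented: [m = 0] is the empty simplex. *)
Definition dmx q m (phi : 'M[RR]_(m, q) -> rat) (M : 'M[RR]_(m.+1, q)) : rat :=
  \sum_(j < m.+1) (-1) ^+ j * phi (row' j M).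

Definition cone q m (b : 'rV[RR]_q) (N : 'M[RR]_(m, q)) : 'M[RR]_(m.+1, q) :=
  col_mx b N.

(* Chain operators are written on the dual side, as operators on cochains. *)
Definition chop q p := forall m, ('M[RR]_(m, q) -> rat) -> 'M[RR]_(m, p) -> rat.

Lemma dmxB q m (phi psi : 'M[RR]_(m, q) -> rat) :
  dmx (fun N => phi N - psi N) = (fun M => dmx phi M - dmx psi M).
Proof.
by apply: funext => M; rewrite /dmx -sumrB; apply: eq_bigr => j _; rewrite mulrBr.
Qed.

Lemma dmx0 q m : dmx (fun _ : 'M[RR]_(m, q) => 0) = fun=> 0.
Proof. by apply: funext => M; rewrite /dmx big1// => j _; rewrite mulr0. Qed.

Lemma row'_row' q m (i : 'I_m.+2) (j : 'I_m.+1) (M : 'M[RR]_(m.+2, q)) :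
  row' j (row' i M) = row' (inord (unbump (bump i j) i)) (row' (lift i j) M).
Proof.
apply/matrixP => a b; rewrite !mxE; congr (M _ b); apply: val_inj => /=.
have ha := ltn_ord a; have hj := ltn_ord j; have hi := ltn_ord i.
rewrite inordK; last by rewrite /unbump /bump; lia.
rewrite /unbump /bump; lia.
Qed.

Lemma dmx_dmx q m (phi : 'M[RR]_(m, q) -> rat) : dmx (dmx phi) = fun=> 0.
Proof.
apply: funext => M; rewrite /dmx.
pose F (p : 'I_m.+2 * 'I_m.+1) := (-1) ^+ p.1 * ((-1) ^+ p.2 * phi (row' p.2 (row' p.1 M))) : rat.
transitivity (\sum_p F p).
  by rewrite -(pair_bigA _ (fun i j => F (i, j)))/=; apply: eq_bigr => i _; rewrite big_distrr.
(* Dropping the same two vertices in the other order: this involution keeps the iterated face and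
   flips the parity of [p.1 + p.2], so the terms cancel in pairs. *)
pose h (p : 'I_m.+2 * 'I_m.+1) : 'I_m.+2 * 'I_m.+1 :=
  (lift p.1 p.2, inord (unbump (bump p.1 p.2) p.1)).
have val2 p : val (h p).2 = unbump (bump p.1 p.2) p.1.
  rewrite /h /= inordK // /unbump /bump.
  have := ltn_ord p.1; have := ltn_ord p.2; lia.
have hK : involutive h.
  move=> p; rewrite [LHS]surjective_pairing [RHS]surjective_pairing.
  have h2 := val2 (h p); have h1 := val2 p.
  have l1 := ltn_ord p.1; have l2 := ltn_ord p.2.
  congr pair; apply: val_inj.
    rewrite /= inordK; last by rewrite /unbump /bump; lia.
    by rewrite /unbump /bump; lia.
  rewrite h2 /= inordK; last by rewrite /unbump /bump; lia.
  by rewrite /unbump /bump; lia.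
have FN p : F (h p) = - F p.
  rewrite /F [in RHS]row'_row' -/(h p).2 -/(h p) !mulrA -!exprD.
  rewrite -mulNr; congr (_ * _).
  rewrite -[RHS]mulN1r -exprS -[LHS]signr_odd -[RHS]signr_odd; congr (_ ^+ _).
  rewrite val2 /=; have l1 := ltn_ord p.1; have l2 := ltn_ord p.2.
  rewrite /unbump /bump.
  case: (leqP p.1 p.2) => c; do ?case: ltnP => ?; rewrite ?oddD /= ?addbA; lia.
have E : \sum_p F p = - \sum_p F p.
  rewrite {1}(reindex_inj (inv_inj hK)) -sumrN; apply: eq_bigr => p _; exact: FN.
lra.
Qed.

Lemma row'_cone0 q m (b : 'rV[RR]_q) (N : 'M[RR]_(m, q)) : row' ord0 (cone b N) = N.
Proof.
apply/matrixP => i j; rewrite !mxE.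
case: splitP => k /= ik; first by have := ltn_ord k; rewrite -ik /bump; lia.
move: ik; rewrite /bump => ik; congr (N _ _); apply: val_inj => /=; lia.
Qed.

Lemma row'_coneS q m (b : 'rV[RR]_q) (N : 'M[RR]_(m.+1, q)) (j : 'I_m.+1) :
  row' (lift ord0 j) (cone b N) = cone b (row' j N).
Proof.
apply/matrixP => i c; rewrite !mxE.
case: (@splitP 1 m i) => k /= ik.
  case: splitP => l /=; first by rewrite !ord1.
  move=> il; move: il (ltn_ord k) (ltn_ord l); rewrite ik /bump /=; lia.
case: splitP => l /= il.
  by move: il (ltn_ord l); rewrite ik /bump /=; lia.
rewrite mxE; congr (N _ _); apply: val_inj => /=.
by move: il; rewrite ik /bump /=; lia.
Qed.

(** Dropping the apex gives the base, dropping another vertex gives the cone over a face of the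
    base. So coning is a contracting homotopy of the augmented complex. *)
Lemma dmx_cone q m (phi : 'M[RR]_(m.+1, q) -> rat) b N :
  dmx phi (cone b N) = phi N - dmx (fun N' => phi (cone b N')) N.
Proof.
rewrite /dmx big_ord_recl mul1r row'_cone0 -sumrN; congr (_ + _).
apply: eq_bigr => j _; rewrite row'_coneS /= exprS; ring.
Qed.

Definition bary p m (M : 'M[RR]_(m, p)) : 'rV[RR]_p := m%:R^-1 *: \sum_i row i M.

(** Transpose of barycentric subdivision: the subdivision of [M] is the cone from its barycentre
    over the subdivided boundary of [M]. *)
Fixpoint sd p m : ('M[RR]_(m, p) -> rat) -> 'M[RR]_(m, p) -> rat :=
  match m with
  | 0 => fun phi => phi
  | m'.+1 => fun phi M => dmx (sd (fun N => phi (cone (bary M) N))) M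
  end.

Lemma sdS p m (phi : 'M[RR]_(m.+1, p) -> rat) M :
  sd phi M = dmx (sd (fun N => phi (cone (bary M) N))) M.
Proof. by []. Qed.

Lemma sdB p m (phi psi : 'M[RR]_(m, p) -> rat) :
  sd (fun N => phi N - psi N) = (fun M => sd phi M - sd psi M).
Proof.
elim: m phi psi => [//|m IH] phi psi; apply: funext => M /=.
by rewrite IH dmxB.
Qed.

(** By [dmx_cone] and induction, the left side is [dmx (sd phi)] minus a double coboundary. *)
Lemma sd_dmx p m (phi : 'M[RR]_(m, p) -> rat) : sd (dmx phi) = dmx (sd phi).
Proof.
elim: m phi => [|m IH] phi; apply: funext => M.
  by rewrite /= /dmx !big_ord1 !mul1r row'_cone0.
rewrite sdS.
have -> : (fun N : 'M[RR]_(m.+1, p) => dmx phi (cone (bary M) N)) =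
   (fun N => phi N - dmx (fun N' => phi (cone (bary M) N')) N).
  by apply: funext => N; rewrite dmx_cone.
by rewrite sdB dmxB IH dmx_dmx subr0.
Qed.

Section ConeHomotopy.
Variables (q p : nat) (A B : chop q p) (apex : forall m, 'M[RR]_(m, p) -> 'rV[RR]_q).
Hypothesis AB : forall m phi psi,
  @A m (fun N => phi N - psi N) = (fun M => A phi M - A psi M).
Hypothesis BB : forall m phi psi,
  @B m (fun N => phi N - psi N) = (fun M => B phi M - B psi M).
Hypothesis Ad : forall m phi, @A m.+1 (dmx phi) = dmx (A phi).
Hypothesis Bd : forall m phi, @B m.+1 (dmx phi) = dmx (B phi).
(** Agreement on the empty simplex expresses compatibility with the augmentation. *)
Hypothesis AB0 : @A 0 = @B 0.

(* The acyclic-carrier homotopy between [A] and [B], built by coning off from [apex]. *)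
Fixpoint hcone m : ('M[RR]_(m.+1, q) -> rat) -> 'M[RR]_(m, p) -> rat :=
  match m with
  | 0 => fun _ _ => 0
  | m'.+1 => fun phi M =>
     let psi N := phi (cone (apex M) N) in
     A psi M - B psi M - dmx (hcone psi) M
  end.

Lemma hconeS m (phi : 'M[RR]_(m.+2, q) -> rat) M :
  let psi N := phi (cone (apex M) N) in
  hcone phi M = A psi M - B psi M - dmx (hcone psi) M.
Proof. by []. Qed.

Lemma hconeB m (phi psi : 'M[RR]_(m.+1, q) -> rat) :
  hcone (fun N => phi N - psi N) = (fun M => hcone phi M - hcone psi M).
Proof.
elim: m phi psi => [|m IH] phi psi; apply: funext => M /=; first by rewrite subrr.
rewrite AB BB IH dmxB; ring.
Qed.

Lemma hconeP m (phi : 'M[RR]_(m.+1, q) -> rat) M :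
  hcone (dmx phi) M + dmx (hcone phi) M = A phi M - B phi M.
Proof.
elim: m phi M => [|m IH] phi M.
  rewrite /=.
  have -> : (fun N => dmx phi (cone (apex M) N)) =
   (fun N => phi N - dmx (fun N' => phi (cone (apex M) N')) N).
    by apply: funext => N; rewrite dmx_cone.
  rewrite AB BB Ad Bd AB0 !dmx0; ring.
rewrite hconeS.
have -> : (fun N => dmx phi (cone (apex M) N)) =
   (fun N => phi N - dmx (fun N' => phi (cone (apex M) N')) N).
  by apply: funext => N; rewrite dmx_cone.
rewrite AB BB Ad Bd hconeB dmxB; set psi := fun N' => phi (cone (apex M) N').
have -> : hcone (dmx psi) = fun M => (A psi M - B psi M) - dmx (hcone psi) M.
  by apply: funext => N; rewrite -IH; ring.
rewrite (dmxB (fun M => A psi M - B psi M)) dmx_dmx dmxB; ring.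
Qed.

End ConeHomotopy.

End AffineChains.

(** * Convex carriers and the shrinking of simplices under subdivision *)

Section ConvexVanishing.

Definition cvx q (C : set 'rV[RR]_q) :=
  forall m (M : 'M[RR]_(m.+1, q)), (forall i, C (row i M)) ->
  forall w, std_simplex m w -> C (w *m M).

Definition rowsIn q (C : set 'rV[RR]_q) m (M : 'M[RR]_(m, q)) := forall i, C (row i M).

Definition diamle q m (D : RR) (M : 'M[RR]_(m, q)) :=
  forall i j, `|row i M - row j M| <= D.

Lemma cvx_and q (C C' : set 'rV[RR]_q) : cvx C -> cvx C' -> cvx (fun x => C x /\ C' x).
Proof.
by move=> h h' m M MC w ww; split; [apply: h|apply: h'] => // i; case: (MC i).
Qed.

Lemma cvx_simplex p : cvx (@std_simplex p).
Proof.
move=> m M MC w [w0 w1]; split=> [j|].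
  rewrite mxE sumr_ge0// => i _; rewrite mulr_ge0//.
  by have [/(_ j)] := MC i; rewrite mxE.
transitivity (\sum_j \sum_i w 0 i * M i j); first by apply: eq_bigr => j _; rewrite mxE.
rewrite exchange_big/= -w1; apply: eq_bigr => i _; rewrite -big_distrr/=.
have [_ r1] := MC i; rewrite -[RHS]mulr1 -r1; congr (_ * _).
by apply: eq_bigr => j _; rewrite mxE.
Qed.

Lemma combB q m (w : 'rV[RR]_m.+1) (M : 'M[RR]_(m.+1, q)) b :
  std_simplex m w -> w *m M - b = \sum_i w 0 i *: (row i M - b).
Proof.
move=> [_ w1]; rewrite mulmx_sum_row.
rewrite [in RHS](eq_bigr (fun i => w 0 i *: row i M - w 0 i *: b)); last first.
  by move=> i _; rewrite scalerBr.
by rewrite sumrB -scaler_suml w1 scale1r.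
Qed.

Lemma cvx_cball q (b : 'rV[RR]_q) r : cvx (fun x => `|x - b| <= r).
Proof.
move=> m M MC w ww; rewrite combB//; case: ww => w0 w1.
apply: le_trans (ler_norm_sum _ _ _) _.
rewrite -[r]mul1r -w1 mulr_suml; apply: ler_sum => i _.
by rewrite normrZ ger0_norm// ler_wpM2l.
Qed.

Definition unif m : 'rV[RR]_m.+1 := const_mx (m.+1%:R^-1).

Lemma unif_simplex m : std_simplex m (unif m).
Proof.
split=> [j|]; first by rewrite mxE invr_ge0.
rewrite (eq_bigr (fun=> m.+1%:R^-1)); last by move=> j _; rewrite mxE.
by rewrite sumr_const card_ord -[_ *+ _]mulr_natl mulfV// pnatr_eq0.
Qed.

Lemma baryE q m (M : 'M[RR]_(m.+1, q)) : bary M = unif m *m M.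
Proof.
rewrite mulmx_sum_row /bary scaler_sumr; apply: eq_bigr => i _.
by rewrite mxE.
Qed.

Lemma cvx_bary q (C : set 'rV[RR]_q) m (M : 'M[RR]_(m.+1, q)) :
  cvx C -> rowsIn C M -> C (bary M).
Proof. by move=> cC MC; rewrite baryE; apply: cC => //; apply: unif_simplex. Qed.

Lemma row_cone0 q m (b : 'rV[RR]_q) (N : 'M[RR]_(m, q)) : row ord0 (cone b N) = b.
Proof.
apply/rowP => j; rewrite !mxE; case: splitP => k /= h; first by rewrite ord1.
by [].
Qed.

Lemma row_coneS q m (b : 'rV[RR]_q) (N : 'M[RR]_(m, q)) i :
  row (lift ord0 i) (cone b N) = row i N.
Proof.
apply/rowP => j; rewrite !mxE; case: splitP => k /=; rewrite /bump => h.
  by have := ltn_ord k; lia.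
by congr (N _ _); apply: val_inj => /=; lia.
Qed.

Lemma rowsIn_cone q (C : set 'rV[RR]_q) m b (N : 'M[RR]_(m, q)) :
  C b -> rowsIn C N -> rowsIn C (cone b N).
Proof.
move=> Cb CN i; case: (unliftP ord0 i) => [j ->|->]; first by rewrite row_coneS.
by rewrite row_cone0.
Qed.

Lemma rowsIn_row' q (C : set 'rV[RR]_q) m (N : 'M[RR]_(m.+1, q)) j :
  rowsIn C N -> rowsIn C (row' j N).
Proof.
move=> CN i; have -> : row i (row' j N) = row (lift j i) N by apply/rowP => c; rewrite !mxE.
exact: CN.
Qed.

Lemma diamle_row' q m D (N : 'M[RR]_(m.+1, q)) j : diamle D N -> diamle D (row' j N).
Proof.
have E i : row i (row' j N) = row (lift j i) N by apply/rowP => c; rewrite !mxE.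
by move=> DN i i'; rewrite !E.
Qed.

(** The factor [1 - 1/m] by which subdivision shrinks a simplex with [m] vertices; its value at
    [m = 0] is 0. *)
Definition theta m : RR := m.-1%:R / m%:R.

Lemma theta_ge0 m : 0 <= theta m. Proof. by rewrite divr_ge0. Qed.

Lemma theta_mono m : theta m <= theta m.+1.
Proof.
case: m => [|m]; first by rewrite /theta invr0 mulr0 mul0r.
rewrite /theta /= ler_pdivrMr ?ltr0n// mulrAC ler_pdivlMr ?ltr0n//.
rewrite -!natrM ler_nat; lia.
Qed.

Lemma theta_lt1 m : theta m < 1.
Proof.
case: m => [|m]; first by rewrite /theta invr0 mulr0.
by rewrite /theta ltr_pdivrMr ?ltr0n// mul1r ltr_nat.
Qed.

Lemma bary_dist q m (M : 'M[RR]_(m.+1, q)) D i :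
  diamle D M -> `|row i M - bary M| <= theta m.+1 * D.
Proof.
move=> DM; rewrite -normrN opprB baryE combB; last exact: unif_simplex.
rewrite (bigD1 i)//= subrr scaler0 add0r.
apply: le_trans (ler_norm_sum _ _ _) _.
apply: (@le_trans _ _ (\sum_(j < m.+1 | j != i) m.+1%:R^-1 * D)).
  apply: ler_sum => j _; rewrite normrZ mxE ger0_norm ?invr_ge0//.
  by rewrite ler_wpM2l ?invr_ge0//; apply: DM.
rewrite sumr_const cardC1 card_ord /= /theta /= -mulrA -[_ *+ m]mulr_natl; exact: lexx.
Qed.

(** The convex set varies in the induction: the faces lie in the ball of radius [theta m.+1 * D]
    around the barycentre, and so do their subdivisions; hence the edges added by coning from the
    barycentre obey the same bound. *)
Lemma sd_vanish q m (C : set 'rV[RR]_q) (M : 'M[RR]_(m, q)) D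
    (phi : 'M[RR]_(m, q) -> rat) :
  cvx C -> rowsIn C M -> diamle D M -> 0 <= D ->
  (forall N, rowsIn C N -> diamle (theta m * D) N -> phi N = 0) -> sd phi M = 0.
Proof.
elim: m C M phi => [|m IH] C M phi cC CM DM D0 h.
  by apply: h => //; case.
rewrite sdS /dmx big1// => j _; rewrite (IH (fun x => C x /\ `|x - bary M| <= theta m.+1 * D))
  ?mulr0//.
- by apply: cvx_and => //; apply: cvx_cball.
- by apply: rowsIn_row' => i; split; [apply: CM|apply: bary_dist].
- exact: diamle_row'.
move=> N CN DN; apply: h.
  apply: rowsIn_cone; first exact: cvx_bary.
  by move=> i; case: (CN i).
have tD : 0 <= theta m.+1 * D by rewrite mulr_ge0// theta_ge0.
move=> i i'; case: (unliftP ord0 i) => [k ->|->]; case: (unliftP ord0 i') => [k' ->|->];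
  rewrite ?row_cone0 ?row_coneS ?subrr ?normr0//.
- apply: le_trans (DN k k') _; rewrite ler_wpM2r// theta_mono//.
- by case: (CN k).
- by rewrite distrC; case: (CN k').
Qed.

Lemma iter_sd_vanish q m l (C : set 'rV[RR]_q) (M : 'M[RR]_(m, q)) D
    (phi : 'M[RR]_(m, q) -> rat) :
  cvx C -> rowsIn C M -> diamle D M -> 0 <= D ->
  (forall N, rowsIn C N -> diamle (theta m ^+ l * D) N -> phi N = 0) ->
  iter l (@sd q m) phi M = 0.
Proof.
elim: l M D phi => [|l IH] M D phi cC CM DM D0 h.
  by apply: h => //; rewrite expr0 mul1r.
rewrite iterS; apply: (sd_vanish cC CM DM D0) => N CN DN.
apply: (IH _ (theta m * D)) => //; first by rewrite mulr_ge0// theta_ge0.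
move=> N' CN' DN'; apply: h => // i i'.
by rewrite exprSr -mulrA; apply: DN'.
Qed.

Definition idop q : chop q q := fun m phi => phi.
Definition sdop q l : chop q q := fun m => iter l (@sd q m).

(** Homotopy between the identity and one subdivision. Coning from barycentres, rather than from a
    vertex, makes it natural for linear maps. *)
Definition hT q m := @hcone q q (@idop q) (@sdop q 1) (fun m => @bary q m) m.

Lemma iter_sdB p l m (phi psi : 'M[RR]_(m, p) -> rat) :
  iter l (@sd p m) (fun N => phi N - psi N) =
  (fun M => iter l (@sd p m) phi M - iter l (@sd p m) psi M).
Proof. by elim: l => [//|l IH]; rewrite iterS IH sdB. Qed.

Lemma iter_sd_dmx p l m (phi : 'M[RR]_(m, p) -> rat) :
  iter l (@sd p _) (dmx phi) = dmx (iter l (@sd p m) phi).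
Proof. by elim: l => [//|l IH]; rewrite iterS IH sd_dmx. Qed.

Lemma hTP q m (phi : 'M[RR]_(m.+1, q) -> rat) :
  (fun M => hT (dmx phi) M + dmx (hT phi) M) = (fun M => phi M - sd phi M).
Proof.
apply: funext => M; apply: hconeP => //.
- by move=> *; rewrite /sdop iter_sdB.
- by move=> *; rewrite /sdop iter_sd_dmx.
Qed.

Lemma hTB q m (phi psi : 'M[RR]_(m.+1, q) -> rat) :
  hT (fun N => phi N - psi N) = (fun M => hT phi M - hT psi M).
Proof.
by apply: hconeB => // *; rewrite /sdop iter_sdB.
Qed.

(** Carrier argument: the apex stays in [C] and both operators evaluate cochains only on simplices
    of [C], hence so does the homotopy. *)
Lemma hcone_vanish q p m A B apex (C : set 'rV[RR]_q) (C' : set 'rV[RR]_p)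
    (M : 'M[RR]_(m, p)) (phi : 'M[RR]_(m.+1, q) -> rat) :
  (forall m (N : 'M[RR]_(m.+1, p)), rowsIn C' N -> C (apex m.+1 N)) ->
  (forall m psi (N : 'M[RR]_(m, p)), rowsIn C' N ->
     (forall N', rowsIn C N' -> psi N' = 0) -> A m psi N = 0 /\ B m psi N = 0) ->
  rowsIn C' M -> (forall N, rowsIn C N -> phi N = 0) ->
  hcone A B apex phi M = 0.
Proof.
move=> ha hAB; elim: m M phi => [//|m IH] M phi CM h.
rewrite hconeS /=.
have h' (N : 'M[RR]_(m.+1, q)) : rowsIn C N -> phi (cone (apex m.+1 M) N) = 0.
  by move=> CN; apply: h; apply: rowsIn_cone => //; apply: ha.
have [-> ->] := hAB _ _ _ CM h'.
rewrite /dmx big1 ?subrr ?subr0// => j _; rewrite IH ?mulr0//.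
exact: rowsIn_row'.
Qed.

Lemma rowsIn_diam q m (M : 'M[RR]_(m, q)) : exists2 D, 0 <= D & diamle D M.
Proof.
exists (\sum_i \sum_j `|row i M - row j M|).
  by apply: sumr_ge0 => i _; apply: sumr_ge0.
move=> i j; rewrite (bigD1 i)//= (bigD1 j)//= -addrA lerDl addr_ge0// ?sumr_ge0// => k _.
by apply: sumr_ge0.
Qed.

Lemma hT_vanish q m (C : set 'rV[RR]_q) (M : 'M[RR]_(m, q))
    (phi : 'M[RR]_(m.+1, q) -> rat) :
  cvx C -> rowsIn C M -> (forall N, rowsIn C N -> phi N = 0) -> hT phi M = 0.
Proof.
move=> cC CM h; apply: (@hcone_vanish _ _ _ _ _ _ C C) => //.
  by move=> m' N CN; apply: cvx_bary.
move=> m' psi N CN hp; split; first exact: hp.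
have [D D0 DN] := rowsIn_diam N.
by apply: (iter_sd_vanish cC CN DN D0) => N' CN' _; apply: hp.
Qed.

End ConvexVanishing.

(** * Naturality of subdivision under linear maps *)

Section Naturality.
Variables (q p : nat) (F : 'M[RR]_(p, q)).

Lemma row'_mul m (M : 'M[RR]_(m.+1, p)) j : row' j (M *m F) = row' j M *m F.
Proof. by apply/matrixP => a b; rewrite !mxE; apply: eq_bigr => c _; rewrite mxE. Qed.

Lemma dmx_nat m (phi : 'M[RR]_(m, q) -> rat) M :
  dmx phi (M *m F) = dmx (fun N => phi (N *m F)) M.
Proof. by rewrite /dmx; apply: eq_bigr => j _; rewrite row'_mul. Qed.

Lemma cone_mul m b (N : 'M[RR]_(m, p)) : cone (b *m F) (N *m F) = cone b N *m F.
Proof. exact: (esym (mul_col_mx b N F)). Qed.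

Lemma bary_mul m (M : 'M[RR]_(m, p)) : bary (M *m F) = bary M *m F.
Proof.
rewrite /bary -scalemxAl mulmx_suml; congr (_ *: _).
by apply: eq_bigr => i _; rewrite row_mul.
Qed.

Lemma sd_nat m (phi : 'M[RR]_(m, q) -> rat) M :
  sd phi (M *m F) = sd (fun N => phi (N *m F)) M.
Proof.
elim: m phi M => [//|m IH] phi M; rewrite !sdS dmx_nat /dmx.
apply: eq_bigr => j _; rewrite IH; congr (_ * sd _ _).
by apply: funext => N; rewrite bary_mul cone_mul.
Qed.

Lemma iter_sd_nat l m (phi : 'M[RR]_(m, q) -> rat) M :
  iter l (@sd q m) phi (M *m F) = iter l (@sd p m) (fun N => phi (N *m F)) M.
Proof.
elim: l M => [//|l IH] M; rewrite iterS sd_nat [in RHS]iterS; congr (sd _ _).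
by apply: funext => N; rewrite IH.
Qed.

Lemma hT_nat m (phi : 'M[RR]_(m.+1, q) -> rat) M :
  hT phi (M *m F) = hT (fun N => phi (N *m F)) M.
Proof.
elim: m phi M => [//|m IH] phi M; rewrite /hT !hconeS /idop /sdop; cbv zeta.
have E : (fun N : 'M[RR]_(m.+1, p) => phi (cone (bary (M *m F)) (N *m F))) =
   (fun N => phi (cone (bary M) N *m F)).
  by apply: funext => N; rewrite bary_mul cone_mul.
congr (_ - _ - _); first by rewrite bary_mul cone_mul.
  by rewrite iter_sd_nat E.
rewrite -E dmx_nat; congr (dmx _ _); apply: funext => N.
exact: IH.
Qed.

End Naturality.

(** * Singular cochains of a subset of the space of matrices *)

Section Singular.
Variables (n d : nat).
Notation sing := (sing n d).
Notation cochain := (cochain n d).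
Notation trunc := (trunc n d _).
Notation dcob := (dcob n d _).

Definition simp (X : set (Mpt n d)) k (s : sing k) : Prop :=
  [/\ (forall x, ~ std_simplex k x -> s x = 0),
      {within std_simplex k, continuous s} &
      (forall x, std_simplex k x -> X (s x))].

(* Cochains are functions on all maps; [coc X] and [nul X] (cocycle and coboundary on [X]) only look at
   simplices in [X]. There are no cochains of degree -1: in degree 0, [nul] means zero. *)
Definition coc X k (c : cochain k) := forall s : sing k.+1, simp X s -> dcob c s = 0.

Definition nul X k : cochain k -> Prop :=
  match k with
  | 0 => fun c => forall s : sing 0, simp X s -> c s = 0
  | p.+1 => fun c => exists h : cochain p, forall s : sing p.+1, simp X s -> c s = dcob h s
  end.

(** The affine simplex with vertex matrix [M] followed by [s], set to 0 outside the standard simplex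
    as the normalisation of singular simplices demands. Through it, [app] turns a singular cochain
    into a function of affine simplices, where subdivision is defined. *)
Definition pull q k (s : 'rV[RR]_q -> Mpt n d) (M : 'M[RR]_(k.+1, q)) : sing k :=
  trunc (fun x => s (x *m M)).

Definition app q k (c : cochain k) (s : 'rV[RR]_q -> Mpt n d) : 'M[RR]_(k.+1, q) -> rat :=
  fun N => c (pull s N).

Lemma truncE k (s : 'rV[RR]_k.+1 -> Mpt n d) x : std_simplex k x -> trunc s x = s x.
Proof. by move=> h; rewrite /Defs.trunc; case: asboolP. Qed.

Lemma truncN k (s : 'rV[RR]_k.+1 -> Mpt n d) x : ~ std_simplex k x -> trunc s x = 0.
Proof. by move=> h; rewrite /Defs.trunc; case: asboolP. Qed.

Lemma trunc_ext k (s s' : 'rV[RR]_k.+1 -> Mpt n d) :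
  (forall x, std_simplex k x -> s x = s' x) -> trunc s = trunc s'.
Proof.
by move=> h; apply: funext => x; rewrite /Defs.trunc; case: asboolP => // /h.
Qed.

Lemma trunc_simp X k (s : sing k) : simp X s -> trunc s = s.
Proof.
case=> h _ _; apply: funext => x; rewrite /Defs.trunc; case: asboolP => // /h.
by move=> ->.
Qed.

Notation rowsD p := (rowsIn (std_simplex p)).

Lemma simplex_mul p m (N : 'M[RR]_(m.+1, p.+1)) x :
  rowsD p N -> std_simplex m x -> std_simplex p (x *m N).
Proof. by move=> RN Dx; apply: cvx_simplex. Qed.

Lemma rowsD1 p : rowsD p (1%:M : 'M[RR]_p.+1).
Proof.
move=> i; split=> [j|]; first by rewrite !mxE; case: eqP.
rewrite (bigD1 i)//= big1 ?addr0 ?mxE ?eqxx// => j ji.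
by rewrite !mxE eq_sym (negbTE ji).
Qed.

Lemma pull_pull p q k (s : 'rV[RR]_q -> Mpt n d) (M : 'M[RR]_(p.+1, q))
  (N : 'M[RR]_(k.+1, p.+1)) : rowsD p N -> pull (pull s M) N = pull s (N *m M).
Proof.
move=> hN; apply: trunc_ext => x Dx; rewrite /pull truncE ?mulmxA//.
exact: simplex_mul.
Qed.

Lemma pull1 X k (s : sing k) : simp X s -> pull s 1%:M = s.
Proof.
move=> hs; rewrite -[RHS](trunc_simp hs); apply: trunc_ext => x _.
by rewrite mulmx1.
Qed.

Lemma faceE k (j : 'I_k.+2) (x : 'rV[RR]_k.+1) : face k j x = x *m row' j 1%:M.
Proof.
apply/rowP => l; rewrite !mxE; case: unliftP => [l' ->|->].
  rewrite (bigD1 l')//= big1 ?addr0 ?mxE ?eqxx ?mulr1// => i il.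
  by rewrite !mxE (inj_eq lift_inj) (negbTE il) mulr0.
by rewrite big1// => i _; rewrite !mxE eq_sym (negbTE (neq_lift _ _)) mulr0.
Qed.

Lemma dcobE k (h : cochain k) s :
  dcob h s = \sum_(j < k.+2) (-1) ^+ j * h (pull s (row' j 1%:M)).
Proof.
rewrite /Defs.dcob; apply: eq_bigr => j _; congr (_ * h _).
by apply: trunc_ext => x _; rewrite /= faceE.
Qed.

Lemma rowsD_row'1 p (j : 'I_p.+1) : rowsD p (row' j (1%:M : 'M[RR]_p.+1)).
Proof. by apply: rowsIn_row'; apply: rowsD1. Qed.

Lemma app_dcob q k (h : cochain k) (s : 'rV[RR]_q -> Mpt n d) (M : 'M[RR]_(k.+2, q)) :
  app (dcob h) s M = dmx (app h s) M.
Proof.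
rewrite /app dcobE /dmx; apply: eq_bigr => j _; congr (_ * h _).
rewrite pull_pull; last exact: rowsD_row'1.
by rewrite -row'_mul mul1mx.
Qed.

Lemma dcob_app' k (h : cochain k) (s : sing k.+1) : dcob h s = dmx (app h s) 1%:M.
Proof. exact: dcobE. Qed.

Lemma dcob_dcob k (h : cochain k) : dcob (dcob h) = fun=> 0.
Proof.
apply: funext => s; rewrite dcob_app'.
have -> : app (dcob h) s = dmx (app h s) by apply: funext => M; rewrite app_dcob.
by rewrite dmx_dmx.
Qed.

Lemma dcobB k (c c' : cochain k) s : dcob (c - c') s = dcob c s - dcob c' s.
Proof. by rewrite !dcobE -sumrB; apply: eq_bigr => j _; rewrite mulrBr. Qed.

Lemma dcobD k (c c' : cochain k) s : dcob (c + c') s = dcob c s + dcob c' s.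
Proof. by rewrite !dcobE -big_split; apply: eq_bigr => j _; rewrite mulrDr. Qed.

Definition scc k (a : rat) (c : cochain k) : cochain k := fun s => a * c s.

Lemma dcobZ k a (c : cochain k) s : dcob (scc a c) s = a * dcob c s.
Proof.
rewrite !dcobE mulr_sumr; apply: eq_bigr => j _.
by rewrite /scc mulrCA.
Qed.

Lemma dcob0 k s : dcob (0 : cochain k) s = 0.
Proof. by rewrite dcobE big1// => j _; rewrite mulr0. Qed.

Lemma mulmx_cont m p (N : 'M[RR]_(m, p)) : continuous (fun x : 'rV[RR]_m => x *m N).
Proof.
move=> x A /nbhs_ballP[e /= e0 eA].
pose S := \sum_i `|row i N|.
have S0 : 0 <= S by apply: sumr_ge0.
have S1 : 0 < S + 1 by rewrite ltr_wpDl.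
apply/nbhs_ballP; exists (e / (S + 1)); first by rewrite /= divr_gt0.
move=> y; rewrite -ball_normE /= => He; apply: eA; rewrite -ball_normE /=.
rewrite -mulmxBl mulmx_sum_row; apply: le_lt_trans (ler_norm_sum _ _ _) _.
apply: (@le_lt_trans _ _ (`|x - y| * S)).
  rewrite mulr_sumr; apply: ler_sum => i _; rewrite normrZ ler_wpM2r//.
  rewrite [leRHS]mx_normrE; apply/bigmax_geP; right => /=; by exists (0, i).
apply: (@le_lt_trans _ _ (e / (S + 1) * S)); first by rewrite ler_wpM2r// ltW.
by rewrite mulrAC ltr_pdivrMr// ltr_pM2l// ltrDl.
Qed.

Lemma within_trunc k (s : 'rV[RR]_k.+1 -> Mpt n d) :
  {within std_simplex k, continuous s} -> {within std_simplex k, continuous (trunc s)}.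
Proof.
apply: subspace_eq_continuous => x xD.
move: xD; rewrite inE => xD. exact: (esym (truncE s xD)).
Qed.

Lemma simp_pull X p k (s : sing p) (N : 'M[RR]_(k.+1, p.+1)) :
  simp X s -> rowsD p N -> simp X (pull s N).
Proof.
move=> [s0 sc sX] hN; split=> [x Dx||x Dx].
- exact: truncN.
- apply: within_trunc; apply/subspace_continuousP => x Dx.
  have Dx' := simplex_mul hN Dx.
  move/subspace_continuousP: sc => /(_ _ Dx') sc.
  move=> A /sc hA.
  have h : nbhs x [set y | std_simplex p (y *m N) -> A (s (y *m N))] :=
    @mulmx_cont _ _ N x [set y | std_simplex p y -> A (s y)] hA.
  change (nbhs x [set y | std_simplex k y -> A (s (y *m N))]).
  apply: filterS h => y hy Dy; apply: hy; exact: simplex_mul.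
- by rewrite /pull truncE//; apply: sX; apply: simplex_mul.
Qed.

Lemma simp_sub (X Y : set (Mpt n d)) k (s : sing k) :
  simp X s -> (forall x, std_simplex k x -> Y (s x)) -> simp Y s.
Proof. by case=> s0 sc _ sY; split. Qed.

Lemma simpW (X Y : set (Mpt n d)) k (s : sing k) : X `<=` Y -> simp X s -> simp Y s.
Proof. by move=> XY hs; apply: (simp_sub hs) => x Dx; apply: XY; case: hs => _ _; apply. Qed.

Lemma compact_simplex p : compact (std_simplex p).
Proof.
apply: bounded_closed_compact.
  exists 1; split=> // y y1 x [x0 x1] /=.
  rewrite [leLHS]mx_normrE; apply/bigmax_leP; split; first by lra.
  move=> [i j] _ /=; rewrite ord1 ger0_norm//; apply: le_trans (ltW y1).
  by rewrite -x1 (bigD1 j)//= lerDl sumr_ge0.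
have -> : std_simplex p = \bigcap_(j in [set: 'I_p.+1]) [set x : 'rV[RR]_p.+1 | 0 <= x 0 j]
    `&` [set x : 'rV[RR]_p.+1 | \sum_j x 0 j = 1].
  apply/seteqP; split=> x [h1 h2]; split=> //; first by move=> j _; exact: h1.
  by move=> j; exact: h1 j I.
apply: closedI.
  apply: closed_bigI => j _.
  have := @closed_comp _ _ (fun x : 'rV[RR]_p.+1 => x 0 j) [set y | 0 <= y].
  by apply=> [x _|]; [exact: coord_continuous|exact: closed_ge].
have := @closed_comp _ _ (fun x : 'rV[RR]_p.+1 => \sum_j x 0 j) [set y | y = 1].
apply=> [x _|]; last exact: closed_eq.
apply: cnt_sum => j _; exact: cnt_coord.
Qed.

Definition relopen (U X : set (Mpt n d)) := forall x, U x -> \forall y \near x, X y -> U y.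

Section Cover.
Variables (U V : set (Mpt n d)).
Hypothesis Uo : relopen U (U `|` V).
Hypothesis Vo : relopen V (U `|` V).
Let X := U `|` V.

Definition lebesgue p (s : sing p) (dl : RR) := 0 < dl /\
  forall x0, std_simplex p x0 ->
  (forall x, std_simplex p x -> `|x - x0| <= dl -> U (s x)) \/
  (forall x, std_simplex p x -> `|x - x0| <= dl -> V (s x)).

(** Lebesgue number: around each point of the simplex a radius works locally, and compactness gives
    one radius for all points. *)
Lemma lebesgueP p (s : sing p) : simp X s -> exists dl, lebesgue s dl.
Proof.
move=> [s0 sc sX].
have nc := (compact_near_coveringP _).1 (@compact_simplex p).
pose P (e : RR) (x0 : 'rV[RR]_p.+1) :=
  (forall x, std_simplex p x -> `|x - x0| <= e -> U (s x)) \/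
  (forall x, std_simplex p x -> `|x - x0| <= e -> V (s x)).
have key W x0 : relopen W X -> std_simplex p x0 -> W (s x0) ->
   \forall x' \near x0 & e \near 0^'+,
     forall x, std_simplex p x -> `|x - x'| <= e -> W (s x).
  move=> Wo Dx0 Wx0.
  move/subspace_continuousP: sc => /(_ _ Dx0) scx.
  have hh : nbhs x0 [set x | std_simplex p x -> X (s x) -> W (s x)] :=
    scx [set y | X y -> W y] (Wo _ Wx0).
  move/nbhs_ballP: hh => [r /= r0 hr].
  exists (ball x0 (r / 2), [set e | e < r / 2]); first split=> /=.
  - by apply: nbhsx_ballx; rewrite divr_gt0.
  - by apply: nbhs_right_lt; rewrite divr_gt0.
  move=> [x' e] [/= hx' he] x Dx hx; apply: hr => //; last exact: sX.
  rewrite -ball_normE /=; move: hx'; rewrite -ball_normE /= => hx'.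
  have -> : x0 - x = (x0 - x') - (x - x') by rewrite opprB addrA subrK.
  apply: le_lt_trans (ler_normB _ _) _; rewrite [ltRHS]splitr ltrD//.
  exact: le_lt_trans hx he.
have H : \forall e \near 0^'+, std_simplex p `<=` P e.
  apply: nc => x0 Dx0; have [Ux|Vx] := sX _ Dx0.
    have := key U x0 Uo Dx0 Ux; apply: filterS => -[x' e] /= h; by left.
  have := key V x0 Vo Dx0 Vx; apply: filterS => -[x' e] /= h; by right.
have [e [e0 he]] : exists e : RR, 0 < e /\ std_simplex p `<=` P e.
  have := filter_ex (filterI (nbhs_right_gt (0 : RR)) H).
  by case=> e [e0 he]; exists e; split.
by exists e; split=> // x0 /he.
Qed.
End Cover.
End Singular.

Lemma theta_expr_small m (dl : RR) : 0 < dl -> exists L, forall l, (L <= l)%N -> theta m ^+ l <= dl.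
Proof.
move=> dl0; have t1 : `|theta m| < 1 by rewrite ger0_norm ?theta_ge0// theta_lt1.
have := cvg_expr t1 => /cvgrPdist_le /(_ _ dl0) [L _ hL].
exists L => l Ll; have := hL l Ll.
by rewrite /= sub0r normrN ger0_norm// exprn_ge0// theta_ge0.
Qed.

Section Ext.
Variables (q : nat) (C : set 'rV[RR]_q).
Hypothesis cC : cvx C.

Lemma hT_ext m (M : 'M[RR]_(m, q)) (phi psi : 'M[RR]_(m.+1, q) -> rat) :
  rowsIn C M -> (forall N, rowsIn C N -> phi N = psi N) -> hT phi M = hT psi M.
Proof.
move=> CM h; apply/eqP; rewrite -subr_eq0; apply/eqP.
have := hTB phi psi => /(congr1 (fun f => f M)) <-.
by apply: (hT_vanish cC CM) => N /h ->; rewrite subrr.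
Qed.

Lemma iter_sd_ext l m (M : 'M[RR]_(m, q)) (phi psi : 'M[RR]_(m, q) -> rat) :
  rowsIn C M -> (forall N, rowsIn C N -> phi N = psi N) ->
  iter l (@sd q m) phi M = iter l (@sd q m) psi M.
Proof.
move=> CM h; apply/eqP; rewrite -subr_eq0; apply/eqP.
have := iter_sdB l phi psi => /(congr1 (fun f => f M)) <-.
have [D D0 DM] := rowsIn_diam M.
by apply: (iter_sd_vanish cC CM DM D0) => N /h -> _; rewrite subrr.
Qed.
End Ext.

Lemma diam_simplex p m (M : 'M[RR]_(m, p.+1)) : rowsIn (std_simplex p) M -> diamle 1 M.
Proof.
move=> MC i j; rewrite [leLHS]mx_normrE; apply/bigmax_leP; split; first exact: ler01.
have h (x : 'rV[RR]_p.+1) k : std_simplex p x -> 0 <= x 0 k <= 1.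
  by move=> [x0 x1]; rewrite x0 -x1 (bigD1 k)//= lerDl sumr_ge0.
move=> [a b] _ /=; rewrite ord1.
have /andP[h1 h2] := h _ b (MC i); have /andP[h3 h4] := h _ b (MC j).
rewrite mxE [X in _ + X]mxE ler_norml; apply/andP; split; lra.
Qed.

(** Serves to compare sums cut off at the subdivision depth of a simplex with sums cut off at the
    depth of one of its faces. *)
Lemma sum_vanish (A : nat -> rat) a b :
  (forall l, (a <= l)%N -> A l = 0) -> (forall l, (b <= l)%N -> A l = 0) ->
  \sum_(l < a) A l = \sum_(l < b) A l.
Proof.
wlog ab : a b / (a <= b)%N.
  by move=> W ha hb; case: (leqP a b) => [|/ltnW] /W; [apply|move=> ->].
move=> ha _; rewrite -!(big_mkord xpredT A).
rewrite [RHS](@big_cat_nat _ _ _ a)//= [X in _ = _ + X]big_nat_cond.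
rewrite [X in _ = _ + X]big1 ?addr0//.
by move=> i /andP[/andP[ai _] _]; apply: ha.
Qed.

(** * Small simplices *)

Section Small.
Variables (n d : nat).
Notation sing := (sing n d).
Notation cochain := (cochain n d).
Notation dcob := (dcob n d _).
Notation rowsD p := (rowsIn (std_simplex p)).
Variables (U V : set (Mpt n d)).
Hypothesis Uo : relopen U (U `|` V).
Hypothesis Vo : relopen V (U `|` V).
Let X := U `|` V.

Definition mmP k (s : sing k) L := exists dl, lebesgue U V s dl /\
  forall l, (L <= l)%N -> theta k.+1 ^+ l <= dl.

(** A depth of subdivision that makes [s] subordinate to the cover. It is chosen for each simplex
    separately and need not be compatible with faces. *)
Definition mm k (s : sing k) : nat := xget 0%N [set L | mmP s L].

Lemma mm_spec k (s : sing k) : simp X s -> mmP s (mm s).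
Proof.
move=> hs; have [dl [dl0 hdl]] := lebesgueP Uo Vo hs.
have [L hL] := theta_expr_small k.+1 dl0.
have : [set L | mmP s L] (mm s); last by [].
by apply: xgetPex; exists L; exists dl.
Qed.

(** The homotopy between the identity and the subdivision iterated [mm s] times, as a sum over the
    intermediate depths. *)
Definition Dop k (c : cochain k.+1) : cochain k := fun s =>
  \sum_(l < mm s) iter l (@sd k.+1 k.+1) (hT (app c s)) 1%:M.

Definition dD k : cochain k -> cochain k :=
  match k with 0 => fun _ => 0 | p.+1 => fun c => dcob (Dop c) end.

(* [c] evaluated on a subdivision fine enough (depending on the simplex) to be subordinate to the cover
   [U, V]: a cochain that vanishes on simplices in [U] or in [V] is thereby killed. *)
Definition smo k (c : cochain k) : cochain k := fun s => c s - dD c s - Dop (dcob c) s.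

Definition vanS k (e : cochain k) :=
  forall s : sing k, simp U s \/ simp V s -> e s = 0.

Lemma app_small k p (e : cochain k) (s : sing p) dl x0 (N : 'M[RR]_(k.+1, p.+1)) :
  vanS e -> simp X s -> lebesgue U V s dl -> std_simplex p x0 ->
  rowsIn (fun x => std_simplex p x /\ `|x - x0| <= dl) N -> app e s N = 0.
Proof.
move=> he hs [dl0 hdl] Dx0 CN; apply: he.
have DN : rowsD p N by move=> i; case: (CN i).
have hp := simp_pull hs DN.
have CC : cvx (fun x => std_simplex p x /\ `|x - x0| <= dl).
  by apply: cvx_and; [exact: cvx_simplex|exact: cvx_cball].
have hx x : std_simplex k x -> `|x *m N - x0| <= dl by move=> Dx; case: (CC _ _ CN _ Dx).
by have [h|h] := hdl _ Dx0; [left|right]; apply: (simp_sub hp) => x Dx;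
  rewrite /pull truncE//; apply: h => //; [exact: simplex_mul|exact: hx|exact: simplex_mul|exact: hx].
Qed.

Lemma hT_small k p (e : cochain k.+1) (s : sing p) dl (N : 'M[RR]_(k.+1, p.+1)) :
  vanS e -> simp X s -> lebesgue U V s dl -> rowsD p N -> diamle dl N -> hT (app e s) N = 0.
Proof.
move=> he hs hdl DN dN.
apply: (@hT_vanish _ _ (fun x => std_simplex p x /\ `|x - row ord0 N| <= dl)).
- by apply: cvx_and; [exact: cvx_simplex|exact: cvx_cball].
- by move=> i; split; [exact: DN|exact: dN].
- by move=> N' CN'; apply: (app_small he hs hdl (DN ord0) CN').
Qed.

Lemma iter_hT_small k p (e : cochain k.+1) (s : sing p) dl l (M : 'M[RR]_(k.+1, p.+1)) :
  vanS e -> simp X s -> lebesgue U V s dl -> rowsD p M -> theta k.+1 ^+ l <= dl ->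
  iter l (@sd p.+1 k.+1) (hT (app e s)) M = 0.
Proof.
move=> he hs hdl DM hl.
apply: (iter_sd_vanish (@cvx_simplex p) DM (diam_simplex DM) ler01) => N DN dN.
apply: (hT_small he hs hdl DN) => i j; apply: le_trans (dN i j) _.
by rewrite mulr1.
Qed.

Lemma iter_app_small k p (e : cochain k) (s : sing p) dl l (M : 'M[RR]_(k.+1, p.+1)) :
  vanS e -> simp X s -> lebesgue U V s dl -> rowsD p M -> theta k.+1 ^+ l <= dl ->
  iter l (@sd p.+1 k.+1) (app e s) M = 0.
Proof.
move=> he hs hdl DM hl.
apply: (iter_sd_vanish (@cvx_simplex p) DM (diam_simplex DM) ler01) => N DN dN.
apply: (app_small he hs hdl (DN ord0)) => i; split; first exact: DN.
by apply: le_trans (dN i ord0) _; rewrite mulr1.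
Qed.

Lemma app_pull k p q (e : cochain k) (s : sing q) (F : 'M[RR]_(p.+1, q.+1)) N :
  rowsD p N -> app e (pull s F) N = app e s (N *m F).
Proof. by move=> DN; rewrite /app pull_pull. Qed.

Lemma iter_hT_pull k p q (e : cochain k.+1) (s : sing q) (F : 'M[RR]_(p.+1, q.+1))
    l (M : 'M[RR]_(k.+1, p.+1)) : rowsD p M ->
  iter l (@sd p.+1 k.+1) (hT (app e (pull s F))) M =
  iter l (@sd q.+1 k.+1) (hT (app e s)) (M *m F).
Proof.
move=> DM; rewrite iter_sd_nat; apply: (iter_sd_ext (@cvx_simplex p)) => // N DN.
rewrite hT_nat; apply: (hT_ext (@cvx_simplex p)) => // N' DN'.
exact: app_pull.
Qed.

(** The sums over a simplex and over its faces have different cut-offs, but all terms beyond either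
    cut-off vanish on a face because [e] kills small simplices. Hence the cut-off of [s] may be used
    throughout, and the sums telescope. *)
Lemma smo_formula k (e : cochain k) (s : sing k) : vanS e -> simp X s ->
  smo e s = iter (mm s) (@sd k.+1 k.+1) (app e s) 1%:M.
Proof.
move=> he hs; pose phi := app e s.
have E1 : Dop (dcob e) s = phi 1%:M - iter (mm s) (@sd k.+1 k.+1) phi 1%:M
    - \sum_(l < mm s) dmx (iter l (@sd k.+1 k) (hT phi)) 1%:M.
  rewrite /Dop (_ : app (dcob e) s = dmx phi); last by apply: funext => M; rewrite app_dcob.
  have E : hT (dmx phi) = fun M => phi M - sd phi M - dmx (hT phi) M.
    apply: funext => M; have := hTP phi => /(congr1 (fun f => f M)) <-; ring.
  pose a l := iter l (@sd k.+1 k.+1) phi 1%:M.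
  pose b l := dmx (iter l (@sd k.+1 k) (hT phi)) 1%:M.
  rewrite (eq_bigr (fun l : 'I__ => a l - a l.+1 - b l)); last first.
    by move=> l _; rewrite E iter_sdB iter_sdB iter_sd_dmx -iterSr.
  transitivity (a 0%N - a (mm s) - \sum_(l < mm s) b l); last by [].
  elim: (mm s) => [|m IH]; first by rewrite !big_ord0 subrr subr0.
  rewrite !big_ord_recr IH /=. ring.
have E2 : dD e s = \sum_(l < mm s) dmx (iter l (@sd k.+1 k) (hT phi)) 1%:M.
  case: k e s he hs @phi {E1} => [|k] e s he hs phi.
    rewrite big1// => l _.
    rewrite (_ : iter l _ _ = fun=> 0) ?dmx0//.
    by elim: (nat_of_ord l) => [//|m IH]; rewrite iterS IH.
  rewrite /dD dcobE.
  under eq_bigr => j _.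
    rewrite /Dop.
    rewrite (_ : \sum_(l < _) _ = \sum_(l < mm s) iter l (@sd k.+2 k.+1) (hT phi) (row' j 1%:M)).
      over.
    have DF : rowsD k.+1 (row' j (1%:M : 'M[RR]_k.+2)) by exact: rowsD_row'1.
    pose A l := iter l (@sd k.+2 k.+1) (hT phi) (row' j 1%:M).
    rewrite (eq_bigr (fun l : 'I__ => A l)); last first.
      move=> l _; rewrite iter_hT_pull ?mul1mx//; exact: rowsD1.
    apply: sum_vanish => l ll.
      have hsj := simp_pull hs DF.
      have [dl [hdl hl]] := mm_spec hsj.
      have := iter_hT_small he hsj hdl (@rowsD1 k) (hl l ll).
      rewrite iter_hT_pull ?mul1mx//; exact: rowsD1.
    have [dl [hdl hl]] := mm_spec hs.
    apply: (iter_hT_small he hs hdl DF); apply: le_trans (hl l ll).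
    by rewrite lerXn2r ?nnegrE ?theta_ge0// theta_mono.
  rewrite exchange_big/= ; under eq_bigr => j _ do rewrite big_distrr.
  by rewrite /= exchange_big.
rewrite /smo E1 E2 -[e s]/(e s) -{1}(pull1 hs); rewrite -/(app e s 1%:M) -/phi; ring.
Qed.
End Small.

(** * Cocycles and coboundaries as linear conditions *)

Section Linear.
Variables (n d : nat).
Notation sing := (sing n d).
Notation cochain := (cochain n d).
Notation dcob := (dcob n d _).
Implicit Types (X Y : set (Mpt n d)).

Lemma dcob_local X k (c c' : cochain k) (s : sing k.+1) : simp X s ->
  (forall s', simp X s' -> c s' = c' s') -> dcob c s = dcob c' s.
Proof.
move=> hs h; rewrite !dcobE; apply: eq_bigr => j _; rewrite h//.
apply: simp_pull => //; exact: rowsD_row'1.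
Qed.

Lemma cocW X Y k (c : cochain k) : X `<=` Y -> coc Y c -> coc X c.
Proof. by move=> XY h s hs; apply: h; apply: simpW hs. Qed.

Lemma nulW X Y k (c : cochain k) : X `<=` Y -> nul Y c -> nul X c.
Proof.
case: k c => [|k] c XY /=; first by move=> h s hs; apply: h; apply: simpW hs.
by move=> [h hh]; exists h => s hs; apply: hh; apply: simpW hs.
Qed.

Lemma nul_ext X k (c c' : cochain k) : (forall s, simp X s -> c s = c' s) -> nul X c -> nul X c'.
Proof.
case: k c c' => [|k] c c' e /=; first by move=> h s hs; rewrite -e// h.
by move=> [h hh]; exists h => s hs; rewrite -e// hh.
Qed.

Lemma coc_ext X k (c c' : cochain k) : (forall s, simp X s -> c s = c' s) -> coc X c -> coc X c'.
Proof. by move=> e h s hs; rewrite -(dcob_local hs e) h. Qed.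

Lemma nul_coc X k (c : cochain k) : nul X c -> coc X c.
Proof.
case: k c => [|k] c /=.
  move=> h; apply: (@coc_ext _ _ (0 : cochain 0)); first by move=> s /h ->.
  by move=> s _; rewrite dcob0.
move=> [h hh]; apply: (@coc_ext _ _ (dcob h)); first by move=> s /hh ->.
by move=> s _; rewrite dcob_dcob.
Qed.

Lemma nul0 X k : nul X (0 : cochain k).
Proof. by case: k => [//|k]; exists 0 => s _; rewrite dcob0. Qed.

Lemma nulD X k (c c' : cochain k) : nul X c -> nul X c' -> nul X (c + c').
Proof.
case: k c c' => [|k] c c' /=; first by move=> h h' s hs; rewrite /GRing.add/= h// h'// addr0.
move=> [h hh] [h' hh']; exists (h + h') => s hs.
by rewrite dcobD -hh// -hh'.
Qed.

Lemma nulZ X k a (c : cochain k) : nul X c -> nul X (scc a c).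
Proof.
case: k c => [|k] c /=; first by move=> h s hs; rewrite /scc h// mulr0.
by move=> [h hh]; exists (scc a h) => s hs; rewrite dcobZ -hh.
Qed.

Lemma sccN1 k (c : cochain k) : scc (-1) c = - c.
Proof. by apply: funext => s; rewrite /scc mulN1r. Qed.

Lemma nulN X k (c : cochain k) : nul X c -> nul X (- c).
Proof. by move=> /(nulZ (-1)); rewrite sccN1. Qed.

Lemma nulB X k (c c' : cochain k) : nul X c -> nul X c' -> nul X (c - c').
Proof. by move=> h /nulN; apply: nulD. Qed.

Lemma coc0 X k : coc X (0 : cochain k).
Proof. by move=> s _; rewrite dcob0. Qed.

Lemma cocD X k (c c' : cochain k) : coc X c -> coc X c' -> coc X (c + c').
Proof. by move=> h h' s hs; rewrite dcobD h// h'// addr0. Qed.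

Lemma cocZ X k a (c : cochain k) : coc X c -> coc X (scc a c).
Proof. by move=> h s hs; rewrite dcobZ h// mulr0. Qed.

Lemma cocN X k (c : cochain k) : coc X c -> coc X (- c).
Proof. by move=> /(cocZ (-1)); rewrite sccN1. Qed.

Lemma cocB X k (c c' : cochain k) : coc X c -> coc X c' -> coc X (c - c').
Proof. by move=> h /cocN; apply: cocD. Qed.

Lemma coc_sum X k (I : Type) (r : seq I) (P : pred I) (F : I -> cochain k) :
  (forall i, P i -> coc X (F i)) -> coc X (\sum_(i <- r | P i) F i).
Proof. by move=> h; elim/big_ind: _ => //; [exact: coc0|exact: cocD]. Qed.

Lemma nul_sum X k (I : Type) (r : seq I) (P : pred I) (F : I -> cochain k) :
  (forall i, P i -> nul X (F i)) -> nul X (\sum_(i <- r | P i) F i).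
Proof. by move=> h; elim/big_ind: _ => //; [exact: nul0|exact: nulD]. Qed.

Lemma coc_nul X k (c c' : cochain k) : nul X (c - c') -> coc X c -> coc X c'.
Proof.
move=> /nul_coc h hc; have := cocB hc h.
by rewrite opprB addrC subrK.
Qed.

Lemma nul_sym X k (c c' : cochain k) : nul X (c - c') -> nul X (c' - c).
Proof. by move=> /nulN; rewrite opprB. Qed.

Lemma nul_trans X k (c' c c'' : cochain k) : nul X (c - c') -> nul X (c' - c'') -> nul X (c - c'').
Proof. by move=> h h'; have := nulD h h'; rewrite addrA subrK. Qed.

Lemma nul_eq X k (c c' : cochain k) : nul X (c - c') -> nul X c' -> nul X c.
Proof. by move=> h h'; have := nulD h h'; rewrite subrK. Qed.

Lemma scc1 k (c : cochain k) : scc 1 c = c.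
Proof. by apply: funext => s; rewrite /scc mul1r. Qed.

Lemma scc0 k (c : cochain k) : scc 0 c = 0.
Proof. by apply: funext => s; rewrite /scc mul0r. Qed.

Lemma sccA k a b (c : cochain k) : scc a (scc b c) = scc (a * b) c.
Proof. by apply: funext => s; rewrite /scc mulrA. Qed.

Lemma sccDl k a b (c : cochain k) : scc (a + b) c = scc a c + scc b c.
Proof. by apply: funext => s; rewrite /scc mulrDl. Qed.

Lemma sccDr k a (c c' : cochain k) : scc a (c + c') = scc a c + scc a c'.
Proof. by apply: funext => s; rewrite /scc mulrDr. Qed.

Lemma sccBr k a (c c' : cochain k) : scc a (c - c') = scc a c - scc a c'.
Proof. by apply: funext => s; rewrite /scc mulrBr. Qed.

Lemma nulZI X k a (c : cochain k) : a != 0 -> nul X (scc a c) -> nul X c.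
Proof. by move=> a0 /(nulZ a^-1); rewrite sccA mulVf// scc1. Qed.

Lemma nul_opp X k (c : cochain k) : nul X (c + c) -> nul X c.
Proof.
move=> h; apply: (@nulZI _ _ 2) => //.
by rewrite (_ : scc 2 c = c + c)//; apply: funext => s; rewrite /scc mulr2n mulrDl !mul1r.
Qed.

End Linear.

(** * Mayer-Vietoris and homotopy invariance *)

Section MayerVietoris.
Variables (n d : nat).
Notation sing := (sing n d).
Notation cochain := (cochain n d).
Notation dcob := (dcob n d _).
Variables (U V : set (Mpt n d)).
Hypothesis Uo : relopen U (U `|` V).
Hypothesis Vo : relopen V (U `|` V).
Let X := U `|` V.
Let Dop' := @Dop n d U V.
Let smo' := @smo n d U V.

Lemma DopB k (c c' : cochain k.+1) : Dop' (c - c') = Dop' c - Dop' c'.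
Proof.
apply: funext => s; rewrite /Dop' /Dop -[RHS]sumrB; apply: eq_bigr => l _.
rewrite (_ : app (c - c') s = fun N => app c s N - app c' s N)//.
by rewrite hTB iter_sdB.
Qed.

Lemma Dop_vanish W k (c : cochain k.+1) (s : sing k) : simp W s ->
  (forall s', simp W s' -> c s' = 0) -> Dop' c s = 0.
Proof.
move=> hs h; rewrite /Dop' /Dop big1// => l _.
have [D D0 DM] := rowsIn_diam (1%:M : 'M[RR]_k.+1).
apply: (iter_sd_vanish (@cvx_simplex k) (@rowsD1 k) DM D0) => N DN _.
apply: (hT_vanish (@cvx_simplex k) DN) => N' DN'.
by apply: h; exact: simp_pull.
Qed.

Lemma Dop0 k : Dop' (0 : cochain k.+1) = 0.
Proof. by have := DopB (0 : cochain k.+1) 0; rewrite !subrr. Qed.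

Lemma dDB k (c c' : cochain k) s : dD U V (c - c') s = dD U V c s - dD U V c' s.
Proof.
case: k c c' s => [|k] c c' s /=; first by rewrite subr0.
by have := DopB c c'; rewrite /Dop' => ->; rewrite dcobB.
Qed.

Lemma dcobBE k (c c' : cochain k) : dcob (c - c') = dcob c - dcob c'.
Proof. by apply: funext => s; rewrite dcobB. Qed.

Lemma smoB k (c c' : cochain k) s : smo' (c - c') s = smo' c s - smo' c' s.
Proof.
rewrite /smo' /smo dDB dcobBE; have := DopB (dcob c) (dcob c'); rewrite /Dop' => ->.
change ((c s - c' s) - (dD U V c s - dD U V c' s) - (Dop' (dcob c) s - Dop' (dcob c') s) =
  (c s - dD U V c s - Dop' (dcob c) s) - (c' s - dD U V c' s - Dop' (dcob c') s)).
move: (c s) (c' s) (dD U V c s) (dD U V c' s) (Dop' _ s) (Dop' _ s) => *; ring.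
Qed.

Lemma dcob_dD k (c : cochain k) : dcob (dD U V c) = 0.
Proof.
case: k c => [|k] c /=; apply: funext => s; first by rewrite dcob0.
by rewrite dcob_dcob.
Qed.

Lemma smo_dcob k (c : cochain k) : dcob (smo' c) = smo' (dcob c).
Proof.
rewrite (_ : smo' c = c - dD U V c - Dop' (dcob c))//.
rewrite !dcobBE dcob_dD subr0.
apply: funext => s; rewrite /smo' /smo dcob_dcob.
have h0 : Dop U V (fun=> 0) = 0 by exact: Dop0.
by rewrite h0 subr0.
Qed.

Lemma smo_vanish k (e : cochain k) (s : sing k) : vanS U V e -> simp X s -> smo' e s = 0.
Proof.
move=> he hs; rewrite /smo' (smo_formula Uo Vo he hs).
have [dl [hdl hl]] := mm_spec Uo Vo hs.
exact: (iter_app_small he hs hdl (@rowsD1 k) (hl _ (leqnn _))).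
Qed.

Lemma smo_coc k (e : cochain k) :
  (forall s, simp U s -> dcob e s = 0) -> (forall s, simp V s -> dcob e s = 0) ->
  coc X (smo' e).
Proof.
move=> hU hV s hs; rewrite smo_dcob; apply: smo_vanish => // s' [/hU|/hV] //.
Qed.

Lemma smo_on W k (e : cochain k) (s : sing k) : coc W e -> simp W s ->
  smo' e s = e s - dD U V e s.
Proof.
move=> hW hs; have h0 : Dop U V (dcob e) s = 0 by apply: (Dop_vanish hs) => s' /hW.
by rewrite /smo' /smo h0 subr0.
Qed.

Lemma dD_nul W k (e : cochain k) : nul W (dD U V e).
Proof. by case: k e => [|k] e //; exists (Dop' e). Qed.

Lemma smo_nul W k (e : cochain k) : coc W e -> nul W (smo' e - e).
Proof.
move=> hW; apply: (@nul_ext _ _ _ _ (- dD U V e)); last exact/nulN/dD_nul.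
move=> s hs; change (- dD U V e s = smo' e s - e s).
by rewrite (smo_on hW hs) addrAC subrr add0r.
Qed.

(** [c - dcob g] vanishes on simplices in [U] or in [V], so [smo'] kills it; and [smo' c] differs
    from [c] by a coboundary. *)
Lemma small_inj k (c : cochain k.+1) (g : cochain k) : coc X c ->
  (forall s, simp U s -> c s = dcob g s) -> (forall s, simp V s -> c s = dcob g s) ->
  nul X c.
Proof.
move=> hc hU hV; exists (Dop' c + smo' g) => s hs.
have E1 := smo_on hc hs.
have E2 : smo' (c - dcob g) s = 0.
  apply: smo_vanish => // s' [/hU|/hV] h; change (c s' - dcob g s' = 0);
  by rewrite h subrr.
move: E2; rewrite smoB -smo_dcob E1 => E2.
rewrite dcobD; change (c s = dD U V c s + dcob (smo' g) s).
by move/eqP: E2; rewrite subr_eq0 subr_eq addrC => /eqP.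
Qed.

Definition glue k (a b : cochain k) : cochain k :=
  fun s => if `[< simp U s >] then a s else b s.

Lemma glueU k (a b : cochain k) s : simp U s -> glue a b s = a s.
Proof. by move=> h; rewrite /glue; case: asboolP. Qed.

Lemma glueV k (a b : cochain k) s :
  (forall s', simp (U `&` V) s' -> a s' = b s') -> simp V s -> glue a b s = b s.
Proof.
move=> h hV; rewrite /glue; case: asboolP => // hU; apply: h.
by apply: (simp_sub hU) => x Dx; split; [case: hU|case: hV] => _ _; apply.
Qed.

Lemma glue_coc k (a b : cochain k) :
  (forall s', simp (U `&` V) s' -> a s' = b s') -> coc U a -> coc V b ->
  exists2 c : cochain k, coc X c & nul U (c - a) /\ nul V (c - b).
Proof.
move=> hab ha hb; exists (smo' (glue a b)).
  apply: smo_coc => s hs.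
    by rewrite (dcob_local (c' := a) hs) ?ha// => s' /glueU ->.
  by rewrite (dcob_local (c' := b) hs) ?hb// => s' /(glueV hab) ->.
have hU : coc U (glue a b) by apply: coc_ext ha => s /glueU ->.
have hV : coc V (glue a b) by apply: coc_ext hb => s /(glueV hab) ->.
split.
  apply: nul_ext (smo_nul hU) => s hs.
  change (smo' (glue a b) s - glue a b s = smo' (glue a b) s - a s).
  by rewrite glueU.
apply: nul_ext (smo_nul hV) => s hs.
change (smo' (glue a b) s - glue a b s = smo' (glue a b) s - b s).
by rewrite glueV.
Qed.

(** A coboundary correction makes [a] and [b] agree as cochains on the intersection. The glued
    cochain satisfies the cocycle equation only on simplices in [U] or in [V]; [smo'] repairs
    this. *)
Theorem MV_glue k (a b : cochain k) : coc U a -> coc V b -> nul (U `&` V) (a - b) ->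
  exists2 c : cochain k, coc X c & nul U (c - a) /\ nul V (c - b).
Proof.
case: k a b => [|k] a b ha hb.
  move=> h; apply: glue_coc => // s /h h'; apply/eqP; rewrite -subr_eq0; exact/eqP.
move=> [h hh]; pose a' : cochain k.+1 := a - dcob h.
have na : nul U (a' - a).
  exists (- h) => s _; rewrite /a' addrAC subrr add0r.
  by have := dcobB 0 h s; rewrite dcob0 !sub0r => ->.
have [|||c hc [h1 h2]] := @glue_coc _ a' b.
- move=> s hs; change (a s - dcob h s = b s).
  rewrite -(hh _ hs); change (a s - (a s - b s) = b s).
  by rewrite opprB addrC subrK.
- by apply: coc_nul ha; apply: nul_sym.
- by [].
by exists c => //; split=> //; apply: nul_trans na.
Qed.

(* [c] represents the image of the class of [f] under the connecting map. *)
Definition conn k (f : cochain k) (c : cochain k.+1) :=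
  exists a b : cochain k, [/\ (forall s, simp U s -> c s = dcob a s),
    (forall s, simp V s -> c s = dcob b s) &
    (forall s, simp (U `&` V) s -> f s = a s - b s)].

Lemma MV_conn1 k (c : cochain k.+1) : coc X c -> nul U c -> nul V c ->
  exists2 f, coc (U `&` V) f & conn f c.
Proof.
move=> hc [a ha] [b hb]; exists (a - b); last by exists a, b.
move=> s hs; rewrite dcobB -ha ?hb -?hb ?subrr//; apply: simpW hs => x [] //.
Qed.

Lemma MV_conn_ex k (f : cochain k) : coc (U `&` V) f ->
  exists2 c, coc X c & conn f c.
Proof.
move=> hf; pose e : cochain k.+1 := glue (dcob f) 0.
have hab s : simp (U `&` V) s -> dcob f s = (0 : cochain k.+1) s by move=> /hf ->.
have hU : coc U e.
  apply: coc_ext (_ : coc U (dcob f)); first by move=> s hs; rewrite /e glueU.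
  by move=> s _; rewrite dcob_dcob.
have hV : coc V e.
  by apply: (@coc_ext _ _ V _ 0 e) => [s hs|]; [rewrite /e glueV|exact: coc0].
exists (smo' e); first by apply: smo_coc.
exists (f - Dop' e), (- Dop' e); split.
- move=> s hs; rewrite (smo_on hU hs) dcobB; congr (_ - _).
  by rewrite /e glueU.
- move=> s hs; rewrite (smo_on hV hs) /e glueV//.
  change (0 - dcob (Dop' e) s = dcob (- Dop' e) s).
  by rewrite -[- Dop' e]sub0r dcobB dcob0.
- move=> s _; change (f s = (f s - Dop' e s) - - Dop' e s).
  by rewrite opprK subrK.
Qed.

(** The primitives of [c] on [U] and [V] are changed by [a], [b] and a primitive on the intersection
    until they agree there; then they glue. *)
Lemma MV_conn_nul k (f : cochain k) c a b : coc X c -> conn f c ->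
  coc U a -> coc V b -> nul (U `&` V) (f - (a - b)) -> nul X c.
Proof.
move=> hc [a0 [b0 [h1 h2 h3]]] ha hb hn.
have [a' [ha' ea]] : exists a', (forall s, simp U s -> c s = dcob a' s) /\ forall s, simp (U `&` V) s -> a' s = b0 s - b s.
  case: k f c a b hc a0 b0 h1 h2 h3 ha hb hn => [|k] f c a b hc a0 b0 h1 h2 h3 ha hb hn.
    exists (a0 - a); split=> s hs; first by rewrite dcobB ha// subr0 h1.
    have H : f s - (a s - b s) = 0 := hn _ hs.
    have e1 := h3 _ hs; change (a0 s - a s = b0 s - b s); lra.
  have [h hh] := hn; exists (a0 - a - dcob h); split=> s hs.
    by rewrite !dcobB ha// dcob_dcob !subr0 h1.
  change (a0 s - a s - dcob h s = b0 s - b s).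
  rewrite -(hh _ hs); change (a0 s - a s - (f s - (a s - b s)) = b0 s - b s).
  rewrite h3//; move: (a0 s) (a s) (b0 s) (b s) => *; ring.
apply: (@small_inj _ c (glue a' (b0 - b))) => // s hs.
  by rewrite (dcob_local (c' := a') hs) ?ha'// => s' /glueU ->.
rewrite (dcob_local (c' := b0 - b) hs); last by move=> s' hs'; rewrite glueV.
by rewrite dcobB hb// subr0 h2.
Qed.

Lemma MV_conn_inj k (f : cochain k) c : conn f c -> nul X c ->
  exists a b, [/\ coc U a, coc V b & nul (U `&` V) (f - (a - b))].
Proof.
move=> [a0 [b0 [h1 h2 h3]]] [g hg]; exists (a0 - g), (b0 - g).
have UX : U `<=` X by move=> x; left.
have VX : V `<=` X by move=> x; right.
split.
- by move=> s hs; rewrite dcobB -h1// hg ?subrr//; apply: simpW hs.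
- by move=> s hs; rewrite dcobB -h2// hg ?subrr//; apply: simpW hs.
apply: nul_ext (nul0 _ _) => s hs.
change (0 = f s - ((a0 s - g s) - (b0 s - g s))); rewrite h3//.
move: (a0 s) (b0 s) (g s) => *; ring.
Qed.

(** A simplex of dimension 0 has one point, so it lies in [U] or in [V]. *)
Lemma MV_deg0 (c : cochain 0) : coc X c -> nul U c -> nul V c -> nul X c.
Proof.
move=> _ hU hV s hs.
have Dx : std_simplex 0 (const_mx 1).
  by split=> [j|]; rewrite ?big_ord1 mxE.
have D1 x : std_simplex 0 x -> x = const_mx 1.
  by move=> [_]; rewrite big_ord1 => h; apply/rowP => j; rewrite ord1 mxE.
by have [_ _ /(_ _ Dx) [Ux|Vx]] := hs; [apply: hU|apply: hV];
  apply: (simp_sub hs) => x /D1 ->.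
Qed.

End MayerVietoris.

Lemma within_precomp (T1 T2 T3 : topologicalType) (A : set T1) (B : set T2)
    (f : T1 -> T2) (g : T2 -> T3) :
  continuous f -> (forall x, A x -> B (f x)) -> {within B, continuous g} ->
  {within A, continuous (g \o f)}.
Proof.
move=> cf AB /subspace_continuousP cg; apply/subspace_continuousP => x Ax W hW.
have h : nbhs x [set y | B (f y) -> W (g (f y))] :=
  @cf x [set y | B y -> W (g y)] (cg _ (AB _ Ax) _ hW).
change (nbhs x [set y | A y -> W (g (f y))]).
apply: filterS h => y hy Ay; apply: hy; exact: AB.
Qed.

Lemma within_postcomp (T1 T2 T3 : topologicalType) (A : set T1)
    (f : T1 -> T2) (g : T2 -> T3) :
  {within A, continuous f} -> (forall x, A x -> {for f x, continuous g}) ->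
  {within A, continuous (g \o f)}.
Proof.
move=> cf cg; apply: within_continuous_comp => // y; rewrite inE => -[x Ax <-].
exact: cg.
Qed.

(** * Pullback of cochains and straight-line homotopies *)

Section Pullback.
Variables (n d n' d' : nat).
Notation sing := (sing n d).

Definition mapto (phi : Mpt n d -> Mpt n' d') (X : set (Mpt n d)) (Y : set (Mpt n' d')) :=
  forall x, X x -> Y (phi x) /\ {for x, continuous phi}.

Definition pb k (phi : Mpt n d -> Mpt n' d') (c : cochain n' d' k) : cochain n d k :=
  fun s => c (trunc n' d' k (phi \o s)).

Lemma simp_map X Y phi k (s : sing k) : mapto phi X Y -> simp X s ->
  simp Y (trunc n' d' k (phi \o s)).
Proof.
move=> h [s0 sc sX]; split=> [x Dx||x Dx].
- exact: truncN.
- apply: within_trunc; apply: within_postcomp => // x Dx.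
  by have [] := h _ (sX _ Dx).
- by rewrite truncE//=; have [] := h _ (sX _ Dx).
Qed.

Lemma trunc_pull phi p k (s : sing p) (F : 'M[RR]_(k.+1, p.+1)) :
  rowsIn (std_simplex p) F ->
  trunc n' d' k (phi \o pull s F) = pull (trunc n' d' p (phi \o s)) F.
Proof.
move=> DF; apply: trunc_ext => x Dx; rewrite /= /pull !truncE//=.
exact: simplex_mul.
Qed.

Lemma dcob_pb k phi (c : cochain n' d' k) :
  dcob n d k (pb phi c) = pb phi (dcob n' d' k c).
Proof.
apply: funext => s; rewrite /pb !dcobE; apply: eq_bigr => j _.
by rewrite trunc_pull//; exact: rowsD_row'1.
Qed.

Lemma pb_coc X Y phi k (c : cochain n' d' k) : mapto phi X Y -> coc Y c -> coc X (pb phi c).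
Proof. by move=> h hc s hs; rewrite dcob_pb /pb hc//; apply: simp_map hs. Qed.

Lemma pb_nul X Y phi k (c : cochain n' d' k) : mapto phi X Y -> nul Y c -> nul X (pb phi c).
Proof.
case: k c => [|k] c h /=; first by move=> hc s hs; apply: hc; apply: simp_map hs.
move=> [g hg]; exists (pb phi g) => s hs.
by rewrite dcob_pb /pb -hg//; apply: simp_map hs.
Qed.

Lemma pbB k phi (c c' : cochain n' d' k) : pb phi (c - c') = pb phi c - pb phi c'.
Proof. by []. Qed.

Lemma pbD k phi (c c' : cochain n' d' k) : pb phi (c + c') = pb phi c + pb phi c'.
Proof. by []. Qed.

Lemma pb0 k phi : pb phi (0 : cochain n' d' k) = 0.
Proof. by []. Qed.

Lemma pbN k phi (c : cochain n' d' k) : pb phi (- c) = - pb phi c.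
Proof. by []. Qed.

Lemma pbZ k phi a (c : cochain n' d' k) : pb phi (scc a c) = scc a (pb phi c).
Proof. by []. Qed.

Lemma pb_sum k phi (I : Type) (r : seq I) (P : pred I) (F : I -> cochain n' d' k) :
  pb phi (\sum_(i <- r | P i) F i) = \sum_(i <- r | P i) pb phi (F i).
Proof.
elim: r => [|a r IH]; first by rewrite !big_nil pb0.
by rewrite !big_cons; case: (P a) => //; rewrite pbD IH.
Qed.

Lemma pb_ext X k phi psi (c : cochain n' d' k) (s : sing k) :
  (forall x, X x -> phi x = psi x) -> simp X s -> pb phi c s = pb psi c s.
Proof.
move=> h [_ _ sX]; rewrite /pb; congr c; apply: trunc_ext => x Dx /=.
by rewrite h//; apply: sX.
Qed.

End Pullback.

Lemma pb_comp n1 d1 n2 d2 n3 d3 k (phi : Mpt n1 d1 -> Mpt n2 d2)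
  (psi : Mpt n2 d2 -> Mpt n3 d3) (c : cochain n3 d3 k) :
  pb phi (pb psi c) = pb (psi \o phi) c.
Proof.
apply: funext => s; rewrite /pb; congr c; apply: trunc_ext => x Dx /=.
by rewrite truncE.
Qed.

Lemma pb_id n d k (c : cochain n d k) X (s : sing n d k) : simp X s -> pb id c s = c s.
Proof. by move=> hs; rewrite /pb (trunc_simp hs). Qed.

Lemma pb_id_nul n d k (c : cochain n d k) X phi : (forall x, X x -> phi x = x) ->
  nul X (pb phi c - c).
Proof.
move=> h; apply: nul_ext (nul0 X k) => s hs.
by change (0 = pb phi c s - c s); rewrite (pb_ext c h hs) (pb_id c hs) subrr.
Qed.

Lemma mapto_comp n1 d1 n2 d2 n3 d3 (phi : Mpt n1 d1 -> Mpt n2 d2)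
  (psi : Mpt n2 d2 -> Mpt n3 d3) X Y Z :
  mapto phi X Y -> mapto psi Y Z -> mapto (psi \o phi) X Z.
Proof.
move=> h1 h2 x Xx; have [Yx c1] := h1 _ Xx; have [Zx c2] := h2 _ Yx; split=> //.
exact: (continuous_comp c1 c2).
Qed.

Section Homotopy.
Variables (n d n' d' : nat).
Notation sing := (sing n d).
Variables (X : set (Mpt n d)) (Y : set (Mpt n' d')) (f0 f1 : Mpt n d -> Mpt n' d').
Hypothesis f0c : forall x, X x -> {for x, continuous f0}.
Hypothesis f1c : forall x, X x -> {for x, continuous f1}.
Hypothesis fY : forall x (t : RR), X x -> 0 <= t <= 1 -> Y ((1 - t) *: f0 x + t *: f1 x).

Definition cyl p : set 'rV[RR]_(p.+1 + 1) :=
  fun z => std_simplex p (lsubmx z) /\ 0 <= (rsubmx z) 0 0 <= 1.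

Lemma cvx_cyl p : cvx (cyl (p := p)).
Proof.
move=> m M MC w ww.
have hl : lsubmx (w *m M) = w *m lsubmx M.
  by apply/rowP => j; rewrite !mxE; apply: eq_bigr => i _; rewrite mxE.
have hr : rsubmx (w *m M) 0 0 = \sum_i w 0 i * (rsubmx (row i M)) 0 0.
  by rewrite !mxE; apply: eq_bigr => i _; rewrite !mxE.
split.
  rewrite hl; apply: cvx_simplex => // i.
  by have [h _] := MC i; congr std_simplex: h; apply/rowP => j; rewrite !mxE.
case: ww => w0 w1; rewrite hr; apply/andP; split.
  by apply: sumr_ge0 => i _; rewrite mulr_ge0//; have [_ /andP[]] := MC i.
rewrite -w1; apply: ler_sum => i _; rewrite ler_piMr//; by have [_ /andP[]] := MC i.
Qed.

(** [cylA] and [cylB] evaluate on the two ends of the prism over a simplex, the last coordinate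
    being the time. *)
Definition cylA p : chop (p.+1 + 1) p.+1 := fun m psi M => psi (row_mx M (const_mx 1)).
Definition cylB p : chop (p.+1 + 1) p.+1 := fun m psi M => psi (row_mx M 0).
Definition cyl_apex p m (M : 'M[RR]_(m, p.+1)) : 'rV[RR]_(p.+1 + 1) := row_mx (bary M) 0.

Definition hH p m := @hcone (p.+1 + 1) p.+1 (@cylA p) (@cylB p) (@cyl_apex p) m.

Lemma row'_row_mx m p q (M : 'M[RR]_(m.+1, p)) (N : 'M[RR]_(m.+1, q)) j :
  row' j (row_mx M N) = row_mx (row' j M) (row' j N).
Proof. by apply/matrixP => a b; rewrite !mxE; case: splitP => l _; rewrite mxE. Qed.

Lemma hHP p m (phi : 'M[RR]_(m.+1, p.+1 + 1) -> rat) M :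
  hH (dmx phi) M + dmx (hH phi) M = phi (row_mx M (const_mx 1)) - phi (row_mx M 0).
Proof.
apply: hconeP => //.
- move=> m' psi; apply: funext => N; rewrite /cylA /dmx; apply: eq_bigr => j _.
  by rewrite row'_row_mx row'_const.
- move=> m' psi; apply: funext => N; rewrite /cylB /dmx; apply: eq_bigr => j _.
  by rewrite row'_row_mx row'_const.
- apply: funext => psi; apply: funext => N; rewrite /cylA /cylB; congr psi.
  by rewrite [LHS]flatmx0 [RHS]flatmx0.
Qed.

Lemma hH_vanish p m (M : 'M[RR]_(m, p.+1)) (phi : 'M[RR]_(m.+1, p.+1 + 1) -> rat) :
  rowsIn (std_simplex p) M -> (forall N, rowsIn (cyl (p := p)) N -> phi N = 0) ->
  hH phi M = 0.
Proof.
have cylrow m' (N : 'M[RR]_(m', p.+1)) (t : RR) : 0 <= t <= 1 -> rowsIn (std_simplex p) N ->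
    rowsIn (cyl (p := p)) (row_mx N (const_mx t)).
  move=> ht DN i; split.
    by rewrite row_row_mx row_mxKl; apply: DN.
  by rewrite row_row_mx row_mxKr !mxE.
move=> DM h; apply: (@hcone_vanish _ _ _ _ _ _ (cyl (p := p)) (std_simplex p)) => //.
  move=> m' N DN; split; rewrite ?row_mxKl ?row_mxKr; first exact: (cvx_bary (@cvx_simplex p)).
  by rewrite mxE lexx ler01.
move=> m' psi N DN hpsi; split; rewrite /cylA /cylB; apply: hpsi; apply: cylrow => //.
  by rewrite ler01 lexx.
by rewrite ler01 lexx.
Qed.

Lemma hHB p m (phi psi : 'M[RR]_(m.+1, p.+1 + 1) -> rat) :
  hH (fun N => phi N - psi N) = (fun M => hH phi M - hH psi M).
Proof. exact: hconeB. Qed.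

Lemma hH_nat p q m (F : 'M[RR]_(p.+1, q.+1)) (phi : 'M[RR]_(m.+1, q.+1 + 1) -> rat) M :
  hH phi (M *m F) = hH (fun N => phi (N *m block_mx F 0 0 1%:M)) M.
Proof.
have bE k (N : 'M[RR]_(k, p.+1)) (N' : 'M[RR]_(k, 1)) :
    row_mx N N' *m block_mx F 0 0 1%:M = row_mx (N *m F) N'.
  by rewrite mul_row_block !mulmx0 addr0 add0r mulmx1.
elim: m phi M => [//|m IH] phi M; rewrite /hH !hconeS /cylA /cylB; cbv zeta.
have E : (fun N : 'M[RR]_(m.+1, p.+1 + 1) => phi (cone (cyl_apex (M *m F)) (N *m block_mx F 0 0 1%:M))) =
   (fun N => phi (cone (cyl_apex M) N *m block_mx F 0 0 1%:M)).
  apply: funext => N; rewrite /cyl_apex bary_mul -cone_mul; congr (phi (cone _ _)).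
  by rewrite bE.
congr (_ - _ - _).
- by have := congr1 (fun g => g (row_mx M (const_mx 1))) E; rewrite /= bE.
- by have := congr1 (fun g => g (row_mx M 0)) E; rewrite /= bE.
rewrite dmx_nat; congr (dmx _ _); apply: funext => N.
by rewrite -E; exact: IH.
Qed.

Definition cylmap p (s : sing p) (z : 'rV[RR]_(p.+1 + 1)) : Mpt n' d' :=
  (1 - rsubmx z 0 0) *: f0 (s (lsubmx z)) + rsubmx z 0 0 *: f1 (s (lsubmx z)).

Lemma cylmap_simp p k (s : sing p) (N : 'M[RR]_(k.+1, p.+1 + 1)) :
  simp X s -> rowsIn (cyl (p := p)) N -> simp Y (pull (cylmap s) N).
Proof.
move=> [s0 sc sX] CN.
have hx x : std_simplex k x -> cyl (x *m N) by move=> Dx; apply: cvx_cyl.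
split=> [x Dx||x Dx]; first exact: truncN; last first.
  rewrite /pull truncE//; have [h1 h2] := hx _ Dx; apply: fY => //; exact: sX.
apply: within_trunc.
have cl (f : Mpt n d -> Mpt n' d') : (forall x, X x -> {for x, continuous f}) ->
    {within std_simplex k, continuous (fun x => f (s (lsubmx (x *m N))))}.
  move=> fc.
  rewrite -[fun x => _]/(f \o (s \o (fun x => lsubmx (x *m N)))).
  apply: within_postcomp; last by move=> x /hx [h _]; apply: fc; apply: sX.
  apply: (within_precomp (B := std_simplex p)) => //.
    rewrite (_ : (fun x => _) = fun x => x *m lsubmx N); first exact: mulmx_cont.
    apply: funext => x.
    by apply/rowP => j; rewrite !mxE; apply: eq_bigr => i _; rewrite mxE.
  by move=> x /hx [].
have cr0 : continuous (fun x : 'rV[RR]_k.+1 => rsubmx (x *m N) 0 0).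
  have -> : (fun x : 'rV[RR]_k.+1 => rsubmx (x *m N) 0 0) =
      fun x => \sum_i x 0 i * N i (rshift p.+1 0) by apply: funext => y; rewrite !mxE.
  by move=> x; apply: cnt_sum => i _; apply: cntM; [exact: cnt_coord|exact: cnt_cst].
have cr := continuous_subspaceT (A := std_simplex k) cr0.
move=> x; apply: (@mx_cont (subspace (std_simplex k)) _ _ _ x) => i j.
rewrite (_ : (fun y => _) = fun y =>
   (1 - rsubmx (y *m N) 0 0) * f0 (s (lsubmx (y *m N))) i j +
   rsubmx (y *m N) 0 0 * f1 (s (lsubmx (y *m N))) i j); last first.
  by apply: funext => y; rewrite /cylmap !mxE.
have ce (f : Mpt n d -> Mpt n' d') : (forall x, X x -> {for x, continuous f}) ->
    cnt (T := subspace (std_simplex k)) (fun y => f (s (lsubmx (y *m N))) i j) x.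
  move=> fc; rewrite /cnt.
  have := @within_postcomp _ _ _ (std_simplex k) (fun x => f (s (lsubmx (x *m N))))
    (fun M : Mpt n' d' => M i j) (cl f fc).
  apply; last first.
  by move=> x' _; exact: coord_continuous.
apply: cntD; apply: cntM.
- by apply: cntB; [exact: cnt_cst|exact: cr].
- exact: ce.
- exact: cr.
- exact: ce.
Qed.

Definition hop k (c : cochain n' d' k.+1) : cochain n d k :=
  fun s => hH (app c (cylmap s)) 1%:M.

(** The prism operator is the acyclic-carrier homotopy between the two ends of the prism. By
    convexity of the prism it only evaluates [c] on simplices swept by the straight-line homotopy,
    which lie in [Y]. *)
Theorem homotopy k (c : cochain n' d' k) : coc Y c -> nul X (pb f1 c - pb f0 c).
Proof.
move=> hc.
have key (s : sing k) : simp X s -> pb f1 c s - pb f0 c s = dmx (hH (app c (cylmap s))) 1%:M.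
  move=> hs; have := hHP (app c (cylmap s)) 1%:M.
  rewrite (_ : dmx (app c _) = app (dcob n' d' k c) (cylmap s)); last first.
    by apply: funext => N; rewrite app_dcob.
  rewrite hH_vanish ?add0r; last 2 first.
  - exact: rowsD1.
  - by move=> N CN; apply: hc; apply: cylmap_simp.
  have E (t : RR) : pull (cylmap s) (row_mx (1%:M : 'M[RR]_k.+1) (const_mx t)) =
      trunc n' d' k ((fun x => (1 - t) *: f0 x + t *: f1 x) \o s).
    apply: trunc_ext => x [x0 x1]; rewrite mul_mx_row mulmx1 /cylmap row_mxKl row_mxKr /=.
    rewrite (_ : (x *m const_mx t) 0 0 = t)// mxE (eq_bigr (fun j => x 0 j * t)); last first.
      by move=> j _; rewrite mxE.
    by rewrite -mulr_suml x1 mul1r.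
  move=> ->; rewrite /app E (_ : 0 = const_mx 0)// E /pb; congr (c _ - c _).
    by apply: trunc_ext => x _ /=; rewrite subrr scale0r add0r scale1r.
  by apply: trunc_ext => x _ /=; rewrite subr0 scale0r addr0 scale1r.
case: k c hc key => [|k] c hc key.
  move=> s hs; change (pb f1 c s - pb f0 c s = 0); rewrite (key _ hs) dmx0//.
exists (hop c) => s hs; change (pb f1 c s - pb f0 c s = dcob n d k (hop c) s).
rewrite (key _ hs) dcobE /dmx; apply: eq_bigr => j _; congr (_ * _).
rewrite -[X in hH _ X]mul1mx hH_nat /hop.
set F := row' j 1%:M.
have DF : rowsIn (std_simplex k.+1) F by exact: rowsD_row'1.
apply/eqP; rewrite -subr_eq0; apply/eqP.
have := hHB (fun N => app c (cylmap s) (N *m block_mx F 0 0 1%:M)) (app c (cylmap (pull s F))).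
move=> /(congr1 (fun g => g 1%:M)) <-; apply: hH_vanish; first exact: rowsD1.
move=> N CN; apply/eqP; rewrite subr_eq0; apply/eqP; congr c.
apply: trunc_ext => x Dx; rewrite mulmxA; move: (cvx_cyl CN Dx); move: (x *m N) => z Cz.
have bz : z *m block_mx F 0 0 1%:M = row_mx (lsubmx z *m F) (rsubmx z).
  by rewrite -{1}[z]hsubmxK mul_row_block !mulmx0 addr0 add0r mulmx1.
by rewrite /cylmap bz row_mxKl row_mxKr /pull truncE//; case: Cz.
Qed.

End Homotopy.

(** * Empty sets, disjoint unions and constant cochains *)

Section EmptyAndDisjoint.
Variables (n d : nat).
Notation cochain := (cochain n d).

Lemma simplex_ne k : std_simplex k (unif k). Proof. exact: unif_simplex. Qed.

Lemma simp_ne (X : set (Mpt n d)) k (s : sing n d k) : simp X s -> exists x, X x.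
Proof. by case=> _ _ h; exists (s (unif k)); apply: h; apply: simplex_ne. Qed.

Lemma nul_empty (X : set (Mpt n d)) k (c : cochain k) : (forall x, ~ X x) -> nul X c.
Proof.
case: k c => [|k] c h /=; first by move=> s /simp_ne [x /h].
by exists 0 => s /simp_ne [x /h].
Qed.

Lemma nul_disjoint (U V : set (Mpt n d)) k (c : cochain k) :
  relopen U (U `|` V) -> relopen V (U `|` V) -> (forall x, U x -> ~ V x) ->
  coc (U `|` V) c -> nul U c -> nul V c -> nul (U `|` V) c.
Proof.
case: k c => [|k] c Uo Vo UV hc hU hV; first exact: MV_deg0.
have [f hf fc] := MV_conn1 hc hU hV.
have H := MV_conn_nul Uo Vo hc fc (@coc0 _ _ U k) (@coc0 _ _ V k); apply: H.
by apply: nul_empty => x [] /UV.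
Qed.

(** The coboundary of a constant cochain is an alternating sum of equal terms: the constant itself
    in odd degree, 0 in even degree. So in odd degree the cocycle condition makes the constant 0,
    and in positive even degree the constant is a coboundary. *)
Lemma nul_point k (a : rat) (c : cochain k) : (0 < k)%N ->
  (forall s, c s = a) -> (exists s : sing n d k.+1, dcob n d k c s = 0) ->
  nul setT c.
Proof.
case: k c => [//|k] c _ ca [s0 hs0].
have sgn m : \sum_(j < m) (-1) ^+ j = (odd m)%:R :> rat.
  elim: m => [|m IH]; first by rewrite big_ord0.
  by rewrite big_ord_recr /= IH -signr_odd; case: (odd m); rewrite ?subrr ?add0r.
have E j (c' : cochain j) s : (forall s, c' s = a) -> dcob n d j c' s = (odd j)%:R * a.
  move=> h; rewrite dcobE (eq_bigr (fun i : 'I_j.+2 => (-1) ^+ i * a)); last first.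
    by move=> i _; rewrite h.
  by rewrite -big_distrl /= sgn /= negbK.
move: hs0; rewrite E// => hs0.
case: (boolP (odd k)) => ok.
  by exists (fun=> a) => s _; rewrite E// ca ok mul1r.
move: hs0; rewrite /= ok mul1r => a0.
by apply: nul_ext (nul0 setT k.+1) => s _; rewrite ca a0.
Qed.

End EmptyAndDisjoint.

(** * Coordinates, their updates and reflections *)

Section CoordMaps.
Variables (n d : nat).
Notation I := ('I_n * 'I_d)%type.
Implicit Types (e : I) (u : Mpt n d) (b : {set I}).

Definition crd e u : RR := u e.1 e.2.

Definition upd e (f : Mpt n d -> RR) u : Mpt n d :=
  \matrix_(i, j) if (i, j) == e then f u else u i j.

Lemma crd_upd e f u : crd e (upd e f u) = f u.
Proof. by case: e => i j; rewrite /crd mxE eqxx. Qed.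

Lemma crd_updN e e' f u : e' != e -> crd e' (upd e f u) = crd e' u.
Proof. by case: e' => i j h; rewrite /crd mxE /= (negbTE h). Qed.

Lemma crd_ext u v : (forall e, crd e u = crd e v) -> u = v.
Proof. by move=> h; apply/matrixP => i j; exact: (h (i, j)). Qed.

Lemma cnt_crd e u : cnt (crd e) u. Proof. exact: cnt_coord. Qed.

Lemma upd_cont e f u : cnt f u -> {for u, continuous (upd e f)}.
Proof.
move=> hf; apply: mx_cont => i j.
rewrite (_ : (fun y => _) = fun y => if (i, j) == e then f y else y i j).
  by case: eqP => _ //; exact: cnt_coord.
by apply: funext => y; rewrite mxE.
Qed.

Lemma crd_seg e u v (t : RR) : crd e ((1 - t) *: u + t *: v) = (1 - t) * crd e u + t * crd e v.
Proof. by rewrite /crd !mxE. Qed.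

Definition nz b u := exists2 e, e \in b & crd e u != 0.

Lemma nz_eq b u v : (forall e, e \in b -> crd e u = crd e v) -> nz b u -> nz b v.
Proof. by move=> h [e eb he]; exists e => //; rewrite -h. Qed.

Definition refl e : Mpt n d -> Mpt n d := upd e (fun u => - crd e u).

Lemma nz_refl b e u : nz b u -> nz b (refl e u).
Proof.
move=> [e' eb he]; exists e' => //; rewrite /refl.
by case: (eqVneq e' e) he => [->|h]; rewrite ?crd_upd ?oppr_eq0 ?crd_updN.
Qed.

Lemma refl_cont e u : {for u, continuous (refl e)}.
Proof. by apply: upd_cont; apply: cntN; apply: cnt_crd. Qed.

Lemma near_nz b u : nz b u -> \forall v \near u, nz b v.
Proof.
move=> [e eb he]; have := cnt_neq0 (@cnt_crd e u) he.
by apply: filterS => v hv; exists e.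
Qed.

End CoordMaps.

(** * Products of punctured coordinate spaces *)

Section Blocks.
Variables (n d : nat) (T : finType).
Notation I := ('I_n * 'I_d)%type.
Notation cochain := (cochain n d).
Implicit Types (B : T -> {set I}) (J : {set T}) (rep : T -> I).

Definition XB B J : set (Mpt n d) := fun u => forall t, t \in J -> nz (B t) u.

Definition degB B J : nat := (\sum_(t in J) #|B t|.-1)%N.

Definition goodB B J rep :=
  [/\ (forall t t', t \in J -> t' \in J -> t != t' -> forall e, e \in B t -> e \notin B t') &
      (forall t, t \in J -> rep t \in B t)].

(* [XB B J] is a product of spheres up to homotopy: besides the classes pulled back from a smaller
   product there is only a top class [om], which a reflection in each block negates. *)
Definition structB B J rep := exists om : forall k, cochain k,
  [/\ (forall k, coc (XB B J) (om k)),
      (forall k, k != degB B J -> om k = 0),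
      (forall k t, t \in J -> nul (XB B J) (pb (refl (rep t)) (om k) + om k)) &
      (forall k (c : cochain k), coc (XB B J) c ->
         exists (lam : rat) (g : T -> cochain k),
           (forall t, t \in J -> coc (XB B (J :\ t)) (g t)) /\
           nul (XB B J) (c - (scc lam (om k) + \sum_(t in J) g t)))].

Lemma XB_sub B J J' : J' \subset J -> XB B J `<=` XB B J'.
Proof. by move=> JJ u h t /(fintype.subsetP JJ) /h. Qed.

Lemma mapto_same (X : set (Mpt n d)) phi : (forall u, X u -> X (phi u)) ->
  (forall u, {for u, continuous phi}) -> mapto phi X X.
Proof. by move=> h1 h2 u Xu; split; [exact: h1|exact: h2]. Qed.

Lemma XB_refl B J e : mapto (@refl n d e) (XB B J) (XB B J).
Proof.
apply: mapto_same => [u h t tJ|u]; last exact: refl_cont.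
by apply: nz_refl; exact: h.
Qed.

(** The whole space contracts to 0 along straight lines, after which a cocycle is constant. The
    constant 1 in degree 0 is the top class of the empty product. *)
Lemma structB0 B rep : structB B finset.set0 rep.
Proof.
exists (fun k => match k with 0 => fun=> 1 | _.+1 => 0 end); split.
- case=> [|k]; last exact: coc0.
  by move=> s _; rewrite dcobE !big_ord_recl big_ord0 /= mulr1 expr1 mulN1r addr0 subrr.
- by case=> //; rewrite /degB big_set0.
- by move=> k t; rewrite inE.
move=> k c hc.
have c0 (u : Mpt n d) : {for u, continuous (fun _ : Mpt n d => 0 : Mpt n d)}.
  exact: cst_continuous.
have hT : XB B finset.set0 = setT by apply/seteqP; split => // u _ t; rewrite inE.
rewrite hT in hc *.
have h0 : nul setT (c - pb (fun=> 0) c).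
  apply: (@nul_trans _ _ _ _ (pb id c)); first by apply/nul_sym/(@pb_id_nul _ _ _ _ setT).
  apply: (@homotopy _ _ _ _ setT setT) => // u _; exact: cvg_id.
exists (match k with 0 => fun c : cochain 0 => c (trunc n d 0 (fun=> 0)) | _.+1 => fun=> 0 end c), (fun=> 0).
split; first by move=> t; rewrite inE.
apply: (nul_trans h0); rewrite big_set0 addr0.
case: k c hc h0 => [|k] c hc h0.
  by apply: nul_ext (nul0 _ _) => s _; rewrite /scc; change (0 = c (trunc n d 0 (fun=> 0)) - c (trunc n d 0 (fun=> 0)) * 1); rewrite mulr1 subrr.
rewrite scc0 subr0; apply: (@nul_point _ _ _ (c (trunc n d k.+1 (fun=> 0)))) => //.
exists (trunc n d k.+2 (fun=> 0)); rewrite dcob_pb /pb hc//.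
split=> [x Dx||//]; first exact: truncN.
by apply: within_trunc; apply: continuous_subspaceT => x; exact: cst_continuous.
Qed.

End Blocks.

Section Helpers.
Variables (n d : nat).
Notation cochain := (cochain n d).

Lemma id_cont (u : Mpt n d) : {for u, continuous (@id (Mpt n d))}.
Proof. exact: cvg_id. Qed.

Lemma homot_id (X Y : set (Mpt n d)) (phi : Mpt n d -> Mpt n d) k (c : cochain k) :
  (forall u, X u -> {for u, continuous phi}) ->
  (forall u (t : RR), X u -> 0 <= t <= 1 -> Y ((1 - t) *: phi u + t *: u)) ->
  coc Y c -> nul X (c - pb phi c).
Proof.
move=> hc hY cY; apply: (@nul_trans _ _ _ _ (pb id c)).
  by apply: nul_sym; apply: (@pb_id_nul _ _ _ _ X).
by apply: (@homotopy _ _ _ _ X Y phi id) => // u _; exact: id_cont.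
Qed.

Lemma crd_seg_same e (u v : Mpt n d) (t : RR) : crd e u = crd e v ->
  crd e ((1 - t) *: u + t *: v) = crd e v.
Proof. by move=> h; rewrite crd_seg h; ring. Qed.

Lemma seg_pos (x y t : RR) : 0 <= t <= 1 -> 0 < x -> 0 < y -> 0 < (1 - t) * x + t * y.
Proof.
move=> /andP[t0 t1] x0 y0; case: (ltrP 0 t) => ht; last first.
  have -> : t = 0 by lra.
  by rewrite subr0 mul1r mul0r addr0.
have := mulr_gt0 ht y0; have : 0 <= (1 - t) * x by rewrite mulr_ge0 ?subr_ge0// ltW.
lra.
Qed.

End Helpers.

(** * Adding a block with a single coordinate *)

Section Single.
Variables (n d : nat) (T : finType).
Notation I := ('I_n * 'I_d)%type.
Notation cochain := (cochain n d).
Variables (B : T -> {set I}) (J : {set T}) (rep : T -> I) (t : T).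
Hypothesis gB : goodB B J rep.
Hypothesis tJ : t \in J.
Hypothesis Bt : forall x, (x \in B t) = (x == rep t).
Let e := rep t.

Let eN t' : t' \in J -> t' != t -> e \notin B t'.
Proof.
move=> h h'; have [g1 g2] := gB; apply: (g1 t t') => //; first by rewrite eq_sym.
exact: g2.
Qed.

Definition HS (sg : RR) (J' : {set T}) : set (Mpt n d) :=
  fun u => XB B (J' :\ t) u /\ 0 < sg * crd e u.

Lemma XB_split (J' : {set T}) : t \in J' -> XB B J' = HS 1 J' `|` HS (-1) J'.
Proof.
move=> tJ'; apply/seteqP; split=> u.
  move=> h; have h' : XB B (J' :\ t) u by apply: XB_sub h; exact: subD1set.
  have [e' ] := h t tJ'; rewrite Bt => /eqP ->; rewrite -/e => h0.
  case: (ltrgt0P (crd e u)) h0 => // h0 _; [left|right]; split=> //; lra.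
move=> h t' t'J'; case: (eqVneq t' t) => [->|t't].
  exists e; first by rewrite Bt.
  case: h => -[_ h]; apply/eqP => h0; move: h; rewrite h0 mulr0; lra.
by case: h => -[h _]; apply: h; rewrite !inE t't.
Qed.

Lemma HS_open sg J' : relopen (HS sg J') (HS 1 J' `|` HS (-1) J').
Proof.
move=> u [h1 h2].
have hc : cnt (fun v => sg * crd e v) u by apply: cntM; [exact: cnt_cst|exact: cnt_crd].
apply: filterS (cnt_gt0 hc h2) => v hv [] [h _]; by split.
Qed.

Definition gset (a : RR) : Mpt n d -> Mpt n d := upd e (fun=> a).

Lemma gset_cont a u : {for u, continuous (gset a)}.
Proof. by apply: upd_cont; exact: cnt_cst. Qed.

Lemma nz_upd f u t' : t' \in J -> t' != t -> nz (B t') u -> nz (B t') (upd e f u).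
Proof.
move=> h1 h2; apply: nz_eq => e' he'; rewrite crd_updN//.
by apply: contraNneq (eN h1 h2) => <-.
Qed.

Lemma XB_upd f u (J' : {set T}) : J' \subset J -> XB B (J' :\ t) u -> XB B (J' :\ t) (upd e f u).
Proof.
move=> JJ h t'; rewrite !inE => /andP[h1 h2]; apply: nz_upd => //.
  exact: (fintype.subsetP JJ).
by apply: h; rewrite !inE h1.
Qed.

Lemma seg_upd f u (s : RR) : (1 - s) *: upd e f u + s *: u = upd e (fun u => (1 - s) * f u + s * crd e u) u.
Proof.
apply: crd_ext => e'; case: (eqVneq e' e) => [->|h]; first by rewrite crd_seg !crd_upd.
by rewrite crd_seg_same crd_updN.
Qed.

Lemma gset_mapto a (J' : {set T}) : a != 0 -> J' \subset J -> t \in J' ->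
  mapto (gset a) (XB B (J' :\ t)) (XB B J').
Proof.
move=> a0 JJ tJ' u h; split; last exact: gset_cont.
move=> t' t'J'; case: (eqVneq t' t) => [->|t't].
  by exists e; rewrite ?Bt ?crd_upd.
by apply: (XB_upd (fun=> a) JJ h); rewrite !inE t't.
Qed.

Lemma gset_homot sg (J' : {set T}) k (c : cochain k) : sg = 1 \/ sg = -1 -> J' \subset J -> t \in J' ->
  coc (XB B J') c -> nul (HS sg J') (c - pb (gset sg) c).
Proof.
move=> hsg JJ tJ' hc; apply: (homot_id (Y := XB B J')) => // u.
  by move=> _; exact: gset_cont.
move=> s [h1 h2] hs; rewrite XB_split// /gset seg_upd.
have h : 0 < sg * ((1 - s) * sg + s * crd e u).
  rewrite mulrDr mulrCA [sg * (s * _)]mulrCA; apply: seg_pos => //.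
  by case: hsg => ->; rewrite ?mulr1 ?mulrNN ?mulr1.
by case: hsg h => -> h; [left|right]; split; rewrite ?crd_upd//; apply: XB_upd.
Qed.

Lemma HS_sub sg (J' : {set T}) : HS sg J' `<=` XB B (J' :\ t). Proof. by move=> u []. Qed.

Lemma HS_disj J' u : HS 1 J' u -> ~ HS (-1) J' u.
Proof. by move=> [_ h] [_ h']; lra. Qed.

Lemma sgn_nul (J' : {set T}) k (c : cochain k) : t \in J' -> coc (XB B J') c ->
  nul (HS 1 J') c -> nul (HS (-1) J') c -> nul (XB B J') c.
Proof.
move=> tJ'; rewrite XB_split// => hc h1 h2.
by apply: nul_disjoint => //; [exact: HS_open|exact: HS_open|exact: HS_disj].
Qed.

(** Multiplication of [x] by the sign of the coordinate [e], which is locally constant. *)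
Lemma sgn_ex (J' : {set T}) k (x : cochain k) : t \in J' -> coc (XB B (J' :\ t)) x ->
  exists y : cochain k, [/\ coc (XB B J') y, nul (HS 1 J') (y - x) & nul (HS (-1) J') (y + x)].
Proof.
move=> tJ' hx; rewrite XB_split//.
have [|||y hy [h1 h2]] := @MV_glue _ _ (HS 1 J') (HS (-1) J') (@HS_open 1 J') (@HS_open (-1) J') k x (- x).
- by apply: cocW hx; exact: HS_sub.
- by apply: cocN; apply: cocW hx; exact: HS_sub.
- by apply: nul_empty => u [] /HS_disj.
by exists y; split=> //; move: h2; rewrite opprK.
Qed.

Lemma deg_single : degB B J = degB B (J :\ t).
Proof.
rewrite /degB (big_setD1 t)//= (_ : #|B t| = 1%N) ?add0n//.
by rewrite (eq_card (B := pred1 e)) ?card1// => x; rewrite Bt.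
Qed.

(** The space splits into two halves according to the sign of the coordinate, each equivalent to the
    product without this block. A class is the half-sum of its restrictions, which does not see the
    sign, plus the sign times the half-difference; [om] is the sign times [om']. *)
Theorem structB_single : structB B (J :\ t) rep -> structB B J rep.
Proof.
move=> [om' [om1 om2 om3 om4]].
have /cid[om omP] : exists om : forall k, cochain k, forall k,
   [/\ coc (XB B J) (om k), nul (HS 1 J) (om k - om' k), nul (HS (-1) J) (om k + om' k)
     & (k != degB B J -> om k = 0)].
  have h k : {y : cochain k | [/\ coc (XB B J) y, nul (HS 1 J) (y - om' k), nul (HS (-1) J) (y + om' k) & (k != degB B J -> y = 0)]}.
    apply: cid; case: (eqVneq k (degB B J)) => [kd|kd].
      by have [y [y1 y2 y3]] := sgn_ex tJ (om1 k); exists y.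
    have o0 : om' k = 0 by apply: om2; rewrite -deg_single.
    exists 0; rewrite o0; split=> //; first exact: coc0.
      by apply: nulB; exact: nul0.
    by apply: nulD; exact: nul0.
  by exists (fun k => sval (h k)) => k; exact: svalP (h k).
have s1 : (1 : RR) = 1 \/ (1 : RR) = -1 by left.
have s2 : (-1 : RR) = 1 \/ (-1 : RR) = -1 by right.
exists om; split.
- by move=> k; have [] := omP k.
- by move=> k; have [] := omP k.
- move=> k t' t'J.
  have [y1 y2 y3 _] := omP k.
  have co : coc (XB B J) (pb (refl (rep t')) (om k) + om k).
    by apply: cocD => //; apply: pb_coc y1; exact: XB_refl.
  case: (eqVneq t' t) => [E|t't].
    have hr (sg : RR) : sg = 1 \/ sg = -1 -> mapto (@refl n d (rep t')) (HS sg J) (HS (- sg) J).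
      move=> _ u [h1 h2]; split; last exact: refl_cont.
      by split; [rewrite E; apply: XB_upd|rewrite E crd_upd; lra].
    (* Once the coordinate [e] may vanish, its reflection is joined to the identity by a straight
       line. *)
    have hom : nul (XB B (J :\ t)) (om' k - pb (refl (rep t')) (om' k)).
      apply: (homot_id (Y := XB B (J :\ t))) => //; first by move=> u _; exact: refl_cont.
      by move=> u s hu _; rewrite E /refl seg_upd; apply: XB_upd.
    apply: sgn_nul => //.
      have := pb_nul (hr 1 s1) y3; rewrite pbD => a1.
      have := nulD (nulD a1 y2) (nulW (@HS_sub 1 J) hom).
      apply: nul_ext => s _.
      change ((pb (refl (rep t')) (om k) s + pb (refl (rep t')) (om' k) s + (om k s - om' k s)) +
        (om' k s - pb (refl (rep t')) (om' k) s) = pb (refl (rep t')) (om k) s + om k s); ring.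
    have := hr (-1) s2; rewrite opprK => hr'.
    have := pb_nul hr' y2; rewrite pbB => a1.
    have := nulB (nulD a1 y3) (nulW (@HS_sub (-1) J) hom).
    apply: nul_ext => s _.
    change ((pb (refl (rep t')) (om k) s - pb (refl (rep t')) (om' k) s + (om k s + om' k s)) -
        (om' k s - pb (refl (rep t')) (om' k) s) = pb (refl (rep t')) (om k) s + om k s); ring.
  have hr sg : mapto (@refl n d (rep t')) (HS sg J) (HS sg J).
    move=> u [h1 h2]; split; last exact: refl_cont.
    split; first by have [] := XB_refl (rep t') h1.
    rewrite crd_updN//; apply: contraNneq (eN t'J t't) => ->.
    by have [_ g2] := gB; exact: g2.
  have h3 := om3 k t' _; have {}h3 := h3 (introT setD1P (conj t't t'J)).
  apply: sgn_nul => //.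
    have := nulD (nulD (pb_nul (hr 1) y2) y2) (nulW (@HS_sub 1 J) h3).
    apply: nul_ext => s _.
    change ((pb (refl (rep t')) (om k) s - pb (refl (rep t')) (om' k) s + (om k s - om' k s)) +
      (pb (refl (rep t')) (om' k) s + om' k s) = pb (refl (rep t')) (om k) s + om k s); ring.
  have := nulB (nulD (pb_nul (hr (-1)) y3) y3) (nulW (@HS_sub (-1) J) h3).
  apply: nul_ext => s _.
  change ((pb (refl (rep t')) (om k) s + pb (refl (rep t')) (om' k) s + (om k s + om' k s)) -
    (pb (refl (rep t')) (om' k) s + om' k s) = pb (refl (rep t')) (om k) s + om k s); ring.
move=> k c hc.
have [y1 y2 y3 _] := omP k.
have n1 : (1 : RR) != 0 by []. have n2 : (-1 : RR) != 0 by rewrite oppr_eq0.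
pose p := pb (gset 1) c; pose m := pb (gset (-1)) c.
have cp : coc (XB B (J :\ t)) p by apply: pb_coc hc; exact: gset_mapto.
have cm : coc (XB B (J :\ t)) m by apply: pb_coc hc; exact: gset_mapto.
pose a := scc 2^-1 (p + m); pose b := scc 2^-1 (p - m).
have ca : coc (XB B (J :\ t)) a by apply: cocZ; apply: cocD.
have cb : coc (XB B (J :\ t)) b by apply: cocZ; apply: cocB.
have [lam [g' [g'1 g'2]]] := om4 k b cb.
have /cid[G GP] : exists G : T -> cochain k, forall t', t' \in J :\ t ->
   [/\ coc (XB B (J :\ t')) (G t'), nul (HS 1 J) (G t' - g' t') & nul (HS (-1) J) (G t' + g' t')].
  have h t' : {y : cochain k | t' \in J :\ t -> 
   [/\ coc (XB B (J :\ t')) y, nul (HS 1 J) (y - g' t') & nul (HS (-1) J) (y + g' t')]}.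
    apply: cid; case: (boolP (t' \in J :\ t)) => t'J; last by exists 0.
    have tJ' : t \in J :\ t' by move: t'J; rewrite !inE eq_sym => /andP[-> _].
    have E : J :\ t :\ t' = J :\ t' :\ t by apply/finset.setP => x; rewrite !inE andbCA.
    have := g'1 t' t'J; rewrite E => hg.
    have [y [z1 z2 z3]] := sgn_ex tJ' hg; exists y => _; split=> //.
      by apply: nulW z2 => u [h1 h2]; split=> //; apply: XB_sub h1; rewrite finset.setSD// subD1set.
    by apply: nulW z3 => u [h1 h2]; split=> //; apply: XB_sub h1; rewrite finset.setSD// subD1set.
  by exists (fun t' => sval (h t')) => t'; exact: svalP (h t').
exists lam, (fun t' => if t' == t then a else G t'); split.
  move=> t' t'J; case: (eqVneq t' t) => [->//|t't].
  by have [] := GP t' (introT setD1P (conj t't t'J)).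
rewrite (big_setD1 t)//= eqxx.
rewrite (eq_bigr (fun i => G i)); last by move=> i; rewrite !inE => /andP[/negbTE ->].
have cg : coc (XB B J) (\sum_(i in J :\ t) G i).
  apply: coc_sum => i iJ; have [h _ _] := GP i iJ; apply: cocW h.
  by apply: XB_sub; exact: subD1set.
have caJ : coc (XB B J) a by apply: cocW ca; apply: XB_sub; exact: subD1set.
apply: sgn_nul => //.
- by apply: cocB => //; apply: cocD; [exact: cocZ|exact: cocD].
- have h1 := gset_homot s1 (subxx J) tJ hc.
  have h2 := nulW (@HS_sub 1 J) g'2.
  have h3 := nulZ lam y2.
  have h4 : nul (HS 1 J) (\sum_(i in J :\ t) (G i - g' i)).
    by apply: nul_sum => i iJ; have [] := GP i iJ.
  rewrite sumrB in h4.
  have := nulB (nulB (nulD h1 h2) h3) h4; apply: nul_ext => s _.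
  change ((c s - p s + (2^-1 * (p s - m s) - (lam * om' k s + (\sum_(i in J :\ t) g' i) s)) - lam * (om k s - om' k s)) -
     ((\sum_(i in J :\ t) G i) s - (\sum_(i in J :\ t) g' i) s) =
     c s - (lam * om k s + (2^-1 * (p s + m s) + (\sum_(i in J :\ t) G i) s))).
  by field.
have h1 := gset_homot s2 (subxx J) tJ hc.
have h2 := nulW (@HS_sub (-1) J) g'2.
have h3 := nulZ lam y3.
have h4 : nul (HS (-1) J) (\sum_(i in J :\ t) (G i + g' i)).
  by apply: nul_sum => i iJ; have [] := GP i iJ.
rewrite big_split/= in h4.
have := nulB (nulB (nulB h1 h2) h3) h4; apply: nul_ext => s _.
change ((c s - m s - (2^-1 * (p s - m s) - (lam * om' k s + (\sum_(i in J :\ t) g' i) s)) - lam * (om k s + om' k s)) -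
     ((\sum_(i in J :\ t) G i) s + (\sum_(i in J :\ t) g' i) s) =
     c s - (lam * om k s + (2^-1 * (p s + m s) + (\sum_(i in J :\ t) G i) s))).
by field.
Qed.

End Single.

(** * Linearity and naturality of the connecting relation *)

Section ConnLinear.
Variables (n d : nat).
Notation cochain := (cochain n d).

Lemma conn0 (U V : set (Mpt n d)) k : conn U V (0 : cochain k) 0.
Proof. by exists 0, 0; split=> s _; rewrite ?dcob0// subr0. Qed.

Lemma connD (U V : set (Mpt n d)) k (f f' : cochain k) c c' :
  conn U V f c -> conn U V f' c' -> conn U V (f + f') (c + c').
Proof.
move=> [a [b [h1 h2 h3]]] [a' [b' [h1' h2' h3']]]; exists (a + a'), (b + b'); split=> s hs.
- by rewrite dcobD -h1// -h1'.
- by rewrite dcobD -h2// -h2'.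
change (f s + f' s = a s + a' s - (b s + b' s)); rewrite h3// h3'//.
move: (a s) (a' s) (b s) (b' s) => *; ring.
Qed.

Lemma connZ (U V : set (Mpt n d)) k x (f : cochain k) c :
  conn U V f c -> conn U V (scc x f) (scc x c).
Proof.
move=> [a [b [h1 h2 h3]]]; exists (scc x a), (scc x b); split=> s hs.
- by rewrite dcobZ -h1.
- by rewrite dcobZ -h2.
by rewrite /scc h3// mulrBr.
Qed.

Lemma connN (U V : set (Mpt n d)) k (f : cochain k) c :
  conn U V f c -> conn U V (- f) (- c).
Proof. by move=> /(connZ (-1)); rewrite !sccN1. Qed.

Lemma connB (U V : set (Mpt n d)) k (f f' : cochain k) c c' :
  conn U V f c -> conn U V f' c' -> conn U V (f - f') (c - c').
Proof. by move=> h /connN; apply: connD. Qed.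

Lemma conn_sum (U V : set (Mpt n d)) k (I : Type) (r : seq I) (P : pred I)
    (f : I -> cochain k) c : (forall i, P i -> conn U V (f i) (c i)) ->
  conn U V (\sum_(i <- r | P i) f i) (\sum_(i <- r | P i) c i).
Proof.
move=> h; elim/big_rec2: _ => [|i y1 y2 Pi h']; first exact: conn0.
by apply: connD => //; exact: h.
Qed.

Lemma connW (U V U' V' : set (Mpt n d)) k (f : cochain k) c : U `<=` U' -> V `<=` V' ->
  conn U' V' f c -> conn U V f c.
Proof.
move=> UU VV [a [b [h1 h2 h3]]]; exists a, b; split=> s hs.
- by apply: h1; apply: simpW hs.
- by apply: h2; apply: simpW hs.
- by apply: h3; apply: simpW hs => u [] /UU ? /VV.
Qed.

Lemma conn_pb n' d' (U V : set (Mpt n d)) (U' V' : set (Mpt n' d')) phi k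
    (f : Defs.cochain n' d' k) c :
  mapto phi U U' -> mapto phi V V' -> conn U' V' f c -> conn U V (pb phi f) (pb phi c).
Proof.
move=> hU hV [a [b [h1 h2 h3]]]; exists (pb phi a), (pb phi b); split=> s hs.
- by rewrite dcob_pb /pb h1//; apply: simp_map hs.
- by rewrite dcob_pb /pb h2//; apply: simp_map hs.
- rewrite /pb h3//; apply: simp_map hs => u [Uu Vu].
  by have [? ?] := hU _ Uu; have [? ?] := hV _ Vu.
Qed.

Lemma conn_swap (U V : set (Mpt n d)) k (f : cochain k) c :
  conn U V f c -> conn V U (- f) c.
Proof.
move=> [a [b [h1 h2 h3]]]; exists b, a; split=> // s hs.
change (- f s = b s - a s); rewrite h3 ?opprB//.
by apply: simpW hs => u [].
Qed.

End ConnLinear.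

(** * Enlarging a block by one coordinate *)

Section Suspension.
Variables (n d : nat) (T : finType).
Notation I := ('I_n * 'I_d)%type.
Notation cochain := (cochain n d).
Variables (B : T -> {set I}) (J : {set T}) (rep : T -> I) (t : T) (e : I).
Hypothesis gB : goodB B J rep.
Hypothesis tJ : t \in J.
Hypothesis eB : e \in B t.
Hypothesis ee0 : e != rep t.
Let e0 := rep t.

Definition Bdel : T -> {set I} := fun t' => if t' == t then B t :\ e else B t'.

Let e0B : e0 \in B t :\ e.
Proof. by rewrite !inE eq_sym ee0; have [_ h] := gB; rewrite h. Qed.

Definition HU (sg : RR) (J' : {set T}) : set (Mpt n d) :=
  fun u => XB B (J' :\ t) u /\ (nz (B t :\ e) u \/ 0 < sg * crd e u).

Lemma nz_split u : nz (B t) u <-> nz (B t :\ e) u \/ crd e u != 0.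
Proof.
split=> [[e' h1 h2]|[[e' h1 h2]|h]]; last by exists e.
  case: (eqVneq e' e) => [<-|h]; [by right|left]; exists e' => //.
  by rewrite !inE h.
by exists e' => //; move: h1; rewrite !inE => /andP[].
Qed.

Lemma XB_D1 (J' : {set T}) u : t \in J' -> XB B J' u <-> XB B (J' :\ t) u /\ nz (B t) u.
Proof.
move=> tJ'; split=> [h|[h1 h2] t' ht'].
  by split; [apply: XB_sub h; exact: subD1set|exact: h].
by case: (eqVneq t' t) => [->//|h]; apply: h1; rewrite !inE h.
Qed.

Lemma HU_union (J' : {set T}) : t \in J' -> XB B J' = HU 1 J' `|` HU (-1) J'.
Proof.
move=> tJ'; apply/seteqP; split=> u.
  move=> /XB_D1 -/(_ tJ') [h1 /nz_split h2].
  case: h2 => [h2|h2]; first by left; split=> //; left.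
  case: (ltrgt0P (crd e u)) h2 => // h0 _; [left|right]; split=> //; right; lra.
move=> h; apply/(XB_D1 _ tJ'); case: h => -[h1 h2]; split=> //; apply/nz_split;
  case: h2 => h2; by [left|right; apply/eqP => h0; move: h2; rewrite h0 mulr0 ltxx].
Qed.

Lemma HU_inter (J' : {set T}) : t \in J' -> HU 1 J' `&` HU (-1) J' = XB Bdel J'.
Proof.
move=> tJ'; apply/seteqP; split=> u.
  move=> [[h1 h2] [_ h3]] t' ht'; rewrite /Bdel; case: eqVneq => [_|h].
    by case: h2 => // h2; case: h3 => // h3; lra.
  by apply: h1; rewrite !inE h.
move=> h.
have h1 : XB B (J' :\ t) u.
  by move=> t'; rewrite !inE => /andP[h1 h2]; have := h t' h2; rewrite /Bdel (negbTE h1).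
have h2 : nz (B t :\ e) u by have := h t tJ'; rewrite /Bdel eqxx.
by split; split=> //; left.
Qed.

Lemma HU_open sg (J' : {set T}) : relopen (HU sg J') (HU 1 J' `|` HU (-1) J').
Proof.
move=> u [h1 [h2|h2]].
  apply: filterS (near_nz h2) => v hv hX; split; last by left.
  by case: hX => -[].
have hc : cnt (fun v => sg * crd e v) u by apply: cntM; [exact: cnt_cst|exact: cnt_crd].
apply: filterS (cnt_gt0 hc h2) => v hv hX; split; last by right.
by case: hX => -[].
Qed.

Lemma XB_keep (J' : {set T}) u w : J' \subset J -> (forall e', e' \notin B t -> crd e' w = crd e' u) ->
  XB B (J' :\ t) u -> XB B (J' :\ t) w.
Proof.
move=> JJ h hu t' t'J; have := hu t' t'J; apply: nz_eq => e' he'; rewrite h//.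
have [g1 g2] := gB; move: t'J; rewrite !inE => /andP[h1 /(fintype.subsetP JJ) h2].
exact: (g1 t' t).
Qed.

Definition susp_g : Mpt n d -> Mpt n d := upd e0 (fun=> 1).

Lemma updc_cont e' a (u : Mpt n d) : {for u, continuous (upd e' (fun=> a))}.
Proof. by apply: upd_cont; exact: cnt_cst. Qed.

Let e0Bt : e0 \in B t. Proof. by move: e0B; rewrite !inE => /andP[]. Qed.

Lemma susp_g_mapto : mapto susp_g (XB B (J :\ t)) (XB B J).
Proof.
move=> u hu; split; last exact: updc_cont.
apply/(XB_D1 _ tJ); split; last by exists e0; rewrite ?crd_upd.
apply: XB_keep hu => // e' he'; rewrite crd_updN//.
by apply: contraNneq he' => ->.
Qed.

(** Three straight homotopies keep block [t] nonzero on the half [HU sg]: move the coordinate [e] to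
    [sg], then the coordinate [e0] to 1, then [e] back to its value. *)
Lemma susp_nul sg k (c : cochain k) : sg = 1 \/ sg = -1 -> coc (XB B J) c ->
  nul (HU sg J) (c - pb susp_g c).
Proof.
move=> hsg hc; pose h1 : Mpt n d -> Mpt n d := upd e (fun=> sg); pose h2 := susp_g \o h1.
have sg0 : sg != 0 by case: hsg => ->; rewrite ?oppr_eq0.
have c2 u : {for u, continuous h2} by apply: continuous_comp; exact: updc_cont.
have off (u : Mpt n d) e' : e' \notin B t ->
    [/\ crd e' (h1 u) = crd e' u, crd e' (h2 u) = crd e' u & crd e' (susp_g u) = crd e' u].
  move=> he'; have n1 : e' != e by apply: contraNneq he' => ->.
  have n2 : e' != e0 by apply: contraNneq he' => ->.
  by rewrite /h2 /= /susp_g /h1 !crd_updN.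
have Xt (u w : Mpt n d) : HU sg J u -> (forall e', e' \notin B t -> crd e' w = crd e' u) ->
    nz (B t) w -> XB B J w.
  move=> [hu _] h hw; apply/(XB_D1 _ tJ); split=> //; exact: XB_keep hu.
have s1 : nul (HU sg J) (c - pb h1 c).
  apply: (homot_id (Y := XB B J)) => // u; first by move=> _; exact: updc_cont.
  move=> s hu hs; apply: Xt (hu) _ _ => [e' he'|].
    by have [q1 _ _] := off u e' he'; rewrite crd_seg_same.
  case: (hu) => _ [[e' h hx]|h].
    exists e'; first by move: h; rewrite !inE => /andP[].
    rewrite crd_seg_same// /h1 crd_updN//; by move: h; rewrite !inE => /andP[].
  exists e => //; rewrite crd_seg /h1 crd_upd.
  have : 0 < sg * ((1 - s) * sg + s * crd e u).
    rewrite mulrDr mulrCA [sg * (s * _)]mulrCA; apply: seg_pos => //.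
    by case: hsg => ->; rewrite ?mulr1 ?mulrNN ?mulr1.
  by apply: contraTneq => ->; rewrite mulr0 ltxx.
have s2 : nul (HU sg J) (pb h2 c - pb h1 c).
  apply: (homotopy (Y := XB B J)) => // u.
    by move=> _; exact: updc_cont.
  move=> s hu hs; apply: Xt (hu) _ _ => [e' he'|].
    have [q1 q2 _] := off u e' he'; rewrite crd_seg q1 q2; ring.
  exists e => //; rewrite crd_seg /h2 /= /susp_g (crd_updN _ _ ee0) /h1 crd_upd.
  by rewrite -mulrDl subrK mul1r.
have s3 : nul (HU sg J) (pb susp_g c - pb h2 c).
  apply: (homotopy (Y := XB B J)) => // u.
    by move=> _; exact: updc_cont.
  move=> s hu hs; apply: Xt (hu) _ _ => [e' he'|].
    have [_ q2 q3] := off u e' he'; rewrite crd_seg q3 q2; ring.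
  exists e0 => //; rewrite crd_seg /h2 /= /susp_g !crd_upd.
  by rewrite -mulrDl subrK mul1r oner_eq0.
by apply: (nul_trans s1); apply: (nul_trans (nul_sym s2)); exact: nul_sym.
Qed.

Lemma deg_susp : degB B J = (degB Bdel J).+1.
Proof.
rewrite /degB (big_setD1 t)//= [in RHS](big_setD1 t)//= /Bdel eqxx -addSn; congr (_ + _)%N.
  rewrite (cardsD1 e (B t)) eB add1n /= prednK//.
  by apply/card_gt0P; exists e0.
by apply: eq_bigr => i; rewrite !inE => /andP[/negbTE -> _].
Qed.

Lemma goodBdel : goodB Bdel J rep.
Proof.
have [g1 g2] := gB; have sB t' e' : e' \in Bdel t' -> e' \in B t'.
  by rewrite /Bdel; case: eqVneq => // ->; rewrite !inE => /andP[].
split=> [t1 t2 h1 h2 h12 e' /sB he'|t1 h1].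
  by apply: contra (g1 _ _ h1 h2 h12 _ he'); exact: sB.
by rewrite /Bdel; case: eqVneq => [->//|_]; exact: g2.
Qed.

Lemma refl_HU t' sg : t' \in J -> mapto (@refl n d (rep t')) (HU sg J) (HU sg J).
Proof.
move=> t'J u [h1 h2]; split; last exact: refl_cont.
split; first by have [] := XB_refl (rep t') h1.
case: h2 => [h2|h2]; [by left; exact: nz_refl|right].
rewrite crd_updN//; case: (eqVneq t' t) => [->//|t't].
have [g1 g2] := gB; apply: contraTneq eB => ->.
by apply: (g1 t' t) => //; exact: g2.
Qed.

(** The space is covered by two halves that forget block [t] up to homotopy, and their intersection
    has the block without [e]. So [om] is the image of [om'] under the connecting map; the
    reflections preserve both halves and the sign is inherited. After subtraction of its part [pg],
    a class comes from the intersection, where the structure is known. *)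
Theorem structB_susp : structB Bdel J rep -> structB B J rep.
Proof.
move=> [om' [om1 om2 om3 om4]].
have XU := HU_union tJ; have XI := HU_inter tJ.
pose U := HU 1 J; pose V := HU (-1) J.
have UVo : relopen U (U `|` V) by exact: HU_open.
have VVo : relopen V (U `|` V) by exact: HU_open.
have h k : {y : cochain k.+1 | [/\ coc (XB B J) y, conn U V (om' k) y & (k.+1 != degB B J -> y = 0)]}.
  apply: cid; case: (eqVneq k.+1 (degB B J)) => kd.
    have := om1 k; rewrite -XI => o1.
    have [y y1 y2] := MV_conn_ex UVo VVo o1.
    by exists y; split=> //; rewrite XU.
  exists 0; split=> //; first exact: coc0.
  rewrite om2; first exact: conn0.
  by apply: contraNneq kd => ->; rewrite deg_susp.
pose om k : cochain k := match k with 0 => 0 | k.+1 => sval (h k) end.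
exists om; split.
- by case=> [|k]; [exact: coc0|rewrite /om; case: (svalP (h k))].
- by case=> [//|k]; rewrite /om; case: (svalP (h k)).
- case=> [|k] t' t'J; first by rewrite pb0 addr0; exact: nul0.
  have [y1 y2 _] := svalP (h k).
  have r1 := refl_HU (sg := 1) t'J; have r2 := refl_HU (sg := -1) t'J.
  have cn := connD (conn_pb r1 r2 y2) y2.
  have := om3 k t' t'J; rewrite -XI => o3.
  rewrite XU; apply: (MV_conn_nul UVo VVo _ cn (@coc0 _ _ U k) (@coc0 _ _ V k)).
    rewrite -[U `|` V]XU; apply: cocD => //; apply: pb_coc y1; exact: XB_refl.
  by apply: nul_ext o3 => s _; change ((pb (refl (rep t')) (om' k) s + om' k s) = (pb (refl (rep t')) (om' k) s + om' k s) - ((0:rat) - 0)); ring.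
move=> k c hc; pose pg := pb susp_g c.
have cpg : coc (XB B (J :\ t)) pg by apply: pb_coc hc; exact: susp_g_mapto.
have JD1 : XB B J `<=` XB B (J :\ t) by apply: XB_sub; exact: subD1set.
have nU : nul U (c - pg) by apply: susp_nul => //; left.
have nV : nul V (c - pg) by apply: susp_nul => //; right.
have c1 : coc (XB B J) (c - pg) by apply: cocB => //; apply: cocW cpg.
case: k c hc @pg cpg nU nV c1 => [|k] c hc pg cpg nU nV c1.
  exists 0, (fun t' => if t' == t then pg else 0); split.
    by move=> t' _; case: eqVneq => [->//|_]; exact: coc0.
  rewrite (big_setD1 t)//= eqxx big1; last by move=> i; rewrite !inE => /andP[/negbTE ->].
  by rewrite scc0 add0r addr0 XU; apply: MV_deg0 => //; rewrite -[U `|` V]XU.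
rewrite XU in c1.
have [f hf fc] := MV_conn1 c1 nU nV.
rewrite [U `&` V]XI in hf.
have [lam [F [F1 F2]]] := om4 k f hf.
have G t' : {y : cochain k.+1 | t' \in J :\ t -> coc (XB B (J :\ t')) y /\ conn U V (F t') y}.
  apply: cid; case: (boolP (t' \in J :\ t)) => t'J; last by exists 0.
  have tJ' : t \in J :\ t' by move: t'J; rewrite !inE eq_sym => /andP[-> _].
  have XU' := HU_union tJ'; have XI' := HU_inter tJ'.
  have := F1 t' _; rewrite -XI' => /(_ _) F1'.
  have [||//|y y1 y2] := @MV_conn_ex _ _ (HU 1 (J :\ t')) (HU (-1) (J :\ t')) _ _ k (F t').
  - exact: HU_open.
  - exact: HU_open.
  - by apply: F1'; move: t'J; rewrite !inE => /andP[].
  exists y => _; split; first by rewrite XU'.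
  by apply: connW y2 => u [u1 u2]; split=> //; apply: XB_sub u1; rewrite finset.setSD// subD1set.
pose g t' := if t' == t then pg else sval (G t').
exists lam, g; split.
  move=> t' t'J; rewrite /g; case: (eqVneq t' t) => [->//|t't].
  by have [] := svalP (G t') (introT setD1P (conj t't t'J)).
rewrite (big_setD1 t)//= {1}/g eqxx.
rewrite (eq_bigr (fun i => sval (G i))); last first.
  move=> i iJ; rewrite /g; case: (i =P t) => // E; exfalso.
  by move/setD1P: iJ => [/eqP].
have [y1 y2 _] := svalP (h k).
have cn := connB (connB fc (connZ lam y2))
   (@conn_sum _ _ U V k _ (index_enum T) (mem (J :\ t)) F (fun i => sval (G i))
      (fun i iJ => (svalP (G i) iJ).2)).
have cG : coc (XB B J) (\sum_(i in J :\ t) sval (G i)).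
  apply: coc_sum => i iJ; have [hh _] := svalP (G i) iJ; apply: cocW hh.
  by apply: XB_sub; exact: subD1set.
(* [F t] does not see block [t], so it is a cocycle on all of [U] and the connecting map kills
   it. *)
have cFt : coc U (F t).
  apply: cocW (F1 t tJ) => u [u1 _] t'; rewrite !inE => /andP[n1 n2].
  by rewrite /Bdel (negbTE n1); apply: u1; rewrite !inE n1.
have := MV_conn_nul UVo VVo _ cn cFt (@coc0 _ _ V k).
rewrite -[U `|` V]XU in c1 *; rewrite [U `&` V]XI => H.
have {}H := H (cocB (cocB c1 (cocZ lam y1)) cG).
have {H} : nul (XB B J) (c - pg - scc lam (sval (h k)) - \sum_(i in J :\ t) sval (G i)).
  apply: H; apply: nul_ext F2 => s _; rewrite (big_setD1 t)//=.
  change (f s - (lam * om' k s + (F t s + (\sum_(i in J :\ t) F i) s)) =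
     f s - lam * om' k s - (\sum_(i in J :\ t) F i) s - (F t s - 0)); ring.
apply: nul_ext => s _.
change (c s - pg s - lam * sval (h k) s - (\sum_(i in J :\ t) sval (G i)) s =
   c s - (lam * sval (h k) s + (pg s + (\sum_(i in J :\ t) sval (G i)) s))); ring.
Qed.

End Suspension.

Section StructThm.
Variables (n d : nat) (T : finType).
Notation I := ('I_n * 'I_d)%type.

(** Induction on the number of coordinates: a block with a second coordinate loses one, otherwise a
    block with one coordinate is dropped. *)
Theorem structBP (B : T -> {set I}) (J : {set T}) rep : goodB B J rep -> structB B J rep.
Proof.
move: {2}(\sum_(t in J) #|B t|)%N (leqnn (\sum_(t in J) #|B t|)%N) => N.
elim: N B J rep => [|N IH] B J rep le gB.
  case: (set_0Vmem J) => [->|[t tJ]]; first exact: structB0.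
  have [_ g2] := gB; move: le; rewrite (big_setD1 t)//= (cardsD1 (rep t)) g2//.
case: (set_0Vmem J) => [->|[t tJ]]; first exact: structB0.
have [g1 g2] := gB.
case: (boolP [exists e, (e \in B t) && (e != rep t)]) => [/existsP[e /andP[eB ee]]|].
  apply: (structB_susp gB tJ eB ee); apply: IH; last exact: goodBdel.
  rewrite (big_setD1 t)//= {1}/Bdel eqxx (eq_bigr (fun i => #|B i|)); last first.
    by move=> i; rewrite !inE /Bdel => /andP[/negbTE ->].
  by move: le; rewrite (big_setD1 t)//= (cardsD1 e (B t)) eB add1n addSn ltnS.
rewrite negb_exists => /forallP hB.
have Bt x : (x \in B t) = (x == rep t).
  apply/idP/eqP => [xB|->]; last exact: g2.
  by have := hB x; rewrite xB /= negbK => /eqP.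
apply: (structB_single gB tJ Bt); apply: IH.
  by move: le; rewrite (big_setD1 t)//= (cardsD1 (rep t)) g2// add1n addSn ltnS; apply: leq_trans; exact: leq_addl.
split=> [t1 t2|t1]; rewrite !inE.
  by move=> /andP[_ h1] /andP[_ h2]; exact: g1.
by move=> /andP[_ h1]; exact: g2.
Qed.
End StructThm.

(** * The top class and its behaviour under reflections and swaps of coordinates *)

Section TopDegree.
Variables (n d : nat) (T : finType).
Notation I := ('I_n * 'I_d)%type.
Notation cochain := (cochain n d).
Implicit Types (B : T -> {set I}) (J : {set T}) (rep : T -> I).

Lemma goodB_sub B J J' rep : J' \subset J -> goodB B J rep -> goodB B J' rep.
Proof.
move=> /fintype.subsetP JJ [g1 g2]; split=> [t t' /JJ h /JJ h'|t /JJ]; [exact: g1|exact: g2].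
Qed.

(** All spheres have positive dimension, so every proper subproduct has strictly smaller top
    degree. *)
Definition bigB B J := forall t, t \in J -> (1 < #|B t|)%N.

Lemma degB_D1 B J t : bigB B J -> t \in J -> (degB B (J :\ t) < degB B J)%N.
Proof.
move=> hB tJ; rewrite /degB [X in (_ < X)%N](big_setD1 t)//=.
by rewrite -[X in (X < _)%N]add0n ltn_add2r; move: (hB t tJ); case: #|_| => [|[|]].
Qed.

Lemma hdB B J rep k (c : cochain k) : goodB B J rep -> bigB B J ->
  (degB B J < k)%N -> coc (XB B J) c -> nul (XB B J) c.
Proof.
move: {2}#|J| (leqnn #|J|) => N; elim: N J c => [|N IH] J c le gB bB kd hc.
  have [om [om1 om2 _ om4]] := structBP gB.
  have [lam [g [g1 g2]]] := om4 k c hc.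
  apply: nul_eq g2 _; apply: nulD.
    have o0 : om k = 0 by apply: om2; rewrite neq_ltn kd orbT.
    by rewrite o0; apply: nulZ; exact: nul0.
  by apply: nul_sum => t tJ; move: le; rewrite (cardsD1 t) tJ.
have [om [om1 om2 _ om4]] := structBP gB.
have [lam [g [g1 g2]]] := om4 k c hc.
apply: nul_eq g2 _; apply: nulD.
  have o0 : om k = 0 by apply: om2; rewrite neq_ltn kd orbT.
    by rewrite o0; apply: nulZ; exact: nul0.
apply: nul_sum => t tJ.
apply: (@nulW _ _ _ (XB B (J :\ t))); first by apply: XB_sub; exact: subD1set.
apply: IH => //.
- by move: le; rewrite (cardsD1 t) tJ.
- exact: goodB_sub (subD1set _ _) gB.
- by move=> t'; rewrite !inE => /andP[_]; exact: bB.
- exact: ltn_trans (degB_D1 bB tJ) kd.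
- exact: g1.
Qed.

Lemma top1 B J rep : goodB B J rep -> bigB B J ->
  exists om : cochain (degB B J), [/\ coc (XB B J) om,
    (forall t, t \in J -> nul (XB B J) (pb (refl (rep t)) om + om)) &
    (forall c, coc (XB B J) c -> exists lam, nul (XB B J) (c - scc lam om))].
Proof.
move=> gB bB; have [om [om1 om2 om3 om4]] := structBP gB.
exists (om (degB B J)); split=> // [t|c hc]; first exact: om3.
have [lam [g [g1 g2]]] := om4 _ c hc; exists lam.
have h : nul (XB B J) (\sum_(t in J) g t).
  apply: nul_sum => t tJ.
  apply: (@nulW _ _ _ (XB B (J :\ t))); first by apply: XB_sub; exact: subD1set.
  apply: (hdB (rep := rep)) => //.
  - exact: goodB_sub (subD1set _ _) gB.
  - by move=> t'; rewrite !inE => /andP[_]; exact: bB.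
  - exact: degB_D1.
  - exact: g1.
by have := nulD g2 h; rewrite opprD addrA addrNK.
Qed.

(** [structB] speaks of the chosen representatives only. The choice is free, so [e] is made the
    representative of its block; the top class is unique up to a scalar. *)
Lemma top_refl B J rep k (c : cochain k) t e : goodB B J rep -> bigB B J ->
  k = degB B J -> coc (XB B J) c -> t \in J -> e \in B t ->
  nul (XB B J) (pb (refl e) c + c).
Proof.
move=> gB bB kE; subst k; move=> hc tJ eB.
pose rep' t' := if t' == t then e else rep t'.
have gB' : goodB B J rep'.
  case: gB => g1 g2; split=> // t' t'J; rewrite /rep'.
  by case: eqVneq => [->//|_]; exact: g2.
have [om [om1 om2 om3]] := top1 gB' bB.
have [lam hl] := om3 c hc.
have := om2 t tJ; rewrite /rep' eqxx => h2.
have h3 := pb_nul (XB_refl (B := B) (J := J) e) hl.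
have := nulD (nulD h3 hl) (nulZ lam h2).
apply: nul_ext => s _; rewrite pbB pbZ.
change (pb (refl e) c s - lam * pb (refl e) om s + (c s - lam * om s) + lam * (pb (refl e) om s + om s) = pb (refl e) c s + c s); ring.
Qed.

Definition tau (e e' : I) : Mpt n d -> Mpt n d := fun u =>
  \matrix_(i, j) if (i, j) == e then crd e' u else if (i, j) == e' then crd e u else u i j.

Lemma crd_tau e e' a u : crd a (tau e e' u) =
  if a == e then crd e' u else if a == e' then crd e u else crd a u.
Proof. by case: a => i j; rewrite {1}/crd mxE. Qed.

Lemma tau_cont e e' u : {for u, continuous (tau e e')}.
Proof.
apply: mx_cont => i j.
rewrite (_ : (fun y => _) = fun y => if (i, j) == e then crd e' y else if (i, j) == e' then crd e y else y i j).
  by case: eqP => _; [exact: cnt_crd|case: eqP => _; exact: cnt_coord].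
by apply: funext => y; rewrite mxE.
Qed.

(** On the two coordinates the segment consists of the matrices with rows [(-(1-s), s)] and
    [(s, 1-s)], of determinant [-((1-s)^2 + s^2)], which is never 0. *)
Lemma tau_seg_nz (b : {set I}) e e' u (s : RR) : e \in b -> e' \in b -> e != e' -> 0 <= s <= 1 ->
  nz b u -> nz b ((1 - s) *: refl e u + s *: tau e e' u).
Proof.
move=> eb e'b ee' /andP[s0 s1] [a ab ha].
have e'e : e' != e by rewrite eq_sym.
case: (eqVneq (crd e u) 0) => [z1|z1]; last first.
  case: (eqVneq ((1 - s) * - crd e u + s * crd e' u) 0) => [w1|w1]; last first.
    by exists e => //; rewrite crd_seg crd_tau eqxx crd_upd.
  exists e' => //; rewrite crd_seg crd_tau (negbTE e'e) eqxx crd_updN//.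
  apply: contraNneq z1 => w2.
  have : ((1 - s) ^+ 2 + s ^+ 2) * crd e u = 0.
    transitivity (s * ((1 - s) * crd e' u + s * crd e u)); last by rewrite w2 mulr0.
    have w1' : (1 - s) * crd e u = s * crd e' u by lra.
    rewrite mulrDl expr2 -mulrA w1'; ring.
  move/eqP; rewrite mulf_eq0 => /orP[|//]; rewrite paddr_eq0 ?sqr_ge0// => /andP[].
  rewrite !sqrf_eq0 => /eqP h1 /eqP h2; exfalso; lra.
case: (eqVneq a e) ha => [->|ae]; first by rewrite z1 eqxx.
case: (eqVneq a e') => [->|ae'] ha.
  case: (eqVneq s 0) => [->|s00].
    exists e' => //; rewrite crd_seg crd_updN//.
    by rewrite subr0 mul1r mul0r addr0.
  exists e => //; rewrite crd_seg crd_tau eqxx crd_upd z1 oppr0 mulr0 add0r.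
  by rewrite mulf_neq0.
exists a => //; rewrite crd_seg crd_tau (negbTE ae) (negbTE ae') crd_updN//.
by rewrite -mulrDl subrK mul1r.
Qed.

Lemma seg_nz_same (b : {set I}) (u v w : Mpt n d) (s : RR) :
  (forall e, e \in b -> crd e v = crd e u /\ crd e w = crd e u) ->
  nz b u -> nz b ((1 - s) *: v + s *: w).
Proof.
move=> h [e eb he]; exists e => //; have [h1 h2] := h e eb.
by rewrite crd_seg h1 h2 -mulrDl subrK mul1r.
Qed.

Lemma top_tau B J rep k (c : cochain k) t e e' : goodB B J rep -> bigB B J ->
  k = degB B J -> coc (XB B J) c -> t \in J -> e \in B t -> e' \in B t -> e != e' ->
  nul (XB B J) (pb (tau e e') c + c).
Proof.
move=> gB bB kE hc tJ eB e'B ee'.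
have h1 := top_refl gB bB kE hc tJ eB.
have h2 : nul (XB B J) (pb (tau e e') c - pb (refl e) c).
  apply: (homotopy (Y := XB B J)) => // u.
  - by move=> _; exact: refl_cont.
  - by move=> _; exact: tau_cont.
  move=> s hu hs t' t'J; case: (eqVneq t' t) => [->|t't].
    by apply: tau_seg_nz => //; exact: hu.
  have [g1 _] := gB.
  have out x : x \in B t -> x \notin B t' by apply: g1 => //; rewrite eq_sym.
  apply: (@seg_nz_same _ u); last exact: hu.
  move=> x xB; have xe : x != e by apply: contraTneq xB => ->; exact: out.
  have xe' : x != e' by apply: contraTneq xB => ->; exact: out.
  by rewrite crd_tau (negbTE xe) (negbTE xe') crd_updN.
have := nulD h2 h1; apply: nul_ext => s _.
change (pb (tau e e') c s - pb (refl e) c s + (pb (refl e) c s + c s) = pb (tau e e') c s + c s); ring.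
Qed.

End TopDegree.

(** * Products of spheres indexed by rows: antipodes and exchanges *)

Section Rows.
Variables (n d : nat).
Hypothesis d2 : (2 <= d)%N.
Notation I := ('I_n * 'I_d)%type.
Notation cochain := (cochain n d).

Definition rowB (m : 'I_n) : {set I} := [set e | e.1 == m].
Definition XJ (J : {set 'I_n}) : set (Mpt n d) := XB rowB J.

Definition rep0 (m : 'I_n) : I := (m, Ordinal (leq_trans (ltn0Sn 1) d2)).

Lemma rowB_good J : goodB rowB J rep0.
Proof.
split=> [t t' _ _ tt' e|t _]; rewrite !inE // => /eqP ->; exact: tt'.
Qed.

Lemma card_rowB m : #|rowB m| = d.
Proof.
rewrite -[RHS]card_ord -(card_imset _ (f := fun j : 'I_d => (m, j))); last by move=> a b [].
apply: eq_card => -[a b]; rewrite inE /=; apply/eqP/imsetP => [->|[j _ [-> _]]//].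
by exists b.
Qed.

Lemma rowB_big J : bigB rowB J. Proof. by move=> t _; rewrite card_rowB. Qed.

Lemma deg_row (J : {set 'I_n}) : degB rowB J = (#|J| * (d - 1))%N.
Proof.
rewrite /degB (eq_bigr (fun=> (d - 1)%N)); first by rewrite sum_nat_const.
by move=> t _; rewrite card_rowB subn1.
Qed.

Lemma hdJ (J : {set 'I_n}) k (c : cochain k) : (#|J| * (d - 1) < k)%N -> coc (XJ J) c -> nul (XJ J) c.
Proof. by move=> h; apply: (hdB (rowB_good J)); [exact: rowB_big|rewrite deg_row]. Qed.

(** Iterating [structBP] on the non-top part of a class ends with the top classes of those
    subproducts whose top degree is [k]. *)
Lemma spanJ k (Pr : cochain k -> Prop) (J : {set 'I_n}) :
  Pr 0 -> (forall c c', Pr c -> Pr c' -> Pr (c + c')) ->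
  (forall c c', nul (XJ J) (c - c') -> Pr c' -> Pr c) ->
  (forall J' : {set 'I_n}, J' \subset J -> (#|J'| * (d - 1))%N = k -> forall c, coc (XJ J') c -> Pr c) ->
  forall c, coc (XJ J) c -> Pr c.
Proof.
move=> P0 PD; have [N] := ubnP #|J|; elim: N J => // N IH J le Pn PJ c hc.
have [om [om1 om2 _ om4]] := structBP (rowB_good J).
have [lam [g [g1 g2]]] := om4 k c hc.
apply: (Pn) g2 _; apply: (PD).
  case: (eqVneq k (degB rowB J)) => kd.
    by apply: (PJ J) => //; [rewrite kd deg_row|exact: cocZ].
  by rewrite om2// (_ : scc _ _ = 0)//; apply: funext => s; rewrite /scc mulr0.
apply: (big_ind Pr) => [|a b ha hb|t tJ]; [exact: P0|exact: PD|].
have sJ := subD1set J t.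
apply: (IH (J :\ t)); last exact: g1.
- by move: le; rewrite (cardsD1 t) tJ add1n ltnS.
- by move=> c1 c2 h; apply: Pn; apply: nulW h; exact: XB_sub.
- by move=> J' JJ; apply: PJ; exact: fintype.subset_trans JJ sJ.
Qed.

Lemma topJ (J : {set 'I_n}) : exists om : cochain (#|J| * (d - 1))%N, coc (XJ J) om /\
    (forall c, coc (XJ J) c -> exists lam, nul (XJ J) (c - scc lam om)).
Proof.
have := top1 (rowB_good J) (@rowB_big J); rewrite deg_row => -[om [om1 _ om3]].
by exists om.
Qed.

Lemma reflJ (J : {set 'I_n}) k (c : cochain k) e : k = (#|J| * (d - 1))%N -> coc (XJ J) c -> e.1 \in J ->
  nul (XJ J) (pb (refl e) c + c).
Proof.
move=> kE hc eJ; apply: (top_refl (rowB_good J) (@rowB_big J) _ hc eJ).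
  by rewrite deg_row.
by rewrite inE.
Qed.

(* [antl p l] and [swl p q l] do the antipode of row [p] and the swap of rows [p], [q] one coordinate at
   a time, so that each step is a reflection up to homotopy. *)
Definition antl (p : 'I_n) (l : nat) : Mpt n d -> Mpt n d := fun u =>
  \matrix_(i, j) if (i == p) && (j < l)%N then - u i j else u i j.
Definition ant p := antl p d.

Lemma antl_cont p l u : {for u, continuous (antl p l)}.
Proof.
apply: mx_cont => i j.
rewrite (_ : (fun y => _) = fun y : Mpt n d => if (i == p) && (j < l)%N then - y i j else y i j).
  by case: (_ && _); [apply: cntN|]; exact: cnt_coord.
by apply: funext => y; rewrite mxE.
Qed.

Lemma antl_mapto p l (J : {set 'I_n}) : mapto (antl p l) (XJ J) (XJ J).
Proof.
apply: mapto_same => [u h t tJ|u]; last exact: antl_cont.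
have [[i j] ib hi] := h t tJ; exists (i, j) => //.
by move: hi; rewrite /crd mxE /=; case: ifP => _ //; rewrite oppr_eq0.
Qed.

Lemma antJ (J : {set 'I_n}) k (c : cochain k) p : k = (#|J| * (d - 1))%N -> coc (XJ J) c -> p \in J ->
  nul (XJ J) (pb (ant p) c - scc ((-1) ^+ d) c).
Proof.
move=> kE hc pJ.
suff H l : (l <= d)%N -> nul (XJ J) (pb (antl p l) c - scc ((-1) ^+ l) c) by exact: H.
elim: l => [_|l IH ld].
  rewrite expr0 scc1; apply: pb_id_nul => x _; apply/matrixP => i j.
  by rewrite mxE andbF.
have h1 := IH (ltnW ld).
pose e : I := (p, Ordinal ld).
have h2 := pb_nul (antl_mapto p l (J := J)) (reflJ (e := e) kE hc pJ).
have := nulB h2 h1; apply: nul_ext => s _; rewrite pbD pb_comp.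
have -> : (@refl n d e \o antl p l) = antl p l.+1.
  apply: funext => u; apply: crd_ext => -[i j]; rewrite /=.
  case: (eqVneq (i, j) e) => [[-> ->]|ne].
    by rewrite crd_upd /crd !mxE /= eqxx ltnn leqnn.
  rewrite crd_updN// /crd !mxE /= ltnS [(j <= l)%N]leq_eqVlt.
  case: (eqVneq i p) => //= ip; case: (eqVneq (j : nat) l) => //= jl.
  by case/negP: ne; rewrite /e; apply/eqP; congr pair => //; apply: val_inj.
change (pb (antl p l.+1) c s + pb (antl p l) c s - (pb (antl p l) c s - (-1) ^+ l * c s) =
  pb (antl p l.+1) c s - (-1) ^+ l.+1 * c s).
rewrite exprS; ring.
Qed.

Definition swl (p q : 'I_n) (l : nat) : Mpt n d -> Mpt n d := fun u =>
  \matrix_(i, j) if (j < l)%N then u (tperm p q i) j else u i j.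
Definition rsw p q : Mpt n d -> Mpt n d := fun u => \matrix_(i, j) u (tperm p q i) j.

Lemma rsw_swl p q : rsw p q = swl p q d.
Proof. by apply: funext => u; apply/matrixP => i j; rewrite !mxE ltn_ord. Qed.

Lemma swl_cont p q l u : {for u, continuous (swl p q l)}.
Proof.
apply: mx_cont => i j.
rewrite (_ : (fun y => _) = fun y : Mpt n d => if (j < l)%N then y (tperm p q i) j else y i j).
  by case: (j < l)%N; exact: cnt_coord.
by apply: funext => y; rewrite mxE.
Qed.

(* Merging the blocks [p] and [q]: inside the merged block the swap of two coordinates is joined to a
   reflection by straight segments. *)
Definition mrg (p q : 'I_n) (t : 'I_n) : {set I} :=
  if t == p then rowB p :|: rowB q else rowB t.

Lemma nzU (b b' : {set I}) (u : Mpt n d) : nz (b :|: b') u <-> nz b u \/ nz b' u.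
Proof.
split=> [[e]|[] [e h1 h2]]; last 2 first.
- by exists e => //; rewrite inE h1.
- by exists e => //; rewrite inE h1 orbT.
by rewrite inE => /orP[h|h] h'; [left|right]; exists e.
Qed.

(** [XJ J] is the intersection of [U] and [V], whose union has rows [p] and [q] merged into one
    block of [2d] coordinates. There the exchange is a product of [d] swaps of coordinates and acts
    on the top class by [(-1)^d]. It also exchanges [U] and [V], which negates the connecting map;
    together this gives [-(-1)^d]. *)
Lemma swapJ (J : {set 'I_n}) k (c : cochain k) p q : k = (#|J| * (d - 1))%N -> coc (XJ J) c ->
  p \in J -> q \in J -> p != q ->
  nul (XJ J) (pb (rsw p q) c + scc ((-1) ^+ d) c).
Proof.
move=> kE hc pJ qJ pq; pose U := XJ (J :\ q); pose V := XJ (J :\ p).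
have UV : U `&` V = XJ J.
  apply/seteqP; split=> u; last first.
    by move=> h; split=> t; rewrite !inE => /andP[_]; exact: h.
  move=> [h1 h2] t tJ; case: (eqVneq t q) => [->|tq]; last by apply: h1; rewrite !inE tq.
  by apply: h2; rewrite !inE eq_sym pq.
pose B := mrg p q.
have UUV : U `|` V = XB B (J :\ q).
  apply/seteqP; split=> u.
    move=> h t; rewrite !inE => /andP[tq tJ]; rewrite /B /mrg; case: eqVneq => [tp|tp].
      apply/nzU; case: h => h; [left|right]; apply: h; rewrite !inE ?pq ?pJ// eq_sym pq//.
    by case: h => h; apply: h; rewrite !inE ?tq ?tp.
  move=> h; have := h p; rewrite !inE pq pJ => /(_ isT); rewrite {1}/B /mrg eqxx => /nzU [hp|hq].
    left=> t ht; have := h t ht; rewrite /B /mrg; case: eqVneq => [->|//] _; exact: hp.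
  right=> t; rewrite !inE => /andP[tp tJ]; case: (eqVneq t q) => [->//|tq].
  by have := h t; rewrite !inE tq tJ /B /mrg (negbTE tp); apply.
have relo (W : set (Mpt n d)) J' : relopen (XJ J') W.
  move=> u hu; have H : \forall v \near u, forall t : 'I_n, t \in J' -> nz (rowB t) v.
    apply: (@filter_forall _ _ _ _ (nbhs_filter u)) => t; case: (boolP (t \in J')) => tJ.
      by apply: filterS (near_nz (hu t tJ)) => v hv _.
    by apply: nearW.
  by apply: filterS H => v hv _ t; exact: hv.
have [c' c'1 c'2] : exists2 c', coc (U `|` V) c' & conn U V c c'.
  by apply: MV_conn_ex; [exact: relo|exact: relo|rewrite UV].
rewrite UUV in c'1.
have gB : goodB B (J :\ q) rep0.
  split=> [t t'|t]; rewrite !inE => /andP[tq tJ].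
    move=> /andP[t'q t'J] tt' e; rewrite /B /mrg.
    case: eqVneq => [tp|tp]; case: eqVneq => [t'p|t'p]; rewrite !inE.
    - by rewrite tp t'p eqxx in tt'.
    - by move=> /orP[]/eqP ->; rewrite eq_sym.
    - by move=> /eqP ->; rewrite negb_or tp tq.
    - by move=> /eqP ->.
  by rewrite /B /mrg; case: eqVneq => [->|]; rewrite !inE eqxx.
have cB : #|B p| = (d + d)%N.
  rewrite /B /mrg eqxx cardsU !card_rowB (_ : rowB p :&: rowB q = finset.set0) ?cards0 ?subn0//.
  apply/finset.setP => e; rewrite !inE; apply/negbTE/negP => /andP[/eqP -> /eqP h].
  by rewrite h eqxx in pq.
have bB : bigB B (J :\ q).
  move=> t _; case: (eqVneq t p) => [->|tp]; first by rewrite cB; lia.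
  by rewrite /B /mrg (negbTE tp) card_rowB.
have dB : k.+1 = degB B (J :\ q).
  have pJq : p \in J :\ q by rewrite !inE pq pJ.
  rewrite /degB (big_setD1 p)//= cB (eq_bigr (fun=> (d - 1)%N)).
    rewrite sum_nat_const kE (cardsD1 q J) qJ (cardsD1 p (J :\ q)) pJq !add1n !mulSn.
    move: (_ * _)%N => x; lia.
  by move=> t; rewrite !inE /B /mrg => /andP[/negbTE -> _]; rewrite card_rowB subn1.
have eqn : p != q by [].
have Hl l : (l <= d)%N -> mapto (swl p q l) (XB B (J :\ q)) (XB B (J :\ q)) /\
     nul (XB B (J :\ q)) (pb (swl p q l) c' - scc ((-1) ^+ l) c').
  have mp l' : mapto (swl p q l') (XB B (J :\ q)) (XB B (J :\ q)).
    apply: mapto_same => [u h t tJ|u]; last exact: swl_cont.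
    have [[i j] ib hi] := h t tJ.
    case: (ltnP j l') => jl; last by exists (i, j) => //; rewrite /crd mxE /= ltnNge jl.
    exists (tperm p q i, j); last by rewrite /crd mxE /= jl tpermK.
    move: ib tJ; rewrite /B /mrg !inE; case: eqVneq => [_|tp]; rewrite !inE /=.
      by move=> /orP[]/eqP ->; rewrite ?tpermL ?tpermR eqxx ?orbT.
    move=> /eqP -> /andP[tq _]; rewrite tpermD 1?eq_sym// eq_sym//.
  elim: l => [_|l IH ld].
    split=> //; rewrite expr0 scc1; apply: pb_id_nul => x _; apply/matrixP => i j.
    by rewrite mxE.
  split=> //; have [h0 h1] := IH (ltnW ld).
  pose e : I := (p, Ordinal ld); pose e' : I := (q, Ordinal ld).
  have ee' : e != e' by rewrite xpair_eqE (negbTE pq).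
  have pJq : p \in J :\ q by rewrite !inE pq pJ.
  have h3 : nul (XB B (J :\ q)) (pb (tau e e') c' + c').
    by apply: (top_tau gB bB dB c'1 pJq) => //; rewrite /B /mrg eqxx !inE eqxx ?orbT.
  have h2 := pb_nul h0 h3.
  have := nulB h2 h1; apply: nul_ext => s _; rewrite pbD pb_comp.
  have -> : (@tau n d e e' \o swl p q l) = swl p q l.+1.
    apply: funext => u; apply: crd_ext => -[i j]; rewrite /= crd_tau.
    case: (eqVneq (i, j) e) => [[-> ->]|ne]; first by rewrite /crd !mxE /= ltnn leqnn tpermL.
    case: (eqVneq (i, j) e') => [[-> ->]|ne']; first by rewrite /crd !mxE /= ltnn leqnn tpermR.
    rewrite /crd !mxE /= ltnS [(j <= l)%N]leq_eqVlt; case: (eqVneq (j : nat) l) => //= jl.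
    rewrite jl ltnn tpermD//; [apply: contraNneq ne => <-|apply: contraNneq ne' => <-];
      by apply/eqP; congr pair; apply: val_inj.
  change (pb (swl p q l.+1) c' s + pb (swl p q l) c' s - (pb (swl p q l) c' s - (-1) ^+ l * c' s) =
    pb (swl p q l.+1) c' s - (-1) ^+ l.+1 * c' s).
  rewrite exprS; ring.
have mUV (J1 J2 : {set 'I_n}) : (forall t, t \in J2 -> tperm p q t \in J1) -> mapto (rsw p q) (XJ J1) (XJ J2).
  move=> hJ u h; split; last by rewrite rsw_swl; exact: swl_cont.
  move=> t tJ; have [[i j] ib hi] := h _ (hJ t tJ); exists (tperm p q i, j).
    by move: ib; rewrite !inE /= => /eqP ->; rewrite tpermK.
  by move: hi; rewrite /crd mxE /= tpermK.
have m1 : mapto (rsw p q) U V.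
  apply: mUV => t; rewrite !inE => /andP[tp tJ]; case: tpermP => [E|E|tp' /eqP tq].
  - by rewrite E eqxx in tp.
  - by rewrite pq.
  - by rewrite tq.
have m2 : mapto (rsw p q) V U.
  apply: mUV => t; rewrite !inE => /andP[tp tJ]; case: tpermP => [E|E|/eqP tp' tq].
  - by rewrite eq_sym pq.
  - by rewrite E eqxx in tp.
  - by rewrite tp'.
have [_ h1] := Hl d (leqnn d).
have c2 := conn_pb m1 m2 (conn_swap c'2).
have c3 := connB c2 (connZ ((-1) ^+ d) c'2).
rewrite rsw_swl in c3; rewrite -UUV in h1.
have [a [b [ca cb hab]]] := MV_conn_inj c3 h1.
(* [U] and [V] have one sphere fewer, so they carry no cohomology in degree [k] and the connecting
   map is injective. *)
have cardJ t : t \in J -> (#|J :\ t| * (d - 1) < k)%N.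
  move=> tJ; rewrite kE (cardsD1 t J) tJ add1n mulSn; lia.
have na := nulW (@subIsetl _ U V) (hdJ (cardJ q qJ) ca).
have nb := nulW (@subIsetr _ U V) (hdJ (cardJ p pJ) cb).
have := nulN (nulD hab (nulB na nb)); rewrite UV rsw_swl; apply: nul_ext => s _; rewrite pbN.
change (- (- pb (swl p q d) c s - (-1) ^+ d * c s - (a s - b s) + (a s - b s)) =
  pb (swl p q d) c s + (-1) ^+ d * c s); ring.
Qed.

End Rows.

(** * A norm on rows and the replacement of one row *)

Section RowNorm.
Variables (n d : nat).

Definition nrm (r : 'rV[RR]_d) : RR := \sum_j `|r 0 j|.

Lemma nrm_ge0 r : 0 <= nrm r. Proof. exact: sumr_ge0. Qed.

Lemma nrm0 : nrm 0 = 0. Proof. by rewrite /nrm big1// => j _; rewrite mxE normr0. Qed.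

Lemma nrm_eq0 r : (nrm r == 0) = (r == 0).
Proof.
apply/eqP/eqP => [|->]; last exact: nrm0.
move/eqP; rewrite psumr_eq0// => /allP h; apply/rowP => j; rewrite mxE.
by have := h j (mem_index_enum _); rewrite normr_eq0 => /eqP.
Qed.

Lemma nrm_gt0 r : (0 < nrm r) = (r != 0).
Proof. by rewrite lt_def nrm_ge0 andbT nrm_eq0. Qed.

Lemma nrmZ a r : nrm (a *: r) = `|a| * nrm r.
Proof. by rewrite /nrm mulr_sumr; apply: eq_bigr => j _; rewrite mxE normrM. Qed.

Lemma nrmN r : nrm (- r) = nrm r.
Proof. by apply: eq_bigr => j _; rewrite mxE normrN. Qed.

Lemma nrm_triangle r s : nrm (r + s) <= nrm r + nrm s.
Proof. by rewrite /nrm -big_split; apply: ler_sum => j _; rewrite mxE ler_normD. Qed.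

Definition setrow (p : 'I_n) (v : 'rV[RR]_d) (u : Mpt n d) : Mpt n d :=
  \matrix_(i, j) if i == p then v 0 j else u i j.

Lemma row_setrow p v u : row p (setrow p v u) = v.
Proof. by apply/rowP => j; rewrite !mxE eqxx. Qed.

Lemma row_setrowN p q v u : q != p -> row q (setrow p v u) = row q u.
Proof. by move=> h; apply/rowP => j; rewrite !mxE (negbTE h). Qed.

Lemma setrow_setrow p v w u : setrow p v (setrow p w u) = setrow p v u.
Proof. by apply/matrixP => i j; rewrite !mxE; case: (i == p). Qed.

Lemma setrow_id p u : setrow p (row p u) u = u.
Proof. by apply/matrixP => i j; rewrite !mxE; case: eqP => [->|]. Qed.

Lemma setrowE p v u i j : setrow p v u i j = if i == p then v 0 j else u i j.
Proof. by rewrite mxE. Qed.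

Lemma setrow_seg p v w u (t : RR) :
  (1 - t) *: setrow p v u + t *: setrow p w u = setrow p ((1 - t) *: v + t *: w) u.
Proof.
apply/matrixP => i j; rewrite !mxE; case: (i == p) => //.
by rewrite -mulrDl subrK mul1r.
Qed.

Lemma row_ext (u v : Mpt n d) : (forall i, row i u = row i v) -> u = v.
Proof. by move=> h; apply/row_matrixP. Qed.

Lemma setrow_cont p (f : Mpt n d -> 'rV[RR]_d) u :
  (forall j, cnt (fun v => f v 0 j) u) -> {for u, continuous (fun v => setrow p (f v) v)}.
Proof.
move=> hf; apply: mx_cont => i j.
rewrite (_ : (fun y => _) = fun y => if i == p then f y 0 j else y i j).
  by case: (i == p); [exact: hf|exact: cnt_coord].
by apply: funext => y; rewrite mxE.
Qed.

Lemma nrm_cnt (T : topologicalType) (f : T -> 'rV[RR]_d) x :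
  (forall j, cnt (fun y => f y 0 j) x) -> cnt (fun y => nrm (f y)) x.
Proof. by move=> h; apply: cnt_sum => j _; apply: cnt_norm. Qed.

Lemma row_cnt p j (u : Mpt n d) : cnt (fun v : Mpt n d => row p v 0 j) u.
Proof.
rewrite (_ : (fun v => _) = fun v : Mpt n d => v p j); first exact: cnt_coord.
by apply: funext => v; rewrite mxE.
Qed.

End RowNorm.

(** * Puncturing a fibration by points along sections *)

Section Tube.
Variables (n d : nat) (T : finType) (p : 'I_n) (g : T -> Mpt n d -> 'rV[RR]_d) (Y : set (Mpt n d)).
Hypothesis Yp : forall v u, Y u -> Y (setrow p v u).
Hypothesis gp : forall a v u, g a (setrow p v u) = g a u.
Hypothesis gc : forall a u j, cnt (fun v : Mpt n d => g a v 0 j) u.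
Hypothesis gD : forall u a b, Y u -> a != b -> g a u != g b u.
Notation cochain := (cochain n d).
Implicit Types (A : {set T}).

Definition puncture A : set (Mpt n d) := fun u => Y u /\ forall a, a \in A -> row p u != g a u.
Definition Ynz : set (Mpt n d) := fun u => Y u /\ row p u != 0.
Definition eps a u : RR := \big[Num.min/1]_(b | b != a) nrm (g a u - g b u).
Definition tube_radius a u : RR := eps a u / 2 / (1 + nrm (row p u)).
Definition tubeR a u : Mpt n d := setrow p (g a u + tube_radius a u *: row p u) u.
Definition tubePsi a u : Mpt n d := setrow p (row p u - g a u) u.
Definition tube a : set (Mpt n d) := fun u => Y u /\ nrm (row p u - g a u) < eps a u.

Lemma gBc a b u j : cnt (fun v : Mpt n d => (g a v - g b v) 0 j) u.
Proof.
rewrite (_ : (fun v => _) = fun v => g a v 0 j - g b v 0 j); first by apply: cntB; exact: gc.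
by apply: funext => v; rewrite !mxE.
Qed.

Lemma rgc a u j : cnt (fun v : Mpt n d => (row p v - g a v) 0 j) u.
Proof.
rewrite (_ : (fun v => _) = fun v => row p v 0 j - g a v 0 j).
  by apply: cntB; [exact: row_cnt|exact: gc].
by apply: funext => v; rewrite !mxE.
Qed.

Lemma eps_cnt a u : cnt (eps a) u.
Proof. by apply: cnt_bigmin => b _; apply: nrm_cnt => j; exact: gBc. Qed.

Lemma eps_gt0 a u : Y u -> 0 < eps a u.
Proof.
move=> Yu; rewrite /eps; elim/big_ind: _ => // [x y x0 y0|b ba].
  by rewrite lt_min x0.
by rewrite nrm_gt0 subr_eq0; apply: gD => //; rewrite eq_sym.
Qed.

Lemma eps_le a b u : b != a -> eps a u <= nrm (g a u - g b u).
Proof. by move=> ba; rewrite /eps (bigD1 b)//= ge_min lexx. Qed.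

Lemma eps_p a v u : eps a (setrow p v u) = eps a u.
Proof. by apply: eq_bigr => b _; rewrite !gp. Qed.

Lemma tube_radius_gt0 a u : Y u -> 0 < tube_radius a u.
Proof.
move=> Yu; rewrite /tube_radius divr_gt0 ?divr_gt0 ?eps_gt0//.
by rewrite ltr_pwDl// nrm_ge0.
Qed.

Lemma tube_radius_half a u : Y u -> nrm (tube_radius a u *: row p u) <= eps a u / 2.
Proof.
move=> Yu; rewrite nrmZ gtr0_norm ?tube_radius_gt0// /tube_radius.
have e0 := eps_gt0 a Yu; have r0 := nrm_ge0 (row p u).
have x0 : 0 < 1 + nrm (row p u) by rewrite ltr_pwDl.
rewrite mulrAC ler_pdivrMr//; move: (eps a u) (nrm _) e0 r0 x0 => e r e0 r0 x0; nra.
Qed.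

Lemma tube_radius_lt a u : Y u -> nrm (tube_radius a u *: row p u) < eps a u.
Proof.
by move=> Yu; apply: le_lt_trans (tube_radius_half a Yu) _; rewrite ltr_pdivrMr// ltr_pMr ?eps_gt0// ltr1n.
Qed.

Lemma eps_le1 a u : eps a u <= 1.
Proof. by rewrite /eps; elim/big_rec: _ => // b x _ h; rewrite ge_min h orbT. Qed.

Lemma tube_radius_le1 a u : Y u -> tube_radius a u <= 1.
Proof.
move=> Yu; rewrite /tube_radius.
have e0 := eps_le1 a u; have r0 := nrm_ge0 (row p u).
have x0 : 0 < 1 + nrm (row p u) by rewrite ltr_pwDl.
by rewrite ler_pdivrMr// mul1r; lra.
Qed.

Lemma tube_radius_cnt a u : cnt (tube_radius a) u.
Proof.
have x0 : 1 + nrm (row p u) != 0 by rewrite gt_eqF// ltr_pwDl// nrm_ge0.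
apply: cntM; first by apply: cntM; [exact: eps_cnt|exact: cnt_cst].
apply: cntV => //; apply: cntD; first exact: cnt_cst.
by apply: nrm_cnt => j; exact: row_cnt.
Qed.

Lemma tubeR_cont a u : {for u, continuous (tubeR a)}.
Proof.
apply: setrow_cont => j.
rewrite (_ : (fun v => _) = fun v => g a v 0 j + tube_radius a v * row p v 0 j); last first.
  by apply: funext => v; rewrite !mxE.
apply: cntD; first exact: gc.
by apply: cntM; [exact: tube_radius_cnt|exact: row_cnt].
Qed.

Lemma tubePsi_cont a u : {for u, continuous (tubePsi a)}.
Proof. by apply: setrow_cont => j; exact: rgc. Qed.

Lemma tube_puncture a A u : tube a u -> row p u != g a u -> puncture A u.
Proof.
move=> [Yu hu] ne; split=> // b _; case: (eqVneq b a) => [->//|ba].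
apply/eqP => e; move: hu; rewrite e -nrmN opprB => /lt_le_trans /(_ (eps_le u ba)).
by rewrite ltxx.
Qed.

Lemma tubeR_mapto a A : mapto (tubeR a) Ynz (puncture A `&` tube a).
Proof.
move=> u [Yu hu]; split; last exact: tubeR_cont.
have tu : tube a (tubeR a u).
  split; first exact: Yp.
  by rewrite row_setrow /tubeR gp eps_p addrC addKr tube_radius_lt.
split=> //; apply: tube_puncture tu _.
rewrite row_setrow gp eq_sym addrC -subr_eq subrr eq_sym scaler_eq0 negb_or hu.
by rewrite gt_eqF ?tube_radius_gt0.
Qed.

Lemma tubePsi_mapto a A : a \in A -> mapto (tubePsi a) (puncture A) Ynz.
Proof.
move=> aA u [Yu hu]; split; last exact: tubePsi_cont.
by split; [exact: Yp|rewrite row_setrow subr_eq0 hu].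
Qed.

Lemma tube_scale a A u (t : RR) : (puncture A `&` tube a) u -> row p u != g a u -> 0 < t <= 1 ->
  (puncture A `&` tube a) (setrow p (g a u + t *: (row p u - g a u)) u).
Proof.
move=> [[Yu _] [_ hu]] ne /andP[t0 t1].
have tu : tube a (setrow p (g a u + t *: (row p u - g a u)) u).
  split; first exact: Yp.
  rewrite row_setrow gp eps_p addrC addKr nrmZ gtr0_norm//; apply: le_lt_trans hu.
  by rewrite ler_piMl// nrm_ge0.
split=> //; apply: tube_puncture tu _.
by rewrite row_setrow gp eq_sym addrC -subr_eq subrr eq_sym scaler_eq0 negb_or subr_eq0 ne gt_eqF.
Qed.

(** The composite only rescales the vector from the section to row [p], so a straight line of
    positive rescalings joins it to the identity. *)
Lemma tubeR_psi a A k (c : cochain k) : a \in A -> coc (puncture A `&` tube a) c ->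
  nul (puncture A `&` tube a) (c - pb (tubePsi a) (pb (tubeR a) c)).
Proof.
move=> aA hc; rewrite pb_comp.
apply: (homot_id (Y := puncture A `&` tube a) _ _ hc) => [u _|u t hu /andP[t0 t1]].
  by apply: continuous_comp; [exact: tubePsi_cont|exact: tubeR_cont].
have Yu : Y u by case: hu => -[].
have ne : row p u != g a u by case: hu => -[_ /(_ a aA)].
rewrite /= /tubeR /tubePsi setrow_setrow row_setrow gp.
set r := tube_radius a _.
have r0 : 0 < r by apply: tube_radius_gt0; exact: Yp.
have r1 : r <= 1 by apply: tube_radius_le1; exact: Yp.
rewrite (_ : t *: u = t *: setrow p (row p u) u); last (by rewrite setrow_id); rewrite setrow_seg.
rewrite (_ : (1 - t) *: _ + _ = g a u + ((1 - t) * r + t) *: (row p u - g a u)).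
  by apply: tube_scale => //; apply/andP; split; nra.
apply/rowP => j; rewrite !mxE; ring.
Qed.

Lemma psi_tubeR a k (c : cochain k) : coc Ynz c ->
  nul Ynz (c - pb (tubeR a) (pb (tubePsi a) c)).
Proof.
move=> hc; rewrite pb_comp.
apply: (homot_id (Y := Ynz) _ _ hc) => [u _|u t [Yu hu] /andP[t0 t1]].
  by apply: continuous_comp; [exact: tubeR_cont|exact: tubePsi_cont].
rewrite /= /tubeR /tubePsi setrow_setrow row_setrow gp [X in setrow p X]addrAC subrr add0r.
have r0 := tube_radius_gt0 a Yu.
rewrite (_ : t *: u = t *: setrow p (row p u) u); last (by rewrite setrow_id); rewrite setrow_seg; split; first exact: Yp.
rewrite row_setrow scalerA -scalerDl scaler_eq0 negb_or hu andbT gt_eqF//; nra.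
Qed.

Lemma puncture_sub A A' : A' \subset A -> puncture A `<=` puncture A'.
Proof. by move=> /fintype.subsetP AA u [Yu h]; split=> // a /AA; exact: h. Qed.

(** On the punctured tube [c] is pulled back from its residue [pb (tubeR a) c], hence null; so [c]
    glues with the zero class on the full tube, which fills the puncture at [a]. *)
Lemma puncture_ext A a k (c : cochain k) : a \in A -> coc (puncture A) c ->
  nul Ynz (pb (tubeR a) c) ->
  exists2 c', coc (puncture (A :\ a)) c' & nul (puncture A) (c' - c).
Proof.
move=> aA hc hn.
have E : puncture A `|` tube a = puncture (A :\ a).
  apply/seteqP; split=> u.
    case=> [|[Yu hu]]; first by apply: puncture_sub; exact: subD1set.
    split=> // b; rewrite !inE => /andP[ba _]; apply/eqP => e.
    move: hu; rewrite e -nrmN opprB => /lt_le_trans /(_ (eps_le u ba)).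
    by rewrite ltxx.
  move=> [Yu hu]; case: (eqVneq (row p u) (g a u)) => [e|ne].
    by right; split=> //; rewrite e subrr nrm0 eps_gt0.
  by left; split=> // b bA; case: (eqVneq b a) => [->//|ba]; apply: hu; rewrite !inE ba.
have [|||||c' hc' [h1 _]] := @MV_glue _ _ (puncture A) (tube a) _ _ k c 0.
- rewrite E => u [Yu hu].
  have := cnt_gt0 (nrm_cnt (@rgc a u)); rewrite nrm_gt0 subr_eq0 => /(_ (hu a aA)).
  apply: filterS => v; rewrite nrm_gt0 subr_eq0 => hv [Yv hv']; split=> // b bA.
  by case: (eqVneq b a) => [->//|ba]; apply: hv'; rewrite !inE ba.
- rewrite E => u [Yu hu].
  have := @cnt_gt0 _ (fun v => eps a v - nrm (row p v - g a v)) u.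
  rewrite subr_gt0 => /(_ _ hu) H.
  have {}H := H (cntB (@eps_cnt a u) (nrm_cnt (@rgc a u))).
  by apply: filterS H => v; rewrite subr_gt0 => hv [Yv _].
- exact: hc.
- exact: coc0.
- rewrite subr0; apply: (nul_eq (tubeR_psi aA _)).
    by apply: cocW hc => u [].
  apply: pb_nul hn; move=> u [hu _]; exact: (tubePsi_mapto aA).
by exists c'; [rewrite -E|].
Qed.

(** Subtracting the pullback of the residue under [tubePsi a] leaves a class with null residue at
    [a], which extends over that puncture. *)
Lemma puncture_span A k (c : cochain k) : coc (puncture A) c ->
  exists2 c0, coc Y c0 & exists2 ca : T -> cochain k, (forall a, coc Ynz (ca a)) &
    nul (puncture A) (c - (c0 + \sum_(a in A) pb (tubePsi a) (ca a))).
Proof.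
have [N] := ubnP #|A|; elim: N A c => // N IH A c le hc.
case: (set_0Vmem A) => [A0|[a aA]].
  exists c; first by apply: cocW hc => u Yu; split=> // a; rewrite A0 inE.
  exists (fun=> 0) => [a|]; first exact: coc0.
  by rewrite A0 big_set0 addr0 subrr; exact: nul0.
have mR : mapto (tubeR a) Ynz (puncture A).
  by move=> u /(tubeR_mapto a A) [[]].
pose x := pb (tubeR a) c; have hx : coc Ynz x by exact: pb_coc mR hc.
have mP := tubePsi_mapto aA.
have [||c' hc' nc'] := @puncture_ext A a k (c - pb (tubePsi a) x) aA.
- by apply: cocB => //; apply: pb_coc hx.
- rewrite pbB; exact: psi_tubeR.
have [|c0 h0 [ca hca hn]] := IH (A :\ a) c' _ hc'.
  by move: le; rewrite (cardsD1 a) aA ltnS.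
exists c0 => //; exists (fun b => if b == a then x else ca b) => [b|]; first by case: eqP.
rewrite (big_setD1 a)//= eqxx.
rewrite (eq_bigr (fun b => pb (tubePsi b) (ca b))); last first.
  by move=> b; rewrite !inE => /andP[/negbTE ->].
have := nulB (nulW (puncture_sub (subD1set A a)) hn) nc'.
set S := \sum_(b in _) _; apply: nul_ext => s _.
change (c' s - (c0 s + S s) - (c' s - (c s - pb (tubePsi a) x s)) =
   c s - (c0 s + (pb (tubePsi a) x s + S s))); ring.
Qed.

Lemma puncture_peel A k (c : cochain k) : coc (puncture A) c ->
  (forall a, a \in A -> nul Ynz (pb (tubeR a) c)) ->
  exists2 c0, coc Y c0 & nul (puncture A) (c - c0).
Proof.
have [N] := ubnP #|A|; elim: N A c => // N IH A c le hc hn.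
case: (set_0Vmem A) => [A0|[a aA]].
  exists c; first by apply: cocW hc => u Yu; split=> // a; rewrite A0 inE.
  by rewrite subrr; exact: nul0.
have [c' hc' nc'] := puncture_ext aA hc (hn a aA).
have [||c0 h0 h] := IH (A :\ a) c' _ hc'.
- by move: le; rewrite (cardsD1 a) aA ltnS.
- move=> b; rewrite !inE => /andP[ba bA]; apply: nul_eq (hn b bA).
  rewrite -pbB; apply: pb_nul nc'.
  by move=> u /(tubeR_mapto b A) [[]].
exists c0 => //; apply: nul_trans (nulW (puncture_sub (subD1set A a)) h).
exact: nul_sym.
Qed.

End Tube.

Notation dsj B J := (fintype.disjoint (mem B) (mem J)).

(** * Symmetric classes in top degree *)

Section Configurations.
Variables (n d : nat).
Hypothesis d2 : (2 <= d)%N.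
Notation cochain := (cochain n d).
Implicit Types (B J : {set 'I_n}) (p q a : 'I_n).

(** Interpolates between the configuration space ([J] empty) and a product of punctured spaces ([B]
    empty): the rows in [J] are difference vectors of points already peeled off. *)
Definition SP B J : set (Mpt n d) := fun u =>
  (forall a b, a \in B -> b \in B -> a != b -> row a u != row b u) /\
  (forall t, t \in J -> row t u != 0).

Lemma nz_row t (u : Mpt n d) : nz (rowB d t) u <-> row t u != 0.
Proof.
split=> [[[i j]]|].
  rewrite inE /= => /eqP -> h; apply: contra_neq h => e.
  by have := congr1 (fun r : 'rV[RR]_d => r 0 j) e; rewrite !mxE.
move=> h; case: (pselect (nz (rowB d t) u)) => // hn; case/negP: h; apply/eqP/rowP => j.
rewrite !mxE; apply: contrapT => /eqP h; apply: hn; exists (t, j) => //.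
by rewrite inE.
Qed.

Lemma SP_XJ J : SP finset.set0 J = XJ J.
Proof.
apply/seteqP; split=> u.
  by move=> [_ h] t tJ; apply/nz_row; exact: h.
by move=> h; split=> [a b|t tJ]; [rewrite inE|apply/nz_row; exact: h].
Qed.

Lemma SP_sub B B' J J' : B' \subset B -> J' \subset J -> SP B J `<=` SP B' J'.
Proof.
move=> /fintype.subsetP BB /fintype.subsetP JJ u [h1 h2]; split=> [a b /BB aB /BB bB|t /JJ]; first exact: h1.
exact: h2.
Qed.

Definition psi p a (u : Mpt n d) : Mpt n d := setrow p (row p u - row a u) u.

Section Peel.
Variables (B J : {set 'I_n}) (p : 'I_n).
Hypothesis pB : p \in B.
Hypothesis pJ : p \notin J.
Let T := {a : 'I_n | a \in B :\ p}.
Let g (a : T) (u : Mpt n d) := row (sval a) u.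
Let Y := SP (B :\ p) J.

Lemma peel_valB (a : T) : sval a \in B /\ sval a != p.
Proof. by case: a => a /= h; move: (h); rewrite !inE => /andP[]. Qed.

Lemma peel_Yp v u : Y u -> Y (setrow p v u).
Proof.
move=> [h1 h2]; split=> [a b aB bB ab|t tJ].
  by rewrite !row_setrowN; [exact: h1|move: bB|move: aB]; rewrite !inE => /andP[].
by rewrite row_setrowN ?h2//; apply: contraNneq pJ => <-.
Qed.

Lemma peel_gp (a : T) v u : g a (setrow p v u) = g a u.
Proof. by rewrite /g row_setrowN//; have [] := peel_valB a. Qed.

Lemma peel_gc (a : T) u j : cnt (fun v : Mpt n d => g a v 0 j) u.
Proof. exact: row_cnt. Qed.

Lemma peel_gD u (a b : T) : Y u -> a != b -> g a u != g b u.
Proof. by move=> [h _] ab; apply: h; [exact: (svalP a)|exact: (svalP b)|exact: ab]. Qed.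

Lemma peel_puncture : puncture p g Y finset.setT = SP B J.
Proof.
apply/seteqP; split=> u.
  move=> [[h1 h2] h3]; split=> // a b aB bB ab.
  case: (eqVneq a p) => [ap|ap].
    have bT : b \in B :\ p by rewrite !inE bB andbT -ap eq_sym.
    by rewrite ap; exact: (h3 (Sub b bT)).
  have aT : a \in B :\ p by rewrite !inE ap.
  case: (eqVneq b p) => [->|bp]; first by rewrite eq_sym; exact: (h3 (Sub a aT)).
  by apply: h1 => //; rewrite !inE bp.
move=> h; split; first by apply: SP_sub h => //; exact: subD1set.
by move=> a _; have [aB ap] := peel_valB a; case: h => h _; apply: h => //; rewrite eq_sym.
Qed.

Lemma peel_Ynz : Ynz p Y = SP (B :\ p) (p |: J).
Proof.
apply/seteqP; split=> u.
  by move=> [[h1 h2] h3]; split=> // t; rewrite !inE => /orP[/eqP ->//|]; exact: h2.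
move=> [h1 h2]; split; last by apply: h2; rewrite !inE eqxx.
by split=> // t tJ; apply: h2; rewrite !inE tJ orbT.
Qed.

Definition resR (a : T) : Mpt n d -> Mpt n d := tubeR p g a.

Lemma resR_mapto (a : T) : mapto (resR a) (SP (B :\ p) (p |: J)) (SP B J).
Proof.
rewrite -peel_puncture -peel_Ynz => u hu.
by have [[h _] ?] := @tubeR_mapto _ _ T p g Y peel_Yp peel_gp peel_gc peel_gD a finset.setT u hu.
Qed.

(** The explicit form of the tube map, from which the later homotopies are estimated. *)
Lemma resR_spec (a : T) u : SP (B :\ p) (p |: J) u -> exists r e, [/\ 0 < r, 0 < e <= 1,
  nrm (r *: row p u) <= e / 2,
  (forall b, b \in B :\ p -> b != sval a -> e <= nrm (row (sval a) u - row b u)) &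
  resR a u = setrow p (row (sval a) u + r *: row p u) u].
Proof.
rewrite -peel_Ynz => -[Yu up]; exists (tube_radius p g a u), (eps g a u); split=> //.
- by apply: (tube_radius_gt0 p peel_gD _ Yu).
- by rewrite eps_le1 andbT; apply: (eps_gt0 peel_gD _ Yu).
- by apply: (tube_radius_half p peel_gD _ Yu).
- by move=> b bB ba; exact: (@eps_le _ _ T g a (Sub b bB) u ba).
Qed.

Lemma SP_peel k (c : cochain k) : coc (SP B J) c ->
  (forall a : T, nul (SP (B :\ p) (p |: J)) (pb (resR a) c)) ->
  exists2 c0, coc (SP (B :\ p) J) c0 & nul (SP B J) (c - c0).
Proof.
rewrite -peel_puncture -peel_Ynz => hc hn.
by apply: (puncture_peel peel_Yp peel_gp peel_gc peel_gD hc) => a _; exact: hn.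
Qed.

Lemma SP_span k (c : cochain k) : coc (SP B J) c ->
  exists2 c0, coc (SP (B :\ p) J) c0 &
  exists2 ca : T -> cochain k, (forall a : T, coc (SP (B :\ p) (p |: J)) (ca a)) &
    nul (SP B J) (c - (c0 + \sum_(a : T) pb (psi p (sval a)) (ca a))).
Proof.
rewrite -peel_puncture -peel_Ynz => hc.
have [c0 h0 [ca h1 h2]] := puncture_span peel_Yp peel_gp peel_gc peel_gD hc.
exists c0 => //; exists ca => //; move: h2.
by rewrite (eq_bigl xpredT)// => a; rewrite inE.
Qed.

Lemma psi_mapto a : a \in B -> a != p -> mapto (psi p a) (SP B J) (SP (B :\ p) (p |: J)).
Proof.
move=> aB ap; rewrite -peel_puncture -peel_Ynz => u hu.
have aT : a \in B :\ p by rewrite !inE ap.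
exact: (@tubePsi_mapto _ _ T p g Y peel_Yp peel_gc (Sub a aT) finset.setT _ u hu).
Qed.

End Peel.

Lemma dsj_peel B J p : dsj B J -> dsj (B :\ p) (p |: J).
Proof.
rewrite -!setI_eq0 => /eqP dj; apply/eqP/finset.setP => x.
have := congr1 (fun S : {set 'I_n} => x \in S) dj; rewrite /= !inE.
by case: (x == p); case: (x \in B); case: (x \in J).
Qed.

Lemma set_max B : B != finset.set0 -> exists2 p, p \in B & forall a, a \in B -> (a <= p)%N.
Proof.
move=> /set0Pn [x xB]; case: (@arg_maxnP _ x (mem B) (fun y : 'I_n => y : nat) xB) => p pB h.
by exists p => // a aB; exact: h.
Qed.

(** Each step peels off the point of largest index; so the point [a] to which it is attached has
    smaller index, which is the source of the condition [f m < m] on forests. *)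
Lemma SP_ind k (Pr : {set 'I_n} -> {set 'I_n} -> cochain k -> Prop) :
  (forall B J, Pr B J 0) -> (forall B J c c', Pr B J c -> Pr B J c' -> Pr B J (c + c')) ->
  (forall B J c c', nul (SP B J) (c - c') -> Pr B J c' -> Pr B J c) ->
  (forall J c, coc (XJ J) c -> Pr finset.set0 J c) ->
  (forall B J p c, p \in B -> dsj B J -> coc (SP (B :\ p) J) c -> Pr (B :\ p) J c -> Pr B J c) ->
  (forall B J p a c, p \in B -> a \in B -> (a < p)%N -> dsj B J ->
     coc (SP (B :\ p) (p |: J)) c -> Pr (B :\ p) (p |: J) c -> Pr B J (pb (psi p a) c)) ->
  forall B J c, dsj B J -> coc (SP B J) c -> Pr B J c.
Proof.
move=> P0 PD Pn Pb Pr1 Pr2 B; have [N] := ubnP #|B|; elim: N B => // N IH B le J c dj hc.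
case: (eqVneq B finset.set0) => [B0|/set_max [p pB pM]].
  by rewrite B0 in hc *; apply: Pb; rewrite -SP_XJ.
have pJ : p \notin J by rewrite (disjointFr dj).
have [c0 h0 [ca h1 h2]] := SP_span pB pJ hc.
have le' : (#|B :\ p| < N)%N by move: le; rewrite (cardsD1 p) pB ltnS.
have dj1 : dsj (B :\ p) J by apply: disjointWl dj; exact: subD1set.
apply: (Pn) h2 _; apply: (PD).
  by apply: (Pr1 _ _ _ _ pB dj h0); exact: IH.
apply: (big_ind (Pr B J)) => [|x y hx hy|a _]; [exact: P0|exact: PD|].
have [aB ap] := peel_valB a.
apply: (Pr2 _ _ _ _ _ pB aB _ dj (h1 a)); first by rewrite ltn_neqAle pM// andbT.
by apply: IH => //; exact: dsj_peel.
Qed.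

(* The top degree of the cohomology of [SP B J]. *)
Definition top B J : nat := ((#|B|.-1 + #|J|) * (d - 1))%N.

Lemma top_psi B J p a : p \in B -> a \in B -> (a < p)%N -> dsj B J ->
  top (B :\ p) (p |: J) = top B J.
Proof.
move=> pB aB ap dj; rewrite /top cardsU1 (disjointFr dj pB) /= (cardsD1 p B) pB.
have aB' : a \in B :\ p by rewrite !inE aB andbT neq_ltn ap.
by rewrite (cardsD1 a (B :\ p)) aB'; congr (_ * _)%N; lia.
Qed.

Lemma top_restr B J p : p \in B -> (1 < #|B|)%N -> (top (B :\ p) J < top B J)%N.
Proof. by move=> pB; rewrite /top (cardsD1 p B) pB; case: #|_| => // m _; rewrite ltn_mul2r /=; lia. Qed.

Lemma hdS k B J (c : cochain k) : dsj B J -> (top B J < k)%N -> coc (SP B J) c -> nul (SP B J) c.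
Proof.
move=> dj kt hc; have := @SP_ind k (fun B J c => (top B J < k)%N -> nul (SP B J) c).
apply; first by move=> *; exact: nul0.
- by move=> {dj kt hc}B {}J {}c c' h h' kt; apply: nulD; [exact: h|exact: h'].
- by move=> {dj kt hc}B {}J {}c c' h h' kt; apply: nul_eq h _; exact: h'.
- move=> {dj kt hc}J {}c hc kt; rewrite SP_XJ; apply: (hdJ d2) => //.
  by move: kt; rewrite /top cards0 add0n.
- move=> {dj kt hc}B {}J p {}c pB dj hc h kt.
  apply: nulW (SP_sub (subD1set B p) (subxx J)) (h _).
  case: (ltnP 1 #|B|) => B1; first exact: ltn_trans (top_restr J pB B1) kt.
  by apply: leq_ltn_trans kt; rewrite /top leq_mul2r leq_add2r (cardsD1 p B) pB /= leq_pred orbT.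
- move=> {dj kt hc}B {}J p a {}c pB aB ap dj hc h kt.
  have pJ : p \notin J by rewrite (disjointFr dj).
  apply: pb_nul (psi_mapto pB pJ aB _) (h _); first by rewrite neq_ltn ap.
  by rewrite (top_psi pB aB ap dj).
- exact: dj.
- exact: hc.
- exact: kt.
Qed.

(* Maps that move only rows outside [B] commute with every [psi p a], so their effect in top degree
   is the one computed on products of spheres. *)
Lemma top_act (phi : Mpt n d -> Mpt n d) (J0 : {set 'I_n}) (s : rat) :
  (forall u, {for u, continuous phi}) ->
  (forall B J, J0 \subset J -> dsj B J -> forall u, SP B J u -> SP B J (phi u)) ->
  (forall p a u, p \notin J0 -> a \notin J0 -> phi (psi p a u) = psi p a (phi u)) ->
  (forall J k (c : cochain k), k = (#|J| * (d - 1))%N -> J0 \subset J -> coc (XJ J) c ->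
     nul (XJ J) (pb phi c - scc s c)) ->
  forall B J k (c : cochain k), k = top B J -> J0 \subset J -> dsj B J -> coc (SP B J) c ->
    nul (SP B J) (pb phi c - scc s c).
Proof.
move=> phic phiS phiP phiX B J k c kE JJ dj hc.
have := @SP_ind k (fun B J c => k = top B J -> J0 \subset J -> dsj B J -> nul (SP B J) (pb phi c - scc s c)).
apply=> //.
- move=> {dj kE JJ hc}B {}J _ _ _; rewrite pb0 (_ : scc s 0 = 0) ?subrr; first exact: nul0.
  by apply: funext => x; rewrite /scc mulr0.
- move=> {dj kE JJ hc}B {}J {}c c' h h' kE JJ dj; rewrite pbD sccDr opprD addrACA.
  by apply: nulD; [exact: h|exact: h'].
- move=> {dj kE JJ hc}B {}J {}c c' h h' kE JJ dj.
  have m : mapto phi (SP B J) (SP B J) by move=> u hu; split; [exact: phiS|exact: phic].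
  have := nulD (nulB (pb_nul m h) (nulZ s h)) (h' kE JJ dj); rewrite pbB sccBr.
  apply: nul_ext => x _.
  change (pb phi c x - pb phi c' x - (scc s c x - scc s c' x) + (pb phi c' x - scc s c' x) = pb phi c x - scc s c x); ring.
- move=> {dj kE JJ hc}J {}c hc kE JJ dj; rewrite SP_XJ; apply: phiX => //.
  by rewrite kE /top cards0 add0n.
- move=> {dj kE JJ hc}B {}J p {}c pB dj hc h kE JJ _.
  have dj1 : dsj (B :\ p) J by apply: disjointWl dj; exact: subD1set.
  apply: nulW (SP_sub (subD1set B p) (subxx J)) _.
  (* If [p] is the only point of [B], the truncated predecessor leaves [top] unchanged; otherwise
     forgetting [p] lowers [top] and the class is null. *)
  case: (ltnP 1 #|B|) => B1; last first.
    by apply: h => //; rewrite kE /top; move: B1; rewrite (cardsD1 p B) pB; case: #|_|.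
  have hn : nul (SP (B :\ p) J) c by apply: hdS => //; rewrite kE; exact: top_restr.
  apply: nulB; last exact: nulZ.
  by apply: pb_nul hn => u hu; split; [exact: phiS|exact: phic].
move=> {dj kE JJ hc}B {}J p a {}c pB aB ap dj hc h kE JJ _.
have pJ : p \notin J by rewrite (disjointFr dj).
have aJ : a \notin J by rewrite (disjointFr dj).
have pJ0 : p \notin J0 by apply: contra pJ; exact: (fintype.subsetP JJ).
have aJ0 : a \notin J0 by apply: contra aJ; exact: (fintype.subsetP JJ).
have dj1 := dsj_peel p dj.
have kE' : k = top (B :\ p) (p |: J) by rewrite (top_psi pB aB ap dj).
have := pb_nul (psi_mapto pB pJ aB _) (h kE' (fintype.subset_trans JJ (finset.subsetUr _ _)) dj1).
rewrite neq_ltn ap => /(_ isT); rewrite pbB pbZ !pb_comp.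
by have -> : phi \o psi p a = psi p a \o phi by apply: funext => u /=; rewrite phiP.
Qed.

Lemma row_ant q t (u : Mpt n d) : row t (ant q u) = if t == q then - row t u else row t u.
Proof. by apply/rowP => j; rewrite !mxE ltn_ord andbT; case: (t == q); rewrite !mxE. Qed.

Lemma row_rsw q r t (u : Mpt n d) : row t (rsw q r u) = row (tperm q r t) u.
Proof. by apply/rowP => j; rewrite !mxE. Qed.

Lemma ant_cont q (u : Mpt n d) : {for u, continuous (ant q)}.
Proof. exact: antl_cont. Qed.

Lemma rsw_cont q r (u : Mpt n d) : {for u, continuous (rsw q r)}.
Proof. by rewrite rsw_swl; exact: swl_cont. Qed.

Lemma row_psi p a t (u : Mpt n d) : row t (psi p a u) = if t == p then row p u - row a u else row t u.
Proof. by case: eqVneq => [->|h]; rewrite ?row_setrow// row_setrowN. Qed.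

Lemma antS B J k (c : cochain k) q : k = top B J -> dsj B J -> q \in J -> coc (SP B J) c ->
  nul (SP B J) (pb (ant q) c - scc ((-1) ^+ d) c).
Proof.
move=> kE dj qJ; apply: (@top_act (ant q) [set q]) => //.
- by move=> u; exact: ant_cont.
- move=> B' J'; rewrite finset.sub1set => qJ' dj' u [h1 h2].
  have qB : forall t, t \in B' -> t != q by move=> t; apply: contraTneq => ->; rewrite (disjointFl dj').
  split=> [a b aB bB ab|t tJ]; first by rewrite !row_ant !(negbTE (qB _ _))//; exact: h1.
  by rewrite row_ant; case: (t == q); rewrite ?oppr_eq0; exact: h2.
- move=> p a u; rewrite !inE => pq aq; apply: row_ext => t.
  rewrite row_psi !row_ant row_psi (negbTE pq) (negbTE aq).
  by case: (eqVneq t p) => [->|//]; rewrite (negbTE pq).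
- move=> J' k' c' k'E; rewrite finset.sub1set => qJ' hc'; exact: (antJ d2).
- by rewrite finset.sub1set.
Qed.

Lemma swapS B J k (c : cochain k) q r : k = top B J -> dsj B J -> q \in J -> r \in J -> q != r ->
  coc (SP B J) c -> nul (SP B J) (pb (rsw q r) c + scc ((-1) ^+ d) c).
Proof.
move=> kE dj qJ rJ qr hc.
suff : nul (SP B J) (pb (rsw q r) c - scc (- (-1) ^+ d) c).
  apply: nul_ext => x _; change (pb (rsw q r) c x - (- (-1) ^+ d) * c x = pb (rsw q r) c x + (-1) ^+ d * c x).
  by rewrite mulNr opprK.
move: hc; apply: (@top_act (rsw q r) [set q; r]) => //.
- by move=> u; exact: rsw_cont.
- move=> B' J'; rewrite finset.subUset !finset.sub1set => /andP[qJ' rJ'] dj' u [h1 h2].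
  have tB t : t \in B' -> tperm q r t = t.
    move=> tB; rewrite tpermD//.
      by apply: contraTneq tB => <-; rewrite (disjointFl dj').
    by apply: contraTneq tB => <-; rewrite (disjointFl dj').
  split=> [a b aB bB ab|t tJ]; first by rewrite !row_rsw !tB//; exact: h1.
  by rewrite row_rsw; case: tpermP => [_|_|_ _]; exact: h2.
- move=> p a u; rewrite !inE !negb_or => /andP[pq pr] /andP[aq ar]; apply: row_ext => t.
  have pE : tperm q r p = p by rewrite tpermD 1?eq_sym.
  have aE : tperm q r a = a by rewrite tpermD 1?eq_sym.
  rewrite row_psi !row_rsw row_psi pE aE.
  by rewrite -{1}pE (inj_eq perm_inj).
- move=> J' k' c' k'E; rewrite finset.subUset !finset.sub1set => /andP[qJ' rJ'] hc'.
  have := swapJ d2 k'E hc' qJ' rJ' qr; apply: nul_ext => x _.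
  change (pb (rsw q r) c' x + (-1) ^+ d * c' x = pb (rsw q r) c' x - (- (-1) ^+ d) * c' x).
  by rewrite mulNr opprK.
- by rewrite finset.subUset !finset.sub1set qJ.
Qed.

End Configurations.

(** * Invariant top classes for odd [d] *)

Section TopInvariants.
Variables (n d : nat).
Hypothesis d2 : (2 <= d)%N.
Notation cochain := (cochain n d).
Implicit Types (B J : {set 'I_n}) (p q a : 'I_n).

Lemma row_seg t (u v : Mpt n d) (s : RR) :
  row t ((1 - s) *: u + s *: v) = (1 - s) *: row t u + s *: row t v.
Proof. by apply/rowP => j; rewrite !mxE. Qed.

(** The points of the cluster stay within distance [e] of the old place of [q], while every other
    point of [B] keeps its place at distance at least [e]; so only collisions inside the cluster
    have to be excluded. *)
Lemma cluster_SP (B0 B J : {set 'I_n}) q e (u v : Mpt n d) :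
  (forall b, b \in B0 -> b != q -> e <= nrm (row q u - row b u)) ->
  (forall a b, a \in B0 -> b \in B0 -> a != b -> row a u != row b u) ->
  (forall b, b \in B0 -> b != q -> row b v = row b u) ->
  (forall b, b \in B -> (b \notin B0) || (b == q) -> nrm (row b v - row q u) < e) ->
  (forall b b', b \in B -> b' \in B -> (b \notin B0) || (b == q) -> (b' \notin B0) || (b' == q) -> b != b' ->
     row b v != row b' v) ->
  (forall t, t \in J -> row t v != 0) -> SP B J v.
Proof.
move=> he hu hv hn hd hJ; split=> // a b aB bB ab.
have far x y : x \in B -> (x \notin B0) || (x == q) -> y \in B0 -> y != q -> row x v != row y v.
  move=> xB nx yB yq; apply/eqP => E; have := hn x xB nx; rewrite E hv// -nrmN opprB.
  by rewrite ltNge he.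
case: (boolP ((a \notin B0) || (a == q))) => na; case: (boolP ((b \notin B0) || (b == q))) => nb.
- exact: hd.
- by move: nb; rewrite negb_or negbK => /andP[]; exact: far.
- by move: na; rewrite negb_or negbK => /andP[x y]; rewrite eq_sym; exact: far.
- move: na nb; rewrite !negb_or !negbK => /andP[aB0 aq] /andP[bB0 bq]; rewrite !hv//; exact: hu.
Qed.

Lemma nrm_conv (x y : 'rV[RR]_d) (t e : RR) : 0 <= t <= 1 -> nrm x < e -> nrm y < e ->
  nrm ((1 - t) *: x + t *: y) < e.
Proof.
move=> t01 hx hy; apply: le_lt_trans (nrm_triangle _ _) _.
have /andP[t0 t1] := t01; rewrite !nrmZ !ger0_norm ?subr_ge0//.
by have := @seg_pos (e - nrm x) (e - nrm y) t t01; rewrite !subr_gt0 => /(_ hx hy); lra.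
Qed.

Section Odd.
Variables (B J : {set 'I_n}) (p : 'I_n).
Hypothesis pB : p \in B.
Hypothesis dj : dsj B J.

(** Near [a], exchanging [p] and [a] reverses the vector from [a] to [p]. Along the straight
    homotopy their difference remains a negative multiple of [row p u]. *)
Lemma resR_ant (a : {a : 'I_n | a \in B :\ p}) k (c : cochain k) : coc (SP B J) c ->
  nul (SP (B :\ p) (p |: J)) (pb (resR a) (pb (rsw p (sval a)) c) - pb (ant p) (pb (resR a) c)).
Proof.
move=> hc; rewrite !pb_comp; have pJ : p \notin J by rewrite (disjointFr dj).
have [aB ap] := peel_valB a; have aJ : sval a \notin J by rewrite (disjointFr dj).
have antX (u : Mpt n d) : SP (B :\ p) (p |: J) u -> SP (B :\ p) (p |: J) (ant p u).
  move=> [h1 h2]; split=> [x y|t tJ].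
    rewrite !inE => /andP[xp xB] /andP[yp yB] xy; rewrite !row_ant (negbTE xp) (negbTE yp).
    by apply: h1; rewrite ?inE ?xp ?yp.
  by rewrite row_ant; case: (t == p); rewrite ?oppr_eq0; exact: h2.
apply: (homotopy (Y := SP B J) _ _ _ hc).
- move=> u hu; apply: continuous_comp; first exact: ant_cont.
  by have [_] := resR_mapto pB pJ a (antX _ hu).
- move=> u hu; apply: continuous_comp; last exact: rsw_cont.
  by have [_] := resR_mapto pB pJ a hu.
move=> u t hu /andP[t0 t1] /=.
have [r [e [r0 /andP[e0 _] hr he ->]]] := resR_spec a hu.
have [r' [e' [r0' /andP[e0' _] hr' he' ->]]] := resR_spec a (antX _ hu).
move: hr'; rewrite !row_ant eqxx (negbTE ap) scalerN nrmN => hr'.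
have up : row p u != 0 by case: hu => _; apply; rewrite !inE eqxx.
set v := _ + _.
have vp : row p v = row (sval a) u - ((1 - t) * r') *: row p u.
  rewrite /v row_seg row_setrow row_rsw tpermL row_setrowN//.
  by apply/rowP => j; rewrite !mxE; ring.
have va : row (sval a) v = row (sval a) u + (t * r) *: row p u.
  rewrite /v row_seg row_setrowN// row_ant (negbTE ap) row_rsw tpermR row_setrow.
  by apply/rowP => j; rewrite !mxE; ring.
have vb b : b != p -> b != sval a -> row b v = row b u.
  move=> bp ba; rewrite /v row_seg row_setrowN// row_ant (negbTE bp) row_rsw tpermD 1?eq_sym//.
  by rewrite row_setrowN//; apply/rowP => j; rewrite !mxE; ring.
have hm : forall x : 'rV[RR]_d, nrm x <= e / 2 \/ nrm x <= e' / 2 -> forall s : RR, 0 <= s <= 1 -> nrm (s *: x) < Num.max e e'.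
  move=> x hx s /andP[s0 s1]; rewrite nrmZ ger0_norm//.
  apply: (@le_lt_trans _ _ (nrm x)); first by rewrite ler_piMl// nrm_ge0.
  by rewrite lt_max; case: hx => hx; apply/orP; [left|right]; lra.
case: (hu) => h1 h2.
apply: (@cluster_SP (B :\ p) B J (sval a) (Num.max e e') u).
- move=> b bB ba; rewrite ge_max he//=; have := he' b bB ba; rewrite !row_ant (negbTE ap).
  by have /negbTE -> : b != p by move: bB; rewrite !inE => /andP[].
- exact: h1.
- by move=> b; rewrite !inE => /andP[bp bB] ba; exact: vb.
- move=> b bB; rewrite !inE bB andbT negbK => /orP[]/eqP ->.
    rewrite vp addrC addKr nrmN -scalerA; apply: hm; first by right.
    by rewrite subr_ge0 t1 lerBlDr lerDl.
  rewrite va addrC addKr -scalerA; apply: hm; first by left.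
  by rewrite t0.
- have ne : row p v != row (sval a) v.
    rewrite vp va -subr_eq0 opprD addrACA subrr add0r -opprD oppr_eq0 -scalerDl scaler_eq0 negb_or up andbT.
    by rewrite gt_eqF//; nra.
  move=> b b' bB bB'; rewrite !inE bB bB' !andbT !negbK => /orP[]/eqP -> /orP[]/eqP ->; rewrite ?eqxx// => _.
  by rewrite eq_sym.
- move=> x xJ; rewrite vb; first by apply: h2; rewrite !inE xJ orbT.
    by apply: contraNneq pJ => <-.
  by apply: contraNneq aJ => <-.
Qed.

End Odd.

(* Restricted to the sphere of [p] around [a], the antipode acts as the exchange of [p] and [a], whereas
   it acts on the top class by [(-1)^d]. *)
Lemma inv_odd B J k (c : cochain k) : odd d -> (1 < #|B|)%N -> dsj B J -> k = top d B J -> coc (SP B J) c ->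
  (forall p q, p \in B -> q \in B -> nul (SP B J) (pb (rsw p q) c - c)) -> nul (SP B J) c.
Proof.
move=> od B1 dj kE hc hi.
have [|p pB _] := set_max (B := B); first by rewrite -card_gt0 (ltn_trans _ B1).
have pJ : p \notin J by rewrite (disjointFr dj).
have [|c0 h0 h] := SP_peel pB pJ hc; last first.
- apply: nul_eq h _; apply: nulW (SP_sub (subD1set B p) (subxx J)) _.
  apply: (hdS d2) => //; first by apply: disjointWl dj; exact: subD1set.
  by rewrite kE; exact: top_restr.
- move=> a; have [aB ap] := peel_valB a.
  set z := pb (resR a) c.
  have mR := @resR_mapto n d B J p pB pJ a.
  have hz : coc (SP (B :\ p) (p |: J)) z by exact: pb_coc mR hc.
  have h1 := pb_nul mR (hi p (sval a) pB aB).
  have h2 := resR_ant pB dj a hc.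
  have kE' : k = top d (B :\ p) (p |: J).
    rewrite kE /top cardsU1 pJ (cardsD1 p B) pB (cardsD1 (sval a) (B :\ p)) !inE aB ap /=.
    by congr (_ * _)%N; lia.
  have h3 := antS d2 kE' (dsj_peel p dj) (setU11 _ _) hz.
  rewrite pbB -/z in h1 h2.
  (* Invariance makes the antipode fix the residue [z], whereas for odd [d] it negates it. *)
  have h4 := nulB h2 (nulB h1 h3).
  apply: nul_opp; apply: nul_ext h4 => s _.
  change (pb (resR a) (pb (rsw p (sval a)) c) s - pb (ant p) z s -
    (pb (resR a) (pb (rsw p (sval a)) c) s - z s - (pb (ant p) z s - (-1) ^+ d * z s)) = z s + z s).
  by rewrite -signr_odd od expr1; ring.
Qed.

End TopInvariants.

(** * Three nearby points, for even [d] *)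

Section ThreeCluster.
Variables (n d : nat).
Hypothesis d2 : (2 <= d)%N.
Notation cochain := (cochain n d).
Variables (B0 J : {set 'I_n}) (p a : 'I_n).
Hypothesis pB0 : p \notin B0.
Hypothesis aB0 : a \notin B0.
Hypothesis pJ : p \notin J.
Hypothesis pa : p != a.
Hypothesis dj : dsj B0 J.

Let ap : a != p. Proof. by rewrite eq_sym. Qed.
Let Jpa := p |: (a |: J).
Let g (b : bool) (u : Mpt n d) : 'rV[RR]_d := if b then row a u else 0.
Let Y := @SP n d B0 (a |: J).

(* The positions of two points of a cluster of three, relative to the third. *)
Definition clust : set (Mpt n d) := fun u => SP B0 Jpa u /\ row p u != row a u.

Let Yp v u : Y u -> Y (setrow p v u).
Proof.
move=> [h1 h2]; split=> [x y xB yB xy|t].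
  by rewrite !row_setrowN; [exact: h1|apply: contraNneq pB0 => <-|apply: contraNneq pB0 => <-].
by rewrite !inE => tJ; rewrite row_setrowN ?h2 ?inE//; case/orP: tJ => [/eqP -> //|]; apply: contraTneq => ->.
Qed.

Let gp b v u : g b (setrow p v u) = g b u.
Proof. by rewrite /g; case: b => //; rewrite row_setrowN. Qed.

Let gc b u j : cnt (fun v : Mpt n d => g b v 0 j) u.
Proof. by case: b; [exact: row_cnt|rewrite /g; exact: cnt_cst]. Qed.

Let gD u (b b' : bool) : Y u -> b != b' -> g b u != g b' u.
Proof.
move=> [_ h]; have ha : row a u != 0 by apply: h; rewrite !inE eqxx.
by case: b; case: b' => // _; rewrite /g // eq_sym.
Qed.

Let E1 : puncture p g Y finset.setT = clust.
Proof.
apply/seteqP; split=> u.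
  move=> [[h1 h2] h3]; have h4 := h3 true (finset.in_setT _); have h5 := h3 false (finset.in_setT _).
  by split=> //; split=> // t; rewrite finset.in_setU1 => /orP[/eqP -> //|]; exact: h2.
move=> [[h1 h2] h3]; split; first by split=> // t; rewrite !inE => tJ; apply: h2; rewrite !inE tJ orbT.
by case=> _; [exact: h3|apply: h2; rewrite !inE eqxx].
Qed.

Let E2 : Ynz p Y = SP B0 Jpa.
Proof.
apply/seteqP; split=> u.
  move=> [[h1 h2] h3]; split=> // t; rewrite finset.in_setU1 => /orP[/eqP -> //|]; exact: h2.
move=> [h1 h2]; split; last by apply: h2; rewrite !inE eqxx.
by split=> // t; rewrite !inE => tJ; apply: h2; rewrite !inE tJ orbT.
Qed.

Let djpa : dsj B0 Jpa.
Proof.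
rewrite -setI_eq0; apply/eqP/finset.setP => x; rewrite !inE.
case: (boolP (x \in B0)) => //= xB.
rewrite (disjointFr dj xB) orbF; apply/negbTE; rewrite negb_or.
by apply/andP; split; apply: contraTneq xB => ->.
Qed.

(** Exchange of [p] with the third point of the cluster, which sits at the origin: after moving the
    origin to [p], the two positions are [-p] and [a - p]. *)
Definition pqswap (u : Mpt n d) : Mpt n d :=
  setrow p (- row p u) (setrow a (row a u - row p u) u).

Lemma row_pqswap t (u : Mpt n d) : row t (pqswap u) =
  if t == p then - row p u else if t == a then row a u - row p u else row t u.
Proof.
rewrite /pqswap; case: (eqVneq t p) => [->|tp]; first by rewrite row_setrow.
by rewrite row_setrowN//; case: (eqVneq t a) => [->|ta]; rewrite ?row_setrow// row_setrowN.
Qed.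

Lemma row_rswpa t (u : Mpt n d) : row t (rsw p a u) =
  if t == p then row a u else if t == a then row p u else row t u.
Proof. by rewrite row_rsw; case: tpermP => [->|->|/eqP/negbTE -> /eqP/negbTE -> //]; rewrite ?eqxx// (negbTE ap). Qed.

Let clust_same (u v : Mpt n d) : clust u -> row p v != 0 -> row a v != 0 -> row p v != row a v ->
  (forall t, t != p -> t != a -> row t v = row t u) -> clust v.
Proof.
move=> [[h1 h2] _] vp va vpa vt; split=> //; split=> [x y xB yB xy|t].
  by rewrite !vt; [exact: h1|apply: contraTneq yB => ->|apply: contraTneq yB => ->|
    apply: contraTneq xB => ->|apply: contraTneq xB => ->].
rewrite !inE; case: (eqVneq t p) => [-> //|tp]; case: (eqVneq t a) => [-> //|ta] /= tJ.
by rewrite vt//; apply: h2; rewrite !inE tJ !orbT.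
Qed.

Let clust_nz (u : Mpt n d) : clust u -> [/\ row p u != 0, row a u != 0 & row p u != row a u].
Proof. by move=> [[_ h] h']; split=> //; apply: h; rewrite !inE eqxx ?orbT. Qed.

Lemma rsw_clust : mapto (@rsw n d p a) clust clust.
Proof.
move=> u hu; split; last exact: rsw_cont.
have [h1 h2 h3] := clust_nz hu; apply: (clust_same hu); rewrite ?row_rswpa ?eqxx ?(negbTE ap) ?eqxx//.
  by rewrite eq_sym.
by move=> t /negbTE tp /negbTE ta; rewrite row_rswpa tp ta.
Qed.

Lemma pqswap_clust : mapto pqswap clust clust.
Proof.
move=> u hu; split.
  have [h1 h2 h3] := clust_nz hu; apply: (clust_same hu); rewrite ?row_pqswap ?eqxx ?(negbTE ap) ?eqxx ?oppr_eq0//.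
  - by rewrite subr_eq0 eq_sym.
  - by rewrite eq_sym -subr_eq0 opprK subrK.
  - by move=> t /negbTE tp /negbTE ta; rewrite row_pqswap tp ta.
apply: mx_cont => i j.
rewrite (_ : (fun y => _) = fun y : Mpt n d => if i == p then - y p j else if i == a then y a j - y p j else y i j).
  case: (i == p); first by apply: cntN; exact: cnt_coord.
  by case: (i == a); [apply: cntB|]; exact: cnt_coord.
by apply: funext => v; rewrite !mxE; case: (i == p); case: (i == a).
Qed.

(** Write [x = al + be], with [al] from the vectors [(p, a)] and [be] from [(p - a, a)], and let
    [S], [T] be the two transpositions. For even [d], [S al = -al] and [T be = -be], hence
    [S be = x + al] and [T al = x + be]. Then [S T S al = -(2 x + al)] and [T S T al = 3 x + be],
    and the braid relation gives [6 x = 0]. *)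
Lemma clust_top k (x : cochain k) : ~~ odd d -> k = top d B0 Jpa -> coc clust x ->
  nul clust (pb (rsw p a) x - x) -> nul clust (pb pqswap x - x) -> nul clust x.
Proof.
move=> ed kE hx hs ht.
have d1 : (-1) ^+ d = 1 :> rat by rewrite -signr_odd (negbTE ed).
rewrite -E1 in hx.
have [x0 h0 [ca hca hn]] := puncture_span Yp gp gc gD hx.
rewrite E2 in hca; rewrite E1 in hn hx.
(* This part forgets [p], so it lives on a space with one sphere fewer. *)
have n0 : nul clust x0.
  apply: (@nulW _ _ _ Y).
    by move=> u [h _]; apply: SP_sub h; [|exact: finset.subsetUr].
  apply: (hdS d2) h0.
    by move: djpa; rewrite ![fintype.disjoint (mem B0) _]disjoint_sym; apply: disjointWl; exact: finset.subsetUr.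
  rewrite kE /top /Jpa [#|p |: _|]cardsU1 finset.in_setU1 (negbTE pa) (negbTE pJ) /= add1n addnS mulSn.
  by rewrite -[X in (X < _)%N]add0n ltn_add2r; move: d2; clear; lia.
pose al := pb (tubePsi p g false) (ca false); pose be := pb (tubePsi p g true) (ca true).
have cS : clust `<=` SP B0 Jpa by move=> u [].
have inT b : b \in [set: bool]%SET by rewrite inE.
have mpsi b : mapto (tubePsi p g b) clust (SP B0 Jpa).
  by rewrite -E1 -E2; exact: tubePsi_mapto.
have xab : nul clust (x - (al + be)).
  have := nulD hn n0; apply: nul_ext => s _.
  rewrite (eq_bigl xpredT) => [|b]; last by rewrite inE.
  rewrite big_bool /=; change (x s - (x0 s + (be s + al s)) + x0 s = x s - (al s + be s)); ring.
have pS : p \in Jpa by rewrite !inE eqxx.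
have aS : a \in Jpa by rewrite !inE eqxx orbT.
have sw b := swapS d2 kE djpa pS aS pa (hca b).
have an b t tS := antS d2 kE djpa (q := t) tS (hca b).
have sal : nul clust (pb (rsw p a) al + al).
  have id0 : tubePsi p g false = id.
    by apply: funext => u; rewrite /tubePsi /g subr0 setrow_id.
  have := nulW cS (sw false); rewrite d1 scc1; apply: nul_ext => s hsi.
  rewrite /al id0; change (pb (rsw p a) (ca false) s + ca false s = pb (rsw p a) (pb id (ca false)) s + pb id (ca false) s).
  by rewrite pb_comp (pb_id (ca false) hsi).
have tbe : nul clust (pb pqswap be + be).
  have h1 := sw true; have h2 := an true _ pS; have h3 := an true _ aS.
  rewrite d1 !scc1 in h1 h2 h3.
  have ma t : t \in Jpa -> mapto (@ant n d t) (SP B0 Jpa) (SP B0 Jpa).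
    move=> tJ u [k1 k2]; split; last exact: ant_cont.
    split=> [y z yB zB yz|y yJ]; rewrite !row_ant; last by case: (y == t); rewrite ?oppr_eq0; exact: k2.
    have ne w : w \in B0 -> (w == t) = false by move=> wB; apply/eqP => wt; rewrite -wt (disjointFr djpa) in tJ.
    by rewrite !ne//; exact: k1.
  have ms : mapto (@rsw n d p a) (SP B0 Jpa) (SP B0 Jpa).
    move=> u [k1 k2]; split; last exact: rsw_cont.
    split=> [y z yB zB yz|y yJ]; rewrite !row_rswpa; last first.
      by case: (y == p); [exact: k2|case: (y == a); exact: k2].
    have ne w t : w \in B0 -> t \in Jpa -> (w == t) = false.
      by move=> wB tJ; apply/eqP => wt; rewrite -wt (disjointFr djpa) in tJ.
    by rewrite !(ne _ _ yB)// !(ne _ _ zB)//; exact: k1.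
  have h4 := pb_nul ms (pb_nul (ma _ aS) h2).
  have h5 := pb_nul ms h3.
  have := pb_nul (mpsi true) (nulD (nulD h4 h5) h1).
  (* In the coordinates [(p - a, a)] the map becomes [(-a, a - p)]: an exchange combined with two
     antipodes, which act trivially for even [d]. *)
  have E : pb pqswap be = pb (tubePsi p g true) (pb (rsw p a) (pb (ant a) (pb (ant p) (ca true)))).
    rewrite /be !pb_comp; apply: (congr1 (fun f => pb f (ca true))); apply: funext => u; apply: row_ext => t.
    rewrite /= /tubePsi /g row_ant row_ant row_rswpa.
    case: (eqVneq t p) => [->|tp].
      by rewrite row_setrow !row_pqswap eqxx (negbTE ap) (negbTE pa) eqxx row_setrowN// opprB addKr.
    rewrite row_setrowN// row_pqswap (negbTE tp); case: (eqVneq t a) => [_|ta].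
      by rewrite row_setrow opprB.
    by rewrite row_setrowN.
  rewrite E /be; apply: nul_ext => s _.
  pose P := pb (tubePsi p g true) (k := k); pose R := pb (@rsw n d p a) (k := k).
  pose X := P (R (pb (ant a) (pb (ant p) (ca true)))) s; pose X1 := P (R (pb (ant a) (ca true))) s.
  pose X2 := P (R (ca true)) s; pose X3 := P (ca true) s.
  change (X - X1 + (X1 - X2) + (X2 + X3) = X + X3); ring.
have braid : (@rsw n d p a \o (pqswap \o @rsw n d p a)) = pqswap \o (@rsw n d p a \o pqswap).
  apply: funext => u; apply: row_ext => t.
  have apF := negbTE ap; have paF := negbTE pa.
  rewrite /= !(row_rswpa, row_pqswap, eqxx, apF, paF).
  by case: (t == p); case: (t == a) => //; rewrite ?opprB ?addKr.
pose S (c : cochain k) := pb (@rsw n d p a) c; pose T (c : cochain k) := pb pqswap c.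
have nS c : nul clust c -> nul clust (S c) by move=> h; apply: pb_nul h; exact: rsw_clust.
have nT c : nul clust c -> nul clust (T c) by move=> h; apply: pb_nul h; exact: pqswap_clust.
have sbe : nul clust (S be - (x + al)).
  have := nulB (nulD hs (nulN (nS _ xab))) sal; apply: nul_ext => s _.
  change (S x s - x s + - (S x s - (S al s + S be s)) - (S al s + al s) = S be s - (x s + al s)); ring.
have tal : nul clust (T al - (x + be)).
  have := nulB (nulD ht (nulN (nT _ xab))) tbe; apply: nul_ext => s _.
  change (T x s - x s + - (T x s - (T al s + T be s)) - (T be s + be s) = T al s - (x s + be s)); ring.
have sts : nul clust (S (T (S al)) + (x + x + al)).
  have := nulD (nS _ (nT _ sal)) (nulN (nulD (nS _ tal) (nulD hs sbe))); apply: nul_ext => s _.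
  change (S (T (S al)) s + S (T al) s + - (S (T al) s - (S x s + S be s) + (S x s - x s + (S be s - (x s + al s)))) =
    S (T (S al)) s + (x s + x s + al s)); ring.
have tst : nul clust (T (S (T al)) - (x + x + x + be)).
  have := nulD (nulD (nT _ (nS _ tal)) (nT _ hs)) (nulD (nT _ sbe) (nulD ht (nulD ht tal))); apply: nul_ext => s _.
  change (T (S (T al)) s - (T (S x) s + T (S be) s) + (T (S x) s - T x s) +
    (T (S be) s - (T x s + T al s) + (T x s - x s + (T x s - x s + (T al s - (x s + be s))))) =
    T (S (T al)) s - (x s + x s + x s + be s)); ring.
have e : S (T (S al)) = T (S (T al)) by rewrite /S /T !pb_comp braid.
rewrite e in sts.
apply: (@nulZI _ _ _ _ 6) => //.
have := nulD (nulB sts tst) xab; apply: nul_ext => s _.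
change (T (S (T al)) s + (x s + x s + al s) - (T (S (T al)) s - (x s + x s + x s + be s)) +
  (x s - (al s + be s)) = 6 * x s); ring.
Qed.

Definition clustR : Mpt n d -> Mpt n d := tubeR p g true.

Lemma clustR_mapto : mapto clustR (SP B0 Jpa) clust.
Proof.
rewrite -E1 -E2 => u hu.
by have [[h _] ?] := @tubeR_mapto _ _ _ p g Y Yp gp gc gD true finset.setT u hu.
Qed.

Lemma clustR_spec u : SP B0 Jpa u -> exists r, [/\ 0 < r, nrm (r *: row p u) < nrm (row a u) &
  clustR u = setrow p (row a u + r *: row p u) u].
Proof.
rewrite -E2 => -[Yu _]; exists (tube_radius p g true u); split=> //.
  exact: (tube_radius_gt0 p gD true Yu).
apply: lt_le_trans (tube_radius_lt p gD true Yu) _.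
by have := @eps_le _ _ _ g true false u isT; rewrite /g subr0.
Qed.

End ThreeCluster.

(** * Inserting a cluster of three at a point *)

Section EvenInvariants.
Variables (n d : nat).
Hypothesis d2 : (2 <= d)%N.
Notation cochain := (cochain n d).
Variables (B0 J : {set 'I_n}) (p a q : 'I_n).
Hypothesis pB0 : p \notin B0.
Hypothesis aB0 : a \notin B0.
Hypothesis pa : p != a.
Hypothesis qB0 : q \in B0.
Let B := p |: (a |: B0).
Hypothesis dj : dsj B J.

Let pq : p != q. Proof. by apply: contraNneq pB0 => ->. Qed.
Let aq : a != q. Proof. by apply: contraNneq aB0 => ->. Qed.
Let ap : a != p. Proof. by rewrite eq_sym. Qed.
Let Jpa := p |: (a |: J).
Let pB : p \in B. Proof. by rewrite !inE eqxx. Qed.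
Let aB : a \in B. Proof. by rewrite !inE eqxx orbT. Qed.
Let qB : q \in B. Proof. by rewrite !inE qB0 !orbT. Qed.
Let pJ : p \notin J. Proof. by rewrite (disjointFr dj). Qed.
Let aJ : a \notin J. Proof. by rewrite (disjointFr dj). Qed.
Let qJ : q \notin J. Proof. by rewrite (disjointFr dj). Qed.
Let dj0 : dsj B0 J.
Proof. by apply: disjointWl dj; rewrite /B; apply/fintype.subsetP => x; rewrite !inE => ->; rewrite !orbT. Qed.

Definition gapq (u : Mpt n d) : RR :=
  \big[Num.min/1]_(b | (b \in B0) && (b != q)) nrm (row q u - row b u).

Lemma gapq_gt0 J' u : SP B0 J' u -> 0 < gapq u.
Proof.
move=> [h _]; rewrite /gapq; elim/big_ind: _ => // [x y x0 y0|b /andP[bB bq]].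
  by rewrite lt_min x0.
by rewrite nrm_gt0 subr_eq0 h// eq_sym.
Qed.

Lemma gapq_le b u : b \in B0 -> b != q -> gapq u <= nrm (row q u - row b u).
Proof. by move=> bB bq; rewrite /gapq (bigD1 b) ?bB//= ge_min lexx. Qed.

Lemma gapq_ext u v : (forall b, b \in B0 -> row b u = row b v) -> gapq u = gapq v.
Proof. by move=> h; apply: eq_bigr => b /andP[bB _]; rewrite !h. Qed.

(** Shrinks the cluster into half the gap around [q]. The denominator is symmetric in [p] and [a],
    so [clustQ] commutes strictly with their exchange. *)
Definition scaleq (u : Mpt n d) : RR := gapq u / 2 / (1 + (nrm (row p u) + nrm (row a u))).

Lemma scaleq_gt0 J' u : SP B0 J' u -> 0 < scaleq u.
Proof.
by move=> /gapq_gt0 h; rewrite /scaleq !divr_gt0// ltr_pwDl// addr_ge0 ?nrm_ge0.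
Qed.

Lemma scaleq_le J' u x : SP B0 J' u -> x = p \/ x = a -> nrm (scaleq u *: row x u) <= gapq u / 2.
Proof.
move=> hu hx; rewrite nrmZ gtr0_norm ?(scaleq_gt0 hu)// /scaleq.
have h1 := gapq_gt0 hu; have h2 := nrm_ge0 (row p u); have h3 := nrm_ge0 (row a u).
have h4 : 0 < 1 + (nrm (row p u) + nrm (row a u)) by rewrite ltr_pwDl// addr_ge0.
rewrite mulrAC ler_pdivrMr//; apply: ler_wpM2l; first by rewrite divr_ge0 ?ltW.
by case: hx => ->; lra.
Qed.

Definition clustQ (u : Mpt n d) : Mpt n d :=
  setrow p (row q u + scaleq u *: row p u) (setrow a (row q u + scaleq u *: row a u) u).

Lemma row_clustQ t u : row t (clustQ u) =
  if (t == p) || (t == a) then row q u + scaleq u *: row t u else row t u.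
Proof.
rewrite /clustQ; case: (eqVneq t p) => [->|tp]; first by rewrite row_setrow.
by rewrite row_setrowN//; case: (eqVneq t a) => [->|ta]; rewrite ?row_setrow// row_setrowN.
Qed.

Lemma scaleq_cnt u : cnt scaleq u.
Proof.
have x0 : 1 + (nrm (row p u) + nrm (row a u)) != 0.
  by rewrite gt_eqF// ltr_pwDl// addr_ge0 ?nrm_ge0.
apply: cntM.
  apply: cntM; last exact: cnt_cst.
  apply: cnt_bigmin => b _; apply: nrm_cnt => j.
  rewrite (_ : (fun y => _) = fun v : Mpt n d => row q v 0 j - row b v 0 j).
    by apply: cntB; exact: row_cnt.
  by apply: funext => v; rewrite !mxE.
apply: cntV => //; apply: cntD; first exact: cnt_cst.
by apply: cntD; apply: nrm_cnt => j; exact: row_cnt.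
Qed.

Lemma clustQ_cont u : {for u, continuous clustQ}.
Proof.
apply: mx_cont => i j.
rewrite (_ : (fun y => _) = fun v : Mpt n d =>
  if (i == p) || (i == a) then v q j + scaleq v * v i j else v i j); last first.
  by apply: funext => v; have := congr1 (fun r : 'rV[RR]_d => r 0 j) (row_clustQ i v); rewrite mxE => ->; case: ifP; rewrite !mxE.
case: (_ || _); last exact: cnt_coord.
by apply: cntD; [exact: cnt_coord|apply: cntM; [exact: scaleq_cnt|exact: cnt_coord]].
Qed.

Lemma tri_SP J' e (u v : Mpt n d) : SP B0 J' u -> J \subset J' ->
  (forall b, b \in B0 -> b != q -> e <= nrm (row q u - row b u)) ->
  (forall b, b != p -> b != a -> b != q -> row b v = row b u) ->
  (forall b, b = p \/ b = a \/ b = q -> nrm (row b v - row q u) < e) ->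
  row p v != row a v -> row p v != row q v -> row a v != row q v -> SP B J v.
Proof.
move=> [h1 h2] /fintype.subsetP JJ he hv hn vpa vpq vaq.
have near b : b \in B -> (b \notin B0) || (b == q) -> b = p \/ b = a \/ b = q.
  rewrite !inE => /orP[/eqP ->|/orP[/eqP ->|->]]; [by left|by right; left|].
  by move=> /eqP ->; right; right.
apply: (@cluster_SP _ _ B0 B J q e u) => //.
- by move=> b bB bq; apply: hv => //; [apply: contraTneq bB => ->|apply: contraTneq bB => ->].
- by move=> b bB /(near b bB); exact: hn.
- move=> b b' bB bB' /(near b bB) hb /(near b' bB') hb'.
  case: hb => [->|[->|->]]; case: hb' => [->|[->|->]]; rewrite ?eqxx// => _; by rewrite eq_sym.
move=> t tJ; rewrite hv; first exact: h2 (JJ t tJ).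
- by apply: contraNneq pJ => <-.
- by apply: contraNneq aJ => <-.
- by apply: contraNneq qJ => <-.
Qed.

Let JJpa : J \subset Jpa.
Proof. by apply/fintype.subsetP => x xJ; rewrite !inE xJ !orbT. Qed.

Let clust_nz (u : Mpt n d) : clust B0 J p a u -> [/\ row p u != 0, row a u != 0 & row p u != row a u].
Proof. by move=> [[_ h] h']; split=> //; apply: h; rewrite !inE eqxx ?orbT. Qed.

Lemma scl_neq (x y v : 'rV[RR]_d) r : r != 0 -> v != 0 -> x - y = r *: v -> x != y.
Proof. by move=> r0 v0 e; rewrite -subr_eq0 e scaler_eq0 negb_or r0. Qed.

Let halfgt (x y : RR) : x <= y / 2 -> 0 < y -> x < y. Proof. by move=> *; lra. Qed.

Lemma clustQ_mapto : mapto clustQ (clust B0 J p a) (SP B J).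
Proof.
move=> u hu; split; last exact: clustQ_cont.
have [u1 u2 u3] := clust_nz hu; have [uS _] := hu.
have s0 := scaleq_gt0 uS; have s1 : scaleq u != 0 by rewrite gt_eqF.
have e0 := gapq_gt0 uS.
have qF : (q == p) = false by rewrite eq_sym (negbTE pq).
have qF' : (q == a) = false by rewrite eq_sym (negbTE aq).
apply: (tri_SP uS JJpa (e := gapq u)); rewrite ?row_clustQ ?eqxx ?orbT ?qF ?qF' /=.
- by move=> b; exact: gapq_le.
- by move=> b /negbTE bp /negbTE ba _; rewrite row_clustQ bp ba.
- move=> b hb; rewrite row_clustQ; case: hb => [->|[->|->]]; rewrite ?eqxx ?orbT ?qF ?qF' /=.
  + by rewrite addrC addKr; apply: halfgt => //; apply: (scaleq_le uS); left.
  + by rewrite addrC addKr; apply: halfgt => //; apply: (scaleq_le uS); right.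
  + by rewrite subrr nrm0.
- apply: (scl_neq s1 (v := row p u - row a u)); first by rewrite subr_eq0.
  by rewrite opprD addrACA subrr add0r scalerBr.
- by apply: (scl_neq s1 u1); rewrite addrC addKr.
- by apply: (scl_neq s1 u2); rewrite addrC addKr.
Qed.

Lemma clustQ_rsw k (c : cochain k) : pb (rsw p a) (pb clustQ c) = pb clustQ (pb (rsw p a) c).
Proof.
rewrite !pb_comp; apply: (congr1 (fun f => pb f c)); apply: funext => u; apply: row_ext => t.
have nB b : b \in B0 -> row b (rsw p a u) = row b u.
  by move=> bB; rewrite row_rsw tpermD//; apply: contraTneq bB => <-.
have es : scaleq (rsw p a u) = scaleq u.
  rewrite /scaleq (gapq_ext nB) !row_rsw tpermL tpermR; congr (_ / (1 + _)); exact: addrC.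
rewrite /= [in RHS]row_rsw !row_clustQ es nB// row_rsw.
by case: tpermP => [->|->|/eqP/negbTE -> /eqP/negbTE -> //]; rewrite ?eqxx ?orbT.
Qed.

Let rseg (t : RR) : 0 <= t <= 1 -> forall x y : RR, 0 < x -> 0 < y -> 0 < (1 - t) * x + t * y.
Proof. by move=> h x y; exact: seg_pos. Qed.

(** The two maps insert the same triangle with a different centre and scale. So they are only
    homotopic, and along the straight line the three differences keep their directions. *)
Lemma clustQ_pqswap k (c : cochain k) : coc (SP B J) c ->
  nul (clust B0 J p a) (pb (pqswap p a) (pb clustQ c) - pb clustQ (pb (rsw p q) c)).
Proof.
move=> hc; rewrite !pb_comp.
have qF : (q == p) = false by rewrite eq_sym (negbTE pq).
have qF' : (q == a) = false by rewrite eq_sym (negbTE aq).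
have apF := negbTE ap; have aqF := negbTE aq.
apply: (homotopy (Y := SP B J) _ _ _ hc).
- by move=> u _; apply: continuous_comp; [exact: clustQ_cont|exact: rsw_cont].
- move=> u hu; apply: continuous_comp; last exact: clustQ_cont.
  by have [] := pqswap_clust pB0 aB0 pa hu.
move=> u t hu ht; have ht' := ht; case/andP: ht' => t0 t1.
have [hu' _] := pqswap_clust pB0 aB0 pa hu.
have [u1 u2 u3] := clust_nz hu; have [uS _] := hu; have [uS' _] := hu'.
have nB b : b \in B0 -> row b (pqswap p a u) = row b u.
  move=> bB; have bp : b == p = false by apply: contraTF bB => /eqP ->.
  have ba : b == a = false by apply: contraTF bB => /eqP ->.
  by rewrite row_pqswap// bp ba.
have ge : gapq (pqswap p a u) = gapq u by exact: gapq_ext.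
set s := scaleq u; set s' := scaleq (pqswap p a u).
have s0 : 0 < s := scaleq_gt0 uS; have s0' : 0 < s' := scaleq_gt0 uS'.
have L x : x = p \/ x = a -> nrm (s *: row x u) < gapq u.
  by move=> hx; apply: halfgt (gapq_gt0 uS); exact: (scaleq_le uS).
have L' x : x = p \/ x = a -> nrm (s' *: row x (pqswap p a u)) < gapq u.
  by move=> hx; rewrite -ge; apply: halfgt (gapq_gt0 uS'); exact: (scaleq_le uS').
have n0 : nrm (0 : 'rV[RR]_d) < gapq u by rewrite nrm0; exact: gapq_gt0 uS.
set v := _ + _.
have vE b : row b v = (1 - t) *: row b (rsw p q (clustQ u)) + t *: row b (clustQ (pqswap p a u)).
  by rewrite /v row_seg.
have vp : row p v = row q u + ((1 - t) *: 0 + t *: (s' *: row p (pqswap p a u))).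
  rewrite vE row_rsw tpermL !row_clustQ eqxx qF qF' /= nB// -/s'.
  by apply/rowP => j; rewrite !mxE; ring.
have vq : row q v = row q u + ((1 - t) *: (s *: row p u) + t *: 0).
  rewrite vE row_rsw tpermR !row_clustQ eqxx qF qF' /= nB// -/s.
  by apply/rowP => j; rewrite !mxE; ring.
have va : row a v = row q u + ((1 - t) *: (s *: row a u) + t *: (s' *: row a (pqswap p a u))).
  rewrite vE row_rsw tpermD 1?eq_sym// !row_clustQ eqxx orbT nB// -/s -/s'.
  by apply/rowP => j; rewrite !mxE; ring.
have r0 : (1 - t) * s + t * s' != 0 by rewrite gt_eqF// rseg.
apply: (tri_SP uS JJpa (e := gapq u)).
- by move=> b; exact: gapq_le.
- move=> b bp ba bq; rewrite vE row_rsw tpermD 1?eq_sym// !row_clustQ (negbTE bp) (negbTE ba) /=.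
  by rewrite row_pqswap// (negbTE bp) (negbTE ba) -scalerDl subrK scale1r.
- move=> b hb; case: hb => [->|[->|->]]; rewrite ?vp ?va ?vq addrC addKr; apply: nrm_conv => //.
  + by apply: L'; left.
  + by apply: L; right.
  + by apply: L'; right.
  + by apply: L; left.
- apply: (scl_neq r0 (v := - row a u)); first by rewrite oppr_eq0.
  rewrite vp va !row_pqswap// !eqxx apF.
  by apply/rowP => j; rewrite !mxE; ring.
- apply: (scl_neq r0 (v := - row p u)); first by rewrite oppr_eq0.
  rewrite vp vq !row_pqswap// !eqxx.
  by apply/rowP => j; rewrite !mxE; ring.
- apply: (scl_neq r0 (v := row a u - row p u)); first by rewrite subr_eq0 eq_sym.
  rewrite va vq !row_pqswap// !eqxx apF.
  by apply/rowP => j; rewrite !mxE; ring.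
Qed.

Lemma cluster_nul k (c : cochain k) : ~~ odd d -> k = top d B0 Jpa -> coc (SP B J) c ->
  (forall x y, x \in B -> y \in B -> nul (SP B J) (pb (rsw x y) c - c)) ->
  nul (clust B0 J p a) (pb clustQ c).
Proof.
move=> ed kE hc hi; apply: (clust_top d2 pB0 aB0 pJ pa dj0 ed kE).
- exact: pb_coc clustQ_mapto hc.
- by rewrite clustQ_rsw -pbB; apply: pb_nul clustQ_mapto _; exact: hi.
- apply: nul_trans (clustQ_pqswap hc) _.
  by rewrite -pbB; apply: pb_nul clustQ_mapto _; exact: hi.
Qed.

End EvenInvariants.

(** * Invariant top classes for even [d] *)

Section EvenVanishing.
Variables (n d : nat).
Hypothesis d2 : (2 <= d)%N.
Notation cochain := (cochain n d).

(** [W] puts [a] near [q] and [p] still nearer to [a]. It is homotopic to [clustQ] after [clustR],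
    and [cluster_nul] kills the pullback under [clustQ]. *)
Lemma cluster_map_nul (B0 J : {set 'I_n}) (p a q : 'I_n) (W : Mpt n d -> Mpt n d) k (c : cochain k) :
  p \notin B0 -> a \notin B0 -> p != a -> q \in B0 -> dsj (p |: (a |: B0)) J ->
  ~~ odd d -> k = top d B0 (p |: (a |: J)) -> coc (SP (p |: (a |: B0)) J) c ->
  (forall x y, x \in p |: (a |: B0) -> y \in p |: (a |: B0) ->
     nul (SP (p |: (a |: B0)) J) (pb (rsw x y) c - c)) ->
  (forall u, SP B0 (p |: (a |: J)) u -> {for u, continuous W}) ->
  (forall u, SP B0 (p |: (a |: J)) u -> exists r r' e, [/\ 0 < r /\ 0 < r', e <= 1,
     (forall b, b \in B0 -> b != q -> e <= nrm (row q u - row b u)),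
     nrm (r *: row p u) <= nrm (r' *: row a u) / 2 /\ nrm (r' *: row a u) <= e / 2 &
     W u = setrow p (row q u + r' *: row a u + r *: row p u) (setrow a (row q u + r' *: row a u) u)]) ->
  nul (SP B0 (p |: (a |: J))) (pb W c).
Proof.
move=> pB0 aB0 pa qB0 dj ed kE hc hi Wc Ws.
have pq : p != q by apply: contraNneq pB0 => ->.
have aq : a != q by apply: contraNneq aB0 => ->.
have ap : a != p by rewrite eq_sym.
have qF : (q == p) = false by rewrite eq_sym (negbTE pq).
have qF' : (q == a) = false by rewrite eq_sym (negbTE aq).
have apF := negbTE ap.
have pJ : p \notin J by rewrite (disjointFr dj)// !inE eqxx.
have mR := @clustR_mapto n d B0 J p a pB0 pJ pa.
have h1 := pb_nul mR (cluster_nul d2 pB0 aB0 pa qB0 dj ed kE hc hi).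
rewrite pb_comp in h1; apply: nul_eq h1.
apply: (homotopy (Y := SP (p |: (a |: B0)) J) _ Wc _ hc).
  move=> u hu; have [_ cR] := mR _ hu; apply: continuous_comp => //; exact: clustQ_cont.
move=> u t hu ht; have /andP[t0 t1] := ht.
have [r [r' [e [[r0 r0'] e1 he [hr hr'] ->]]]] := Ws u hu.
have [s [s0 hs clE]] := clustR_spec hu.
have [cl _] := mR _ hu; have [clS _] := cl.
have [up ua] : row p u != 0 /\ row a u != 0.
  by case: hu => _ h; split; apply: h; rewrite !inE eqxx ?orbT.
set u1 := clustR p a u in clE cl clS *.
have u1p : row p u1 = row a u + s *: row p u by rewrite clE row_setrow.
have u1b b : b != p -> row b u1 = row b u by move=> bp; rewrite clE row_setrowN.
have ge : gapq B0 q u1 = gapq B0 q u.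
  by apply: gapq_ext => // b bB; apply: u1b; apply: contraTneq bB => ->.
have eg : e <= gapq B0 q u.
  rewrite /gapq; elim/big_ind: _ => // [x y x0 y0|b /andP[]]; last exact: he.
  by rewrite le_min x0.
set de := scaleq B0 p a q u1; have de0 : 0 < de := scaleq_gt0 p a qB0 clS.
have g0 : 0 < gapq B0 q u := gapq_gt0 qB0 hu.
have La : nrm (de *: row a u) < gapq B0 q u.
  have := @scaleq_le n d B0 p a q qB0 _ _ _ clS (or_intror (erefl a)); rewrite u1b// -/de ge. lra.
have Lp : nrm (de *: row p u1) < gapq B0 q u.
  have := @scaleq_le n d B0 p a q qB0 _ _ _ clS (or_introl (erefl p)); rewrite -/de ge; lra.
have Ma : nrm (r' *: row a u) < gapq B0 q u by lra.
have Mp : nrm (r' *: row a u + r *: row p u) < gapq B0 q u.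
  apply: le_lt_trans (nrm_triangle _ _) _; lra.
have n0 : nrm (0 : 'rV[RR]_d) < gapq B0 q u by rewrite nrm0.
set v := _ + _.
have vE b : row b v = (1 - t) *: row b (clustQ B0 p a q u1) +
   t *: row b (setrow p (row q u + r' *: row a u + r *: row p u) (setrow a (row q u + r' *: row a u) u)).
  by rewrite /v row_seg.
have qp : q != p by rewrite qF.
have va : row a v = row q u + ((1 - t) *: (de *: row a u) + t *: (r' *: row a u)).
  rewrite vE row_clustQ eqxx orbT row_setrowN// row_setrow -/de !u1b//.
  by apply/rowP => j; rewrite !mxE; ring.
have vp : row p v = row q u + ((1 - t) *: (de *: row p u1) + t *: (r' *: row a u + r *: row p u)).
  rewrite vE row_clustQ eqxx row_setrow -/de u1b//.
  by apply/rowP => j; rewrite !mxE; ring.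
have vb b : b != p -> b != a -> row b v = row b u.
  move=> bp ba; rewrite vE row_clustQ (negbTE bp) (negbTE ba) !row_setrowN//=.
  by rewrite -scalerDl subrK scale1r.
have vq : row q v = row q u by apply: vb; rewrite // qF'.
have JJ : J \subset p |: (a |: J) by apply/fintype.subsetP => x xJ; rewrite !inE xJ !orbT.
have al0 : 0 < (1 - t) * de + t * r' by exact: seg_pos.
have be0 : 0 < (1 - t) * (de * s) + t * r by apply: seg_pos => //; exact: mulr_gt0.
apply: (@tri_SP n d B0 J p a q pB0 aB0 qB0 dj _ (gapq B0 q u) u v hu JJ).
- by move=> b; exact: gapq_le.
- by move=> b bp ba _; exact: vb.
- move=> b hb; case: hb => [->|[->|->]]; rewrite ?vp ?va ?vq 1?addrC ?addKr.
  + exact: nrm_conv.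
  + exact: nrm_conv.
  + by rewrite addNr nrm0.
- apply: (scl_neq (r := (1 - t) * (de * s) + t * r) (v := row p u)) => //; first by rewrite gt_eqF.
  by rewrite vp va u1p; apply/rowP => j; rewrite !mxE; ring.
(* A collision of [p] with [q] is excluded because, at both ends of the homotopy, the offset of [a]
   from [q] is longer than the offset of [p] from [a]. *)
- rewrite vp vq eq_sym addrC -subr_eq subrr eq_sym u1p; apply/eqP => z.
  have : nrm (((1 - t) * de + t * r') *: row a u) = nrm (((1 - t) * (de * s) + t * r) *: row p u).
    rewrite -[RHS]nrmN; congr nrm; apply/eqP; rewrite -subr_eq0 opprK -z; apply/eqP.
    by apply/rowP => j; rewrite !mxE; ring.
  rewrite !nrmZ !gtr0_norm//.
  move: hs hr; rewrite !nrmZ !gtr0_norm// => hs hr.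
  have a0 : 0 < nrm (row a u) by rewrite nrm_gt0.
  have := seg_pos ht (mulr_gt0 de0 (_ : 0 < nrm (row a u) - s * nrm (row p u))) (_ : 0 < r' * nrm (row a u) - r * nrm (row p u)).
  rewrite subr_gt0 => /(_ hs); have := mulr_gt0 r0' a0 => h3.
  have h4 : 0 < r' * nrm (row a u) - r * nrm (row p u) by lra.
  move=> /(_ h4) h5 h6; suff : (0 : RR) < 0 by rewrite ltxx.
  lra.
- apply: (scl_neq (r := (1 - t) * de + t * r') (v := row a u)) => //; first by rewrite gt_eqF.
  by rewrite va vq; apply/rowP => j; rewrite !mxE; ring.
Qed.

(** Two residues are taken, of [p] at [a] and then of [a] at [q]; the composed tube map has the
    nested form of [cluster_map_nul]. A class all of whose residues are null comes from one point
    fewer, where its degree exceeds the top degree. *)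
Lemma inv_even (B J : {set 'I_n}) k (c : cochain k) : ~~ odd d -> (2 < #|B|)%N -> dsj B J ->
  k = top d B J -> coc (SP B J) c ->
  (forall p q, p \in B -> q \in B -> nul (SP B J) (pb (rsw p q) c - c)) -> nul (SP B J) c.
Proof.
move=> ed B2 dj kE hc hi.
have [|p pB _] := set_max (B := B); first by rewrite -card_gt0 (ltn_trans _ B2).
have pJ : p \notin J by rewrite (disjointFr dj).
have dj1 := dsj_peel p dj.
have [|c0 h0 h] := SP_peel pB pJ hc; last first.
  apply: nul_eq h _; apply: nulW (SP_sub (subD1set B p) (subxx J)) _.
  apply: (hdS d2) => //; first by apply: disjointWl dj; exact: subD1set.
  by rewrite kE; apply: top_restr => //; exact: ltn_trans B2.
move=> aT; have [aB ap] := peel_valB aT; set a := sval aT in aB ap *.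
have aB' : a \in B :\ p by rewrite !inE ap.
have aJ' : a \notin p |: J by rewrite (disjointFr dj1).
have mR1 := @resR_mapto n d B J p pB pJ aT.
have hz : coc (SP (B :\ p) (p |: J)) (pb (resR aT) c) by exact: pb_coc mR1 hc.
have cB : #|B| = (#|B :\ p :\ a|).+2 by rewrite (cardsD1 p) pB (cardsD1 a (B :\ p)) aB'.
have [|z0 hz0 hzn] := SP_peel aB' aJ' hz; last first.
  apply: nul_eq hzn _; apply: nulW (SP_sub (subD1set _ a) (subxx _)) _.
  apply: (hdS d2) hz0; first by apply: disjointWl dj1; exact: subD1set.
  rewrite kE /top cardsU1 pJ cB /= add1n; move: B2; rewrite cB.
  by case: #|_| => // m _; rewrite /= ltn_mul2r; move: d2; clear; lia.
move=> qT; have [qB' qa] := peel_valB qT; set q := sval qT in qB' qa *.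
have mR2 := @resR_mapto n d (B :\ p) (p |: J) a aB' aJ' qT.
set B0 := B :\ p :\ a in cB *.
have qB0 : q \in B0 by rewrite !inE qa; move: qB'; rewrite !inE.
have pB0 : p \notin B0 by rewrite !inE eqxx andbF.
have aB0 : a \notin B0 by rewrite !inE eqxx.
have BE : p |: (a |: B0) = B by rewrite /B0 !finset.setD1K.
rewrite pb_comp.
have JE : a |: (p |: J) = p |: (a |: J) by exact: finset.setUCA.
rewrite -BE in dj hc hi.
rewrite JE; apply: (cluster_map_nul pB0 aB0 _ qB0 dj ed _ hc hi).
- by rewrite eq_sym.
- rewrite kE /top cB cardsU1 !inE eq_sym (negbTE ap) (negbTE pJ) cardsU1.
  have -> : a \notin J by move: aJ'; rewrite !inE negb_or => /andP[].
  move: qB0; rewrite (cardsD1 q B0) => ->; congr (_ * _)%N; clear; lia.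
- move=> u; rewrite -JE => hu; have [h1 h2] := mR2 _ hu; have [_ h3] := mR1 _ h1.
  exact: continuous_comp.
move=> u; rewrite -JE => hu; have [h1 _] := mR2 _ hu.
have [r' [e' [r0' /andP[e0' e1'] hr' he' E2]]] := resR_spec qT hu.
have [r [e [r0 /andP[e0 e1] hr he E1]]] := resR_spec aT h1.
have pa : p != a by rewrite eq_sym.
rewrite -/q in he' E2; rewrite -/a in he E1.
have pR : row p (resR qT u) = row p u by rewrite E2 row_setrowN.
have aR : row a (resR qT u) = row q u + r' *: row a u by rewrite E2 row_setrow.
have qR : row q (resR qT u) = row q u by rewrite E2 row_setrowN.
rewrite pR in hr E1; rewrite aR in he E1.
exists r, r', e'; split=> //.
  split=> //; have := he q qB' qa; rewrite qR addrC addKr; lra.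
by rewrite /= E1 E2.
Qed.

End EvenVanishing.

(** * Forest classes and far points *)

Section Monomials.
Variables (n d : nat).
Hypothesis d2 : (2 <= d)%N.
Notation cochain := (cochain n d).
Notation C := (@conf n d).
Implicit Types (B J : {set 'I_n}) (f : 'I_n -> 'I_n).

Lemma conf_SP : C = SP finset.setT finset.set0.
Proof.
apply/seteqP; split=> u; first by move=> h; split=> [a b _ _|t]; [exact: h|rewrite inE].
by move=> [h _] a b; apply: h; rewrite inE.
Qed.

(** Keeps the rows outside [J], on which the peeling still acts; [Gmap] collapses them to 0. *)
Definition Kmap f J (u : Mpt n d) : Mpt n d := \matrix_(i, j) if i \in J then u i j - u (f i) j else u i j.
Definition Gmap f J (u : Mpt n d) : Mpt n d := \matrix_(i, j) if i \in J then u i j - u (f i) j else 0.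
Definition forest f J := forall m, m \in J -> (f m < m)%N.

Lemma row_Kmap f J u t : row t (Kmap f J u) = if t \in J then row t u - row (f t) u else row t u.
Proof. by apply/rowP => j; rewrite !mxE; case: (t \in J); rewrite !mxE. Qed.

Lemma row_Gmap f J u t : row t (Gmap f J u) = if t \in J then row t u - row (f t) u else 0.
Proof. by apply/rowP => j; rewrite !mxE; case: (t \in J); rewrite !mxE. Qed.

Lemma Kmap_cont f J u : {for u, continuous (Kmap f J)}.
Proof.
apply: mx_cont => i j.
rewrite (_ : (fun y => _) = fun y : Mpt n d => if i \in J then y i j - y (f i) j else y i j).
  by case: (i \in J); [apply: cntB|]; exact: cnt_coord.
by apply: funext => v; rewrite !mxE.
Qed.

Lemma Gmap_cont f J u : {for u, continuous (Gmap f J)}.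
Proof.
apply: mx_cont => i j.
rewrite (_ : (fun y => _) = fun y : Mpt n d => if i \in J then y i j - y (f i) j else 0).
  by case: (i \in J); [apply: cntB; exact: cnt_coord|exact: cnt_cst].
by apply: funext => v; rewrite !mxE.
Qed.

Lemma forest_neq f J m : forest f J -> m \in J -> m != f m.
Proof. by move=> h /h; rewrite neq_ltn => ->; rewrite orbT. Qed.

Lemma Kmap_SP f B J : forest f J -> dsj B J -> mapto (Kmap f J) C (SP B J).
Proof.
move=> fJ dj u hu; split; last exact: Kmap_cont.
split=> [a b aB bB ab|t tJ]; first by rewrite !row_Kmap (disjointFr dj aB) (disjointFr dj bB); exact: hu.
by rewrite row_Kmap tJ subr_eq0; apply: hu; exact: forest_neq fJ tJ.
Qed.

Lemma Gmap_XJ f J J' : forest f J -> J' \subset J -> mapto (Gmap f J) C (XJ J').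
Proof.
move=> fJ /fintype.subsetP JJ u hu; split; last exact: Gmap_cont.
move=> t /JJ tJ; apply/nz_row; rewrite row_Gmap tJ subr_eq0; apply: hu; exact: forest_neq fJ tJ.
Qed.

(** [SP_ind] is run on classes of [SP B J] pulled back along an arbitrary forest map [Kmap f J].
    Each peeled point adds an edge, and once [B] is empty [spanJ] reduces to products of [i]
    spheres. *)
Lemma conf_span i k (Pr : cochain k -> Prop) : k = (i * (d - 1))%N ->
  Pr 0 -> (forall c c', Pr c -> Pr c' -> Pr (c + c')) ->
  (forall c c', nul C (c - c') -> Pr c' -> Pr c) ->
  (forall f J c, forest f J -> #|J| = i -> coc (XJ J) c -> Pr (pb (Gmap f J) c)) ->
  forall c, coc C c -> Pr c.
Proof.
move=> kE P0 PD Pn PG c.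
have H := @SP_ind n d k (fun B J c => forall f, forest f J -> dsj B J -> Pr (pb (Kmap f J) c)).
rewrite conf_SP => hc; have dj : dsj [set: 'I_n]%SET (finset.set0 : {set 'I_n}).
  by rewrite -setI_eq0 finset.setI0.
have {H} := H _ _ _ _ _ _ _ _ _ dj hc.
have fo0 : forest id finset.set0 by move=> m; rewrite inE.
move=> H; apply: (Pn) (H _ _ _ _ _ _ id fo0 dj) => //.
- apply/nul_sym; apply: (@pb_id_nul _ _ _ _ C) => u _; apply: row_ext => t.
  by rewrite row_Kmap inE.
- move=> B J c1 c2 h1 h2 f fJ djJ; rewrite pbD; apply: PD; [exact: h1|exact: h2].
- move=> B J c1 c2 hn h f fJ djJ; apply: (Pn) (h f fJ djJ).
  by rewrite -pbB; apply: pb_nul hn; exact: Kmap_SP.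
- move=> J c1 hc1 f fJ djJ.
  apply: (@spanJ n d d2 k (fun c => Pr (pb (Kmap f J) c)) J) hc1 => //.
  + by move=> x y hx hy; rewrite pbD; exact: PD.
  + move=> x y hxy hy; apply: (Pn) hy; rewrite -pbB; apply: pb_nul hxy.
    by rewrite -SP_XJ; exact: Kmap_SP.
  move=> J' JJ kJ c2 hc2.
  have fJ' : forest f J' by move=> m mJ; apply: fJ; exact: (fintype.subsetP JJ).
  (* Rows outside [J'] are unconstrained in [XJ J'], so a straight line joins [Gmap f J'] to
     [Kmap f J]. *)
  apply: (Pn _ (pb (Gmap f J') c2)); last first.
    apply: PG => //; move: kJ; rewrite kE; move=> /eqP; rewrite eqn_mul2r subn_eq0 leqNgt d2 /=.
    by move/eqP.
  apply: (homotopy (Y := XJ J')) hc2.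
  + by move=> u _; exact: Gmap_cont.
  + by move=> u _; exact: Kmap_cont.
  move=> u s hu _ t tJ; apply/nz_row; rewrite row_seg row_Gmap row_Kmap tJ (fintype.subsetP JJ _ tJ).
  rewrite -scalerDl subrK scale1r subr_eq0; apply: hu; exact: forest_neq fJ' tJ.
- move=> B J p c1 pB djJ hc1 h f fJ _; apply: h => //.
  by apply: disjointWl djJ; exact: subD1set.
move=> B J p a c1 pB aB ap djJ hc1 h f fJ _.
(* The peeled point [p] becomes a child of [a]; [a < p] preserves the forest condition. *)
pose f' x := if x == p then a else f x.
have aJ : a \notin J by rewrite (disjointFr djJ aB).
have pJ : p \notin J by rewrite (disjointFr djJ pB).
rewrite pb_comp (_ : _ \o _ = Kmap f' (p |: J)); last first.
  apply: funext => u; apply: row_ext => t /=; rewrite row_psi !row_Kmap finset.in_setU1 /f'.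
  by rewrite (negbTE aJ) (negbTE pJ); case: eqVneq => [->|].
apply: h; last exact: dsj_peel.
move=> m; rewrite finset.in_setU1 /f'; case: eqVneq => [->//|_] /=; exact: fJ.
Qed.

Definition hgt (a : 'I_n) (u : Mpt n d) : RR := 1 + \sum_(i | i != a) nrm (row i u).
Definition coord0 : 'I_d := Ordinal (ltnW d2).
(** A coordinate whose reflection leaves the direction of the far point unchanged; it exists as
    [d >= 2]. *)
Definition coord1 : 'I_d := Ordinal d2.
Definition far a (u : Mpt n d) : Mpt n d := setrow a (hgt a u *: delta_mx 0 coord0) u.

Lemma hgt_gt a i u : i != a -> nrm (row i u) < hgt a u.
Proof.
move=> ia; rewrite /hgt (bigD1 i)//= addrCA ltrDl ltr_pwDl//; apply: sumr_ge0 => *; exact: nrm_ge0.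
Qed.

Lemma coord_nrm (r : 'rV[RR]_d) j : `|r 0 j| <= nrm r.
Proof. by rewrite /nrm (bigD1 j)//= lerDl; apply: sumr_ge0. Qed.

Lemma far_gt a i u : i != a -> 0 < far a u a coord0 - u i coord0.
Proof.
move=> ia; rewrite subr_gt0 setrowE eqxx !mxE !eqxx mulr1.
apply: le_lt_trans (hgt_gt u ia); have := coord_nrm (row i u) coord0; rewrite !mxE.
exact/le_trans/ler_norm.
Qed.

Lemma far_cont a u : {for u, continuous (far a)}.
Proof.
apply: setrow_cont => j.
rewrite (_ : (fun v => _) = fun v => hgt a v * (delta_mx 0 coord0 : 'rV[RR]_d) 0 j); last first.
  by apply: funext => v; rewrite !mxE.
apply: cntM; last exact: cnt_cst.
apply: cntD; first exact: cnt_cst.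
by apply: cnt_sum => i _; apply: nrm_cnt => l; exact: row_cnt.
Qed.

Lemma far_mapto a : mapto (far a) C C.
Proof.
move=> u hu; split; last exact: far_cont.
have key i : i != a -> row a (far a u) != row i (far a u).
  move=> ia; apply/eqP => e; have := far_gt u ia.
  have := congr1 (fun r : 'rV[RR]_d => r 0 coord0) e; rewrite !mxE !eqxx (negbTE ia) => ->.
  by rewrite subrr ltxx.
move=> x y xy; case: (eqVneq x a) => [xa|xa].
  by rewrite xa; apply: key; rewrite eq_sym -xa.
case: (eqVneq y a) => [->|ya]; first by rewrite eq_sym key.
by rewrite !row_setrowN//; exact: hu.
Qed.

Definition isolated f J a := (a \notin J) && [forall m, (m \in J) ==> (f m != a)].

Lemma far_isolated f J a k (c : cochain k) : isolated f J a ->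
  pb (far a) (pb (Gmap f J) c) = pb (Gmap f J) c.
Proof.
move=> /andP[aJ /forallP h]; rewrite pb_comp; apply: (congr1 (fun g => pb g c)).
apply: funext => u; apply: row_ext => t /=; rewrite !row_Gmap; case: (boolP (t \in J)) => // tJ.
have := h t; rewrite tJ /= => fa; rewrite !row_setrowN//.
by apply: contraNneq aJ => <-.
Qed.

(** If [a] is an end of the edge at [m], sending [a] far away makes the first coordinate of the edge
    vector nonzero. So reflecting another coordinate of that vector is homotopic to the identity,
    while it negates the top class; twice the class is therefore null. *)
Lemma far_linked f J a k (c : cochain k) : k = (#|J| * (d - 1))%N -> forest f J -> coc (XJ J) c ->
  ~~ isolated f J a -> nul C (pb (far a) (pb (Gmap f J) c)).
Proof.
move=> kE fJ hc; rewrite negb_and negbK negb_forall => ha.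
have [m mJ hm] : exists2 m, m \in J & (m == a) || (f m == a).
  case/orP: ha => [aJ|/existsP [m]]; first by exists a => //; rewrite eqxx.
  by rewrite negb_imply negbK => /andP[mJ fm]; exists m => //; rewrite fm orbT.
have mM : mapto (Gmap f J \o far a) C (XJ J).
  exact: (mapto_comp (@far_mapto a) (Gmap_XJ fJ (subxx J))).
set e : 'I_n * 'I_d := (m, coord1).
have h1 := pb_nul mM (reflJ d2 (e := e) kE hc mJ).
rewrite pb_comp; apply: nul_opp.
have h2 : nul C (pb (@refl n d e \o (Gmap f J \o far a)) c - pb (Gmap f J \o far a) c).
  apply: (homotopy (Y := XJ J) _ _ _ hc).
  - by move=> u hu; have [] := mM u hu.
  - by move=> u hu; apply: continuous_comp; [have [] := mM u hu|exact: refl_cont].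
  move=> u s hu _ t tJ; have [hM _] := mM u hu.
  set w := (Gmap f J \o far a) u in hM *.
  case: (eqVneq t m) => [->|tm]; last first.
    apply: nz_eq (hM t tJ) => e'; rewrite inE => /eqP te.
    rewrite crd_seg /refl crd_updN -?mulrDl ?subrK ?mul1r//.
    by apply: contraNneq tm => E; rewrite -te E.
  exists (m, coord0); first by rewrite inE.
  rewrite crd_seg /refl crd_updN -?mulrDl ?subrK ?mul1r; last by rewrite xpair_eqE eqxx.
  rewrite /w /crd /= mxE mJ.
  have fm := forest_neq fJ mJ.
  have key i : i != a -> 0 < far a u a coord0 - far a u i coord0.
    by move=> ia; rewrite [far a u i _]setrowE (negbTE ia) far_gt.
  case/orP: hm => /eqP E; first by rewrite -{1}E E gt_eqF// key// -E eq_sym.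
  by rewrite -oppr_eq0 opprB E gt_eqF// key// -E.
have := nulB h1 h2; apply: nul_ext => s _; rewrite pbD pb_comp.
change (pb (@refl n d e \o (Gmap f J \o far a)) c s + pb (Gmap f J \o far a) c s -
  (pb (@refl n d e \o (Gmap f J \o far a)) c s - pb (Gmap f J \o far a) c s) =
  pb (Gmap f J \o far a) c s + pb (Gmap f J \o far a) c s); ring.
Qed.

End Monomials.

(** * Symmetrization over a set of points and the trees of a forest *)

Section Injectivity.
Variables (n d : nat).
Hypothesis d2 : (2 <= d)%N.
Notation cochain := (cochain n d).
Notation C := (@conf n d).
Implicit Types (A B J : {set 'I_n}) (f : 'I_n -> 'I_n) (s t : 'S_n).

Definition rp (s : 'S_n) (u : Mpt n d) : Mpt n d := \matrix_(i, j) u (s i) j.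

Lemma row_rp s u m : row m (rp s u) = row (s m) u.
Proof. by apply/rowP => j; rewrite !mxE. Qed.

Lemma rp_cont s u : {for u, continuous (rp s)}.
Proof.
apply: mx_cont => i j; rewrite (_ : (fun y => _) = fun y : Mpt n d => y (s i) j); first exact: cnt_coord.
by apply: funext => v; rewrite mxE.
Qed.

Lemma rp_conf s : mapto (rp s) C C.
Proof.
move=> u hu; split; last exact: rp_cont.
by move=> a b ab; rewrite !row_rp; apply: hu; rewrite (inj_eq perm_inj).
Qed.

Lemma pb_rp s t k (c : cochain k) : pb (rp s) (pb (rp t) c) = pb (rp (t * s)%g) c.
Proof.
rewrite pb_comp; apply: (congr1 (fun g => pb g c)); apply: funext => u.
by apply/matrixP => i j; rewrite !mxE permM.
Qed.

Lemma rp1 u : rp 1%g u = u.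
Proof. by apply/matrixP => i j; rewrite mxE perm1. Qed.

Lemma rsw_rp p q : @rsw n d p q = rp (tperm p q).
Proof. by apply: funext => u; apply/matrixP => i j; rewrite !mxE. Qed.

Lemma rp_far s a : rp s \o far d2 (s a) = far d2 a \o rp s.
Proof.
apply: funext => u; apply: row_ext => t /=; rewrite row_rp.
case: (eqVneq t a) => [->|ta]; last by rewrite !row_setrowN ?(inj_eq perm_inj)// row_rp.
rewrite !row_setrow; congr (_ *: _); rewrite /hgt; congr (_ + _).
rewrite (reindex_inj (@perm_inj _ s)) /=; apply: eq_big => [i|i _]; first by rewrite (inj_eq perm_inj).
by rewrite row_rp.
Qed.

Lemma natr_scc k (c : cochain k) m : c *+ m = scc m%:R c.
Proof.
elim: m => [|m IH]; first by rewrite mulr0n scc0.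
by rewrite mulrS IH -{1}[c]scc1 -sccDl mulrS.
Qed.

Definition symA A k (c : cochain k) : cochain k := \sum_(s | perm_on A s) pb (rp s) c.

Lemma symAD A k (c c' : cochain k) : symA A (c + c') = symA A c + symA A c'.
Proof. by rewrite /symA -big_split. Qed.

Lemma symA_nul A k (c : cochain k) : nul C c -> nul C (symA A c).
Proof. by move=> h; apply: nul_sum => s _; apply: pb_nul h; exact: rp_conf. Qed.

Lemma perm_onMl A s t : perm_on A t -> perm_on A (t * s)%g = perm_on A s.
Proof.
move=> ht; apply/idP/idP => h; last exact: perm_onM.
by rewrite -[s](mulKg t); apply: perm_onM => //; exact: perm_onV.
Qed.

Lemma symA_rp A t k (c : cochain k) : perm_on A t -> symA A (pb (rp t) c) = symA A c.
Proof.
move=> ht; rewrite /symA [RHS](reindex_inj (mulgI t)) /=.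
by apply: eq_big => [s|s _]; rewrite ?perm_onMl// pb_rp.
Qed.

(** [symA A] absorbs each [rp t], so the hypothesis yields [#|T|] times the claim. *)
Lemma symA_kill A (T : {set 'S_n}) k (c : cochain k) : (forall t, t \in T -> perm_on A t) -> (0 < #|T|)%N ->
  nul C (\sum_(t in T) pb (rp t) c) -> nul C (symA A c).
Proof.
move=> hT T0 hn; have := symA_nul A hn.
have -> : symA A (\sum_(t in T) pb (rp t) c) = scc #|T|%:R (symA A c).
  rewrite -natr_scc -sumr_const.
  rewrite [RHS](eq_bigr (fun t => symA A (pb (rp t) c))); last by move=> t tT; apply/esym/symA_rp/hT.
  elim/big_rec2: _ => [|t y1 y2 _ <-]; last by rewrite symAD.
  by rewrite /symA big1.
by apply: nulZI; rewrite pnatr_eq0 -lt0n.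
Qed.

Section Roots.
Variables (f : 'I_n -> 'I_n) (J : {set 'I_n}).
Hypothesis fJ : forest f J.

Definition parent x := if x \in J then f x else x.
(** Each step to a parent lowers the index, so [n] steps reach the root of the tree from any
    vertex. *)
Definition root x := iter n parent x.

Lemma iter_parent m x : iter m parent x \in J -> (iter m parent x + m <= x)%N.
Proof.
elim: m => [|m IH] /=; first by rewrite addn0.
case: (boolP (iter m parent x \in J)) => h.
  rewrite /parent h => _; apply: leq_trans (IH h); rewrite addnS -addSn leq_add2r; exact: fJ.
by rewrite {1}/parent (negbTE h) (negbTE h).
Qed.

Lemma root_notin x : root x \notin J.
Proof.
apply/negP => /iter_parent h; have := ltn_ord x; rewrite ltnNge => /negP; apply.
by apply: leq_trans h; exact: leq_addl.
Qed.

Lemma root_id x : x \notin J -> root x = x.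
Proof.
move=> h; suff H m : iter m parent x = x by exact: H.
by elim: m => //= m ->; rewrite /parent (negbTE h).
Qed.

Lemma root_parent x : x \in J -> root (f x) = root x.
Proof.
move=> xJ; have := root_notin x; rewrite /root => h.
have -> : f x = parent x by rewrite /parent xJ.
by rewrite -iterSr iterS /parent (negbTE h).
Qed.

Definition comp r : {set 'I_n} := [set x | root x == r].

Lemma comp_J x r : x \in comp r -> x != r -> x \in J.
Proof.
by rewrite inE => /eqP <-; apply: contraNT => /root_id ->.
Qed.

(** The remaining points of [A] inject into [J]: a point of [J] goes to itself, and a root whose
    tree leaves [A] goes to a vertex of its tree outside [A], which is not the root and so lies in
    [J]. *)
Lemma card_good A : (#|A| <= #|[set r in A :\: J | comp r \subset A]| + #|J|)%N.
Proof.
set g := [set r in _ | _].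
pose b r := [pick y in comp r :\: A].
pose phi x := if x \in J then x else odflt x (b x).
have bP x : x \in A -> x \notin J -> x \notin g -> [/\ phi x \in J, phi x \notin A & root (phi x) = x].
  move=> xA xJ; rewrite inE !inE xA xJ /= => /subsetPn [y yB yA].
  rewrite /phi (negbTE xJ) /b; case: pickP => [z|]; last by move/(_ y); rewrite !inE yA; move: yB; rewrite inE => ->.
  rewrite finset.in_setD => /andP[zA zB] /=; split=> //; last by move: zB; rewrite inE => /eqP.
  by apply: comp_J zB _; apply: contraNneq zA => ->.
have gA : g \subset A by apply/fintype.subsetP => x; rewrite !inE => /andP[/andP[_ ->]].
rewrite -(cardsID g A) (finset.setIidPr gA) leq_add2l.
rewrite -(card_in_imset (f := phi)).
  apply/subset_leq_card/fintype.subsetP => y /imsetP [x]; rewrite finset.in_setD => /andP[xg xA] ->.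
  by case: (boolP (x \in J)) => xJ; [rewrite /phi xJ|have [] := bP x xA xJ xg].
move=> x y; rewrite !finset.in_setD => /andP[xg xA] /andP[yg yA] e.
case: (boolP (x \in J)) => xJ; case: (boolP (y \in J)) => yJ.
- by move: e; rewrite /phi xJ yJ.
- by have [_ h _] := bP y yA yJ yg; move: h; rewrite -e /phi xJ xA.
- by have [_ h _] := bP x xA xJ xg; move: h; rewrite e /phi yJ yA.
- by have [_ _ <-] := bP x xA xJ xg; have [_ _ <-] := bP y yA yJ yg; rewrite e.
Qed.

Lemma comp_card r : r \notin J -> ~~ isolated f J r -> (1 < #|comp r|)%N.
Proof.
move=> rJ; rewrite /isolated rJ negb_forall => /existsP [m]; rewrite negb_imply negbK => /andP[mJ /eqP fm].
rewrite (cardsD1 r) inE root_id// eqxx (cardsD1 m) !inE -root_parent// fm root_id// eqxx andbT.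
by have -> : m != r by apply: contraNneq rJ => <-.
Qed.

Lemma comp_parent x r : x \in J -> (f x \in comp r) = (x \in comp r).
Proof. by move=> xJ; rewrite !inE root_parent. Qed.

(** The forest map factors through [SP B J'], where the tree [B] is kept as a configuration and only
    the other edges become vectors. There the symmetrized class is an invariant top class, which
    vanishes by [inv_odd] or [inv_even]. *)
Lemma comp_sym_nul r k (c : cochain k) : k = (#|J| * (d - 1))%N -> coc (XJ J) c -> r \notin J ->
  (odd d /\ (1 < #|comp r|)%N) \/ (~~ odd d /\ (2 < #|comp r|)%N) ->
  nul C (symA (comp r) (pb (Gmap f J) c)).
Proof.
move=> kE hc rJ hB; set B := comp r.
have rB : r \in B by rewrite inE root_id.
pose J' := J :\: B.
have fJ' : forest f J' by move=> m; rewrite inE => /andP[_]; exact: fJ.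
have dj : dsj B J' by rewrite -setI_eq0; apply/eqP/finset.setP => x; rewrite !inE; case: (_ == r).
have mH := @Kmap_SP n d f B J' fJ' dj.
pose G' (v : Mpt n d) : Mpt n d := \matrix_(i, j) if i \in J then (if i \in B then v i j - v (f i) j else v i j) else 0.
have rG m v : row m (G' v) = if m \in J then (if m \in B then row m v - row (f m) v else row m v) else 0.
  by apply/rowP => j; rewrite !mxE; case: (m \in J); case: (m \in B); rewrite !mxE.
have mG : mapto G' (SP B J') (XJ J).
  move=> u [h1 h2]; split.
    move=> t tJ; apply/nz_row; rewrite rG tJ; case: (boolP (t \in B)) => tB; last by apply: h2; rewrite inE tB.
    by rewrite subr_eq0; apply: h1; rewrite ?comp_parent//; exact: forest_neq tJ.
  apply: mx_cont => i j.
  rewrite (_ : (fun y => _) = fun y : Mpt n d => if i \in J then (if i \in B then y i j - y (f i) j else y i j) else 0).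
    case: (i \in J); last exact: cnt_cst.
    by case: (i \in B); [apply: cntB|]; exact: cnt_coord.
  by apply: funext => v; rewrite mxE.
have EG : Gmap f J = G' \o Kmap f J'.
  apply: funext => u; apply: row_ext => t /=; rewrite row_Gmap rG !row_Kmap !inE -/B.
  case: (boolP (t \in J)) => tJ //; rewrite andbT.
  case: (boolP (root t == r)) => tB //=; rewrite (_ : _ && _ = false)//.
  by rewrite root_parent// tB.
pose y := pb G' c; have hy : coc (SP B J') y by exact: pb_coc mG hc.
have rpS t : perm_on B t -> mapto (rp t) (SP B J') (SP B J').
  move=> ht u [h1 h2]; split; last exact: rp_cont.
  split=> [a b aB bB ab|m]; rewrite !row_rp; first by apply: h1; rewrite ?perm_closed// (inj_eq perm_inj).
  by move=> mJ; rewrite (out_perm ht) ?h2// (disjointFl dj).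
have rpH t : perm_on B t -> Kmap f J' \o rp t = rp t \o Kmap f J'.
  move=> ht; apply: funext => u; apply: row_ext => m /=; rewrite row_rp !row_Kmap !row_rp.
  case: (boolP (m \in J')) => mJ'.
    have mB : m \notin B by rewrite (disjointFl dj).
    have mJ : m \in J by move: mJ'; rewrite inE => /andP[].
    by rewrite (out_perm ht mB) mJ' [t (f m)](out_perm ht)// comp_parent.
  case: (boolP (m \in B)) => mB.
    by rewrite (disjointFr dj (_ : t m \in B))// perm_closed.
  by rewrite (out_perm ht mB) (negbTE mJ').
pose N := \sum_(t | perm_on B t) pb (rp t) y.
have hN : nul (SP B J') N.
  (* A tree has one edge fewer than vertices; this is what makes [k] the top degree. *)
  have cB : #|B|.-1 = #|J :&: B|.
    rewrite (cardsD1 r B) rB; apply: eq_card => x; rewrite !inE.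
    case: (eqVneq x r) => [->|xr] /=; first by rewrite (negbTE rJ).
    case: (boolP (root x == r)) => xB; rewrite ?andbF// andbT.
    by rewrite (comp_J _ xr)// inE.
  have kT : k = top d B J' by rewrite /top cB cardsID.
  have cN : coc (SP B J') N by apply: coc_sum => t ht; apply: pb_coc hy; exact: rpS.
  have iN p q : p \in B -> q \in B -> nul (SP B J') (pb (rsw p q) N - N).
    move=> pB qB; have htp : perm_on B (tperm p q).
      by apply/fintype.subsetP => x; rewrite inE; case: tpermP => [->|->|]; rewrite ?eqxx.
    rewrite (_ : pb _ N = N) ?subrr; first exact: nul0.
    rewrite /N rsw_rp pb_sum [RHS](reindex_inj (mulIg (tperm p q))) /=.
    apply: eq_big => [t|t _]; last by rewrite pb_rp.
    apply/idP/idP => h; first exact: perm_onM.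
    by rewrite -[t](mulgK (tperm p q)); apply: perm_onM => //; exact: perm_onV.
  case: hB => -[od cB2]; first exact: (inv_odd d2 od cB2 dj kT cN iN).
  exact: (inv_even d2 od cB2 dj kT cN iN).
rewrite (_ : symA B _ = pb (Kmap f J') N); first exact: pb_nul mH hN.
rewrite /N pb_sum; apply: eq_bigr => t ht.
by rewrite EG -pb_comp !pb_comp -!pb_comp !pb_comp -rpH.
Qed.

(** The permutation [t] exchanges the two trees. On the edge vectors this is the exchange of two
    sphere factors, which acts by -1 for even [d]. *)
Lemma pair_comp_nul r1 r2 k (c : cochain k) : ~~ odd d -> k = (#|J| * (d - 1))%N -> coc (XJ J) c ->
  r1 \notin J -> r2 \notin J -> r1 != r2 -> #|comp r1| = 2%N -> #|comp r2| = 2%N ->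
  exists t, [/\ perm_on (comp r1 :|: comp r2) t & nul C (pb (Gmap f J) c + pb (rp t) (pb (Gmap f J) c))].
Proof.
move=> ed kE hc r1J r2J r12 c1 c2.
have mk r : r \notin J -> #|comp r| = 2%N -> exists m, [/\ m \in J, f m = r & comp r = [set r; m]%SET].
  move=> rJ cr; have rB : r \in comp r by rewrite inE root_id.
  have : #|comp r :\ r| = 1%N by move: cr; rewrite (cardsD1 r) rB => -[].
  move/eqP/cards1P => [m hm]; exists m.
  have mB : m \in comp r :\ r by rewrite hm inE.
  have [mr mB'] : m != r /\ m \in comp r by move: mB; rewrite !inE => /andP[].
  have mJ := comp_J mB' mr; split=> //; last by rewrite -hm finset.setD1K.
  apply/eqP; case: (eqVneq (f m) r) => // fr.
  have : f m \in comp r :\ r by rewrite finset.in_setD1 fr comp_parent.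
  by rewrite hm inE => /eqP e; have := fJ mJ; rewrite e ltnn.
have [m1 [m1J f1 B1]] := mk r1 r1J c1; have [m2 [m2J f2 B2]] := mk r2 r2J c2.
have R1 : root m1 = r1 by rewrite -root_parent// f1 root_id.
have R2 : root m2 = r2 by rewrite -root_parent// f2 root_id.
have m12 : m1 != m2 by apply: contra_neq r12 => e; rewrite -R1 -R2 e.
have m1r1 : m1 != r1 by apply: contraNneq r1J => <-.
have m1r2 : m1 != r2 by apply: contraNneq r2J => <-.
have m2r1 : m2 != r1 by apply: contraNneq r1J => <-.
have m2r2 : m2 != r2 by apply: contraNneq r2J => <-.
pose t := (tperm r1 r2 * tperm m1 m2)%g.
have t1 : t r1 = r2 by rewrite permM tpermL tpermD.
have t2 : t r2 = r1 by rewrite permM tpermR tpermD.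
have t3 : t m1 = m2 by rewrite permM [tperm r1 r2 _]tpermD 1?eq_sym// tpermL.
have t4 : t m2 = m1 by rewrite permM [tperm r1 r2 _]tpermD 1?eq_sym// tpermR.
have t5 x : x \notin comp r1 -> x \notin comp r2 -> t x = x.
  rewrite B1 B2 !inE !negb_or => /andP[a1 a2] /andP[a3 a4].
  by rewrite permM !tpermD 1?eq_sym.
exists t; split.
  apply/fintype.subsetP => x; rewrite inE; apply: contraNT; rewrite finset.in_setU negb_or => /andP[x1 x2].
  by rewrite t5.
have E : Gmap f J \o rp t = @rsw n d m1 m2 \o Gmap f J.
  apply: funext => u; apply: row_ext => x /=; rewrite row_rsw !row_Gmap !row_rp.
  case: tpermP => [->|->|/eqP x1 /eqP x2]; first by rewrite m1J m2J f1 f2 t1 t3.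
    by rewrite m1J m2J f1 f2 t2 t4.
  case: (boolP (x \in J)) => // xJ.
  have xB1 : x \notin comp r1 by rewrite B1 !inE negb_or (negbTE x1) andbT; apply: contraTneq xJ => ->.
  have xB2 : x \notin comp r2 by rewrite B2 !inE negb_or (negbTE x2) andbT; apply: contraTneq xJ => ->.
  by rewrite !t5// comp_parent.
have := pb_nul (Gmap_XJ fJ (subxx J)) (swapJ d2 kE hc m1J m2J m12).
rewrite -signr_odd (negbTE ed) scc1 pb_comp E pbD pb_comp.
by rewrite addrC.
Qed.

End Roots.

End Injectivity.

(** * Vanishing, antisymmetry and finiteness for configuration spaces *)

Section ConfTheorems.
Variables (n d : nat).
Hypothesis d2 : (2 <= d)%N.
Notation cochain := (cochain n d).
Notation C := (@conf n d).
Implicit Types (A B J : {set 'I_n}) (f : 'I_n -> 'I_n) (s t : 'S_n).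

(* The product of the [1 - P_a] for [a] in [l]. *)
Definition killA (l : seq 'I_n) k (c : cochain k) : cochain k :=
  foldr (fun a x => x - pb (far d2 a) x) c l.

Lemma killAD l k (c c' : cochain k) : killA l (c + c') = killA l c + killA l c'.
Proof. by elim: l => //= a l ->; rewrite pbD opprD addrACA. Qed.

Lemma killAB l k (c c' : cochain k) : killA l (c - c') = killA l c - killA l c'.
Proof. by elim: l => //= a l ->; rewrite pbB !opprD !opprK [RHS]addrACA. Qed.

Lemma killA0 l k : killA l (0 : cochain k) = 0.
Proof. by have := killAB l (0 : cochain k) 0; rewrite !subrr. Qed.

Lemma killA_nul l k (c : cochain k) : nul C c -> nul C (killA l c).
Proof.
elim: l => //= a l IH /IH h; apply: nulB => //; apply: pb_nul h; exact: far_mapto.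
Qed.

Lemma killA_fixed (l : seq 'I_n) k (c : cochain k) : (forall a, a \in l -> nul C (pb (far d2 a) c)) ->
  nul C (killA l c - c).
Proof.
elim: l => [|a l IH] h /=; first by rewrite subrr; exact: nul0.
have h1 := IH (fun b bl => h b (mem_behead (s := a :: l) bl)).
have h2 := pb_nul (@far_mapto _ _ d2 a) h1.
have := nulB h1 (nulD h2 (h a (mem_head _ _))); apply: nul_ext => x _.
change (killA l c x - c x - (pb (far d2 a) (killA l c) x - pb (far d2 a) c x + pb (far d2 a) c x) =
  killA l c x - pb (far d2 a) (killA l c) x - c x); ring.
Qed.

Lemma killA_mono (l : seq 'I_n) f J k (c : cochain k) : k = (#|J| * (d - 1))%N -> forest f J -> coc (XJ J) c ->
  nul C (killA l (pb (Gmap f J) c) - (if has (isolated f J) l then 0 else pb (Gmap f J) c)).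
Proof.
move=> kE fJ hc; elim: l => [|a l IH] /=; first by rewrite subrr; exact: nul0.
set g := pb (Gmap f J) c in IH *.
have h2 := pb_nul (@far_mapto _ _ d2 a) IH.
case: ifP IH h2 => hl IH h2.
  rewrite orbT; have := nulB IH h2; apply: nul_ext => x _; rewrite pbB pb0.
  by rewrite !subr0.
rewrite orbF; case: (boolP (isolated f J a)) => ha.
  have := nulB IH h2; rewrite pbB /g far_isolated//; apply: nul_ext => x _.
  set K := killA l _; set G := pb (Gmap f J) c.
  change (K x - G x - (pb (far d2 a) K x - G x) = K x - pb (far d2 a) K x - 0); ring.
have := nulB IH (nulD h2 (far_linked d2 kE fJ hc ha)); apply: nul_ext => x _.
change (killA l g x - g x - (pb (far d2 a) (killA l g) x - pb (far d2 a) g x + pb (far d2 a) g x) =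
  killA l g x - pb (far d2 a) (killA l g) x - g x); ring.
Qed.

Lemma symA_sub A B k (c : cochain k) : B \subset A -> nul C (symA B c) -> nul C (symA A c).
Proof.
move=> BA h; apply: (@symA_kill n d A [set t | perm_on B t]%SET).
- by move=> t; rewrite inE => ht; exact: fintype.subset_trans BA.
- by apply/card_gt0P; exists 1%g; rewrite inE perm_on1.
by rewrite (eq_bigl (fun t => perm_on B t))// => t; rewrite inE.
Qed.

(** Without isolated points in [A], every tree counted by [card_good] has at least two vertices. The
    count gives one such tree for odd [d] and two for even [d]; in the even case one of them has
    three vertices, or both are pairs and their exchange negates the class. *)
Lemma mono_sym_nul i A f J k (c : cochain k) : k = (#|J| * (d - 1))%N -> #|J| = i -> forest f J -> coc (XJ J) c ->
  (i + (if odd d then 0 else 1) < #|A|)%N -> (forall a, a \in A -> ~~ isolated f J a) ->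
  nul C (symA A (pb (Gmap f J) c)).
Proof.
move=> kE Ji fJ hc hA hi.
have := card_good f J A; set g := finset _ => hg; rewrite Ji in hg.
have gP r : r \in g -> [/\ r \in A, r \notin J & comp f J r \subset A].
  by rewrite inE finset.in_setD => /andP[/andP[-> ->] ->].
have one r : r \in g -> (odd d /\ (1 < #|comp f J r|)%N) \/ (~~ odd d /\ (2 < #|comp f J r|)%N) ->
    nul C (symA A (pb (Gmap f J) c)).
  by move=> /gP [rA rJ BA] h; apply: (symA_sub BA); exact: comp_sym_nul.
have big r : r \in g -> (1 < #|comp f J r|)%N by move=> /gP [rA rJ _]; apply: comp_card => //; exact: hi.
case: (boolP (odd d)) hA => od hA.
  have /card_gt0P [r rg] : (0 < #|g|)%N by lia.
  by apply: (one r rg); left; split=> //; exact: big.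
have /card_gt1P [r1 [r2 [r1g r2g r12]]] : (1 < #|g|)%N by lia.
have [h1|h1] := ltnP 2 #|comp f J r1|; first by apply: (one r1 r1g); right.
have [h2|h2] := ltnP 2 #|comp f J r2|; first by apply: (one r2 r2g); right.
have [_ r1J B1] := gP r1 r1g; have [_ r2J B2] := gP r2 r2g.
have c1 : #|comp f J r1| = 2%N by apply/eqP; rewrite eqn_leq h1 big.
have c2 : #|comp f J r2| = 2%N by apply/eqP; rewrite eqn_leq h2 big.
have [t [ht hn]] := pair_comp_nul d2 fJ od kE hc r1J r2J r12 c1 c2.
have htA : perm_on A t by apply: fintype.subset_trans ht _; rewrite finset.subUset B1.
by apply: nul_opp; have := symA_nul A hn; rewrite symAD symA_rp.
Qed.

(** The product of the [1 - P_a] fixes [c] up to a coboundary, and symmetrization multiplies it by a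
    positive number. The composite of the two kills every forest class: those with an isolated point
    in [A] by the product, the others by [mono_sym_nul]. *)
Theorem conf_inj i A k (c : cochain k) : k = (i * (d - 1))%N -> coc C c ->
  (i + (if odd d then 0 else 1) < #|A|)%N ->
  (forall s, perm_on A s -> nul C (pb (rp s) c - c)) ->
  (forall a, a \in A -> nul C (pb (far d2 a) c)) -> nul C c.
Proof.
move=> kE hc hA hs hf.
have Q : nul C (symA A (killA (enum A) c)).
  apply: (@conf_span n d d2 i k (fun x => nul C (symA A (killA (enum A) x)))) hc => //.
  - by rewrite killA0; apply: symA_nul; exact: nul0.
  - by move=> x y hx hy; rewrite killAD symAD; exact: nulD.
  - move=> x y hxy hy; have := nulD (symA_nul A (killA_nul (enum A) hxy)) hy.
    by rewrite -symAD killAB subrK.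
  move=> f J x fJ Ji hx; have kJ : k = (#|J| * (d - 1))%N by rewrite Ji.
  have := symA_nul A (killA_mono (enum A) kJ fJ hx).
  set g := pb _ x; set z := (if _ then _ else _) => h.
  suff h2 : nul C (symA A z) by have := nulD h h2; rewrite -symAD subrK.
  rewrite /z; case: hasP => [_|hh]; first by apply: symA_nul; exact: nul0.
  apply: (mono_sym_nul kJ Ji fJ hx hA) => a aA; apply/negP => ha; apply: hh; exists a => //.
  by rewrite mem_enum.
have h1 : nul C (symA A c).
  have hfl a : a \in enum A -> nul C (pb (far d2 a) c) by rewrite mem_enum; exact: hf.
  have := nulB Q (symA_nul A (killA_fixed hfl)); apply: nul_ext => x _.
  have := symAD A (killA (enum A) c - c) c; rewrite subrK => ->.
  set S := symA A (_ - _); change (S x + symA A c x - S x = symA A c x); ring.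
pose S := [set s | perm_on A s]%SET.
have h2 : nul C (symA A c - c *+ #|S|).
  rewrite -sumr_const (_ : symA A c = \sum_(s in S) pb (rp s) c).
    by rewrite -sumrB; apply: nul_sum => s; rewrite inE; exact: hs.
  by apply: eq_bigl => s; rewrite inE.
have := nulB h1 h2; rewrite opprB addrC subrK natr_scc; apply: nulZI.
by rewrite pnatr_eq0 -lt0n; apply/card_gt0P; exists 1%g; rewrite inE perm_on1.
Qed.

Theorem conf_antisym (cl : 'I_n -> nat) N i k (c : cochain k) : k = (i * (d - 1))%N -> coc C c ->
  (forall m, (cl m < N)%N) -> (2 * i + N < n)%N ->
  nul C (\sum_(s : 'S_n | [forall m, cl (s m) == cl m]) scc ((-1) ^+ odd_perm s) (pb (rp s) c)).
Proof.
move=> kE hc clN hN; pose K (x : cochain k) :=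
  \sum_(s : 'S_n | [forall m, cl (s m) == cl m]) scc ((-1) ^+ odd_perm s) (pb (rp s) x).
have KD x y : K (x + y) = K x + K y.
  by rewrite /K -big_split; apply: eq_bigr => s _; rewrite pbD sccDr.
have Kn x : nul C x -> nul C (K x).
  by move=> h; apply: nul_sum => s _; apply: nulZ; apply: pb_nul h; exact: rp_conf.
apply: (@conf_span n d d2 i k (fun x => nul C (K x))) hc => //.
- by apply: Kn; exact: nul0.
- by move=> x y hx hy; rewrite KD; exact: nulD.
- by move=> x y hxy hy; have := nulD (Kn _ hxy) hy; rewrite -KD subrK.
move=> f J x fJ Ji hx; set g := pb _ x.
pose iso := [set a | isolated f J a]%SET.
(* Each of the [i] edges has two ends, so at most [2 * i] points are not isolated. *)
have ciso : (n - 2 * i <= #|iso|)%N.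
  have : (#|~: iso| <= 2 * i)%N.
    apply: (@leq_trans #|J :|: f @: J|).
      apply/subset_leq_card/fintype.subsetP => a; rewrite !inE negb_and negbK => /orP[->//|].
      rewrite negb_forall => /existsP [m]; rewrite negb_imply negbK => /andP[mJ /eqP <-].
      by rewrite imset_f ?orbT.
    apply: leq_trans (leq_card_setU _ _) _; rewrite mul2n -addnn leq_add// ?Ji//.
    by rewrite -Ji leq_imset_card.
  have := cardsC iso; rewrite card_ord; lia.
have [p [q [pI qI pq clpq]]] : exists p q, [/\ p \in iso, q \in iso, p != q & cl p = cl q].
  pose h (a : 'I_n) : 'I_N := Ordinal (clN a).
  have : ~~ injectiveb (fun x : {a | a \in iso} => h (sval x)).
    apply/negP => /injectiveP/leq_card; rewrite card_ord.
    have -> : #|{: {a | a \in iso}}| = #|iso| by rewrite card_sig; apply: eq_card => y; rewrite !inE.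
    by move: ciso hN; lia.
  move/injectivePn => [[p pI] [[q qI] pq e]]; exists p, q; split=> //; last by have := congr1 val e.
pose t := tperm p q.
have tg : pb (rp t) g = g.
  rewrite /g pb_comp; apply: (congr1 (fun h => pb h x)); apply: funext => u; apply: row_ext => m /=.
  rewrite !row_Gmap !row_rp; case: (boolP (m \in J)) => // mJ.
  have ne a : a \in iso -> (a != m) && (a != f m).
    rewrite inE => /andP[aJ /forallP h]; have := h m; rewrite mJ /= eq_sym => ->; rewrite andbT.
    by apply: contraNneq aJ => ->.
  by have /andP[a1 a2] := ne p pI; have /andP[a3 a4] := ne q qI; rewrite !tpermD.
apply: nul_opp; rewrite (_ : K g + K g = 0); first exact: nul0.
rewrite {1}/K (reindex_inj (mulgI t)) /= -[X in X + _]opprK -sumrN.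
rewrite [X in - X](_ : _ = K g) ?addNr//; apply: eq_big => [s|s _].
  have tc m : cl (t m) = cl m by rewrite /t; case: tpermP => [->|->|].
  apply/forallP/forallP => h m; have := h (t m); rewrite permM ?tpermK ?tc //.
rewrite odd_permM odd_tperm pq -pb_rp tg -sccN1 sccA; congr (scc _ _).
by case: (odd_perm s); rewrite /= ?expr0 ?expr1 ?mulN1r ?opprK.
Qed.

(** The top cohomology of [XJ J] is spanned by one class, so each forest contributes one class up to
    scalars, and there are finitely many pairs [(f, J)]. *)
Theorem conf_finite i k : k = (i * (d - 1))%N -> exists (T : finType) (b : T -> cochain k),
  (forall j, coc C (b j)) /\
  forall c, coc C c -> exists a : T -> rat, nul C (c - \sum_j scc (a j) (b j)).
Proof.
move=> kE.
have H J : exists om : cochain k, coc (XJ J) om /\ (#|J| = i ->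
    forall c, coc (XJ J) c -> exists lam, nul (XJ J) (c - scc lam om)).
  case: (eqVneq #|J| i) => [Ji|Ji]; last by exists 0; split; [exact: coc0|move=> E; rewrite E eqxx in Ji].
  by subst k; rewrite -Ji; have [om [h1 h2]] := topJ d2 J; exists om.
have [om hom] := choice H.
pose T : finType := ({ffun 'I_n -> 'I_n} * {set 'I_n})%type.
pose fo (x : T) := [forall m, (m \in x.2) ==> (x.1 m < m)%N] && (#|x.2| == i).
pose b (x : T) : cochain k := if fo x then pb (Gmap x.1 x.2) (om x.2) else 0.
have foP x : fo x -> forest x.1 x.2 by move=> /andP[/forallP h _] m mJ; have := h m; rewrite mJ.
exists T, b; split.
  move=> x; rewrite /b; case: ifP => [/foP h|_]; last exact: coc0.
  by apply: pb_coc (Gmap_XJ h (subxx _)) _; have [] := hom x.2.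
move=> c hc; apply: (@conf_span n d d2 i k (fun c => exists a : T -> rat, nul C (c - \sum_j scc (a j) (b j)))) hc => //.
- exists (fun=> 0); rewrite big1 ?subr0; first exact: nul0.
  by move=> x _; rewrite scc0.
- move=> x y [a ha] [a' ha']; exists (fun j => a j + a' j).
  rewrite (eq_bigr (fun j => scc (a j) (b j) + scc (a' j) (b j))); last by move=> j _; rewrite sccDl.
  by rewrite big_split opprD addrACA; exact: nulD.
- by move=> x y hxy [a ha]; exists a; exact: nul_trans hxy ha.
move=> f J x fJ Ji hx; have [h1 /(_ Ji x hx) [lam hl]] := hom J.
pose z : T := ([ffun m => f m], J).
have Ef : Gmap z.1 z.2 = @Gmap n d f J.
  by apply: funext => u; apply: row_ext => m; rewrite !row_Gmap /= ffunE.
have foz : fo z by rewrite /fo /= Ji eqxx andbT; apply/forallP => m; apply/implyP => /fJ; rewrite ffunE.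
exists (fun j => if j == z then lam else 0).
rewrite (bigD1 z)//= eqxx big1; last by move=> j /negbTE ->; rewrite scc0.
by rewrite addr0 /b foz Ef -pbZ -pbB; apply: pb_nul hl; exact: Gmap_XJ.
Qed.

End ConfTheorems.

(** * Specht modules and highest weight vectors *)

Section GroupSums.
Variables (n : nat) (V : lmodType rat) (act : 'S_n -> V -> V).
Hypothesis act_lin : forall s a u v, act s (a *: u + v) = a *: act s u + act s v.
Hypothesis act1 : forall v, act 1%g v = v.
Hypothesis actM : forall s t v, act s (act t v) = act (t * s)%g v.
Implicit Types (X Y : {set 'I_n}) (s t : 'S_n).

Lemma actD s u v : act s (u + v) = act s u + act s v.
Proof. by rewrite -[u in LHS]scale1r act_lin scale1r. Qed.

Lemma act0 s : act s 0 = 0.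
Proof. by apply: (addIr (act s 0)); rewrite -actD addr0 add0r. Qed.

Lemma actZ s a v : act s (a *: v) = a *: act s v.
Proof. by rewrite -[a *: v in LHS]addr0 act_lin act0 addr0. Qed.

Lemma actN s v : act s (- v) = - act s v.
Proof. by rewrite -scaleN1r actZ scaleN1r. Qed.

Lemma actB s u v : act s (u - v) = act s u - act s v.
Proof. by rewrite actD actN. Qed.

Lemma act_sum s (I : Type) (r : seq I) (P : pred I) (F : I -> V) :
  act s (\sum_(i <- r | P i) F i) = \sum_(i <- r | P i) act s (F i).
Proof. by elim/big_rec2: _ => [|i x y _ <-]; rewrite ?act0 ?actD. Qed.

Definition twsum (H : pred 'S_n) (ch : 'S_n -> rat) (v : V) : V := \sum_(s | H s) ch s *: act s v.

Lemma twsumD H ch u v : twsum H ch (u + v) = twsum H ch u + twsum H ch v.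
Proof. by rewrite /twsum -big_split; apply: eq_bigr => s _; rewrite actD scalerDr. Qed.

Lemma twsumZ H ch a v : twsum H ch (a *: v) = a *: twsum H ch v.
Proof. by rewrite /twsum scaler_sumr; apply: eq_bigr => s _; rewrite actZ !scalerA mulrC. Qed.

Lemma twsum0 H ch : twsum H ch 0 = 0.
Proof. by apply: (addIr (twsum H ch 0)); rewrite -twsumD addr0 add0r. Qed.

Lemma twsumN H ch v : twsum H ch (- v) = - twsum H ch v.
Proof. by rewrite -scaleN1r twsumZ scaleN1r. Qed.

Lemma twsum_sum H ch (I : Type) (r : seq I) (P : pred I) (F : I -> V) :
  twsum H ch (\sum_(i <- r | P i) F i) = \sum_(i <- r | P i) twsum H ch (F i).
Proof. by elim/big_rec2: _ => [|i x y _ <-]; rewrite ?twsum0 ?twsumD. Qed.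

Lemma twsum_act H ch t v : (forall s, H (t * s)%g = H s) -> (forall s, ch (t * s)%g = ch t * ch s) ->
  twsum H ch v = ch t *: twsum H ch (act t v).
Proof.
move=> hH hc; rewrite /twsum (reindex_inj (mulgI t)) /= scaler_sumr.
by apply: eq_big => [s|s _]; rewrite ?hH// hc actM scalerA.
Qed.

Lemma act_twsum H ch t v : (forall s, H (s * t)%g = H s) -> (forall s, ch (s * t)%g = ch s * ch t) ->
  twsum H ch v = ch t *: act t (twsum H ch v).
Proof.
move=> hH hc; rewrite {1}/twsum (reindex_inj (mulIg t)) /= /twsum act_sum scaler_sumr.
by apply: eq_big => [s|s _]; rewrite ?hH// hc actZ actM scalerA mulrC.
Qed.

(** Sorts [H'] by the image of [x]: the elements sending [x] to [a] form the coset of [H] given by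
    [tperm a x]. *)
Lemma twsum_coset (H H' : pred 'S_n) ch (x : 'I_n) Y v :
  (forall s t, ch (s * t)%g = ch s * ch t) -> (forall g, H' g -> g x \in Y) ->
  (forall a g, a \in Y -> H' g && (g x == a) = H (g * tperm a x)%g) ->
  twsum H' ch v = \sum_(a in Y) ch (tperm a x) *: act (tperm a x) (twsum H ch v).
Proof.
move=> hc hY hH; rewrite /twsum (partition_big (fun g : 'S_n => g x) (fun a => a \in Y)) //=.
apply: eq_bigr => a aY; rewrite act_sum scaler_sumr.
rewrite (reindex_inj (mulIg (tperm a x))) /=; apply: eq_big => [g|g _].
  by rewrite hH// -mulgA tperm2 mulg1.
by rewrite hc actZ actM scalerA mulrC.
Qed.

Lemma twsum_comm (H H' : pred 'S_n) ch ch' v : (forall s t, H s -> H' t -> (s * t = t * s)%g) ->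
  twsum H ch (twsum H' ch' v) = twsum H' ch' (twsum H ch v).
Proof.
move=> h; rewrite /twsum.
rewrite (eq_bigr (fun s => \sum_(t | H' t) (ch s * ch' t) *: act (t * s)%g v)); last first.
  by move=> s _; rewrite act_sum scaler_sumr; apply: eq_bigr => t _; rewrite actZ actM scalerA.
rewrite exchange_big /=; apply: eq_bigr => t Ht.
rewrite act_sum scaler_sumr; apply: eq_bigr => s Hs.
by rewrite actZ actM scalerA mulrC h.
Qed.

Lemma perm_onMr X s t : perm_on X t -> perm_on X (s * t)%g = perm_on X s.
Proof.
move=> ht; apply/idP/idP => h; last exact: perm_onM.
by rewrite -[s](mulgK t); apply: perm_onM => //; exact: perm_onV.
Qed.

Lemma perm_on_disj X Y s t : perm_on X s -> perm_on Y t -> (forall x, x \in X -> x \notin Y) -> (s * t = t * s)%g.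
Proof.
move=> hs ht XY; apply/permP => x; rewrite !permM; case: (boolP (x \in X)) => xX.
  by rewrite (out_perm ht (XY _ xX)) (out_perm ht (XY _ _)) ?perm_closed.
rewrite (out_perm hs xX); case: (boolP (x \in Y)) => xY; last by rewrite (out_perm ht xY) (out_perm hs xX).
rewrite (out_perm hs)//; apply/negP => /XY; rewrite perm_closed// xY.
by [].
Qed.

Lemma perm_on_tperm X a b : a \in X -> b \in X -> perm_on X (tperm a b).
Proof. by move=> aX bX; apply/fintype.subsetP => x; rewrite inE; case: tpermP => [->|->|]; rewrite ?eqxx. Qed.

Definition sym X : V -> V := twsum (perm_on X) (fun=> 1).
Definition symcard X : rat := (#|[pred s | perm_on X s]|)%:R.

Lemma symcard_neq0 X : symcard X != 0.
Proof. by rewrite pnatr_eq0 -lt0n; apply/card_gt0P; exists 1%g; rewrite inE perm_on1. Qed.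

Lemma symE X v : sym X v = \sum_(s | perm_on X s) act s v.
Proof. by apply: eq_bigr => s _; rewrite scale1r. Qed.

Lemma sym_act X t v : perm_on X t -> sym X (act t v) = sym X v.
Proof.
move=> ht; rewrite [RHS](twsum_act (t := t)) ?scale1r// => s; rewrite ?mul1r//.
exact: perm_onMl.
Qed.

Lemma act_sym X t v : perm_on X t -> act t (sym X v) = sym X v.
Proof.
move=> ht; rewrite {2}/sym [RHS](act_twsum (t := t)) ?scale1r// => s; rewrite ?mul1r//.
exact: perm_onMr.
Qed.

Lemma sym_fix X v : (forall s, perm_on X s -> act s v = v) -> sym X v = symcard X *: v.
Proof.
move=> h; rewrite symE (eq_bigr (fun=> v)) // sumr_const /symcard scaler_nat.
by [].
Qed.

Lemma sym_comp X Y v : Y \subset X -> sym X (sym Y v) = symcard Y *: sym X v.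
Proof.
move=> YX; rewrite (symE Y) /sym twsum_sum (eq_bigr (fun=> sym X v)) ?sumr_const ?scaler_nat//.
by move=> s hs; apply: sym_act; exact: fintype.subset_trans YX.
Qed.

Lemma sym_disj X Y v : (forall x, x \in X -> x \notin Y) -> sym X (sym Y v) = sym Y (sym X v).
Proof. by move=> XY; apply: twsum_comm => s t hs ht; exact: perm_on_disj XY. Qed.

Lemma act_sym_disj X t v Y : perm_on Y t -> (forall x, x \in X -> x \notin Y) -> act t (sym X v) = sym X (act t v).
Proof.
move=> ht XY; rewrite !symE act_sum; apply: eq_bigr => s hs.
by rewrite !actM (perm_on_disj hs ht XY).
Qed.

Lemma perm_on_coset (x : 'I_n) X a (g : 'S_n) : x \notin X -> a \in x |: X ->
  perm_on (x |: X) g && (g x == a) = perm_on X (g * tperm a x)%g.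
Proof.
move=> xX aX; have ht : perm_on (x |: X) (tperm a x) by apply: perm_on_tperm => //; rewrite !inE eqxx.
apply/andP/idP => [[hg /eqP gx]|h].
  have hgt : perm_on (x |: X) (g * tperm a x)%g by rewrite perm_onMr.
  apply/fintype.subsetP => y; rewrite inE => hy; have := fintype.subsetP hgt y; rewrite inE hy => /(_ isT).
  rewrite finset.in_setU1; case: (eqVneq y x) hy => [->|//]; by rewrite permM gx tpermL eqxx.
split.
  rewrite -(perm_onMr _ ht); apply: fintype.subset_trans h _; exact: finset.subsetUr.
have := out_perm h xX; rewrite permM => /(congr1 (tperm a x)); rewrite tpermK tpermR => ->.
by [].
Qed.

Lemma sym_U1 (x : 'I_n) X v : x \notin X -> (forall s, perm_on X s -> act s v = v) ->
  sym (x |: X) v = symcard X *: (v + \sum_(a in X) act (tperm a x) v).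
Proof.
move=> xX hv; rewrite {1}/sym (@twsum_coset (perm_on X) _ _ x (x |: X)).
- rewrite big_setU1//= tperm1 act1 -/(sym X v) sym_fix// scale1r scalerDr scaler_sumr.
  by congr (_ + _); apply: eq_bigr => a _; rewrite scale1r actZ.
- by move=> s t; rewrite mulr1.
- by move=> g hg; rewrite perm_closed// !inE eqxx.
by move=> a g aX; exact: perm_on_coset.
Qed.

End GroupSums.

(** * Polytabloids and the Young symmetrizer *)

Section Tableau.
Variables (n : nat) (row col : 'I_n -> nat).
Hypothesis rc_inj : forall a b, row a = row b -> col a = col b -> a = b.
Hypothesis rc_up : forall m k, (k <= row m)%N -> exists m', row m' = k /\ col m' = col m.
Hypothesis rc_left : forall m c, (c <= col m)%N -> exists m', row m' = row m /\ col m' = c.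
Implicit Types (X Y : {set 'I_n}) (s t q r : 'S_n) (T : 'I_n -> nat).

Definition psgn s : rat := (-1) ^+ odd_perm s.
Definition colperm q := [forall m, col (q m) == col m].
Definition rowperm' r := [forall m, row (r m) == row m].
Definition rowset k : {set 'I_n} := [set a | row a == k]%SET.

Lemma psgnM s t : psgn (s * t)%g = psgn s * psgn t.
Proof. by rewrite /psgn odd_permM signr_addb. Qed.

Lemma psgn1 : psgn 1%g = 1. Proof. by rewrite /psgn odd_perm1 expr0. Qed.

Lemma psgnV s : psgn s^-1%g = psgn s. Proof. by rewrite /psgn odd_permV. Qed.

Lemma psgn_sq s : psgn s * psgn s = 1.
Proof. by rewrite -psgnM /psgn odd_permM addbb expr0. Qed.

Lemma psgn_tperm a b : a != b -> psgn (tperm a b) = -1.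
Proof. by move=> h; rewrite /psgn odd_tperm h expr1. Qed.

Lemma colpermP q : reflect (forall m, col (q m) = col m) (colperm q).
Proof. by apply: (iffP forallP) => h m; apply/eqP; rewrite h. Qed.

Lemma rowpermP r : reflect (forall m, row (r m) = row m) (rowperm' r).
Proof. by apply: (iffP forallP) => h m; apply/eqP; rewrite h. Qed.

Lemma colpermMr t s : colperm t -> colperm (s * t)%g = colperm s.
Proof.
move=> /colpermP ht; apply/colpermP/colpermP => h m; last by rewrite permM ht h.
by rewrite -ht -permM h.
Qed.

Lemma colpermMl t s : colperm t -> colperm (t * s)%g = colperm s.
Proof.
move=> /colpermP ht; apply/colpermP/colpermP => h m; last by rewrite permM h ht.
by have := h (t^-1%g m); rewrite permM permKV -(ht (t^-1%g m)) permKV.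
Qed.

Lemma colpermV q : colperm q^-1%g = colperm q.
Proof. by apply/colpermP/colpermP => h m; [rewrite -{2}(permK q m) h|rewrite -{2}(permKV q m) h]. Qed.

Lemma rowpermMl t s : rowperm' t -> rowperm' (t * s)%g = rowperm' s.
Proof.
move=> /rowpermP ht; apply/rowpermP/rowpermP => h m; last by rewrite permM h ht.
by have := h (t^-1%g m); rewrite permM permKV -(ht (t^-1%g m)) permKV.
Qed.

Lemma rowpermMr t s : rowperm' t -> rowperm' (s * t)%g = rowperm' s.
Proof.
move=> /rowpermP ht; apply/rowpermP/rowpermP => h m; last by rewrite permM ht h.
by rewrite -ht -permM h.
Qed.

Lemma rowpermV q : rowperm' q^-1%g = rowperm' q.
Proof. by apply/rowpermP/rowpermP => h m; [rewrite -{2}(permK q m) h|rewrite -{2}(permKV q m) h]. Qed.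

Lemma colperm1 : colperm 1%g. Proof. by apply/colpermP => m; rewrite perm1. Qed.
Lemma rowperm1 : rowperm' 1%g. Proof. by apply/rowpermP => m; rewrite perm1. Qed.

Lemma rowcol1 q : rowperm' q -> colperm q -> q = 1%g.
Proof. by move=> /rowpermP h1 /colpermP h2; apply/permP => m; rewrite perm1; apply: rc_inj. Qed.

(* The coefficient of the tabloid [T] in the polytabloid of the standard numbering. *)
Definition eT T : rat := \sum_(q | colperm q && [forall m, row (q^-1%g m) == T m]) psgn q.

Lemma eT_col T q0 : colperm q0 -> eT (T \o q0) = psgn q0 * eT T.
Proof.
move=> h; rewrite /eT mulr_sumr (reindex_inj (mulIg q0^-1%g)) /=.
have h' : colperm q0^-1%g by rewrite colpermV.
apply: eq_big => [q|q _]; last by rewrite psgnM psgnV mulrC.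
rewrite colpermMr//; congr (_ && _); apply/forallP/forallP => H m.
  by have := H (q0^-1%g m); rewrite permKV invMg invgK permM permKV.
by rewrite invMg invgK permM; apply: H.
Qed.

Lemma eT_row : eT row = 1.
Proof.
rewrite /eT (bigD1 1%g) /=; last by rewrite colperm1; apply/forallP => m; rewrite invg1 perm1.
rewrite psgn1 big1 ?addr0// => q /andP[/andP[hc hr]] /eqP []; apply: rowcol1 => //.
by rewrite -rowpermV.
Qed.

Lemma eT_supp T : eT T != 0 -> exists g : 'S_n, T =1 row \o g.
Proof.
move=> h; case: (pickP (fun q => colperm q && [forall m, row (q^-1%g m) == T m])) => [q|h0].
  by move=> /andP[_ /forallP hq]; exists q^-1%g => m; apply/esym/eqP/hq.
by move: h; rewrite /eT big_pred0 ?eqxx.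
Qed.

Section ColumnSort.
Variables (T : 'I_n -> nat) (g : 'S_n).
Hypothesis Tg : T =1 row \o g.
Hypothesis Tinj : forall a b, col a = col b -> T a = T b -> a = b.

Let cT c j := #|[pred m | (col m == c) && (T m < j)%N]|.
Let cR c j := #|[pred m | (col m == c) && (row m < j)%N]|.

Let cTR c j : (cT c j <= cR c j)%N.
Proof.
case: (pickP (fun m => (col m == c) && (j <= row m)%N)) => [m /andP[/eqP mc mj]|h0]; last first.
  apply/subset_leq_card/fintype.subsetP => m; rewrite !inE => /andP[mc _]; rewrite mc /=.
  by have := h0 m; rewrite mc /= ltnNge => ->.
apply: (@leq_trans j).
  rewrite /cT cardE -(size_map T) -[X in (_ <= X)%N](size_iota 0 j); apply: uniq_leq_size.
    rewrite map_inj_in_uniq ?enum_uniq// => a b; rewrite !mem_enum !inE => /andP[/eqP ha _] /andP[/eqP hb _].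
    by apply: Tinj; rewrite ha hb.
  by move=> x /mapP [a]; rewrite mem_enum !inE => /andP[_ ha] ->; rewrite mem_iota.
rewrite /cR cardE -(size_map row) -[X in (X <= _)%N](size_iota 0 j); apply: uniq_leq_size; first exact: iota_uniq.
move=> x; rewrite mem_iota add0n /= => xj.
have [m' [mr mc']] := rc_up (leq_trans (ltnW xj) mj).
by apply/mapP; exists m' => //; rewrite mem_enum !inE mc' mc eqxx mr.
Qed.

Let total j : #|[pred m | (T m < j)%N]| = #|[pred m | (row m < j)%N]|.
Proof.
rewrite -(card_imset _ (@perm_inj _ g)); apply: eq_card => x; rewrite inE.
apply/imsetP/idP => [[m]|h]; first by rewrite !inE Tg /= => ? ->.
by exists (g^-1%g x); rewrite ?permKV// inE Tg /= permKV.
Qed.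

Let cTR_eq c j : cT c j = cR c j.
Proof.
pose N := (\sum_m col m).+1.
have cN m : (col m < N)%N by rewrite ltnS (bigD1 m)//= leq_addr.
have part (P : pred 'I_n) : #|P| = (\sum_(x < N) #|[pred m | (col m == x) && P m]|)%N.
  rewrite -sum1_card (partition_big (fun m => Ordinal (cN m)) xpredT)//=; apply: eq_bigr => x _.
  by rewrite -sum1_card; apply: eq_bigl => m; rewrite !inE andbC; congr (_ && _).
apply/eqP; rewrite eqn_leq cTR /= leqNgt; apply/negP => lt.
case: (ltnP c N) => cN'; last first.
  move: lt; rewrite /cR (@eq_card0 _ [pred m | _ & _]) // => m; rewrite inE.
  by apply/negbTE; rewrite negb_and; apply/orP; left; rewrite neq_ltn (leq_trans (cN m)).
have := total j; rewrite (part [pred m | (T m < j)%N]) (part [pred m | (row m < j)%N]).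
rewrite (bigD1 (Ordinal cN'))//= [RHS](bigD1 (Ordinal cN'))//=.
move=> e; have : (\sum_(x < N | x != Ordinal cN') #|[pred m | (col m == x) && (T m < j)]| <=
  \sum_(x < N | x != Ordinal cN') #|[pred m | (col m == x) && (row m < j)]|)%N.
  by apply: leq_sum => x _; exact: cTR.
rewrite leqNgt => /negP; apply; rewrite -(ltn_add2l (cR c j)) -[X in (X < _)%N]e ltn_add2r.
exact: lt.
Qed.

(** In each column the distinct values of [T] give at most as many entries below [j] as [row] does.
    Over all columns the counts agree because [T] rearranges [row], so they agree column by column
    and [T] takes the values of [row] in every column. *)
Lemma column_sort : exists2 q, colperm q & T =1 row \o q.
Proof.
have cell m : exists m', row m' = T m /\ col m' = col m.
  apply: contrapT => no.
  have big m' : col m' = col m -> (row m' < T m)%N.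
    move=> mc; rewrite ltnNge; apply/negP => h; have [x [x1 x2]] := rc_up h.
    by apply: no; exists x; rewrite x2.
  have := cTR_eq (col m) (T m); rewrite /cT /cR => e.
  have : (#|[pred x | (col x == col m) && (T x < T m)]| < #|[pred x | (col x == col m) && (row x < T m)]|)%N.
    apply: proper_card; apply/properP; split.
      by apply/fintype.subsetP => x; rewrite !inE => /andP[/eqP xc _]; rewrite xc eqxx big.
    by exists m; rewrite !inE eqxx ?big// ltnn.
  by rewrite e ltnn.
pose h m := odflt m [pick m' | (row m' == T m) && (col m' == col m)].
have hP m : row (h m) = T m /\ col (h m) = col m.
  rewrite /h; case: pickP => [x /andP[/eqP ? /eqP ?]//|no].
  by have [x [x1 x2]] := cell m; have := no x; rewrite x1 x2 !eqxx.
have hi : injective h.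
  move=> a b e; have [a1 a2] := hP a; have [b1 b2] := hP b.
  by apply: Tinj; [rewrite -a2 -b2 e|rewrite -a1 -b1 e].
exists (perm hi); first by apply/colpermP => m; rewrite permE; case: (hP m).
by move=> m; rewrite /= permE; case: (hP m).
Qed.

End ColumnSort.

(** The coefficients of the polytabloid after the Young symmetrizer has been applied to it. *)
Definition eK T : rat := \sum_(q | colperm q) \sum_(r | rowperm' r) psgn q * eT (T \o (r * q)%g).

Lemma eT_ext T T' : T =1 T' -> eT T = eT T'.
Proof. by move=> h; apply: eq_bigl => q; congr (_ && _); apply: eq_forallb => m; rewrite h. Qed.

Lemma eK_ext T T' : T =1 T' -> eK T = eK T'.
Proof. by move=> h; apply: eq_bigr => q _; apply: eq_bigr => r _; congr (_ * _); apply: eT_ext => m /=; rewrite h. Qed.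

Lemma eK_col T q0 : colperm q0 -> eK (T \o q0) = psgn q0 * eK T.
Proof.
move=> h; rewrite /eK mulr_sumr [RHS](reindex_inj (mulIg q0)) /=.
apply: eq_big => [q|q _]; first by rewrite colpermMr.
rewrite mulr_sumr; apply: eq_bigr => r _.
rewrite psgnM (mulrC (psgn q) (psgn q0)) !mulrA psgn_sq mul1r; congr (_ * _).
by apply: eT_ext => m /=; rewrite !permM.
Qed.

(** Both sides are antisymmetric under column permutations. If [T] repeats a value in a column, or
    does not rearrange [row], both vanish; otherwise [column_sort] reduces to [T = row]. *)
Lemma eKE T : eK T = eK row * eT T.
Proof.
have anti (F : ('I_n -> nat) -> rat) a b : (forall S q, colperm q -> F (S \o q) = psgn q * F S) ->
    (forall S S', S =1 S' -> F S = F S') ->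
    a != b -> col a = col b -> T a = T b -> F T = 0.
  move=> hF ext ab cab Tab; have hq : colperm (tperm a b).
    by apply/colpermP => m; case: tpermP => [->|->|].
  have := hF T _ hq; rewrite psgn_tperm// mulN1r (ext _ T); last first.
    by move=> m /=; case: tpermP => [->|->|].
  by move=> /eqP; rewrite -addr_eq0 -mulr2n mulrn_eq0 => /eqP.
case: (pselect (forall a b, col a = col b -> T a = T b -> a = b)) => [inj|ninj]; last first.
  have [a [b [ab cab Tab]]] : exists a b, [/\ a != b, col a = col b & T a = T b].
    apply: contrapT => no; apply: ninj => a b cab Tab; apply/eqP/negPn/negP => ab.
    by apply: no; exists a, b.
  rewrite (anti eK a b)//; [|exact: eK_col|exact: eK_ext].
  by rewrite (anti eT a b) ?mulr0//; [exact: eT_col|exact: eT_ext].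
case: (pselect (exists g : 'S_n, T =1 row \o g)) => [[g Tg]|no].
  have [q hq Tq] := column_sort Tg inj.
  by rewrite (eK_ext Tq) (eT_ext Tq) eK_col// eT_col// eT_row mulr1 mulrC.
have e0 : eT T = 0 by apply/eqP/negPn/negP => /eT_supp.
rewrite e0 mulr0 /eK big1// => q _; rewrite big1// => r _.
rewrite (_ : eT _ = 0) ?mulr0//; apply/eqP/negPn/negP => /eT_supp [g hg]; apply: no.
by exists ((r * q)^-1 * g)%g => m; have := hg ((r * q)^-1%g m); rewrite /= permKV permM.
Qed.

Definition eqrow (a b : 'S_n) : rat := [forall m, row (a m) == row (b m)]%:R.

Definition numR : rat := (#|[pred r | rowperm' r]|)%:R.

Lemma numR_neq0 : numR != 0.
Proof. by rewrite pnatr_eq0 -lt0n; apply/card_gt0P; exists 1%g; rewrite inE rowperm1. Qed.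

(** Splits a coincidence of tabloids into a sum of products, which is what produces the squares in
    [eK_row_neq0]. *)
Lemma eqrow_sum a b : numR * eqrow a b = \sum_g eqrow g a * eqrow g b.
Proof.
case: (boolP [forall m, row (a m) == row (b m)]) => [/forallP h|h].
  rewrite /eqrow (introT forallP h) mulr1 /numR -sum1_card natr_sum.
  rewrite [RHS](reindex_inj (mulgI a)) /= [LHS]big_mkcond /=.
  apply: eq_bigr => g _; rewrite !inE.
  have -> : [forall m, row ((a * g)%g m) == row (a m)] = rowperm' g.
    apply/forallP/forallP => H m; last by rewrite permM.
    by have := H (a^-1%g m); rewrite permM !permKV.
  have -> : [forall m, row ((a * g)%g m) == row (b m)] = rowperm' g.
    apply/forallP/forallP => H m; last by rewrite permM -(eqP (h m)).
    by have := H (a^-1%g m); rewrite permM -(eqP (h _)) !permKV.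
  by case: (rowperm' g); rewrite ?mulr1 ?mulr0.
rewrite {1}/eqrow (negbTE h) mulr0 big1// => g _; apply/eqP; rewrite mulf_eq0 !pnatr_eq0 !eqb0 -negb_and.
apply: contra h => /andP[/forallP h1 /forallP h2]; apply/forallP => m.
by rewrite -(eqP (h1 m)) (eqP (h2 m)).
Qed.

(* Up to the positive factor [numR ^+ 2], the scalar [eK row] is a sum of squares. *)
Lemma eK_row_neq0 : eK row != 0.
Proof.
pose Nf g := \sum_(q | colperm q) \sum_(r | rowperm' r) psgn q * eqrow g (r * q)%g.
have E : numR * (numR * eK row) = \sum_g Nf g * Nf g.
  have E1 : numR * eK row = \sum_(q | colperm q) \sum_(r | rowperm' r) \sum_(q' | colperm q') \sum_(r' | rowperm' r')
      psgn q * psgn q' * eqrow (r * q)%g (r' * q')%g.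
    rewrite /eK mulr_sumr; apply: eq_bigr => q _; rewrite mulr_sumr.
    have E2 r : rowperm' r -> numR * (psgn q * eT (row \o (r * q)%g)) = 
       \sum_(r' | rowperm' r') \sum_(q' | colperm q') psgn q * psgn q' * eqrow (r' * (r * q))%g (r' * q')%g.
      move=> _; rewrite /numR -sum1_card natr_sum mulr_suml; apply: eq_bigr => r' _.
      rewrite mul1r /eT mulr_sumr (reindex_inj invg_inj) /= big_mkcondr /=.
      apply: eq_big => [q'|q' _]; first by rewrite colpermV.
      rewrite psgnV; have -> : eqrow (r' * (r * q))%g (r' * q')%g = [forall m, row (q'^-1^-1%g m) == (row \o (r * q)%g) m]%:R.
        congr ((nat_of_bool _)%:R); apply/forallP/forallP => H m; first by have := H (r'^-1%g m); rewrite /= invgK !permM !permKV eq_sym.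
        by have := H (r' m); rewrite invgK /= !permM eq_sym.
      by case: [forall _, _]; rewrite ?mulr1 ?mulr0.
    rewrite (eq_bigr _ E2) exchange_big /=.
    transitivity (\sum_(r' | rowperm' r') \sum_(r | rowperm' r) \sum_(q' | colperm q')
       psgn q * psgn q' * eqrow (r * q)%g (r' * q')%g).
      apply: eq_bigr => r' hr'; rewrite [RHS](reindex_inj (mulgI r')) /=.
      by apply: eq_big => [r|r _]; [rewrite rowpermMl|apply: eq_bigr => q' _; rewrite mulgA].
    by rewrite exchange_big /=; apply: eq_bigr => r _; exact: exchange_big.
  rewrite E1 mulr_sumr /Nf.
  transitivity (\sum_(q | colperm q) \sum_(r | rowperm' r) \sum_(q' | colperm q') \sum_(r' | rowperm' r') \sum_g
    (psgn q * eqrow g (r * q)%g) * (psgn q' * eqrow g (r' * q')%g)).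
    apply: eq_bigr => q _; rewrite mulr_sumr; apply: eq_bigr => r _; rewrite mulr_sumr; apply: eq_bigr => q' _.
    rewrite mulr_sumr; apply: eq_bigr => r' _; rewrite mulrCA eqrow_sum mulr_sumr; apply: eq_bigr => g _.
    by rewrite mulrACA.
  rewrite (eq_bigr (fun q => \sum_g \sum_(r | rowperm' r) \sum_(q' | colperm q') \sum_(r' | rowperm' r')
    (psgn q * eqrow g (r * q)%g) * (psgn q' * eqrow g (r' * q')%g))); last first.
    move=> q _; rewrite [RHS]exchange_big /=; apply: eq_bigr => r _; rewrite [RHS]exchange_big /=.
    by apply: eq_bigr => q' _; rewrite [RHS]exchange_big.
  rewrite exchange_big /=; apply: eq_bigr => g _; rewrite mulr_suml; apply: eq_bigr => q _.
  rewrite mulr_suml; apply: eq_bigr => r _; rewrite mulr_sumr; apply: eq_bigr => q' _; by rewrite mulr_sumr.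
have N1 : Nf 1%g = numR.
  rewrite /Nf (bigD1 1%g) ?colperm1//= [X in _ + X]big1 ?addr0; last first.
    move=> q /andP[hq q1]; rewrite big1// => r hr; apply/eqP; rewrite mulf_eq0; apply/orP; right.
    rewrite pnatr_eq0 eqb0; apply: contra q1 => /forallP h; apply/eqP; apply: rowcol1 => //.
    rewrite -(rowpermMl q hr); apply/rowpermP => m; have := h m; rewrite perm1 => /eqP ->; by [].
  rewrite /numR -sum1_card natr_sum; apply: eq_bigr => r /rowpermP hr.
  rewrite psgn1 mul1r mulg1 /eqrow (_ : [forall _, _] = true)//.
  by apply/forallP => m; rewrite perm1 hr.
apply/eqP => h0; move: E; rewrite h0 !mulr0 => /esym/eqP.
rewrite psumr_eq0; last by move=> g _; rewrite -expr2 sqr_ge0.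
by move=> /allP /(_ 1%g (mem_index_enum _)); rewrite N1 /= mulf_eq0 orbb (negbTE numR_neq0).
Qed.

End Tableau.

(** * Highest weight vectors and homomorphisms from a Specht module *)

Section SpechtHom.
Variables (n : nat) (V : lmodType rat) (act : 'S_n -> V -> V).
Hypothesis act_lin : forall s a u v, act s (a *: u + v) = a *: act s u + act s v.
Hypothesis act1 : forall v, act 1%g v = v.
Hypothesis actM : forall s t v, act s (act t v) = act (t * s)%g v.
Variables (row col : 'I_n -> nat).
Hypothesis rc_inj : forall a b, row a = row b -> col a = col b -> a = b.
Hypothesis rc_up : forall m k, (k <= row m)%N -> exists m', row m' = k /\ col m' = col m.
Hypothesis rc_left : forall m c, (c <= col m)%N -> exists m', row m' = row m /\ col m' = c.
Implicit Types (X Y : {set 'I_n}) (s t q r : 'S_n) (T : 'I_n -> nat).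
Notation sy := (sym act).
Notation colperm := (colperm col).
Notation rowperm' := (rowperm' row).
Notation rowset := (rowset row).
Notation et := (eT row col).

(** The possible images of the standard polytabloid under equivariant maps: all linear relations
    among polytabloids must hold among the translates of [x]. *)
Definition spechtRel (x : V) := forall c : 'S_n -> rat,
  (forall T, \sum_t c t * et (T \o t) = 0) -> \sum_t c t *: act t x = 0.

Definition hwv (v : V) := (forall a b, row a = row b -> act (tperm a b) v = v) /\
  (forall k b, (k < row b)%N -> sy (b |: rowset k) v = 0).

Definition kap X : V -> V := twsum act (fun s => perm_on X s && colperm s) (@psgn n).
Definition kappa : V -> V := twsum act colperm (@psgn n).
Definition rho : V -> V := twsum act rowperm' (fun=> 1).

Lemma scale2_eq0 (v : V) : v = - v -> v = 0.
Proof.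
move=> /eqP; rewrite -addr_eq0 -[v]scale1r -scalerDl scaler_eq0 => /orP[|/eqP ->]; last by rewrite scaler0.
by rewrite -mulr2n pnatr_eq0.
Qed.

(** Multiplying [s] by the transposition of [x] and [s x] gives one more fixed point, so
    transpositions inside rows generate the row group. *)
Lemma row_gen v : (forall a b, row a = row b -> act (tperm a b) v = v) -> forall s, rowperm' s -> act s v = v.
Proof.
move=> hv s; have [N] := ubnP #|[pred x | s x != x]|; elim: N s => // N IH s le hs.
case: (pickP (fun x => s x != x)) => [x sx|h0]; last first.
  by rewrite (_ : s = 1%g) ?act1//; apply/permP => x; rewrite perm1; apply/eqP/negPn/negP; rewrite h0.
have rx : row x = row (s x) by rewrite (rowpermP _ _ hs).
have ht : rowperm' (tperm x (s x)) by apply/rowpermP => m; case: tpermP => [->|->|].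
have -> : s = (s * tperm x (s x) * tperm x (s x))%g by rewrite -mulgA tperm2 mulg1.
rewrite -actM IH ?hv ?rowpermMr//; move: le; rewrite ltnS; apply: leq_trans.
rewrite (cardD1 x [pred y | s y != y]) inE sx add1n ltnS; apply/subset_leq_card/fintype.subsetP => y.
rewrite !inE permM; case: (eqVneq y x) => [->|yx]; first by rewrite tpermR eqxx.
apply: contraNN => /eqP sy; rewrite sy tpermD// 1?eq_sym//.
by rewrite -sy (inj_eq perm_inj).
Qed.

(** Averaging over the row group and collecting terms, the coefficient of [act h v] becomes the
    relation [c] evaluated at the tabloid of [h^-1], which is 0. *)
Lemma kappa_spechtRel v : (forall s, rowperm' s -> act s v = v) -> spechtRel (kappa v).
Proof.
move=> hv c hc; apply/eqP; have : numR row *: (\sum_t c t *: act t (kappa v)) == 0; last first.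
  by rewrite scaler_eq0 (negbTE (numR_neq0 row)).
apply/eqP; rewrite /numR -sum1_card natr_sum scaler_suml.
transitivity (\sum_(r | rowperm' r) \sum_t \sum_(q | colperm q) (c t * psgn q) *: act (r * (q * t))%g v).
  apply: eq_bigr => r hr; have {}hr : rowperm' r := hr.
  rewrite scale1r; apply: eq_bigr => t _.
  rewrite /kappa /twsum (act_sum act_lin) scaler_sumr; apply: eq_bigr => q _.
  by rewrite (actZ act_lin) actM scalerA -[in RHS]actM (hv r hr).
rewrite exchange_big /=.
transitivity (\sum_(h : 'S_n) (\sum_t c t * et ((row \o h^-1%g) \o t)) *: act h v); last first.
  by apply: big1 => h _; rewrite hc scale0r.
transitivity (\sum_t \sum_(h : 'S_n) (c t * et ((row \o h^-1%g) \o t)) *: act h v); last first.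
  by rewrite exchange_big /=; apply: eq_bigr => h _; rewrite scaler_suml.
apply: eq_bigr => t _; rewrite exchange_big /=.
transitivity (\sum_(q | colperm q) \sum_(h : 'S_n)
   (c t * (psgn q * [forall m, row (q^-1%g m) == ((row \o h^-1%g) \o t) m]%:R)) *: act h v).
  apply: eq_bigr => q _; rewrite (reindex_inj (mulIg (q * t)^-1%g)) /= big_mkcond /=; apply: eq_bigr => h _.
  have -> : rowperm' (h * (q * t)^-1)%g = [forall m, row (q^-1%g m) == ((row \o h^-1%g) \o t) m].
    apply/rowpermP/forallP => H m /=.
      have := H (h^-1%g (t m)); rewrite invMg !permM permKV permK => ->; exact: eqxx.
    have := H (t^-1%g (h m)); rewrite /= permKV permK invMg !permM => /eqP ->.
    by [].
  case: [forall _, _]; last by rewrite !mulr0 scale0r.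
  by rewrite mulr1 -mulgA mulVg mulg1.
rewrite exchange_big /=; apply: eq_bigr => h _; rewrite /eT mulr_sumr scaler_suml big_mkcondr /=.
apply: eq_bigr => q _; case: [forall _, _]; by rewrite ?mulr1// !mulr0 scale0r.
Qed.

Lemma spechtRel_col x q : spechtRel x -> colperm q -> act q x = psgn q *: x.
Proof.
move=> hx hq; pose c t : rat := (t == q)%:R - psgn q * (t == 1%g)%:R.
have sumc (W : lmodType rat) (F : 'S_n -> W) : \sum_t c t *: F t = F q - psgn q *: F 1%g.
  rewrite /c (eq_bigr (fun t => (t == q)%:R *: F t - (psgn q * (t == 1%g)%:R) *: F t)); last first.
    by move=> t _; rewrite scalerBl.
  rewrite sumrB (bigD1 q)//= eqxx scale1r big1 ?addr0; last by move=> t /negbTE ->; rewrite scale0r.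
  rewrite (bigD1 1%g)//= eqxx mulr1 [X in _ - (_ + X)]big1 ?addr0// => t /negbTE ->.
  by rewrite mulr0 scale0r.
have := hx c; rewrite sumc act1 => H; apply/eqP; rewrite -subr_eq0; apply/eqP/H => T.
have := sumc rat^o (fun t => et (T \o t)); rewrite /GRing.scale /= => ->.
rewrite eT_col// (_ : et (T \o (1%g : 'S_n)) = et T) ?subrr//.
by apply: eT_ext => m /=; rewrite perm1.
Qed.

(** In each term [act r x] of the row sum, [b] has above it, in row [k] and in the same column for
    the numbering moved by [r], the point [r y0]. Their transposition negates the term, while
    symmetrization over [b] and row [k] absorbs it. *)
Lemma rho_hwv x : (forall q, colperm q -> act q x = psgn q *: x) -> hwv (rho x).
Proof.
move=> hx; split=> [a b ab|k b kb].
  have ht : rowperm' (tperm a b) by apply/rowpermP => m; case: tpermP => [->|->|].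
  rewrite [RHS](act_twsum act_lin actM (t := tperm a b)) ?scale1r// => s; rewrite ?mulr1//.
  exact: rowpermMr.
rewrite /rho /sym twsum_sum// big1// => r hr; rewrite scale1r.
pose x0 := r^-1%g b; have rx0 : row x0 = row b by rewrite -[in RHS](permKV r b) (rowpermP _ _ hr).
have [y0 [ry0 cy0]] : exists y0, row y0 = k /\ col y0 = col x0 by apply: rc_up; rewrite rx0 ltnW.
have xy : x0 != y0 by apply: contraTneq kb => e; rewrite -rx0 e ry0 ltnn.
have hq : colperm (tperm x0 y0) by apply/colpermP => m; case: tpermP => [->|->|].
have h1 : act (tperm b (r y0)) (act r x) = - act r x.
  have -> : act (tperm b (r y0)) (act r x) = act r (act (tperm x0 y0) x).
    rewrite !actM; congr act; rewrite -[b in LHS](permKV r b) -/x0 -tpermJ.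
    by rewrite conjgE mulgA mulgV mul1g.
  by rewrite hx// psgn_tperm// scaleN1r (actN act_lin).
apply: scale2_eq0; rewrite -twsumN// -h1 [RHS](sym_act actM)//.
by apply: perm_on_tperm; rewrite !inE ?eqxx// (rowpermP _ _ hr) ry0 eqxx orbT.
Qed.

(** On polytabloids the Young symmetrizer is multiplication by [eK row col row], by [eKE]. This is a
    linear relation among polytabloids, so it passes to [x]. *)
Lemma kappa_rho x : spechtRel x -> kappa (rho x) = eK row col row *: x.
Proof.
move=> hx; pose c t : rat := \sum_(q | colperm q) \sum_(r | rowperm' r) psgn q * ((r * q)%g == t)%:R
  - eK row col row * (t == 1%g)%:R.
have sumc (W : lmodType rat) (F : 'S_n -> W) : \sum_t c t *: F t =
   \sum_(q | colperm q) \sum_(r | rowperm' r) psgn q *: F (r * q)%g - eK row col row *: F 1%g.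
  rewrite /c (eq_bigr (fun t => \sum_(q | colperm q) \sum_(r | rowperm' r) (psgn q * ((r * q)%g == t)%:R) *: F t
     - (eK row col row * (t == 1%g)%:R) *: F t)); last first.
    move=> t _; rewrite scalerBl scaler_suml; congr (_ - _); apply: eq_bigr => q _.
    by rewrite scaler_suml.
  rewrite sumrB; congr (_ - _); last first.
    rewrite (bigD1 1%g)//= eqxx mulr1 big1 ?addr0// => t /negbTE ->.
    by rewrite mulr0 scale0r.
  rewrite exchange_big /=; apply: eq_bigr => q _; rewrite exchange_big /=; apply: eq_bigr => r _.
  rewrite (bigD1 (r * q)%g)//= eqxx mulr1 big1 ?addr0// => t; rewrite eq_sym => /negbTE ->.
  by rewrite mulr0 scale0r.
have := hx c; rewrite sumc act1 => H; apply/eqP; rewrite -subr_eq0; apply/eqP.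
rewrite -[RHS]H.
  congr (_ - _); apply: eq_bigr => q _; rewrite /rho /twsum (act_sum act_lin) scaler_sumr.
  by apply: eq_bigr => r _; rewrite scale1r actM.
move=> T; have := sumc rat^o (fun t => et (T \o t)); rewrite /GRing.scale /= => ->.
have -> : et (T \o (1%g : 'S_n)) = et T by apply: eT_ext => m /=; rewrite perm1.
by apply/eqP; rewrite subr_eq0 -eKE.
Qed.

(** Hook length argument. Let [Z] be the cells below [x] in its column and [Rx] the cells of its row
    from [x] to the right. For each [a] in [Rx], [w] is the sum over [y] in [Z] of its images under
    [tperm y a]. Summing over [a], the highest weight relation for [y] and the row of [x] turns the
    right side into [-#|Z|] times [w], so [#|Rx| + #|Z|], the hook length of [x], annihilates
    [w]. *)
Lemma kap_step X (x : 'I_n) v : hwv v ->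
  (forall m, (m \in X) = (col m < col x)%N || ((col m == col x) && (row x < row m)%N)) ->
  kap (x |: X) v = 0 -> kap X v = 0.
Proof.
move=> [hv1 hv2] hX h0; set w := kap X v.
have hrow := row_gen hv1.
have xX : x \notin X by rewrite hX !ltnn andbF.
pose Z : {set 'I_n} := [set y in X | col y == col x]%SET.
pose Rx : {set 'I_n} := [set a | (row a == row x) && (col x <= col a)%N]%SET.
have RxX a : a \in Rx -> a \notin X.
  by rewrite inE hX => /andP[/eqP -> h]; rewrite ltnn andbF orbF -leqNgt.
have ZX y : y \in Z -> y \in X by rewrite inE => /andP[].
have w1 : w = \sum_(y in Z) act (tperm y x) w.
  move: h0; rewrite {1}/kap (@twsum_coset _ _ _ act_lin actM (fun s => perm_on X s && colperm s) _ _ x (x |: Z)).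
  - have xZ : x \notin Z by apply: contra xX; exact: ZX.
    rewrite big_setU1//= tperm1 psgn1 act1 scale1r -/(kap X v) -/w => /eqP; rewrite addr_eq0 => /eqP e; rewrite {1}e.
    rewrite -sumrN; apply: eq_bigr => y yZ; rewrite psgn_tperm ?scaleN1r ?opprK//.
    by apply: contraNneq xZ => <-.
  - exact: (@psgnM n).
  - move=> g /andP[hg /colpermP hc]; rewrite !inE hc eqxx andbT.
    by have := perm_closed x hg; rewrite !inE eqxx.
  move=> a g; rewrite finset.in_setU1 => aY.
  have ca : col a = col x by case/orP: aY => [/eqP ->//|]; rewrite inE => /andP[_ /eqP].
  have aX : a \in x |: X by rewrite finset.in_setU1; case/orP: aY => [->//|/ZX ->]; rewrite orbT.
  rewrite andbAC perm_on_coset//; congr (_ && _); rewrite colpermMr//.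
  by apply/colpermP => m; case: tpermP => [->|->|].
have w2 a : a \in Rx -> w = \sum_(y in Z) act (tperm y a) w.
  move=> aR; have aX := RxX a aR; have ra : row a = row x by move: aR; rewrite inE => /andP[/eqP].
  have h1 : act (tperm a x) w = w.
    rewrite /w /kap /twsum (act_sum act_lin); apply: eq_bigr => s /andP[hs _].
    rewrite (actZ act_lin) actM; congr (_ *: _).
    have -> : (s * tperm a x = tperm a x * s)%g.
      apply: (@perm_on_disj _ X (~: X)) => //; last by move=> y; rewrite inE negbK.
      by apply: perm_on_tperm; rewrite inE.
    by rewrite -actM hv1.
  rewrite -{1}h1 {1}w1 (act_sum act_lin); apply: eq_bigr => y yZ.
  rewrite actM; have -> : (tperm y x * tperm a x = tperm a x * tperm y a)%g.
    have yX := ZX y yZ.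
    have -> : tperm y a = (tperm y x ^ tperm a x)%g.
      rewrite tpermJ tpermR tpermD//; first by apply: contraNneq aX => ->.
      by apply: contraNneq xX => ->.
    by rewrite conjgE tpermV !mulgA tperm2 mul1g.
  by rewrite -actM h1.
have comm a : a \notin X -> \sum_(y in Z) act (tperm y a) w = kap X (\sum_(y in Z) act (tperm y a) v).
  move=> aX; rewrite /w /kap {2}/twsum /twsum.
  transitivity (\sum_(s | perm_on X s && colperm s) psgn s *: \sum_(y in Z) act (tperm y a) (act s v)).
    rewrite (eq_bigr (fun y => \sum_(s | perm_on X s && colperm s) psgn s *: act (tperm y a) (act s v))).
      by rewrite exchange_big /=; apply: eq_bigr => s _; rewrite scaler_sumr.
    by move=> y _; rewrite (act_sum act_lin); apply: eq_bigr => s _; rewrite (actZ act_lin).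
  apply: eq_bigr => s /andP[hs /colpermP hc]; congr (_ *: _); rewrite (act_sum act_lin).
  rewrite (reindex_inj (@perm_inj _ s)) /=; apply: eq_big => [y|y _].
    by rewrite !inE hc perm_closed.
  rewrite !actM; congr act.
  have -> : tperm (s y) a = (tperm y a ^ s)%g by rewrite tpermJ (out_perm hs aX).
  by rewrite conjgE !mulgA mulgV mul1g.
(* Cells [a] to the left of [x] contribute nothing: with [b] in the row of [y] and the column of
   [a], the transposition of [a] and [b] fixes the vector, since [b] and [y] share a row, but
   changes the sign of [kap X]. *)
have kill y a : y \in Z -> row a = row x -> (col a < col x)%N -> kap X (act (tperm y a) v) = 0.
  move=> yZ ra ca; have yX := ZX y yZ; have cy : col y = col x by move: yZ; rewrite inE => /andP[_ /eqP].
  have ry : (row x < row y)%N by move: yX; rewrite hX cy ltnn eqxx.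
  have [b [rb cb]] : exists b, row b = row y /\ col b = col a by apply: rc_left; rewrite cy ltnW.
  have ab : a != b by apply: contraTneq ry => e; rewrite -ra e rb ltnn.
  have bX : b \in X by rewrite hX cb ca.
  have aX : a \in X by rewrite hX ca.
  have by_ : b != y by apply: contraTneq ca => e; rewrite -cb e cy ltnn.
  have ay : a != y by apply: contraTneq ry => e; rewrite -ra e ltnn.
  set u := act _ v; apply: scale2_eq0.
  have u1 : act (tperm a b) u = u.
    rewrite /u actM; have -> : (tperm y a * tperm a b = tperm y b * tperm y a)%g.
      have -> : tperm y b = (tperm a b ^ tperm y a)%g by rewrite tpermJ tpermR tpermD// eq_sym.
      by rewrite conjgE tpermV -!mulgA tperm2 mulg1.
    by rewrite -actM hv1.
  have ht : colperm (tperm a b) by apply/colpermP => m; case: tpermP => [->|->|].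
  rewrite {1}/kap (twsum_act actM (t := tperm a b)) ?u1 ?psgn_tperm// ?scaleN1r//.
    by move=> s; rewrite perm_onMl ?colpermMl// perm_on_tperm.
  by move=> s; rewrite psgnM psgn_tperm.
have E : (#|Rx|)%:R *: w = - ((#|Z|)%:R *: w).
  transitivity (\sum_(a in Rx) w); first by rewrite sumr_const scaler_nat.
  rewrite (eq_bigr (fun a => kap X (\sum_(y in Z) act (tperm y a) v))); last first.
    by move=> a aR; rewrite {1}(w2 a aR) comm// RxX.
  rewrite -(twsum_sum act_lin) exchange_big /= (twsum_sum act_lin).
  rewrite scaler_nat -sumr_const -sumrN; apply: eq_bigr => y yZ.
  have yk : (row x < row y)%N by move: (yZ); rewrite inE hX => /andP[h /eqP cy]; move: h; rewrite cy ltnn eqxx.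
  have yR : y \notin rowset (row x) by rewrite inE neq_ltn yk orbT.
  have := hv2 _ _ yk; rewrite (sym_U1 act_lin act1 actM yR); last first.
    move=> s hs; apply: hrow; apply/rowpermP => m; case: (boolP (m \in rowset (row x))) => mr.
      by have := perm_closed m hs; rewrite mr; move: mr; rewrite !inE => /eqP -> /eqP.
    by rewrite (out_perm hs mr).
  move=> /eqP; rewrite scaler_eq0 (negbTE (symcard_neq0 _)) /= => /eqP hrel.
  have -> : \sum_(a in Rx) act (tperm y a) v = - v - \sum_(a in rowset (row x) | (col a < col x)%N) act (tperm y a) v.
    have S : \sum_(a in rowset (row x)) act (tperm a y) v =
        \sum_(a in rowset (row x) | (col a < col x)%N) act (tperm y a) v + \sum_(a in Rx) act (tperm y a) v.
      rewrite (bigID (fun a => (col a < col x)%N)) /=; congr (_ + _).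
        by apply: eq_bigr => a _; rewrite tpermC.
      by apply: eq_big => [a|a _]; rewrite ?inE -?leqNgt// tpermC.
    move: hrel; rewrite S; move: (\sum_(a in _ | _) _) (\sum_(a in Rx) _) => s1 s2 hrel.
    by apply: (addrI (v + s1)); rewrite -addrA hrel -opprD subrr.
  rewrite (twsumD act_lin) !(twsumN act_lin) (twsum_sum act_lin) [X in _ - X]big1 ?subr0//.
  by move=> a /andP[]; rewrite inE => /eqP ra ca; exact: kill.
have : ((#|Rx|)%:R + (#|Z|)%:R) *: w = 0 by rewrite scalerDl E addNr.
move/eqP; rewrite scaler_eq0 -natrD pnatr_eq0 addn_eq0 => /orP[/andP[/eqP/cards0_eq h _]|/eqP//].
have : x \in Rx by rewrite inE eqxx leqnn.
by rewrite h inE.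
Qed.

Lemma kappa_inj v : hwv v -> kappa v = 0 -> v = 0.
Proof.
move=> hv; pose R := (\sum_m row m).+1.
have rR m : (row m < R)%N by rewrite ltnS (bigD1 m)//= leq_addr.
move: R rR => R rR.
(* Orders the cells by columns from left to right and inside a column from the bottom up, as
   [kap_step] demands; the antisymmetrizer is then stripped of one cell at a time. *)
pose key m := (col m * R + (R.-1 - row m))%N.
have key_lt m x : (key m < key x)%N = (col m < col x)%N || ((col m == col x) && (row x < row m)%N).
  have hm := rR m; have hx := rR x; rewrite /key.
  case: (ltngtP (col m) (col x)) => [lt|gt|->] /=; last by rewrite ltn_add2l; lia.
    have := leq_mul2r R (col m).+1 (col x); rewrite lt orbT mulSn => h; lia.
  have := leq_mul2r R (col x).+1 (col m); rewrite gt orbT mulSn => h; apply/negbTE; lia.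
pose X j : {set 'I_n} := [set m | (key m < j)%N]%SET.
have H j : kap (X j) v = 0 -> v = 0.
  elim: j => [|j IH].
    rewrite /kap /twsum (bigD1 1%g) /=; last by rewrite perm_on1 colperm1.
    rewrite psgn1 scale1r act1 big1 ?addr0// => s /andP[/andP[hs _] /eqP []].
    by apply/permP => m; rewrite perm1 (out_perm hs)// inE.
  case: (pickP (fun x => key x == j)) => [x /eqP kx|no].
    have -> : X j.+1 = x |: X j.
      apply/finset.setP => m; rewrite !inE ltnS leq_eqVlt; congr (_ || _).
      apply/eqP/eqP => [e|->//]; have h1 := key_lt m x; have h2 := key_lt x m.
      move: h1 h2; rewrite e kx !ltnn => /esym/norP[a1 a2] /esym/norP[b1 b2].
      apply: rc_inj; last by lia.
      have e2 : col m = col x by lia.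
      by move: a2 b2; rewrite e2 eqxx /=; lia.
    move=> h; apply: IH; apply: (kap_step hv _ h) => m.
    by rewrite inE -kx key_lt.
  have -> // : X j.+1 = X j.
  by apply/finset.setP => m; rewrite !inE ltnS leq_eqVlt no.
move=> h0; apply: (H (\sum_m (key m).+1)%N); rewrite -[RHS]h0; apply: eq_bigl => s.
rewrite (_ : X _ = finset.setT); first by rewrite (_ : perm_on _ s)//; apply/fintype.subsetP => m; rewrite inE.
by apply/finset.setP => m; rewrite !inE (bigD1 m)//= addSn ltnS leq_addr.
Qed.

Lemma hwv_rowperm v s : hwv v -> rowperm' s -> act s v = v.
Proof. by move=> [h _]; exact: row_gen. Qed.

Lemma kappa_onto x : spechtRel x -> exists2 v, hwv v & kappa v = x.
Proof.
move=> hx; exists ((eK row col row)^-1 *: rho x).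
  have [h1 h2] := rho_hwv (fun q => spechtRel_col hx (q := q)).
  split=> [a b ab|k b kb]; first by rewrite (actZ act_lin) h1.
  by rewrite /sym (twsumZ act_lin) [twsum _ _ _ _]h2// scaler0.
rewrite /kappa (twsumZ act_lin) -/(kappa (rho x)) kappa_rho// scalerA mulVf ?scale1r//.
exact: eK_row_neq0.
Qed.

End SpechtHom.

(** * Stability of highest weight vectors *)

Section Stability.
Variables (n : nat) (V W : lmodType rat) (aV : 'S_n -> V -> V) (aW : 'S_n.+1 -> W -> W).
Hypothesis aV_lin : forall s a u v, aV s (a *: u + v) = a *: aV s u + aV s v.
Hypothesis aV1 : forall v, aV 1%g v = v.
Hypothesis aVM : forall s t v, aV s (aV t v) = aV (t * s)%g v.
Hypothesis aW_lin : forall s a u v, aW s (a *: u + v) = a *: aW s u + aW s v.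
Hypothesis aW1 : forall v, aW 1%g v = v.
Hypothesis aWM : forall s t v, aW s (aW t v) = aW (t * s)%g v.
Variables (star : 'I_n.+1) (iota : V -> W) (pi : W -> V).
Notation L := (lift star).
Hypothesis iota_lin : forall a (u v : V), iota (a *: u + v) = a *: iota u + iota v.
Hypothesis pi_lin : forall a (u v : W), pi (a *: u + v) = a *: pi u + pi v.
Hypothesis iotaT : forall (a b : 'I_n) v, iota (aV (tperm a b) v) = aW (tperm (L a) (L b)) (iota v).
Hypothesis piT : forall (a b : 'I_n) w, pi (aW (tperm (L a) (L b)) w) = aV (tperm a b) (pi w).
Hypothesis pi_iota : forall v, pi (iota v) = v.
Variables (row : 'I_n -> nat) (row' : 'I_n.+1 -> nat).
Hypothesis rowL : forall m : 'I_n, row' (L m) = row m.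
Hypothesis row_star : row' star = 0%N.
Implicit Types (X : {set 'I_n}) (v : V) (w : W).

(* The operator [P_a]: forget the point [a], relabelling the new far point as [a]. *)
Definition farop (a : 'I_n) v : V := pi (aW (tperm (L a) star) (iota v)).
Definition dilate X v : V := v + \sum_(a in X) farop a v.

Hypothesis dilate_surj : forall X v, exists u, dilate X u = v.
Hypothesis dilate_inj : forall X v, dilate X v = 0 -> v = 0.

Let A := rowset row 0.
Definition firstrow : {set 'I_n.+1} := star |: [set L a | a in A]%SET.
(** The stable range is what supplies this hypothesis. *)
Hypothesis pi_inj : forall w, (forall s, perm_on firstrow s -> aW s w = w) -> pi w = 0 -> w = 0.

Definition stab v : W := sym aW firstrow (iota v).

Let LI : injective L. Proof. exact: lift_inj. Qed.
Let starL (a : 'I_n) : star != L a. Proof. exact: neq_lift. Qed.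
Let starX X : star \notin [set L a | a in X]%SET.
Proof. by apply/imsetP => -[a _ e]; have := starL a; rewrite -e eqxx. Qed.

Let iD (u v : V) : iota (u + v) = iota u + iota v.
Proof. by rewrite -[u in LHS]scale1r iota_lin scale1r. Qed.
Let pD (u v : W) : pi (u + v) = pi u + pi v.
Proof. by rewrite -[u in LHS]scale1r pi_lin scale1r. Qed.
Let i0 : iota 0 = 0. Proof. by apply: (addIr (iota 0)); rewrite -iD addr0 add0r. Qed.
Let p0 : pi 0 = 0. Proof. by apply: (addIr (pi 0)); rewrite -pD addr0 add0r. Qed.
Let iZ a (v : V) : iota (a *: v) = a *: iota v. Proof. by rewrite -[a *: v]addr0 iota_lin i0 !addr0. Qed.
Let pZ a (v : W) : pi (a *: v) = a *: pi v. Proof. by rewrite -[a *: v]addr0 pi_lin p0 !addr0. Qed.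
Let isum (I : Type) (r : seq I) (P : pred I) (F : I -> V) :
  iota (\sum_(i <- r | P i) F i) = \sum_(i <- r | P i) iota (F i).
Proof. by elim/big_rec2: _ => [|i x y _ <-]; rewrite ?i0 ?iD. Qed.
Let psum (I : Type) (r : seq I) (P : pred I) (F : I -> W) :
  pi (\sum_(i <- r | P i) F i) = \sum_(i <- r | P i) pi (F i).
Proof. by elim/big_rec2: _ => [|i x y _ <-]; rewrite ?p0 ?pD. Qed.

Lemma perm_gen (k : nat) (U : lmodType rat) (act : 'S_k -> U -> U) (Z : {set 'I_k}) (u : U) :
  (forall x, act 1%g x = x) -> (forall s t x, act s (act t x) = act (t * s)%g x) ->
  (forall a b, a \in Z -> b \in Z -> act (tperm a b) u = u) -> forall s, perm_on Z s -> act s u = u.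
Proof.
move=> act1 actM h s hs; pose r (m : 'I_k) := if m \in Z then 0%N else m.+1.
apply: (@row_gen k U act act1 actM r).
  move=> a b; rewrite /r; case: ifP => aZ; case: ifP => bZ // e; first exact: h.
  by have -> : a = b; [apply: val_inj; case: e|rewrite tperm1 act1].
apply/rowpermP => m; rewrite /r; case: (boolP (m \in Z)) => mZ; first by rewrite perm_closed// mZ.
by rewrite (out_perm hs mZ) (negbTE mZ).
Qed.

Definition tinv X v := forall a b, a \in X -> b \in X -> aV (tperm a b) v = v.

Let iota_inv X v : tinv X v -> forall s, perm_on [set L a | a in X]%SET s -> aW s (iota v) = iota v.
Proof.
move=> h; apply: perm_gen => // _ _ /imsetP [a aX ->] /imsetP [b bX ->].
by rewrite -iotaT h.
Qed.

Lemma symL X b v : tinv X v -> b \notin X ->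
  sym aW (L b |: [set L a | a in X]%SET) (iota v) =
  symcard [set L a | a in X]%SET *: iota (v + \sum_(a in X) aV (tperm a b) v).
Proof.
move=> hv bX; rewrite (sym_U1 aW_lin aW1 aWM); last exact: iota_inv.
  congr (_ *: _); rewrite iD isum big_imset /=; last by move=> ? ? _ _; exact: LI.
  by congr (_ + _); apply: eq_bigr => a _; rewrite iotaT.
by rewrite mem_imset.
Qed.

(** The term without [star] gives [pi (iota v) = v]; a transposition of [star] with a point [a]
    gives [farop a v]. *)
Lemma pi_sym_star X v : tinv X v ->
  pi (sym aW (star |: [set L a | a in X]%SET) (iota v)) = symcard [set L a | a in X]%SET *: dilate X v.
Proof.
move=> hv; rewrite (sym_U1 aW_lin aW1 aWM) //; last exact: iota_inv.
rewrite pZ pD psum big_imset /=; last by move=> ? ? _ _; exact: LI.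
by rewrite pi_iota.
Qed.

Lemma farop_tperm a b c v : farop c (aV (tperm a b) v) = aV (tperm a b) (farop (tperm a b c) v).
Proof.
rewrite /farop iotaT -piT !aWM; congr (pi (aW _ _)).
have -> : tperm (L (tperm a b c)) star = (tperm (L c) star ^ tperm (L a) (L b))%g.
  rewrite tpermJ [tperm _ _ star]tpermD 1?eq_sym//; congr (tperm _ _).
  case: tpermP => [->|->|/eqP ca /eqP cb]; rewrite ?tpermL ?tpermR//.
  by rewrite tpermD// (inj_eq LI) eq_sym.
by rewrite conjgE tpermV -!mulgA tperm2 mulg1.
Qed.

Lemma dilateD X u v : dilate X (u + v) = dilate X u + dilate X v.
Proof.
rewrite /dilate addrACA -big_split; congr (_ + _); apply: eq_bigr => a _.
by rewrite /farop iD (actD aW_lin) pD.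
Qed.

Lemma dilate0 X : dilate X 0 = 0.
Proof. by apply: (addIr (dilate X 0)); rewrite -dilateD addr0 add0r. Qed.

Lemma dilate_sum X (I : Type) (r : seq I) (P : pred I) (F : I -> V) :
  dilate X (\sum_(i <- r | P i) F i) = \sum_(i <- r | P i) dilate X (F i).
Proof. by elim/big_rec2: _ => [|i x y _ <-]; rewrite ?dilate0 ?dilateD. Qed.

Lemma dilate_tperm X a b v : (forall c, (tperm a b c \in X) = (c \in X)) ->
  dilate X (aV (tperm a b) v) = aV (tperm a b) (dilate X v).
Proof.
move=> hX; rewrite /dilate (actD aV_lin) (act_sum aV_lin); congr (_ + _).
rewrite [RHS](reindex_inj (@perm_inj _ (tperm a b))) /=.
by apply: eq_big => [c|c _]; [rewrite hX|rewrite farop_tperm].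
Qed.

Let hwv_tinv v k : hwv aV row v -> tinv (rowset row k) v.
Proof. by move=> [h _] a b; rewrite !inE => /eqP ra /eqP rb; apply: h; rewrite ra rb. Qed.

Let relV v k b : tinv (rowset row k) v -> (k < row b)%N ->
  sym aV (b |: rowset row k) v = symcard (rowset row k) *: (v + \sum_(a in rowset row k) aV (tperm a b) v).
Proof.
move=> hv kb; rewrite (sym_U1 aV_lin aV1 aVM)//; first by rewrite inE neq_ltn kb orbT.
by apply: perm_gen.
Qed.

Let rowset'S k : rowset row' k.+1 = [set L a | a in rowset row k.+1]%SET.
Proof.
apply/finset.setP => x; rewrite inE; apply/idP/imsetP => [|[a]]; last by rewrite inE => h ->; rewrite rowL.
case: (unliftP star x) => [a ->|->]; last by rewrite row_star.
by rewrite rowL => h; exists a => //; rewrite inE.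
Qed.

Let rowset'0 : rowset row' 0 = firstrow.
Proof.
apply/finset.setP => x; rewrite finset.in_setU1 inE; case: (unliftP star x) => [a ->|->]; last by rewrite row_star eqxx.
by rewrite rowL [L a == star]eq_sym (negbTE (starL a)) (mem_imset _ _ LI) inE.
Qed.

Let first_row x : (x \in firstrow) = (row' x == 0%N).
Proof. by rewrite -rowset'0 inE. Qed.

Let relsum v k b : hwv aV row v -> (k < row b)%N -> v + \sum_(a in rowset row k) aV (tperm a b) v = 0.
Proof.
move=> hv kb; have [_ h2] := hv; have := h2 k b kb; rewrite relV//; last exact: hwv_tinv.
by move/eqP; rewrite scaler_eq0 (negbTE (symcard_neq0 _)) => /eqP.
Qed.

Lemma stab_hwv v : hwv aV row v -> hwv aW row' (stab v).
Proof.
move=> hv; split=> [a b ab|k b kb].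
  case: (eqVneq (row' a) 0%N) => ra.
    by rewrite /stab (act_sym aW_lin aWM)//; apply: perm_on_tperm; rewrite first_row -?ab ra.
  have rb : row' b != 0%N by rewrite -ab.
  rewrite /stab (@act_sym_disj _ _ _ aW_lin aWM _ _ _ (~: firstrow)); last 2 first.
  - by apply: perm_on_tperm; rewrite finset.in_setC first_row.
  - by move=> x; rewrite finset.in_setC negbK.
  move: ab ra rb; case: (unliftP star a) => [a' ->|->]; last by rewrite row_star eqxx.
  case: (unliftP star b) => [b' ->|->]; last by rewrite row_star eqxx.
  by rewrite !rowL => ab _ _; have [h _] := hv; rewrite -iotaT h.
move: kb; case: (unliftP star b) => [b' ->|->]; last by rewrite row_star.
rewrite rowL => kb; have tv := @hwv_tinv v k hv.
have bX : b' \notin rowset row k by rewrite inE neq_ltn kb orbT.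
have h0 : sym aW (L b' |: [set L a | a in rowset row k]%SET) (iota v) = 0.
  by rewrite symL// relsum// i0 scaler0.
(* For a lower row the two symmetrizations have disjoint supports and commute. For the first row,
   the one over the lengthened row and [b] absorbs the one over the old row and [b], which
   vanishes. *)
case: k kb tv bX h0 => [|k] kb tv bX h0; last first.
  rewrite rowset'S /stab sym_disj//; first by rewrite h0 /sym (twsum0 aW_lin).
  move=> x; rewrite first_row finset.in_setU1 => /orP[/eqP ->|/imsetP [a]]; first by rewrite rowL -lt0n (ltn_trans _ kb).
  by rewrite inE => /eqP ra ->; rewrite rowL ra.
rewrite rowset'0 /stab (sym_comp aW_lin aWM); last exact: finset.subsetUr.
have : sym aW (L b' |: firstrow) (sym aW (L b' |: [set L a | a in rowset row 0]%SET) (iota v)) = 0.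
  by rewrite h0 /sym (twsum0 aW_lin).
rewrite (sym_comp aW_lin aWM); last by rewrite finset.setUS// finset.subsetUr.
move/eqP; rewrite scaler_eq0 (negbTE (symcard_neq0 _)) => /eqP ->.
by rewrite scaler0.
Qed.

Lemma stab_inj v : hwv aV row v -> stab v = 0 -> v = 0.
Proof.
move=> hv /(congr1 pi); rewrite /stab pi_sym_star; last exact: hwv_tinv.
rewrite p0 => /eqP; rewrite scaler_eq0 (negbTE (symcard_neq0 _)) => /eqP; exact: dilate_inj.
Qed.

(** The preimage is [v] with [dilate A v = pi w], up to a scalar: then [stab v] and a multiple of
    [w] have the same image under [pi], and [pi_inj] applies. The highest weight conditions for [v]
    are recovered by injectivity of [dilate]. *)
Lemma stab_onto w : hwv aW row' w -> exists2 v, hwv aV row v & stab v = w.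
Proof.
move=> [hw1 hw2]; have [v hv] := dilate_surj A (pi w).
pose c := symcard [set L a | a in A]%SET; have c0 : c != 0 := symcard_neq0 _.
have inv a b : row a = row b -> aV (tperm a b) v = v.
  move=> ab; apply/eqP; rewrite -subr_eq0; apply/eqP/(@dilate_inj A).
  rewrite -[- v]scaleN1r dilateD dilate_tperm; last first.
    by move=> x; rewrite !inE; case: tpermP => [->|->|]; rewrite ?ab.
  have -> : dilate A (-1 *: v) = - dilate A v.
    by apply/eqP; rewrite -addr_eq0 -dilateD scaleN1r addNr dilate0.
  by rewrite hv -piT hw1 ?subrr// !rowL.
have tv k : tinv (rowset row k) v.
  by move=> a b; rewrite !inE => /eqP ra /eqP rb; apply: inv; rewrite ra rb.
have sw : stab v = c *: w.
  apply/eqP; rewrite -subr_eq0; apply/eqP/pi_inj.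
    move=> s hs; rewrite (actB aW_lin) (actZ aW_lin) /stab (act_sym aW_lin aWM)//; congr (_ - _ *: _).
    apply: (perm_gen aW1 aWM) hs => a b; rewrite !first_row => /eqP ra /eqP rb.
    by apply: hw1; rewrite ra rb.
  have pe : pi (stab v) = c *: pi w by rewrite -hv; exact: pi_sym_star (tv 0%N).
  by rewrite pD -scaleN1r !pZ pe scaleN1r subrr.
suff hwvv : hwv aV row v.
  exists (c^-1 *: v).
    have [h1 h2] := hwvv; split=> [a b ab|k b kb]; first by rewrite (actZ aV_lin) h1.
    by rewrite /sym (twsumZ aV_lin) [twsum _ _ _ _]h2// scaler0.
  by rewrite /stab iZ /sym (twsumZ aW_lin) -/(sym _ _ _) -/(stab v) sw scalerA mulVf// scale1r.
split=> // k b kb; rewrite relV//; set z := v + _; suff -> : z = 0 by rewrite scaler0.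
have bX : b \notin rowset row k by rewrite inE neq_ltn kb orbT.
have hr : sym aW (L b |: rowset row' k) w = 0 by apply: hw2; rewrite rowL.
(* For a lower row the transpositions involved fix the first row pointwise, so they commute with
   [dilate A] and the relation for [w] is transported. *)
case: k kb bX @z hr => [|k] kb bX z hr; last first.
  apply: (@dilate_inj A); rewrite /z dilateD dilate_sum.
  rewrite (eq_bigr (fun a => pi (aW (tperm (L a) (L b)) w))).
    rewrite hv -(big_imset (fun x => pi (aW (tperm x (L b)) w)))/=; last by move=> ? ? _ _; exact: LI.
    rewrite -psum -pD -rowset'S; move: hr; rewrite (sym_U1 aW_lin aW1 aWM).
    - by move=> /eqP; rewrite scaler_eq0 (negbTE (symcard_neq0 _)) => /eqP ->; rewrite p0.
    - by rewrite inE rowL neq_ltn kb orbT.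
    apply: (perm_gen aW1 aWM) => x y; rewrite !inE => /eqP rx /eqP ry.
    by apply: hw1; rewrite rx ry.
  move=> a; rewrite inE => /eqP ra; rewrite dilate_tperm ?hv ?piT// => x.
  by rewrite !inE; case: tpermP => [->|->|_ _ //]; rewrite ra; case: (row b) kb.
rewrite rowset'0 in hr.
have h1 : sym aW (L b |: firstrow) (iota v) = 0.
  have : sym aW (L b |: firstrow) (stab v) = 0 by rewrite sw /sym (twsumZ aW_lin) [twsum _ _ _ _]hr scaler0.
  rewrite /stab (sym_comp aW_lin aWM); last exact: finset.subsetUr.
  by move/eqP; rewrite scaler_eq0 (negbTE (symcard_neq0 _)) => /eqP.
have h2 : sym aW (L b |: firstrow) (iota z) = 0.
  have : sym aW (L b |: firstrow) (sym aW (L b |: [set L a | a in rowset row 0]%SET) (iota v)) = 0.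
    rewrite (sym_comp aW_lin aWM) ?h1 ?scaler0//.
    by rewrite finset.setUS// finset.subsetUr.
  rewrite symL// /sym (twsumZ aW_lin) => /eqP.
  by rewrite scaler_eq0 (negbTE (symcard_neq0 _)) => /eqP.
have tz : tinv (b |: rowset row 0) z.
  have zE : z = (symcard (rowset row 0))^-1 *: sym aV (b |: rowset row 0) v.
    by rewrite relV// scalerA mulVf ?scale1r// symcard_neq0.
  by move=> x y xX yX; rewrite zE (actZ aV_lin) (act_sym aV_lin aVM)//; apply: perm_on_tperm.
(* For the first row, [z] is invariant on the row together with [b], so [pi_sym_star] applies with
   this larger set; this is why [dilate] is considered for all sets [X]. *)
apply: (@dilate_inj (b |: rowset row 0)); have := pi_sym_star tz.
rewrite finset.imsetU1 finset.setUCA h2 p0 => /esym/eqP.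
by rewrite scaler_eq0 (negbTE (symcard_neq0 _)) => /eqP.
Qed.

End Stability.

(** * Dimensions of subspaces *)

Section Dimension.

Definition pdim (V : lmodType rat) (P : V -> Prop) m := exists B : 'I_m -> V,
  [/\ (forall j, P (B j)), (forall x, P x -> exists a : 'I_m -> rat, x = \sum_j a j *: B j) &
      (forall a : 'I_m -> rat, \sum_j a j *: B j = 0 -> forall j, a j = 0)].

Lemma pdim_transport (V W : lmodType rat) (P : V -> Prop) (Q : W -> Prop) (F : V -> W) m :
  (forall a u v, F (a *: u + v) = a *: F u + F v) -> P 0 ->
  (forall a u v, P u -> P v -> P (a *: u + v)) ->
  (forall v, P v -> Q (F v)) -> (forall v, P v -> F v = 0 -> v = 0) ->
  (forall w, Q w -> exists2 v, P v & F v = w) -> pdim P m -> pdim Q m.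
Proof.
move=> Fl P0 PD FQ Fi Fo [B [B1 B2 B3]].
have FD u v : F (u + v) = F u + F v by rewrite -[u in LHS]scale1r Fl scale1r.
have F0 : F 0 = 0 by apply: (addIr (F 0)); rewrite -FD addr0 add0r.
have FZ a v : F (a *: v) = a *: F v by rewrite -[a *: v in LHS]addr0 Fl F0 addr0.
have Fs (a : 'I_m -> rat) : F (\sum_j a j *: B j) = \sum_j a j *: F (B j).
  by elim/big_rec2: _ => [//|j x y _ <-]; rewrite FD FZ.
have Ps (a : 'I_m -> rat) : P (\sum_j a j *: B j).
  by elim/big_rec: _ => [//|j x _ hx]; exact: PD.
exists (fun j => F (B j)); split=> [j|w /Fo [v Pv <-]|a]; first exact/FQ.
  by have [a ->] := B2 v Pv; exists a.
by rewrite -Fs => h; apply: B3; exact: Fi h.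
Qed.

(** A matrix of maximal rank among those with rows in [P] has all of [P] as its row space. *)
Lemma pdim_exists M (P : 'rV[rat]_M -> Prop) : P 0 -> (forall a u v, P u -> P v -> P (a *: u + v)) ->
  exists m, pdim P m.
Proof.
move=> P0 PD; pose R r := `[< exists A : 'M[rat]_M, (forall i, P (row i A)) /\ \rank A = r >].
have Ps p (A : 'M[rat]_(p, M)) : (forall i, P (row i A)) -> forall v : 'rV_p, P (v *m A).
  move=> hA v; rewrite mulmx_sum_row; elim/big_rec: _ => [//|j x _ hx]; exact: PD.
have ex0 : exists r, R r.
  by exists 0%N; apply/asboolP; exists 0; split=> [i|]; rewrite ?row0// mxrank0.
have bR r : R r -> (r <= M)%N by move=> /asboolP [A [_ <-]]; exact: rank_leq_row.
have [r /asboolP [A [hA rA]] hmax] := ex_maxnP ex0 bR.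
have sub (v : 'rV_M) : P v -> (v <= A)%MS.
  move=> Pv; have : R (\rank (A + v)%MS).
    apply/asboolP; exists (A + v)%MS; split=> // i.
    have /sub_addsmxP [[x y] /= ->] := row_sub i (A + v)%MS.
    rewrite -[x *m A]scale1r; apply: (PD); first exact: Ps.
    by rewrite [y]mx11_scalar mul_scalar_mx -[_ *: v]addr0; exact: (PD).
  move/hmax; rewrite -rA => h; have /eqP e : \rank A == \rank (A + v)%MS.
    by rewrite eqn_leq h andbT mxrankS// addsmxSl.
  have := mxrank_leqif_eq (addsmxSl A v); rewrite e => -[_ /esym]; rewrite eqxx => /eqmxP h2.
  by rewrite h2 addsmxSr.
exists (\rank A), (fun j => row j (row_base A)); split=> [j|x /sub|a].
- have : (row j (row_base A) <= A)%MS by rewrite -(eq_row_base A) row_sub.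
  by move=> /submxP [D ->]; exact: Ps.
- rewrite -(eq_row_base A) => /submxP [D ->]; exists (fun j => D 0 j).
  by rewrite mulmx_sum_row.
rewrite (_ : \sum_j _ = (\row_j a j) *m row_base A); last first.
  by rewrite mulmx_sum_row; apply: eq_bigr => j _; rewrite mxE.
rewrite -[RHS](mul0mx _ (row_base A)) => /(row_free_inj (row_base_free A)) h j.
by have := congr1 (fun r : 'rV_(\rank A) => r 0 j) h; rewrite !mxE.
Qed.

Lemma surj_inj M (f : 'rV[rat]_M -> 'rV[rat]_M) : (forall a u v, f (a *: u + v) = a *: f u + f v) ->
  (forall v, exists u, f u = v) -> forall v, f v = 0 -> v = 0.
Proof.
move=> fl fs; have fD u v : f (u + v) = f u + f v by rewrite -[u in LHS]scale1r fl scale1r.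
have f0 : f 0 = 0 by apply: (addIr (f 0)); rewrite -fD addr0 add0r.
have fZ a v : f (a *: v) = a *: f v by rewrite -[a *: v in LHS]addr0 fl f0 addr0.
pose A : 'M[rat]_M := \matrix_(i < M) f (delta_mx 0 i).
have fA v : f v = v *m A.
  rewrite {1}[v]row_sum_delta mulmx_sum_row.
  have : forall s : seq 'I_M, f (\sum_(j <- s) v 0 j *: delta_mx 0 j) = \sum_(j <- s) v 0 j *: row j A.
    by elim=> [|j s IH]; rewrite ?big_nil ?f0// !big_cons fD fZ IH rowK.
  exact.
have fu : row_full A.
  rewrite -sub1mx; apply/row_subP => i; have [u hu] := fs (row i 1%:M).
  by rewrite -hu fA submxMl.
move=> v; rewrite fA => h; have uA : A \in unitmx by rewrite -row_full_unit.
by rewrite -[v](mulmxK uA) h mul0mx.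
Qed.

End Dimension.

(** * Multiplicities *)

Section Coordinates.
Variables (n d k M : nat) (b : 'I_M -> Defs.cochain n d k).
Notation C := (@conf n d).

Definition basisC := [/\ (forall j, coc C (b j)),
  (forall c, coc C c -> exists a : 'I_M -> rat, nul C (c - \sum_j scc (a j) (b j))) &
  (forall a : 'I_M -> rat, nul C (\sum_j scc (a j) (b j)) -> forall j, a j = 0)].

Definition lc (v : 'rV[rat]_M) : Defs.cochain n d k := \sum_j scc (v 0 j) (b j).

Lemma lc_lin a u v : lc (a *: u + v) = scc a (lc u) + lc v.
Proof.
rewrite /lc; have -> : scc a (\sum_j scc (u 0 j) (b j)) = \sum_j scc (a * u 0 j) (b j).
  elim/big_rec2: _ => [|j x y _ <-]; first by apply: funext => s; rewrite /scc mulr0.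
  by rewrite sccDr sccA.
by rewrite -big_split /=; apply: eq_bigr => j _; rewrite -sccDl !mxE.
Qed.

Hypothesis hb : basisC.

Lemma lc_coc v : coc C (lc v).
Proof. by case: hb => h _ _; apply: coc_sum => j _; apply: cocZ. Qed.

Lemma lc_nul v : nul C (lc v) -> v = 0.
Proof. by case: hb => _ _ h /h e; apply/rowP => j; rewrite mxE e. Qed.

Lemma lc0 : lc 0 = 0.
Proof. by apply: big1 => j _; rewrite mxE scc0. Qed.

Lemma lc_eq u v : nul C (lc u - lc v) -> u = v.
Proof.
move=> h; apply/eqP; rewrite -subr_eq0; apply/eqP/lc_nul.
by rewrite -[u - v]addrC -scaleN1r lc_lin sccN1 addrC.
Qed.

Lemma lc_onto c : coc C c -> exists v, nul C (c - lc v).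
Proof.
case: hb => _ h _ /h [a ha]; exists (\row_j a j); rewrite /lc.
by rewrite (eq_bigr (fun j => scc (a j) (b j)))// => j _; rewrite mxE.
Qed.

End Coordinates.

(** A spanning family of minimal size: a relation with a nonzero coefficient at [j0] would eliminate
    that member. *)
Lemma conf_basis n d i k : (2 <= d)%N -> k = (i * (d - 1))%N ->
  exists M (b : 'I_M -> Defs.cochain n d k), basisC b.
Proof.
move=> d2 kE; pose C := @conf n d.
pose S M := `[< exists b : 'I_M -> Defs.cochain n d k, (forall j, coc C (b j)) /\
  forall c, coc C c -> exists a : 'I_M -> rat, nul C (c - \sum_j scc (a j) (b j)) >].
have ex : exists M, S M.
  have [T [b [h1 h2]]] := @conf_finite n d d2 i k kE; exists #|T|; apply/asboolP.
  exists (fun j => b (enum_val j)); split=> // c /h2 [a ha]; exists (fun j => a (enum_val j)).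
  by move: ha; rewrite (reindex (@enum_val T predT))//; apply: onW_bij; exact: enum_val_bij.
case: (ex_minnP ex) => M /asboolP [b [h1 h2]] hmin; exists M, b; split=> // a ha j0.
apply/eqP/negPn/negP => aj0; case: M b h1 h2 hmin a ha j0 aj0 => [|M] b h1 h2 hmin a ha j0 aj0; first by case: j0 {aj0}.
suff /hmin : S M by rewrite ltnn.
apply/asboolP; exists (fun j => b (lift j0 j)); split=> // c /h2 [a' ha'].
pose l := a' j0 / a j0.
exists (fun j => a' (lift j0 j) - l * a (lift j0 j)).
have := nulD ha' (nulZ l ha); apply: nul_ext => s _.
have E (x : 'I_M.+1 -> rat) : (\sum_j scc (x j) (b j)) s = \sum_j x j * b j s.
  by elim/big_rec2: _ => // j y z _ <-.
have E' (x : 'I_M -> rat) : (\sum_j scc (x j) (b (lift j0 j))) s = \sum_j x j * b (lift j0 j) s.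
  by elim/big_rec2: _ => // j y z _ <-.
change (c s - (\sum_j scc (a' j) (b j)) s + l * (\sum_j scc (a j) (b j)) s =
  c s - (\sum_j scc (a' (lift j0 j) - l * a (lift j0 j)) (b (lift j0 j))) s).
rewrite !E E' -addrA; congr (_ + _); rewrite !(bigD1_ord j0)//=.
rewrite [in RHS](eq_bigr (fun j => a' (lift j0 j) * b (lift j0 j) s - l * (a (lift j0 j) * b (lift j0 j) s))); last first.
  by move=> j _; rewrite mulrBl mulrA.
rewrite sumrB -mulr_sumr mulrDr mulrA (_ : l * a j0 = a' j0); last by rewrite /l divfK.
rewrite !opprD opprK; move: (a' j0 * _) (\sum_(i < M) _) (\sum_(i < M) _) => x y z; ring.
Qed.

Section Operators.
Variables (k : nat).

(** [F] is the map induced by [phi] on cohomology, written in the coordinates of [b] and [b'];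
    cohomology is thereby replaced by row vectors. *)
Definition opspec n d n' d' M M' (b : 'I_M -> Defs.cochain n d k) (b' : 'I_M' -> Defs.cochain n' d' k)
    (phi : Mpt n' d' -> Mpt n d) (F : 'rV[rat]_M -> 'rV[rat]_M') :=
  forall v, nul (@conf n' d') (pb phi (lc b v) - lc b' (F v)).

Variables (n d n' d' M M' : nat) (b : 'I_M -> Defs.cochain n d k) (b' : 'I_M' -> Defs.cochain n' d' k).
Hypothesis hb : basisC b.
Hypothesis hb' : basisC b'.

Lemma op_exists phi : mapto phi (@conf n' d') (@conf n d) -> exists F, opspec b b' phi F.
Proof.
move=> h; have H v : exists x, nul (@conf n' d') (pb phi (lc b v) - lc b' x).
  by apply: (lc_onto hb'); apply: pb_coc h _; exact: lc_coc.
by have [F hF] := choice H; exists F.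
Qed.

Lemma op_lin phi F : opspec b b' phi F -> forall a u v, F (a *: u + v) = a *: F u + F v.
Proof.
move=> h a u v; apply: (lc_eq hb'); have := nulB (nulD (nulZ a (h u)) (h v)) (h (a *: u + v)).
rewrite !lc_lin; apply: nul_ext => s _; rewrite pbD pbZ.
set x := pb phi (lc b u); set y := pb phi (lc b v).
change (a * (x s - lc b' (F u) s) + (y s - lc b' (F v) s) - (a * x s + y s - lc b' (F (a *: u + v)) s) =
  lc b' (F (a *: u + v)) s - (a * lc b' (F u) s + lc b' (F v) s)); ring.
Qed.

Lemma op_uniq phi psi F G : opspec b b' phi F -> opspec b b' psi G ->
  (forall c : Defs.cochain n d k, coc (@conf n d) c -> nul (@conf n' d') (pb phi c - pb psi c)) -> F =1 G.
Proof.
move=> h1 h2 h v; apply: (lc_eq hb'); have := nulD (nulB (h2 v) (h1 v)) (h _ (lc_coc hb v)).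
apply: nul_ext => s _.
change (pb psi (lc b v) s - lc b' (G v) s - (pb phi (lc b v) s - lc b' (F v) s) + (pb phi (lc b v) s - pb psi (lc b v) s) =
  lc b' (F v) s - lc b' (G v) s); ring.
Qed.

Lemma op_eq phi psi F G : opspec b b' phi F -> opspec b b' psi G -> phi =1 psi -> F =1 G.
Proof.
move=> h1 h2 e; apply: (op_uniq h1 h2) => c _.
by rewrite (_ : phi = psi) ?subrr; [exact: nul0|exact: funext].
Qed.

End Operators.

Lemma op_id k n d M (b : 'I_M -> Defs.cochain n d k) phi : phi =1 id -> opspec b b phi id.
Proof. by move=> h v; apply: (@pb_id_nul _ _ _ _ (@conf n d)). Qed.

Lemma op_comp k n d n' d' n'' d'' M M' M'' (b : 'I_M -> Defs.cochain n d k)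
  (b' : 'I_M' -> Defs.cochain n' d' k) (b'' : 'I_M'' -> Defs.cochain n'' d'' k) phi psi F G :
  mapto psi (@conf n'' d'') (@conf n' d') -> opspec b b' phi F -> opspec b' b'' psi G ->
  opspec b b'' (phi \o psi) (G \o F).
Proof.
move=> m h1 h2 v; rewrite -pb_comp; apply: nul_trans (h2 (F v)).
by rewrite -pbB; apply: pb_nul m _; exact: h1.
Qed.

(** * Forgetting a point and adding a far one *)

Section AddRemove.
Variables (n d : nat).
Hypothesis d2 : (2 <= d)%N.
Variable star : 'I_n.+1.
Notation L := (lift star).

Definition forget (u : Mpt n.+1 d) : Mpt n d := row' star u.
Definition addfar (u : Mpt n d) : Mpt n.+1 d := \matrix_(i, j)
  if unlift star i is Some m then u m j
  else ((1 + \sum_m nrm (row m u)) *: (delta_mx 0 (coord0 d2) : 'rV[RR]_d)) 0 j.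

Lemma row_forget m u : row m (forget u) = row (L m) u.
Proof. by apply/rowP => j; rewrite !mxE. Qed.

Lemma row_addfar m u : row (L m) (addfar u) = row m u.
Proof. by apply/rowP => j; rewrite !mxE liftK. Qed.

Lemma row_addfar_star u : row star (addfar u) = (1 + \sum_m nrm (row m u)) *: delta_mx 0 (coord0 d2).
Proof. by apply/rowP => j; rewrite !mxE unlift_none ?mxE. Qed.

Lemma forget_conf : mapto forget (@conf n.+1 d) (@conf n d).
Proof.
move=> u hu; split; first by move=> a b ab; rewrite !row_forget; apply: hu; rewrite (inj_eq lift_inj).
apply: mx_cont => i j; rewrite (_ : (fun y => _) = fun y : Mpt n.+1 d => y (L i) j); first exact: cnt_coord.
by apply: funext => v; rewrite mxE.
Qed.

Lemma add_forget u : addfar (forget u) = far d2 star u.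
Proof.
apply: row_ext => i; case: (unliftP star i) => [m ->|->].
  by rewrite row_addfar row_forget row_setrowN// eq_sym neq_lift.
rewrite row_addfar_star row_setrow /hgt; congr ((_ + _) *: _).
rewrite [RHS]big_mkcond (bigD1_ord star)//= eqxx add0r; apply: eq_bigr => m _.
by rewrite row_forget eq_sym neq_lift.
Qed.

Lemma forget_add u : forget (addfar u) = u.
Proof. by apply: row_ext => m; rewrite row_forget row_addfar. Qed.

Lemma addfar_conf : mapto addfar (@conf n d) (@conf n.+1 d).
Proof.
move=> u hu; split; last first.
  apply: mx_cont => i j; case: (unliftP star i) => [m ->|->].
    rewrite (_ : (fun y => _) = fun y : Mpt n d => y m j); first exact: cnt_coord.
    by apply: funext => v; rewrite mxE liftK.
  rewrite (_ : (fun y => _) = fun y : Mpt n d => (1 + \sum_m nrm (row m y)) * (delta_mx 0 (coord0 d2) : 'rV[RR]_d) 0 j).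
    apply: cntM; last exact: cnt_cst; apply: cntD; first exact: cnt_cst.
    by apply: cnt_sum => m _; apply: nrm_cnt => l; exact: row_cnt.
  by apply: funext => v; rewrite mxE unlift_none mxE.
have key m : row star (addfar u) != row (L m) (addfar u).
  rewrite row_addfar_star row_addfar; apply/eqP => e.
  have h1 : nrm (row m u) < 1 + \sum_m nrm (row m u).
    by rewrite (bigD1 m)//= addrCA ltrDl ltr_pwDl// sumr_ge0// => *; exact: nrm_ge0.
  have := le_lt_trans (coord_nrm (row m u) (coord0 d2)) h1; rewrite -e mxE mxE !eqxx mulr1.
  by rewrite ltNge ler_norm.
move=> a b; case: (unliftP star a) => [a' ->|->]; case: (unliftP star b) => [b' ->|->] ab.
- by rewrite !row_addfar; apply: hu; apply: contraNneq ab => ->.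
- by rewrite eq_sym.
- exact: key.
- by rewrite eqxx in ab.
Qed.

(** The two maps put [a] on the same axis at different heights: the height in [addfar] also counts
    the old position of [a]. Both heights exceed the norms of all other points, and so does
    everything between them. *)
Lemma addfar_far a k (c : Defs.cochain n d k) : coc (@conf n d) c ->
  nul (@conf n d) (pb (forget \o rp (tperm (L a) star) \o addfar) c - pb (far d2 a) c).
Proof.
move=> hc; pose hh (u : Mpt n d) : RR := 1 + \sum_m nrm (row m u).
have E u : (forget \o rp (tperm (L a) star) \o addfar) u = setrow a (hh u *: delta_mx 0 (coord0 d2)) u.
  apply: row_ext => m; rewrite /= row_forget row_rp; case: (eqVneq m a) => [->|ma].
    by rewrite tpermL row_addfar_star row_setrow.
  by rewrite tpermD ?row_addfar ?row_setrowN// ?(inj_eq lift_inj) 1?eq_sym// eq_sym neq_lift.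
apply: (homotopy (Y := @conf n d) _ _ _ hc) => [u _|u hu|u t hu /andP[t0 t1]].
- exact: far_cont.
- have [h1 c1] := addfar_conf hu; have [h2 c2] := rp_conf (tperm (L a) star) h1.
  have [_ c3] := forget_conf h2.
  by apply: continuous_comp; [exact: c1|apply: continuous_comp; [exact: c2|exact: c3]].
rewrite E /far setrow_seg !scalerA -scalerDl.
set r := _ + _; have rgt m : m != a -> nrm (row m u) < r.
  move=> ma; have h1 := hgt_gt u ma; have h2 : hgt a u <= hh u.
    by rewrite lerD2l [leRHS](bigD1 a)//= lerDr nrm_ge0.
  by rewrite /r; move: h1 h2; move: (nrm _) (hgt _ _) (hh _) => x y z *; nra.
have key m : m != a -> r *: delta_mx 0 (coord0 d2) != row m u.
  move=> ma; apply/eqP => e.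
  have := le_lt_trans (coord_nrm (row m u) (coord0 d2)) (rgt m ma).
  by rewrite -e !mxE !eqxx mulr1 ltNge ler_norm.
move=> x y xy; case: (eqVneq x a) => [xa|xa].
  by rewrite xa row_setrow row_setrowN -?xa 1?eq_sym//; rewrite eq_sym key// -xa eq_sym.
case: (eqVneq y a) => [->|ya]; last by rewrite !row_setrowN//; exact: hu.
by rewrite row_setrow row_setrowN// eq_sym key.
Qed.

Lemma forget_rp a b u : forget (rp (tperm (L a) (L b)) u) = rp (tperm a b) (forget u).
Proof.
apply: row_ext => m; rewrite row_forget !row_rp row_forget; congr (row _ _).
by case: tpermP => [/lift_inj ->|/lift_inj ->|/eqP ma /eqP mb]; rewrite ?tpermL ?tpermR// tpermD//;
  [apply: contraNneq ma => ->|apply: contraNneq mb => ->].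
Qed.

Lemma addfar_rp a b u : addfar (rp (tperm a b) u) = rp (tperm (L a) (L b)) (addfar u).
Proof.
apply: row_ext => i; rewrite row_rp; case: (unliftP star i) => [m ->|->].
  rewrite row_addfar row_rp -row_addfar; congr (row _ _).
  by case: (tpermP (L a)) => [/lift_inj ->|/lift_inj ->|/eqP ma /eqP mb]; rewrite ?tpermL ?tpermR// tpermD//;
    [apply: contraNneq ma => ->|apply: contraNneq mb => ->].
rewrite tpermD 1?eq_sym ?neq_lift// !row_addfar_star; congr ((_ + _) *: _).
by rewrite [RHS](reindex_inj (@perm_inj _ (tperm a b))) /=; apply: eq_bigr => m _; rewrite row_rp.
Qed.

End AddRemove.

(** A forest class is an eigenvector with eigenvalue [N.+1], one plus the number of isolated points
    in [X], which is invertible. *)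
Lemma dilate_far_surj n d (d2 : (2 <= d)%N) i k (X : {set 'I_n}) (c : Defs.cochain n d k) :
  k = (i * (d - 1))%N -> coc (@conf n d) c ->
  exists2 c', coc (@conf n d) c' & nul (@conf n d) (c - (c' + \sum_(a in X) pb (far d2 a) c')).
Proof.
move=> kE hc; pose C := @conf n d.
apply: (@conf_span n d d2 i k (fun c => exists2 c', coc C c' & nul C (c - (c' + \sum_(a in X) pb (far d2 a) c')))) hc => //.
- exists 0; first exact: coc0.
  by rewrite big1 ?addr0 ?subrr//; exact: nul0.
- move=> x y [x' hx nx] [y' hy ny]; exists (x' + y'); first exact: cocD.
  have -> : \sum_(a in X) pb (far d2 a) (x' + y') = \sum_(a in X) pb (far d2 a) x' + \sum_(a in X) pb (far d2 a) y'.
    by rewrite -big_split.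
  by rewrite [X in _ - X]addrACA opprD addrACA; exact: nulD.
- by move=> x y hxy [y' hy ny]; exists y' => //; exact: nul_trans hxy ny.
move=> f J x fJ Ji hx; set g := pb _ x; have kJ : k = (#|J| * (d - 1))%N by rewrite Ji.
have hg : coc C g by apply: pb_coc hx; exact: Gmap_XJ.
pose N := #|[set a in X | isolated f J a]%SET|; pose r : rat := (N.+1%:R)^-1.
have r0 : N.+1%:R != 0 :> rat by rewrite pnatr_eq0.
exists (scc r g); first exact: cocZ.
have H : nul C (\sum_(a in X) pb (far d2 a) g - g *+ N).
  rewrite /N -sumr_const [X in _ - X](eq_bigl (fun a => (a \in X) && isolated f J a)); last by move=> a; rewrite inE.
  rewrite (bigID (isolated f J)) /= addrAC -sumrB; apply: nulD; apply: nul_sum => a /andP[aX ha].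
    by rewrite /g far_isolated// subrr; exact: nul0.
  exact: far_linked.
have -> : \sum_(a in X) pb (far d2 a) (scc r g) = scc r (\sum_(a in X) pb (far d2 a) g).
  elim/big_rec2: _ => [|a y z _ ->]; first by apply: funext => s; rewrite /scc mulr0.
  by rewrite sccDr.
have := nulN (nulZ r H); rewrite natr_scc; apply: nul_ext => s _.
set S := \sum_(a in X) _.
change (- (r * (S s - N%:R * g s)) = g s - (r * g s + r * S s)).
have e : r * (1 + N%:R) = 1 by rewrite addrC natr1 mulVf.
have e' : r * (1 + N%:R) * g s = g s by rewrite e mul1r.
rewrite -[X in _ = X - _]e'; ring.
Qed.

(** * The cells of a partition in reading order *)

Section Cells.

Lemma cellsE l : cells l = [seq (r, c) | r <- iota 0 (size l), c <- iota 0 (nth 0%N l r)].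
Proof. by []. Qed.

Lemma mem_cells l x : (x \in cells l) = (x.1 < size l)%N && (x.2 < nth 0%N l x.1)%N.
Proof.
rewrite cellsE; apply/allpairsPdep/andP => [[r [c [hr hc ->]]]|[h1 h2]].
  by move: hr hc; rewrite !mem_iota.
by exists x.1, x.2; rewrite !mem_iota; split=> //; case: (x).
Qed.

Lemma uniq_cells l : uniq (cells l).
Proof.
rewrite cellsE; apply: allpairs_uniq_dep; first exact: iota_uniq; first by move=> *; exact: iota_uniq.
by move=> [x1 x2] [y1 y2] _ _ /= [-> ->].
Qed.

Lemma size_cells l : size (cells l) = sumn l.
Proof.
rewrite cellsE size_allpairs_dep; congr sumn; rewrite -[RHS](mkseq_nth 0%N) /mkseq.
by apply: eq_map => r; rewrite size_iota.
Qed.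

Variables (n : nat) (l : seq nat).
Hypothesis ln : sumn l = n.
Hypothesis lS : sorted (fun a b : nat => (b <= a)%N) l.

Lemma cell_of (m : 'I_n) : nth (0%N, 0%N) (cells l) m = (rowOf n l m, colOf n l m) :> nat * nat.
Proof. by rewrite /rowOf /colOf; case: (nth _ _ _). Qed.

Lemma cell_mem (m : 'I_n) : (rowOf n l m, colOf n l m) \in cells l.
Proof. by rewrite -cell_of mem_nth// size_cells ln. Qed.

Lemma cell_inj (a b : 'I_n) : rowOf n l a = rowOf n l b -> colOf n l a = colOf n l b -> a = b.
Proof.
move=> h1 h2; apply: val_inj; apply/eqP.
have sz (m : 'I_n) : (m < size (cells l))%N by rewrite size_cells ln.
by have := nth_uniq (0%N, 0%N) (sz a) (sz b) (uniq_cells l); rewrite !cell_of h1 h2 eqxx => <-.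
Qed.

Lemma cell_exists x : x \in cells l -> exists m : 'I_n, rowOf n l m = x.1 /\ colOf n l m = x.2.
Proof.
move=> h; have hi : (index x (cells l) < n)%N by rewrite -[X in (_ < X)%N]ln -size_cells index_mem.
by exists (Ordinal hi); rewrite /rowOf /colOf /= nth_index.
Qed.

Lemma part_le i j : (i <= j)%N -> (nth 0%N l j <= nth 0%N l i)%N.
Proof.
move=> ij; case: (ltnP j (size l)) => hj; last by rewrite nth_default.
have := @sorted_leq_nth _ (fun a b : nat => (b <= a)%N) _ _ 0%N l lS i j.
by rewrite !inE; apply => //; [move=> x y z h1 h2; exact: leq_trans h2 h1|exact: leq_ltn_trans ij hj].
Qed.

Lemma cell_up (m : 'I_n) k : (k <= rowOf n l m)%N -> exists m', rowOf n l m' = k /\ colOf n l m' = colOf n l m.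
Proof.
move=> hk; have := cell_mem m; rewrite mem_cells /= => /andP[h1 h2].
apply: (@cell_exists (k, colOf n l m)); rewrite mem_cells /= (leq_ltn_trans hk h1).
exact: leq_trans h2 (part_le hk).
Qed.

Lemma cell_left (m : 'I_n) c : (c <= colOf n l m)%N -> exists m', rowOf n l m' = rowOf n l m /\ colOf n l m' = c.
Proof.
move=> hc; have := cell_mem m; rewrite mem_cells /= => /andP[h1 h2].
by apply: (@cell_exists (rowOf n l m, c)); rewrite mem_cells /= h1 (leq_ltn_trans hc h2).
Qed.

Lemma col_lt (m : 'I_n) : (colOf n l m < nth 0%N l 0)%N.
Proof.
have := cell_mem m; rewrite mem_cells /= => /andP[_ h]; apply: leq_trans h (part_le _).
exact: leq0n.
Qed.

End Cells.

Section FirstRow.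
Variables (nu : seq nat).

Definition lower_cells := [seq (r, c) | r <- iota 1 (size nu), c <- iota 0 (nth 0%N nu r.-1)].

Lemma cells_cons N : cells (N :: nu) = [seq (0%N, c) | c <- iota 0 N] ++ lower_cells.
Proof.
rewrite cellsE /= ; congr (_ ++ flatten _); apply/eq_in_map => r; rewrite mem_iota.
by case: r.
Qed.

Variables (n N : nat).
Hypothesis nN : (N + sumn nu = n)%N.

Lemma star_lt : (N < n.+1)%N. Proof. by rewrite ltnS -nN leq_addr. Qed.
(** The new cell is inserted at the end of the first row, so [lift star] preserves the rows of all
    old cells. *)
Definition star : 'I_n.+1 := Ordinal star_lt.

Lemma nth_cells_lift (m : 'I_n) :
  nth (0%N, 0%N) (cells (N.+1 :: nu)) (lift star m) = nth (0%N, 0%N) (cells (N :: nu)) m.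
Proof.
rewrite !cells_cons !nth_cat !size_map !size_iota (_ : nat_of_ord (lift star m) = bump N m)// /bump.
case: (ltnP m N) => mN.
  have m1 : (m < N.+1)%N by exact: ltnW.
  by rewrite add0n m1 !(nth_map 0%N) ?size_iota// !nth_iota.
by rewrite add1n ltnS ltnNge mN /= subSS.
Qed.

Lemma row_lift (m : 'I_n) : rowOf n.+1 (N.+1 :: nu) (lift star m) = rowOf n (N :: nu) m.
Proof. by rewrite /rowOf nth_cells_lift. Qed.

Lemma row_star0 : rowOf n.+1 (N.+1 :: nu) star = 0%N.
Proof.
by rewrite /rowOf cells_cons nth_cat size_map size_iota ltnS leqnn (nth_map 0%N) ?size_iota.
Qed.

Lemma row_eq0 (m : 'I_n) : (rowOf n (N :: nu) m == 0%N) = (m < N)%N.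
Proof.
rewrite /rowOf cells_cons nth_cat size_map size_iota; case: ltnP => mN.
  by rewrite (nth_map 0%N) ?size_iota.
have : nth (0%N, 0%N) lower_cells (m - N) \in lower_cells.
  apply: mem_nth; have := size_cells (N :: nu); rewrite cells_cons size_cat size_map size_iota /= nN.
  by move=> h; rewrite -(ltn_add2l N) h subnKC.
move/allpairsPdep => [r [c [hr _ ->]]] /=; move: hr; rewrite mem_iota.
by case: r.
Qed.

Lemma card_row0 : #|rowset (fun m : 'I_n => rowOf n (N :: nu) m) 0| = N.
Proof.
have h : (N <= n)%N by rewrite -nN leq_addr.
have wi : injective (widen_ord h) by move=> a b /(congr1 val) e; apply: val_inj.
rewrite -[RHS]card_ord -(card_imset predT wi).
apply: eq_card => m; rewrite inE row_eq0; apply/idP/imsetP => [mN|[x _ ->]]; last by rewrite /=.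
by exists (Ordinal mN) => //; exact: val_inj.
Qed.

End FirstRow.

(** * Comparison with the definitions of the statement *)

Lemma coh_eqP n d k (f g : Defs.cochain n d k) : coh_eq n d k f g <-> nul (@conf n d) (f - g).
Proof.
case: k f g => [|k] f g; last by [].
split=> h s hs; last by apply/eqP; rewrite -subr_eq0; apply/eqP; exact: h.
by change (f s - g s = 0); rewrite h ?subrr.
Qed.

(** [cact] does not truncate after permuting rows, but a normalised simplex is 0 outside the
    standard simplex and permuting rows keeps it 0. *)
Lemma cact_pb n d k (p : 'S_n) (f : Defs.cochain n d k) : nul (@conf n d) (cact n d k p f - pb (rp p) f).
Proof.
apply: nul_ext (nul0 _ _) => s [s0 _ _]; change (0 = cact n d k p f s - pb (rp p) f s).
rewrite /cact /pb (_ : _ \o s = trunc n d k (rp p \o s)) ?subrr//.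
apply: funext => x /=; apply/matrixP => i j; case: (pselect (std_simplex k x)) => Dx.
  by rewrite truncE//= !mxE invgK.
by rewrite truncN// s0// !mxE.
Qed.

(** Conjugation by [t] carries the column stabilizer of [t] to that of the standard numbering. *)
Lemma polytabE n l (t : 'S_n) T : polytab n l t T = eT (rowOf n l) (colOf n l) (T \o t).
Proof.
rewrite /polytab /eT [LHS](reindex_inj (@conjg_inj _ t)) /=; apply: eq_big => [q|q _]; last first.
  by rewrite /psgn odd_permJ.
congr (_ && _); apply/forallP/forallP => h m.
- by have := h (t m); rewrite conjgE !permM !permK.
- by have := h (t^-1%g m); rewrite conjgE !permM !permK.
- by have := h (t m); rewrite /tabloid conjgE !mulgA mulgV mul1g invMg !permM !permK.
- by have := h (t^-1%g m); rewrite /tabloid conjgE !mulgA mulgV mul1g invMg /= !permM permKV.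
Qed.

Section HomGlue.
Variables (n d k M : nat) (b : 'I_M -> Defs.cochain n d k) (l : seq nat).
Hypothesis hb : basisC b.
Variable act : 'S_n -> 'rV[rat]_M -> 'rV[rat]_M.
Hypothesis hact : forall s, opspec b b (rp s) (act s).
Notation C := (@conf n d).

Lemma hact_lin s a u v : act s (a *: u + v) = a *: act s u + act s v.
Proof. exact: (op_lin hb (hact s)). Qed.

Lemma hact1 v : act 1%g v = v.
Proof. by apply: (op_eq hb hb (hact 1%g) (op_id b (@rp1 n d))). Qed.

Lemma hactM s t v : act s (act t v) = act (t * s)%g v.
Proof.
have h := op_comp (@rp_conf n d s) (hact t) (hact s).
by apply: (op_eq hb hb h (hact (t * s)%g)) => u; apply/matrixP => i j; rewrite !mxE permM.
Qed.

Lemma lc_sum (I : finType) (c : I -> rat) (x : I -> 'rV[rat]_M) :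
  lc b (\sum_t c t *: x t) = fun s => \sum_t c t * lc b (x t) s.
Proof.
have H (r : seq I) : lc b (\sum_(t <- r) c t *: x t) = fun s => \sum_(t <- r) c t * lc b (x t) s.
  elim: r => [|t r IH]; first by rewrite big_nil lc0; apply: funext => s; rewrite big_nil.
  by rewrite big_cons lc_lin IH; apply: funext => s; rewrite big_cons.
exact: H.
Qed.

Lemma nul_lincomb (I : finType) (c : I -> rat) (x y : I -> Defs.cochain n d k) :
  (forall t, nul C (x t - y t)) -> nul C ((fun s => \sum_t c t * x t s) - (fun s => \sum_t c t * y t s)).
Proof.
move=> h; have : nul C (\sum_t scc (c t) (x t - y t)) by apply: nul_sum => t _; exact: nulZ.
apply: nul_ext => s _; change ((\sum_t scc (c t) (x t - y t)) s = (\sum_t c t * x t s) - (\sum_t c t * y t s)).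
rewrite -sumrB; elim/big_rec2: _ => // t p q _ <-.
change (c t * (x t s - y t s) + q s = c t * x t s - c t * y t s + q s); ring.
Qed.

(** A homomorphism is determined by the image of the polytabloid of the identity numbering; its
    other values are translates of this one. *)
Lemma hom_dim_pdim m : pdim (spechtRel act (rowOf n l) (colOf n l)) m -> hom_dim n d l k m.
Proof.
move=> [B [B1 B2 B3]]; exists (fun j t => lc b (act t (B j))); split.
- move=> j; split=> [t|p t|c hc].
  + exact: lc_coc.
  + apply/coh_eqP; rewrite -hactM; apply: nul_sym; exact: nul_trans (cact_pb _ _) (hact _ _).
  apply/coh_eqP; have := B1 j c => H.
  rewrite (_ : (fun s => _) = lc b (\sum_t c t *: act t (B j))); last by rewrite lc_sum.
  rewrite H ?lc0 ?subrr; first exact: nul0.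
  by move=> T; rewrite -[RHS](hc T); apply: eq_bigr => t _; rewrite polytabE.
- move=> w [w1 w2 w3]; have [x hx] := lc_onto hb (w1 1%g : coc C (w 1%g)).
  have wt t : nul C (w t - lc b (act t x)).
    have /coh_eqP h := w2 t 1%g; rewrite mul1g in h.
    apply: nul_trans h _; apply: nul_trans (cact_pb _ _) _; apply: nul_trans (hact t x).
    by rewrite -pbB; apply: pb_nul hx; exact: rp_conf.
  have Px : spechtRel act (rowOf n l) (colOf n l) x.
    move=> c hc; apply: (lc_nul hb); rewrite lc_sum.
    have h1 : nul C (fun s => \sum_t c t * w t s).
      have /coh_eqP : coh_eq n d k (fun s => \sum_t c t * w t s) (fun=> 0).
        by apply: w3 => T; rewrite -[RHS](hc T); apply: eq_bigr => t _; rewrite polytabE.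
      by rewrite (_ : (fun=> 0) = 0 :> Defs.cochain n d k)// subr0.
    apply: nul_eq h1; exact: nul_sym (nul_lincomb _ wt).
  have [a xa] := B2 x Px; exists a => t; apply/coh_eqP; apply: nul_trans (wt t) _.
  have -> : lc b (act t x) = lincomb n d k m a (fun j t => lc b (act t (B j))) t.
    rewrite xa (act_sum hact_lin) (eq_bigr (fun j => a j *: act t (B j))) ?lc_sum//.
    by move=> j _; rewrite (actZ hact_lin).
  by rewrite subrr; exact: nul0.
move=> a h; apply: B3; apply: (lc_nul hb); have /coh_eqP := h 1%g.
rewrite (_ : (fun _ => 0) = 0 :> Defs.cochain n d k)// subr0.
rewrite (_ : lincomb _ _ _ _ _ _ _ = lc b (\sum_j a j *: B j))// lc_sum.
by apply: funext => s; apply: eq_bigr => j _; rewrite hact1.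
Qed.

End HomGlue.

Lemma acts_exist n d k M (b : 'I_M -> Defs.cochain n d k) : basisC b ->
  exists act : 'S_n -> 'rV[rat]_M -> 'rV[rat]_M, forall s, opspec b b (rp s) (act s).
Proof.
move=> hb; have H s : exists F, opspec b b (@rp n d s) F by exact: (op_exists hb hb (@rp_conf n d s)).
by have [act h] := choice H; exists act.
Qed.

Lemma opspec_homot k n d n' d' M M' (b : 'I_M -> Defs.cochain n d k) (b' : 'I_M' -> Defs.cochain n' d' k) phi psi F :
  basisC b -> opspec b b' phi F ->
  (forall c : Defs.cochain n d k, coc (@conf n d) c -> nul (@conf n' d') (pb phi c - pb psi c)) -> opspec b b' psi F.
Proof. by move=> hb h hh v; apply: nul_trans (h v); apply: nul_sym; apply: hh; exact: lc_coc. Qed.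

Lemma partition_cons nu n : is_partition nu -> (sumn nu + head 0%N nu <= n)%N ->
  sorted (fun a b : nat => (b <= a)%N) ((n - sumn nu)%N :: nu) /\ sumn ((n - sumn nu)%N :: nu) = n.
Proof.
move=> /andP[hs _] h; split; last by rewrite /= subnK//; apply: leq_trans h; exact: leq_addr.
by case: nu hs h => //= x nu hs h; rewrite hs andbT; lia.
Qed.

Lemma mult_zero d i nu n : (2 <= d)%N -> is_partition nu -> (2 * i < sumn nu)%N ->
  (sumn nu + head 0%N nu <= n)%N -> f_mult d i nu n 0.
Proof.
move=> d2 pnu hi hn; have [lS ln] := partition_cons pnu hn; set l := _ :: nu in lS ln.
have [M [b hb]] := @conf_basis n d i _ d2 erefl; have [act hact] := acts_exist hb.
apply: (hom_dim_pdim hb hact); exists (fun=> 0); split=> [[]//|x Px|a _ []//].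
exists (fun=> 0); rewrite big_ord0.
have aL := hact_lin hb hact; have a1 := hact1 hb hact; have aM := hactM hb hact.
have anti q : colperm (colOf n l) q -> act q x = psgn q *: x by exact: (spechtRel_col a1 Px).
have hN : (2 * i + nth 0%N l 0 < n)%N.
  rewrite /l /=; have : (sumn nu <= n)%N by apply: leq_trans hn; exact: leq_addr.
  by move: hi; lia.
(* Antisymmetrization over columns kills all classes, yet it multiplies [x] by the number of column
   permutations. *)
have := conf_antisym d2 erefl (lc_coc hb x) (col_lt ln lS) hN.
set S := \sum_(s | _) _ => hS.
have E : nul (@conf n d) (S - lc b (\sum_(s | colperm (colOf n l) s) psgn s *: act s x)).
  have -> : lc b (\sum_(s | colperm (colOf n l) s) psgn s *: act s x) =
      \sum_(s | colperm (colOf n l) s) scc (psgn s) (lc b (act s x)).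
    elim/big_rec2: _ => [|s u v _ <-]; first exact: lc0.
    by rewrite lc_lin.
  rewrite /S -sumrB; apply: nul_sum => s _; rewrite -sccBr; apply: nulZ; exact: hact.
have := lc_nul hb (nul_eq (nul_sym E) hS).
rewrite (eq_bigr (fun=> x)); last by move=> s hs; rewrite anti// scalerA psgn_sq scale1r.
rewrite sumr_const -scaler_nat => /eqP; rewrite scaler_eq0 pnatr_eq0 => /orP[/eqP h|/eqP //].
by have : true = false by exact: etrans (esym (colperm1 (colOf n l))) (card0_eq h 1%g).
Qed.

Lemma mult_stable d i nu n : (2 <= d)%N -> is_partition nu -> (sumn nu + head 0%N nu <= n)%N ->
  (sumn nu + i + (if odd d then 0 else 1) <= n)%N ->
  exists m, f_mult d i nu n m /\ f_mult d i nu n.+1 m.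
Proof.
move=> d2 pnu hn hr; have [lS ln] := partition_cons pnu hn.
have [lS' ln'] := partition_cons pnu (leqW hn).
have sn : (sumn nu <= n)%N by apply: leq_trans hn; exact: leq_addr.
rewrite /f_mult subSn// in lS' ln' *; set N := (n - sumn nu)%N in lS ln lS' ln' *.
have nN : (N + sumn nu = n)%N by rewrite subnK.
set k := (i * (d - 1))%N; have kE : k = (i * (d - 1))%N by [].
have [M [b hb]] := @conf_basis n d i k d2 kE; have [aV hV] := acts_exist hb.
have [M' [b' hb']] := @conf_basis n.+1 d i k d2 kE; have [aW hW] := acts_exist hb'.
have V1 := hact_lin hb hV; have V2 := hact1 hb hV; have V3 := hactM hb hV.
have W1 := hact_lin hb' hW; have W2 := hact1 hb' hW; have W3 := hactM hb' hW.
pose st := star nN; have mF := @forget_conf n d st; have mA := @addfar_conf n d d2 st.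
have [io hio] := op_exists hb hb' mF; have [pj hpj] := op_exists hb' hb mA.
have ioL := op_lin hb' hio; have pjL := op_lin hb hpj.
pose r := rowOf n (N :: nu); pose r' := rowOf n.+1 (N.+1 :: nu).
have ioT (x y : 'I_n) v : io (aV (tperm x y) v) = aW (tperm (lift st x) (lift st y)) (io v).
  apply: (op_eq hb hb' (op_comp mF (hV (tperm x y)) hio) (op_comp (@rp_conf n.+1 d _) hio (hW _))) => u /=.
  by rewrite forget_rp.
have pjT (x y : 'I_n) w : pj (aW (tperm (lift st x) (lift st y)) w) = aV (tperm x y) (pj w).
  apply: (op_eq hb' hb (op_comp mA (hW _) hpj) (op_comp (@rp_conf n d _) hpj (hV (tperm x y)))) => u /=.
  by rewrite addfar_rp.
have pjio v : pj (io v) = v.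
  by apply: (op_eq hb hb (op_comp mA hio hpj) (op_id b (@forget_add n d d2 st))).
have far_spec a : opspec b b (far d2 a) (farop aW st io pj a).
  apply: (opspec_homot (phi := forget st \o rp (tperm (lift st a) st) \o addfar d2 st) hb); last first.
    by move=> c hc; exact: addfar_far.
  have h1 := op_comp (@rp_conf n.+1 d (tperm (lift st a) st)) hio (hW (tperm (lift st a) st)).
  exact: (op_comp mA h1 hpj).
have dil_spec X v : nul (@conf n d) (lc b (dilate aW st io pj X v) -
    (lc b v + \sum_(a in X) pb (far d2 a) (lc b v))).
  have -> : lc b (dilate aW st io pj X v) = lc b v + \sum_(a in X) lc b (farop aW st io pj a v).
    have lD x y : lc b (x + y) = lc b x + lc b y by rewrite -[x in LHS]scale1r lc_lin scc1.
    rewrite /dilate lD; congr (_ + _); elim/big_rec2: _ => [|a x y _ <-]; [exact: lc0|exact: lD].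
  rewrite opprD addrACA subrr add0r -sumrB; apply: nul_sum => a _; apply: nul_sym; exact: far_spec.
have dil_surj X v : exists u, dilate aW st io pj X u = v.
  have [c' hc' nc'] := dilate_far_surj d2 X kE (lc_coc hb v).
  have [u hu] := lc_onto hb hc'; exists u; apply: (lc_eq hb).
  apply: nul_trans (dil_spec X u) _; apply: nul_sym; apply: nul_trans nc' _.
  rewrite opprD addrACA -sumrB; apply: nulD => //; apply: nul_sum => a _.
  by rewrite -pbB; apply: pb_nul hu; exact: far_mapto.
have dil_inj X v : dilate aW st io pj X v = 0 -> v = 0.
  apply: surj_inj v => [a u v|v]; last exact: dil_surj.
  apply: (lc_eq hb); rewrite lc_lin.
  have := nulB (dil_spec X (a *: u + v)) (nulD (nulZ a (dil_spec X u)) (dil_spec X v)).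
  rewrite lc_lin.
  have -> : \sum_(x in X) pb (far d2 x) (scc a (lc b u) + lc b v) =
     scc a (\sum_(x in X) pb (far d2 x) (lc b u)) + \sum_(x in X) pb (far d2 x) (lc b v).
    elim/big_rec3: _ => [|x p q s _ ->]; first by rewrite addr0; apply: funext => s; rewrite /scc mulr0.
    by rewrite pbD pbZ sccDr addrACA.
  set S1 := \sum_(x in X) _; set S2 := \sum_(x in X) _; apply: nul_ext => s _.
  set D0 := lc b (dilate aW st io pj X (a *: u + v)); set D1 := lc b (dilate aW st io pj X u); set D2 := lc b (dilate aW st io pj X v).
  change (D0 s - (a * lc b u s + lc b v s + (a * S1 s + S2 s)) -
     (a * (D1 s - (lc b u s + S1 s)) + (D2 s - (lc b v s + S2 s))) = D0 s - (a * D1 s + D2 s)); ring.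
have pj_inj w : (forall s, perm_on (firstrow st r) s -> aW s w = w) -> pj w = 0 -> w = 0.
  move=> hw pw; apply: (lc_nul hb').
  have inv s : perm_on (firstrow st r) s -> nul (@conf n.+1 d) (pb (rp s) (lc b' w) - lc b' w).
    by move=> hs; have := hW s w; rewrite (hw s hs).
  (* Forgetting the point [st] and adding a far one is [far d2 st], so its effect on [w] factors
     through [pj w = 0]. *)
  have farstar : nul (@conf n.+1 d) (pb (far d2 st) (lc b' w)).
    have := op_comp mF hpj hio w; rewrite /= pw.
    have -> : io 0 = 0 by apply: (addIr (io 0)); have := ioL 1 0 0; rewrite !scale1r !add0r.
    rewrite lc0 subr0 (_ : addfar d2 st \o forget st = far d2 st)//.
    by apply: funext => u /=; exact: add_forget.
  (* The range is used here: the lengthened first row has [n + 1 - sumn nu] points, and this must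
     exceed [i], or [i + 1] for even [d]. *)
  apply: (@conf_inj n.+1 d d2 i (firstrow st r) k _ kE (lc_coc hb' w)) => //.
    rewrite /firstrow cardsU1 card_imset; last exact: lift_inj.
    rewrite (card_row0 nN) (_ : (_ \notin _) = true); last first.
      by apply/imsetP => -[a _ e]; have := neq_lift st a; rewrite -e eqxx.
    by rewrite add1n ltnS -(leq_add2l (sumn nu)) addnA [X in (_ <= X)%N]addnC nN.
  (* For the other points of the first row, [far d2 x] is conjugate to [far d2 st] by a
     transposition that fixes [w]. *)
  move=> x; rewrite finset.in_setU1 => hx; pose s := tperm x st.
  have hs : perm_on (firstrow st r) s by apply: perm_on_tperm; rewrite finset.in_setU1 ?eqxx.
  have sx : s x = st by rewrite /s tpermL.
  have h1 : nul (@conf n.+1 d) (pb (rp s) (pb (far d2 x) (lc b' w))).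
    rewrite pb_comp -rp_far sx -pb_comp.
    apply: nul_eq farstar; rewrite -pbB; apply: pb_nul (inv s hs); exact: far_mapto.
  have := pb_nul (@rp_conf n.+1 d s) h1; rewrite pb_rp /s tperm2.
  apply: nul_eq; apply: nul_sym; apply: (@pb_id_nul _ _ _ _ (@conf n.+1 d)) => u _; exact: rp1.
have hL (m : 'I_n) : r' (lift st m) = r m by exact: row_lift.
have hS : r' st = 0%N by exact: row_star0.
pose cl := colOf n (N :: nu); pose cl' := colOf n.+1 (N.+1 :: nu).
have hw0 : hwv aV r 0.
  by split=> [x y _|x y _]; [rewrite (act0 V1)|rewrite /sym (twsum0 V1)].
have hwl a u v : hwv aV r u -> hwv aV r v -> hwv aV r (a *: u + v).
  move=> [u1 u2] [v1 v2]; split=> [x y xy|x y xy]; first by rewrite V1 u1// v1.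
  by rewrite /sym (twsumD V1) (twsumZ V1) -!/(sym _ _ _) u2// v2// scaler0 addr0.
have hw0' : hwv aW r' 0.
  by split=> [x y _|x y _]; [rewrite (act0 W1)|rewrite /sym (twsum0 W1)].
have hwl' a u v : hwv aW r' u -> hwv aW r' v -> hwv aW r' (a *: u + v).
  move=> [u1 u2] [v1 v2]; split=> [x y xy|x y xy]; first by rewrite W1 u1// v1.
  by rewrite /sym (twsumD W1) (twsumZ W1) -!/(sym _ _ _) u2// v2// scaler0 addr0.
(* The multiplicities for [n] and [n.+1] are both the dimension of the highest weight vectors,
   through [kappa] on either side and [stab] in between. *)
have [m hm] := pdim_exists hw0 hwl; exists m; split.
  apply: (hom_dim_pdim hb hV); move: hm.
  apply: (@pdim_transport _ _ _ _ (kappa aV cl)) => //.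
  - by move=> a u v; rewrite /kappa (twsumD V1) (twsumZ V1).
  - by move=> v hv; apply: kappa_spechtRel => // s hs; exact: (hwv_rowperm V2 V3 hv hs).
  - by move=> v hv; apply: (kappa_inj V1 V2 V3 (cell_inj ln) (cell_left ln)).
  - by move=> w hw; apply: (kappa_onto V1 V2 V3 (cell_inj ln) (cell_up ln lS)).
have {}hm : pdim (hwv aW r') m.
  move: hm; apply: (@pdim_transport _ _ _ _ (stab aW st io r)) => //.
  - by move=> a u v; rewrite /stab ioL /sym (twsumD W1) (twsumZ W1).
  - by move=> v hv; apply: stab_hwv.
  - by move=> v hv; apply: stab_inj.
  - by move=> w hw; apply: stab_onto.
apply: (hom_dim_pdim hb' hW); move: hm.
apply: (@pdim_transport _ _ _ _ (kappa aW cl')) => //.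
- by move=> a u v; rewrite /kappa (twsumD W1) (twsumZ W1).
- by move=> v hv; apply: kappa_spechtRel => // s hs; exact: (hwv_rowperm W2 W3 hv hs).
- by move=> v hv; apply: (kappa_inj W1 W2 W3 (cell_inj ln') (cell_left ln')).
- by move=> w hw; apply: (kappa_onto W1 W2 W3 (cell_inj ln') (cell_up ln' lS')).
Qed.

End Development.

Theorem mainTheorem15 (d i : nat) (nu : seq nat) :
  (2 <= d)%N -> (1 <= i)%N -> is_partition nu ->
  ((2 * i < sumn nu)%N ->
     forall n, (sumn nu + head 0 nu <= n)%N -> f_mult d i nu n 0)
  /\
  (forall n, (sumn nu + head 0 nu <= n)%N ->
     (sumn nu + i + (if odd d then 0 else 1) <= n)%N ->
     exists m, f_mult d i nu n m /\ f_mult d i nu n.+1 m).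
Proof.
move=> d2 i1 pnu; split; first by move=> hi n hn; exact: Development.mult_zero.
by move=> n hn hr; exact: Development.mult_stable.
Qed.
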